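(* Let $N$ be the model obtained by adding $\omega_2$ Cohen reals to a model of CH. Then in $N$ every strong $\gamma$-set is countable, but there is an uncountable $\gamma$-set.
   Context: An open cover $\mathcal{U}$ of a space $X$ is an $\omega$-cover if $X\notin\mathcal{U}$ and every finite subset of $X$ is contained in some member of $\mathcal{U}$; it is a $k$-cover if every $k$-element subset of $X$ is contained in some member of $\mathcal{U}$. A sequence/family of open sets is a $\gamma$-cover of $X$ if it is infinite and each $x\in X$ lies in all but finitely many of its members. A $\gamma$-set is a separable metric space in which every open $\omega$-cover contains a $\gamma$-subcover. A set $X$ (of reals) is a strong $\gamma$-set if there is an increasing sequence of integers $(k_n:n<\omega)$ such that for every sequence $(\mathcal{U}_n:n<\omega)$ where each $\mathcal{U}_n$ is an open $k_n$-cover of $X$, there exist $U_n\in\mathcal{U}_n$ such that $(U_n:n<\omega)$ is a $\gamma$-cover of $X$. *)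

(* Defs.v *)
(* The notions in [InAStructure] are first-order formulas of the language {∈},
   written as predicates over an arbitrary structure (D, E) and evaluated inside
   it: every quantifier ranges over D, and functions, numbers, covers, sequences
   etc. are elements of D. *)

Set Implicit Arguments.

Section InAStructure.

Variables (D : Type) (E : D -> D -> Prop).

Local Notation "x ∈ y" := (E x y) (at level 70).

(* Equality is not primitive: "x ≃ y" has the force of equality in every
   structure satisfying the extensionality axiom of [zfc] below. *)
Definition same (x y : D) : Prop := forall z, z ∈ x <-> z ∈ y.
Local Notation "x ≃ y" := (same x y) (at level 70).

Definition sub (x y : D) : Prop := forall z, z ∈ x -> z ∈ y.
Local Notation "x ⊆ y" := (sub x y) (at level 70).

Definition is_empty (x : D) : Prop := forall z, ~ z ∈ x.
Definition is_upair (p x y : D) : Prop := forall z, z ∈ p <-> z ≃ x \/ z ≃ y.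
(* Kuratowski pair *)
Definition is_pair (p x y : D) : Prop :=
  exists a b, is_upair a x x /\ is_upair b x y /\ is_upair p a b.
Definition is_prod (c a b : D) : Prop :=
  forall p, p ∈ c <-> exists x y, x ∈ a /\ y ∈ b /\ is_pair p x y.
Definition is_power (P a : D) : Prop := forall x, x ∈ P <-> x ⊆ a.
Definition is_succ (s x : D) : Prop := forall z, z ∈ s <-> z ∈ x \/ z ≃ x.

Definition is_inductive (i : D) : Prop :=
  (exists e, is_empty e /\ e ∈ i) /\
  (forall x, x ∈ i -> exists s, is_succ s x /\ s ∈ i).
Definition is_omega (w : D) : Prop :=
  is_inductive w /\ forall i, is_inductive i -> w ⊆ i.
Definition is_two (t : D) : Prop :=
  exists z o, is_empty z /\ is_succ o z /\ is_succ t o.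

(* [app f x y] is "f(x) = y" (or "x f y" when f is a relation), [app2 f x y z]
   is "f(x, y) = z". *)
Definition app (f x y : D) : Prop := exists p, is_pair p x y /\ p ∈ f.
Definition app2 (f x y z : D) : Prop := exists p, is_pair p x y /\ app f p z.

Definition is_fun (f a b : D) : Prop :=
  (forall p, p ∈ f -> exists x y, x ∈ a /\ y ∈ b /\ is_pair p x y) /\
  (forall x, x ∈ a -> exists y, app f x y /\ forall y', app f x y' -> y' ≃ y).
Definition is_injective (f : D) : Prop :=
  forall x x' y, app f x y -> app f x' y -> x ≃ x'.
Definition injects (a b : D) : Prop := exists f, is_fun f a b /\ is_injective f.
Definition equinumerous (a b : D) : Prop :=
  exists f, is_fun f a b /\ is_injective f /\
            forall y, y ∈ b -> exists x, x ∈ a /\ app f x y.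
Definition finite (a : D) : Prop :=
  exists w n, is_omega w /\ n ∈ w /\ equinumerous a n.
Definition countable (a : D) : Prop := exists w, is_omega w /\ injects a w.

Definition CH : Prop :=
  exists w P, is_omega w /\ is_power P w /\
    forall S, S ⊆ P -> countable S \/ equinumerous S P.

Definition is_transitive (x : D) : Prop := forall y, y ∈ x -> y ⊆ x.
Definition is_ordinal (x : D) : Prop :=
  is_transitive x /\ forall y, y ∈ x -> is_transitive y.
(* l is the least ordinal which does not inject into k. *)
Definition is_next_cardinal (k l : D) : Prop :=
  is_ordinal l /\ ~ injects l k /\ forall a, a ∈ l -> injects a k.
Definition is_omega2 (w2 : D) : Prop :=
  exists w w1, is_omega w /\ is_next_cardinal w w1 /\ is_next_cardinal w1 w2.

(* ** ZFC.  Formulas are needed as data only for the two schemes; variables are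
   de Bruijn indices, and the remaining connectives and equality are definable. *)

Inductive formula : Type :=
| Mem (i j : nat)
| Bot
| Imp (p q : formula)
| All (p : formula).

Definition scons (x : D) (v : nat -> D) (n : nat) : D :=
  match n with O => x | S m => v m end.

Fixpoint sat (v : nat -> D) (p : formula) : Prop :=
  match p with
  | Mem i j => v i ∈ v j
  | Bot => False
  | Imp p q => sat v p -> sat v q
  | All p => forall x, sat (scons x v) p
  end.

Record zfc : Prop := {
  zfc_extensionality : forall x y z, x ≃ y -> x ∈ z -> y ∈ z;
  zfc_foundation : forall x, (exists y, y ∈ x) ->
    exists y, y ∈ x /\ forall z, z ∈ x -> ~ z ∈ y;
  zfc_pairing : forall x y, exists p, is_upair p x y;
  zfc_union : forall x, exists u, forall z, z ∈ u <-> exists y, y ∈ x /\ z ∈ y;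
  zfc_power : forall x, exists P, is_power P x;
  zfc_infinity : exists i, is_inductive i;
  zfc_separation : forall (p : formula) (v : nat -> D) (a : D),
    exists b, forall x, x ∈ b <-> x ∈ a /\ sat (scons x v) p;
  zfc_replacement : forall (p : formula) (v : nat -> D) (a : D),
    (forall x, x ∈ a -> exists y, sat (scons x (scons y v)) p /\
       forall y', sat (scons x (scons y' v)) p -> y' ≃ y) ->
    exists b, forall y, y ∈ b <-> exists x, x ∈ a /\ sat (scons x (scons y v)) p;
  zfc_choice : forall a,
    (forall x, x ∈ a -> exists z, z ∈ x) ->
    (forall x y z, x ∈ a -> y ∈ a -> z ∈ x -> z ∈ y -> x ≃ y) ->
    exists c, forall x, x ∈ a ->
      exists z, z ∈ x /\ z ∈ c /\ forall z', z' ∈ x -> z' ∈ c -> z' ≃ z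
}.

(* ** Cohen forcing Fn(ω₂ × ω, 2): finite partial functions, ordered by reverse
   inclusion. *)

Definition cohen_condition (p : D) : Prop :=
  exists w w2 c t, is_omega w /\ is_omega2 w2 /\ is_prod c w2 w /\ is_two t /\
    finite p /\
    (forall q, q ∈ p -> exists x i, x ∈ c /\ i ∈ t /\ is_pair q x i) /\
    (forall x i j, app p x i -> app p x j -> i ≃ j).

Definition cohen_dense (A : D) : Prop :=
  (forall p, p ∈ A -> cohen_condition p) /\
  (forall p, cohen_condition p -> exists q, q ∈ A /\ p ⊆ q).

(* G is a subset of the poset which need not be an element of the structure,
   while the dense sets to be met are elements of the structure. *)
Record cohen_generic (G : D -> Prop) : Prop := {
  generic_condition : forall p, G p -> cohen_condition p;
  generic_nonempty : exists p, G p;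
  generic_upward : forall p q, G p -> cohen_condition q -> q ⊆ p -> G q;
  generic_directed : forall p q, G p -> G q -> exists r, G r /\ p ⊆ r /\ q ⊆ r;
  generic_dense : forall A, cohen_dense A -> exists p, G p /\ p ∈ A
}.

(* ** The real line, as a Dedekind complete ordered field. *)

Definition is_zero (R add o : D) : Prop :=
  o ∈ R /\ forall x, x ∈ R -> app2 add x o x.
Definition lt (le x y : D) : Prop := app le x y /\ ~ x ≃ y.
Definition is_binop (f R : D) : Prop := exists c, is_prod c R R /\ is_fun f c R.

Record is_reals (R add mul le : D) : Prop := {
  add_binop : is_binop add R;
  mul_binop : is_binop mul R;
  add_comm : forall x y z, app2 add x y z -> app2 add y x z;
  mul_comm : forall x y z, app2 mul x y z -> app2 mul y x z;
  add_assoc : forall x y z u v s,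
    app2 add x y u -> app2 add u z s -> app2 add y z v -> app2 add x v s;
  mul_assoc : forall x y z u v s,
    app2 mul x y u -> app2 mul u z s -> app2 mul y z v -> app2 mul x v s;
  mul_add : forall x y z s t u v,
    app2 add y z s -> app2 mul x s t -> app2 mul x y u -> app2 mul x z v ->
    app2 add u v t;
  zero_ex : exists o, is_zero R add o;
  add_inverse : forall o x, is_zero R add o -> x ∈ R ->
    exists y, y ∈ R /\ app2 add x y o;
  one_ex : exists i, i ∈ R /\ ~ is_zero R add i /\
    (forall x, x ∈ R -> app2 mul x i x) /\
    (forall x, x ∈ R -> ~ is_zero R add x -> exists y, y ∈ R /\ app2 mul x y i);
  le_refl : forall x, x ∈ R -> app le x x;
  le_antisym : forall x y, x ∈ R -> y ∈ R -> app le x y -> app le y x -> x ≃ y;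
  le_trans : forall x y z, x ∈ R -> y ∈ R -> z ∈ R ->
    app le x y -> app le y z -> app le x z;
  le_total : forall x y, x ∈ R -> y ∈ R -> app le x y \/ app le y x;
  le_add : forall x y z u v, x ∈ R -> y ∈ R -> z ∈ R ->
    app le x y -> app2 add x z u -> app2 add y z v -> app le u v;
  le_mul : forall o x y z, is_zero R add o -> x ∈ R -> y ∈ R ->
    app le o x -> app le o y -> app2 mul x y z -> app le o z;
  sup_ex : forall S, S ⊆ R -> (exists x, x ∈ S) ->
    (exists b, b ∈ R /\ forall x, x ∈ S -> app le x b) ->
    exists s, s ∈ R /\ (forall x, x ∈ S -> app le x s) /\
      forall b, b ∈ R -> (forall x, x ∈ S -> app le x b) -> app le s b
}.

(* Relatively open subsets of a set X of reals. *)
Definition line_open (R le X U : D) : Prop :=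
  U ⊆ X /\
  forall x, x ∈ U -> exists a b, a ∈ R /\ b ∈ R /\ lt le a x /\ lt le x b /\
    forall y, y ∈ X -> lt le a y -> lt le y b -> y ∈ U.

Record is_metric (R add le X d : D) : Prop := {
  metric_fun : exists c, is_prod c X X /\ is_fun d c R;
  metric_nonneg : forall o x y r, is_zero R add o -> app2 d x y r -> app le o r;
  metric_zero : forall o x y, is_zero R add o -> x ∈ X -> y ∈ X ->
    (app2 d x y o <-> x ≃ y);
  metric_sym : forall x y r, app2 d x y r -> app2 d y x r;
  metric_triangle : forall x y z r s t u,
    app2 d x y r -> app2 d y z s -> app2 d x z t -> app2 add r s u -> app le t u
}.

Definition in_ball (le d x e y : D) : Prop := exists r, app2 d x y r /\ lt le r e.
Definition is_positive (R add le e : D) : Prop :=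
  e ∈ R /\ forall o, is_zero R add o -> lt le o e.

Definition metric_open (R add le X d U : D) : Prop :=
  U ⊆ X /\
  forall x, x ∈ U -> exists e, is_positive R add le e /\
    forall y, y ∈ X -> in_ball le d x e y -> y ∈ U.

Definition metric_separable (R add le X d : D) : Prop :=
  exists Q, Q ⊆ X /\ countable Q /\
    forall x e, x ∈ X -> is_positive R add le e ->
      exists q, q ∈ Q /\ in_ball le d x e q.

(* ** Covers of a space X whose open sets are given by the predicate O. *)

Definition is_open_cover (O : D -> Prop) (X U : D) : Prop :=
  (forall u, u ∈ U -> O u) /\ (forall x, x ∈ X -> exists u, u ∈ U /\ x ∈ u).

Definition is_omega_cover (O : D -> Prop) (X U : D) : Prop :=
  is_open_cover O X U /\ ~ X ∈ U /\
  forall F, F ⊆ X -> finite F -> exists u, u ∈ U /\ F ⊆ u.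

Definition is_k_cover (O : D -> Prop) (k X U : D) : Prop :=
  is_open_cover O X U /\
  forall F, F ⊆ X -> equinumerous F k -> exists u, u ∈ U /\ F ⊆ u.

Definition is_gamma_cover (O : D -> Prop) (X U : D) : Prop :=
  (forall u, u ∈ U -> O u) /\ ~ finite U /\
  forall x, x ∈ X -> exists F, finite F /\ forall u, u ∈ U -> ~ x ∈ u -> u ∈ F.

Definition is_seq (w c : D) : Prop := exists Z, is_fun c w Z.

(* A sequence indexed by ω is infinite as a sequence, with or without repeated
   terms, and "all but finitely many of its members" counts indices. *)
Definition is_gamma_seq (O : D -> Prop) (w X c : D) : Prop :=
  is_seq w c /\ (forall n u, app c n u -> O u) /\
  forall x, x ∈ X ->
    exists F, finite F /\ forall n u, app c n u -> ~ x ∈ u -> n ∈ F.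

Definition is_gamma_set (X d : D) : Prop :=
  exists R add mul le, is_reals R add mul le /\
    is_metric R add le X d /\ metric_separable R add le X d /\
    forall U, is_omega_cover (metric_open R add le X d) X U ->
      exists V, V ⊆ U /\ is_gamma_cover (metric_open R add le X d) X V.

(* On ω, ∈ is the strict order. *)
Definition is_increasing (k : D) : Prop :=
  forall m n a b, m ∈ n -> app k m a -> app k n b -> a ∈ b.

Definition is_strong_gamma_set (X : D) : Prop :=
  exists R add mul le, is_reals R add mul le /\ X ⊆ R /\
    exists w k, is_omega w /\ is_fun k w w /\ is_increasing k /\
      forall Us, is_seq w Us ->
        (forall n kn U, app k n kn -> app Us n U ->
           is_k_cover (line_open R le X) kn X U) ->
        exists c, is_gamma_seq (line_open R le X) w X c /\
          forall n u U, app c n u -> app Us n U -> u ∈ U.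

End InAStructure.

(* ** The ambient universe of sets: well-founded trees with extensional equality. *)

Inductive V : Type := mkV (A : Type) (f : A -> V).

Fixpoint veq (x y : V) : Prop :=
  match x, y with
  | mkV f, mkV g =>
      (forall a, exists b, veq (f a) (g b)) /\ (forall b, exists a, veq (f a) (g b))
  end.

Definition vmem (x y : V) : Prop :=
  match y with mkV g => exists b, veq x (g b) end.

Definition idx (x : V) : Type := match x with @mkV A _ => A end.
Definition elt (x : V) : idx x -> V := match x with @mkV _ f => f end.

Definition vupair (x y : V) : V := mkV (fun b : bool => if b then x else y).
Definition vpair (x y : V) : V := vupair (vupair x x) (vupair x y).

Definition carrier (M : V -> Prop) : Type := {x : V | M x}.
Definition mem_in (M : V -> Prop) (x y : carrier M) : Prop :=
  vmem (proj1_sig x) (proj1_sig y).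

Definition transitive_class (M : V -> Prop) : Prop :=
  forall x y, M x -> vmem y x -> M y.

(* val_G(t) = {val_G(s) : (s, p) ∈ t for some p ∈ G}.  The sets s occurring
   here are elements of elements of elements of t, which indexes the recursion. *)
Fixpoint val (G : V -> Prop) (t : V) : V :=
  match t with
  | @mkV A f =>
      mkV (fun i : {i : {a : A & {b : idx (f a) & idx (elt (f a) b)}} |
                      exists p, G p /\
                        veq (f (projT1 i))
                          (vpair (elt (elt (f (projT1 i)) (projT1 (projT2 i)))
                                    (projT2 (projT2 i))) p)} =>
             val G (elt (elt (f (projT1 (proj1_sig i)))
                           (projT1 (projT2 (proj1_sig i))))
                      (projT2 (projT2 (proj1_sig i)))))
  end.

(* M[G].  Every t in M is used as a name: elements of t that are not of the
   form (s, p) with p a condition are ignored by [val]. *)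
Definition generic_extension (M : V -> Prop) (G : carrier M -> Prop) (x : V) : Prop :=
  exists t, M t /\
    veq x (val (fun p => exists q, G q /\ veq p (proj1_sig q)) t).

(* Main.v *)
(** Let N = M[G].

    Strong gamma-sets are countable.  Suppose X in N is an uncountable strong
    gamma-set with bounds k_n; choose distinct points y_a of X, a < omega_1.  Every
    y_a depends on countably many Cohen coordinates, so some d < omega_2 is used by
    none of the y_a, nor by k.  Fix a countable family of closed intervals
    containing, for any finitely many distinct reals, pairwise disjoint intervals
    around them.  The d-th Cohen real selects intervals C(n,i), i <= k_n, for each n;
    when these are disjoint, a set of k_n points misses one of them, and the sets
    X \ C(n,i), i <= k_n, form a k_n-cover.  Given a choice i(n), pigeonhole on
    the finite conditions and genericity of the d-th real give some a such that y_a
    lies in C(n,i(n)) for infinitely many n, so the chosen sets are not a gamma-cover.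

    An uncountable gamma-set.  Under CH build in M an almost decreasing sequence
    x_a, a < omega_1, of infinite subsets of omega so that X = Fin u {x_a} satisfies:
    for each sequence (V_p) of clopen omega-covers of X there are an infinite A and
    U(n,p) in V_p, p < n in A, such that each point of X is in U(n,p) for all p < n
    and all but finitely many n in A.  Let U' in N be an omega-cover of X.  A name of
    it involves only countably many coordinates, and each of the countably many
    conditions p on these has the ground model omega-cover V_p of the clopen sets
    which some extension of p puts into U'.  If (U(n,p)) is selected from this
    sequence, then by genericity U(n,p) is in U' for infinitely many n.

    The models are first collapsed so that equality becomes Leibniz equality.
    Separation in N is the forcing theorem for names in M, all elements of M being
    names. *)
From Stdlib Require Import Classical ClassicalEpsilon FunctionalExtensionality PropExtensionality.
From Stdlib Require Import Arith Lia List Reals Lra Ring Relations Wellfounded.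
Require Import Defs.
Set Implicit Arguments.

(** * Definability in models of set theory *)

(** Every set formed inside a model by separation or replacement needs a formula. [Def] replaces
    formulas by a semantic notion closed under the connectives, and [dfn] checks it from the shape
    of a predicate. Well-foundedness makes the natural numbers of both models standard, so finite
    combinatorics is done outside, with [nat] and lists. N is treated as a Zermelo model whose sets
    are well-ordered by ordinals of their names; recursions in N keep their values in a given set.

    The chain condition is replaced by closure: a countable set of coordinates closed under chosen
    witnesses decides countably many statements, and what a condition decides is already decided by
    its restriction to these coordinates. So the d-th Cohen real can be rewritten without disturbing
    what is known about the points y_a. The choice i(n) may itself depend on that real. Hence k_n +
    2 points of one unbounded fibre are collected, each is placed into its own selected set, and
    only then is the choice decided; whatever it is, it catches one of the points. *)

Lemma fchoice (A B : Type) (R : A -> B -> Prop) : (forall x, exists y, R x y) -> exists f, forall x, R x (f x).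
Proof.
  intros H. exists (fun x => proj1_sig (constructive_indefinite_description _ (H x))).
  intros x; apply proj2_sig.
Qed.

(** The common setting for the collapses of M and N: Leibniz equality and well-founded membership.
    [z_power] only asks for a set including all subsets, from which separation cuts out the power
    set; replacement and choice enter as separate hypotheses. *)
Record zermelo := {
  car :> Type;
  mem : car -> car -> Prop;
  mem_ext : forall x y, (forall z, mem z x <-> mem z y) -> x = y;
  mem_wf : well_founded mem;
  z_pair : forall x y, exists p, forall z, mem z p <-> z = x \/ z = y;
  z_union : forall x, exists u, forall z, mem z u <-> exists y, mem y x /\ mem z y;
  z_power : forall x, exists P, forall z, (forall w, mem w z -> mem w x) -> mem z P;
  z_inf : exists i, is_inductive mem i;
  z_sep : forall p v a, exists b, forall x, mem x b <-> mem x a /\ sat mem (scons x v) p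
}.
Arguments mem {z} _ _.
Notation "x ∈ y" := (mem x y) (at level 70).
Notation "x ∉ y" := (~ mem x y) (at level 70).
Notation "x ⊆ y" := (sub mem x y) (at level 70).

Fixpoint ren (f : nat -> nat) (p : formula) : formula :=
  match p with
  | Mem i j => Mem (f i) (f j)
  | Bot => Bot
  | Imp p q => Imp (ren f p) (ren f q)
  | All p => All (ren (fun n => match n with O => O | S m => S (f m) end) p)
  end.

Lemma sat_ren D (E : D -> D -> Prop) p : forall v f, sat E v (ren f p) <-> sat E (fun i => v (f i)) p.
Proof.
  induction p as [i j| |p IHp q IHq|p IHp]; intros v f; simpl; try tauto.
  - rewrite IHp, IHq; tauto.
  - assert (e : forall x, (fun i => scons x v (match i with O => O | S m => S (f m) end)) = scons x (fun i => v (f i)))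
      by (intros x; extensionality i; destruct i; auto).
    split; intros H x; specialize (H x); [apply IHp in H|apply IHp]; [rewrite <- e|rewrite e]; auto.
Qed.

Section Definability.
Context {M : zermelo}.
Notation env := (nat -> M).

(* [Def P]: P is first-order definable with parameters from M; the lookup [r]
   sends the free variables of the formula to the environment or to parameters. *)
Definition look (r : nat -> nat + M) (v : env) (i : nat) : M :=
  match r i with inl k => v k | inr c => c end.
Definition Def (P : env -> Prop) := exists p r, forall v, P v <-> sat mem (look r v) p.
(** A term is definable when its graph is: variable 0 holds the value and the arguments are shifted
    by one. *)
Definition TDef (t : env -> M) := Def (fun v => v 0 = t (fun n => v (S n))).

Lemma Def_iff P Q : (forall v, P v <-> Q v) -> Def P -> Def Q.
Proof. intros H (p & r & Hp); exists p, r; intros v; rewrite <- Hp, H; tauto. Qed.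

Lemma Def_mem0 i j : Def (fun v => v i ∈ v j).
Proof. exists (Mem 0 1), (fun n => match n with O => inl i | _ => inl j end); reflexivity. Qed.

Lemma Def_const (P : Prop) : Def (fun _ => P).
Proof.
  destruct (classic P) as [H|H]; [exists (Imp Bot Bot)|exists Bot];
    exists (fun _ => inl 0); simpl; tauto.
Qed.

Lemma Def_imp P Q : Def P -> Def Q -> Def (fun v => P v -> Q v).
Proof.
  intros (p & r & Hp) (q & s & Hq).
  (* Even variables serve p and odd ones q, which keeps the two lookups apart. *)
  exists (Imp (ren (fun i => 2 * i) p) (ren (fun i => S (2 * i)) q)),
    (fun i => if Nat.even i then r (Nat.div2 i) else s (Nat.div2 i)).
  intros v; simpl sat; rewrite !sat_ren, Hp, Hq.
  replace (fun i => look _ v (2 * i)) with (look r v).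
  replace (fun i => look _ v (S (2 * i))) with (look s v). tauto.
  - extensionality i; unfold look. rewrite Nat.even_succ, Nat.odd_mul, Nat.div2_succ_double; reflexivity.
  - extensionality i; unfold look. rewrite Nat.even_mul, Nat.div2_double; reflexivity.
Qed.

Lemma Def_all (Q : env -> M -> Prop) :
  Def (fun v => Q (fun n => v (S n)) (v 0)) -> Def (fun v => forall x, Q v x).
Proof.
  intros (p & r & Hp).
  (* Variables looked up at the quantified position become the bound variable 0; all others move up
     by one. *)
  exists (All (ren (fun i => match r i with inl O => O | _ => S i end) p)),
    (fun i => match r i with inl (S k) => inl k | t => t end).
  intros v; cbn [sat].
  assert (e : forall x, (fun i => scons x (look (fun i => match r i with inl (S k) => inl k | t => t end) v)
      (match r i with inl O => O | _ => S i end)) = look r (scons x v)).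
  { intros x; extensionality i; unfold look. destruct (r i) as [[|k]|c] eqn:e; simpl; rewrite ?e; auto. }
  split; intros H x; specialize (H x); specialize (Hp (scons x v)); cbn [scons] in Hp.
  - rewrite sat_ren, e. apply Hp, H.
  - rewrite sat_ren, e in H. apply Hp, H.
Qed.

Lemma Def_not P : Def P -> Def (fun v => ~ P v).
Proof. intros H; apply Def_imp; [exact H|apply Def_const]. Qed.
Lemma Def_or P Q : Def P -> Def Q -> Def (fun v => P v \/ Q v).
Proof.
  intros H H'; apply Def_iff with (fun v => ~ P v -> Q v).
  intros v; destruct (classic (P v)); tauto. apply Def_imp; auto using Def_not.
Qed.
Lemma Def_and P Q : Def P -> Def Q -> Def (fun v => P v /\ Q v).
Proof.
  intros H H'; apply Def_iff with (fun v => ~ (P v -> ~ Q v)).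
  intros v; destruct (classic (P v)), (classic (Q v)); tauto. auto using Def_not, Def_imp.
Qed.
Lemma Def_eqv P Q : Def P -> Def Q -> Def (fun v => P v <-> Q v).
Proof. intros; apply Def_and; apply Def_imp; auto. Qed.
Lemma Def_ex (Q : env -> M -> Prop) :
  Def (fun v => Q (fun n => v (S n)) (v 0)) -> Def (fun v => exists x, Q v x).
Proof.
  intros H; apply Def_iff with (fun v => ~ forall x, ~ Q v x).
  - intros v; split; [intros h; apply not_all_not_ex in h; auto|intros [x h] h'; exact (h' x h)].
  - apply Def_not, (Def_all (fun v x => ~ Q v x)), Def_not, H.
Qed.
Lemma Def_eq0 i j : Def (fun v => v i = v j).
Proof.
  apply Def_iff with (fun v => forall x, x ∈ v i <-> x ∈ v j).
  - intros v; split; [apply mem_ext|intros ->; tauto].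
  - apply (Def_all (fun v x => x ∈ v i <-> x ∈ v j)), Def_eqv; apply Def_mem0.
Qed.
Lemma TDef_var n : TDef (fun v => v n).
Proof. apply Def_eq0. Qed.
Lemma TDef_const c : TDef (fun _ => c).
Proof.
  apply Def_iff with (fun v => forall x, x ∈ v 0 <-> x ∈ c).
  - intros v; split; [apply mem_ext|intros ->; tauto].
  - apply (Def_all (fun v x => x ∈ v 0 <-> x ∈ c)), Def_eqv; [apply Def_mem0|].
    exists (Mem 0 1), (fun n => match n with O => inl 0 | _ => inr c end); reflexivity.
Qed.

Lemma Def_shift f P : Def P -> Def (fun v => P (fun n => v (f n))).
Proof.
  intros (p & r & Hp). exists p, (fun i => match r i with inl k => inl (f k) | t => t end).
  intros v; rewrite Hp. replace (look _ v) with (look r (fun n => v (f n))); [tauto|].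
  extensionality i; unfold look; destruct (r i); auto.
Qed.

Lemma Def_sub (Q : env -> M -> Prop) t :
  TDef t -> Def (fun v => Q (fun n => v (S n)) (v 0)) -> Def (fun v => Q v (t v)).
Proof.
  intros H H'; apply Def_iff with (fun v => exists x, x = t v /\ Q v x).
  - intros v; split; [intros (x & -> & h); exact h|eauto].
  - apply (Def_ex (fun v x => x = t v /\ Q v x)), Def_and; auto.
Qed.
Lemma TDef_shift f t : TDef t -> TDef (fun v => t (fun n => v (f n))).
Proof.
  intros H. apply (Def_shift (fun n => match n with O => O | S m => S (f m) end)) in H. exact H.
Qed.
Lemma Def_mem s t : TDef s -> TDef t -> Def (fun v => s v ∈ t v).
Proof.
  intros Hs Ht. apply (Def_sub (fun v x => x ∈ t v) Hs).
  apply (Def_sub (fun v y => v 0 ∈ y) (t := fun v => t (fun n => v (S n)))).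
  exact (TDef_shift S Ht). apply Def_mem0.
Qed.
Lemma Def_eq s t : TDef s -> TDef t -> Def (fun v => s v = t v).
Proof.
  intros Hs Ht. apply (Def_sub (fun v x => x = t v) Hs). exact Ht.
Qed.

Definition inh : inhabited M := match z_inf M with ex_intro _ x _ => inhabits x end.
Definition the (P : M -> Prop) : M := epsilon inh P.
Lemma theP P : (exists x, P x) -> P (the P).
Proof. apply epsilon_spec. Qed.
Lemma the_eq (P : M -> Prop) x : P x -> (forall y, P y -> y = x) -> the P = x.
Proof. intros H H'; apply H', theP; eauto. Qed.
Lemma TDef_the (P : env -> M -> Prop) :
  (forall v, exists x, P v x /\ forall y, P v y -> y = x) ->
  Def (fun v => P (fun n => v (S n)) (v 0)) -> TDef (fun v => the (P v)).
Proof.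
  intros H; apply Def_iff; intros v. destruct (H (fun n => v (S n))) as (x & h & u).
  rewrite (the_eq _ h u). split; [apply u|intros ->; auto].
Qed.

Definition D1 (P : M -> Prop) := Def (fun v => P (v 0)).
Definition sep (a : M) (P : M -> Prop) := the (fun b => forall x, x ∈ b <-> x ∈ a /\ P x).
Lemma sep_ex a P : D1 P -> exists b, forall x, x ∈ b <-> x ∈ a /\ P x.
Proof.
  intros (p & r & Hp).
  (* The predicate depends on one argument only, so every variable looked up in the environment may
     be identified with the tested element. *)
  destruct (z_sep M (ren (fun i => match r i with inl _ => O | _ => S i end) p)
    (fun i => match r i with inr c => c | _ => a end) a) as [b Hb].
  exists b; intros x; rewrite Hb, sat_ren, (Hp (fun _ => x)).
  replace (look r (fun _ => x)) with (fun i => scons x (fun i => match r i with inr c => c | _ => a end)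
     match r i with inl _ => 0 | inr _ => S i end); [tauto|].
  extensionality i; unfold look; destruct (r i) eqn:e; simpl; rewrite ?e; auto.
Qed.
Lemma in_sep a P x : D1 P -> x ∈ sep a P <-> x ∈ a /\ P x.
Proof. intros H; revert x; exact (theP _ (sep_ex a H)). Qed.
Lemma Def_inst (P : env -> M -> Prop) v : Def (fun v => P (fun n => v (S n)) (v 0)) -> D1 (P v).
Proof.
  intros (p & r & Hp).
  exists p, (fun i => match r i with inl (S k) => inr (v k) | t => t end).
  intros w; specialize (Hp (scons (w 0) v)). simpl in Hp. 
  replace (look _ w) with (look r (scons (w 0) v)); [exact Hp|].
  extensionality i; unfold look; destruct (r i) as [[|k]|c] eqn:e; simpl; auto.
Qed.
Lemma TDef_sep (a : env -> M) (P : env -> M -> Prop) :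
  TDef a -> Def (fun v => P (fun n => v (S n)) (v 0)) -> TDef (fun v => sep (a v) (P v)).
Proof.
  intros Ha HP. apply TDef_the with (P := fun v b => forall x, x ∈ b <-> x ∈ a v /\ P v x).
  - intros v. destruct (@sep_ex (a v) (P v)) as [b Hb]. apply Def_inst; auto.
    exists b; split; auto. intros y Hy; apply mem_ext; intros z; rewrite Hb, Hy; tauto.
  - apply (Def_all (fun v x => x ∈ v 0 <-> x ∈ a (fun n => v (S n)) /\ P (fun n => v (S n)) x)).
    apply Def_eqv. apply Def_mem0. apply Def_and.
    apply Def_mem. apply TDef_var. apply (TDef_shift (fun n => S (S n))); auto.
    apply (Def_shift (fun n => match n with O => O | S m => S (S m) end)) in HP. exact HP.
Qed.
End Definability.
Arguments the {M} _.
Arguments sep {M} _ _.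

Create HintDb dfn.
Ltac dfn_hook := fail.
Definition D1T (M : zermelo) (F : M -> M) := TDef (fun v => F (v 0)).
Definition D2 (M : zermelo) (P : M -> M -> Prop) := Def (fun v => P (v 0) (v 1)).
Definition D2T (M : zermelo) (F : M -> M -> M) := TDef (fun v => F (v 0) (v 1)).
Arguments D1T {M} F. Arguments D2 {M} P. Arguments D2T {M} F.
Lemma TDef_D1T (M : zermelo) F (t : (nat -> M) -> M) : D1T F -> TDef t -> TDef (fun v => F (t v)).
Proof.
  intros HF Ht. apply (Def_sub (fun v x => v 0 = F x) (t := fun v => t (fun n => v (S n)))).
  exact (TDef_shift S Ht).
  exact (Def_shift (fun n => match n with O => 1 | _ => 0 end) HF).
Qed.
Lemma Def_D1 (M : zermelo) P (t : (nat -> M) -> M) : D1 P -> TDef t -> Def (fun v => P (t v)).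
Proof.
  intros HP Ht. apply (Def_sub (fun v x => P x) Ht), HP.
Qed.
Lemma Def_D2 (M : zermelo) P (s t : (nat -> M) -> M) :
  D2 P -> TDef s -> TDef t -> Def (fun v => P (s v) (t v)).
Proof.
  intros HP Hs Ht. apply (Def_sub (fun v x => P x (t v)) Hs).
  apply (Def_sub (fun v y => P (v 0) y) (t := fun v => t (fun n => v (S n)))).
  exact (TDef_shift S Ht).
  exact (Def_shift (fun n => match n with O => 1 | _ => 0 end) HP).
Qed.
Lemma TDef_D2T (M : zermelo) F (s t : (nat -> M) -> M) :
  D2T F -> TDef s -> TDef t -> TDef (fun v => F (s v) (t v)).
Proof.
  intros HP Hs Ht. apply (Def_sub (fun v x => v 0 = F x (t (fun n => v (S n)))) (t := fun v => s (fun n => v (S n)))).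
  exact (TDef_shift S Hs).
  apply (Def_sub (fun v y => v 1 = F (v 0) y) (t := fun v => t (fun n => v (S (S n))))).
  exact (TDef_shift (fun n => S (S n)) Ht).
  exact (Def_shift (fun n => match n with O => 2 | 1 => 1 | _ => 0 end) HP).
Qed.
(** Goals are solved by syntax, with one closure lemma for each shape; [dfn_hook] is redefined
    whenever further operations have been proved definable. *)
Ltac dfn1 :=
  lazymatch goal with
  | |- D1 _ => unfold D1
  | |- D2 _ => unfold D2
  | |- D1T _ => unfold D1T
  | |- D2T _ => unfold D2T
  | |- Def (fun _ => ?P) => apply Def_const
  | |- TDef (fun _ => ?c) => apply TDef_const
  | |- TDef (fun v => v ?n) => apply TDef_var
  | |- Def (fun v => _ /\ _) => apply Def_and
  | |- Def (fun v => _ \/ _) => apply Def_or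
  | |- Def (fun v => _ <-> _) => apply Def_eqv
  | |- Def (fun v => ~ _) => apply Def_not
  | |- Def (fun v => exists x, _) => refine (Def_ex _ _)
  | |- Def (fun v => mem _ _) => apply Def_mem
  | |- Def (fun v => @eq _ _ _) => apply Def_eq
  | |- TDef (fun v => ?t (fun n => v (@?f n))) => apply (TDef_shift f)
  | |- TDef (fun v => sep _ _) => refine (TDef_sep _ _ _)
  | |- Def (fun v => forall x : car _, _) => refine (Def_all _ _)
  | |- Def (fun v => _ -> _) => apply Def_imp
  | |- _ => first [assumption
      | match goal with H : D1T ?F |- TDef (fun v => ?F _) => apply (TDef_D1T H) end
      | match goal with H : D2T ?F |- TDef (fun v => ?F _ _) => apply (TDef_D2T H) end
      | match goal with H : D1 ?F |- Def (fun v => ?F _) => apply (Def_D1 H) end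
      | match goal with H : D2 ?F |- Def (fun v => ?F _ _) => apply (Def_D2 H) end
      | dfn_hook | progress autounfold with dfn | fail 1]
  end.
Ltac dfn := cbv beta; repeat (dfn1; cbv beta).

Section Basics.
Context {M : zermelo}.
Implicit Types x y z a b p f : M.

Definition upair x y : M := the (fun p => forall z, z ∈ p <-> z = x \/ z = y).
Lemma in_upair x y z : z ∈ upair x y <-> z = x \/ z = y.
Proof. revert z; exact (theP _ (z_pair _ x y)). Qed.
Lemma TDef_upair s t : TDef s -> TDef t -> TDef (fun v => upair (s v) (t v)).
Proof.
  intros Hs Ht; apply TDef_the with (P := fun v p => forall z, z ∈ p <-> z = s v \/ z = t v).
  - intros v; destruct (z_pair M (s v) (t v)) as [p Hp]; exists p; split; auto.
    intros q Hq; apply mem_ext; intros z; rewrite Hp, Hq; tauto.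
  - dfn.
Qed.
Definition un a : M := the (fun u => forall z, z ∈ u <-> exists y, y ∈ a /\ z ∈ y).
Lemma in_un a z : z ∈ un a <-> exists y, y ∈ a /\ z ∈ y.
Proof. revert z; exact (theP _ (z_union M a)). Qed.
Lemma TDef_un s : TDef s -> TDef (fun v => un (s v)).
Proof.
  intros Hs; apply TDef_the with (P := fun v p => forall z, z ∈ p <-> exists y, y ∈ s v /\ z ∈ y).
  - intros v; destruct (z_union M (s v)) as [p Hp]; exists p; split; auto.
    intros q Hq; apply mem_ext; intros z; rewrite Hp, Hq; tauto.
  - dfn.
Qed.
Definition pow a : M := the (fun u => forall z, z ∈ u <-> z ⊆ a).
Lemma pow_ex a : exists u : M, forall z, z ∈ u <-> z ⊆ a.
Proof.
  destruct (z_power M a) as [P HP].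
  exists (sep P (fun z => z ⊆ a)). intros z; rewrite in_sep. split; [tauto|].
  intros h; split; auto. unfold sub; dfn.
Qed.
Lemma in_pow a z : z ∈ pow a <-> z ⊆ a.
Proof. revert z; exact (theP _ (pow_ex a)). Qed.
Lemma TDef_pow s : TDef s -> TDef (fun v => pow (s v)).
Proof.
  intros Hs; apply TDef_the with (P := fun v p => forall z, z ∈ p <-> z ⊆ s v).
  - intros v; destruct (pow_ex (s v)) as [p Hp]; exists p; split; auto.
    intros q Hq; apply mem_ext; intros z; rewrite Hp, Hq; tauto.
  - unfold sub; dfn.
Qed.
End Basics.

(** * Elementary set theory *)
Unset Strict Implicit.

Ltac dfn_hook ::= first [simple apply TDef_upair | simple apply TDef_un | simple apply TDef_pow].
#[export] Hint Unfold sub D1 : dfn.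

Section Ops.
Context {M : zermelo}.
Implicit Types x y z a b p f : M.

Lemma mem_ind (P : M -> Prop) : (forall x, (forall y, y ∈ x -> P y) -> P x) -> forall x, P x.
Proof. exact (well_founded_ind (@mem_wf M) P). Qed.
Lemma mem_min (P : M -> Prop) : (exists x, P x) -> exists x, P x /\ forall y, y ∈ x -> ~ P y.
Proof.
  intros [x H]; apply NNPP; intros N; revert x H.
  refine (mem_ind _). intros x IH h; apply N; eauto.
Qed.
Lemma mem_irr x : x ∉ x.
Proof. revert x; refine (mem_ind _); intros x IH H; exact (IH _ H H). Qed.
Lemma mem_asym x y : x ∈ y -> y ∉ x.
Proof. revert y; revert x; refine (mem_ind _); intros x IH y H H'; exact (IH _ H' _ H' H). Qed.

Definition emp : M := the (fun e => forall z, z ∉ e).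
Lemma in_emp z : z ∉ emp.
Proof.
  revert z; refine (theP (fun e => forall z, z ∉ e) _). exists (sep (pow (the (fun _ => True))) (fun _ => False)).
  intros z; rewrite in_sep by dfn; tauto.
Qed.
Definition sing x := upair x x.
Lemma in_sing x z : z ∈ sing x <-> z = x.
Proof. unfold sing; rewrite in_upair; tauto. Qed.
Definition cup a b := un (upair a b).
Lemma in_cup a b z : z ∈ cup a b <-> z ∈ a \/ z ∈ b.
Proof.
  unfold cup; rewrite in_un. split.
  - intros (y & H & H'); rewrite in_upair in H; destruct H as [-> | ->]; auto.
  - intros [H|H]; [exists a|exists b]; rewrite in_upair; auto.
Qed.
Definition succ x := cup x (sing x).
Lemma in_succ x z : z ∈ succ x <-> z ∈ x \/ z = x.
Proof. unfold succ; rewrite in_cup, in_sing; tauto. Qed.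
Lemma sub_antisym a b : a ⊆ b -> b ⊆ a -> a = b.
Proof. intros H H'; apply mem_ext; split; auto. Qed.
Lemma sub_refl a : a ⊆ a.
Proof. intros z; auto. Qed.
Lemma sub_trans a b c : a ⊆ b -> b ⊆ c -> a ⊆ c.
Proof. intros H H' z; auto. Qed.

Definition pr x y := upair (upair x x) (upair x y).
Lemma upair_inj x y x' y' : upair x y = upair x' y' -> (x = x' /\ y = y') \/ (x = y' /\ y = x').
Proof.
  intros e.
  assert (h : forall z, (z = x \/ z = y) <-> (z = x' \/ z = y')) by (intros z; rewrite <- !in_upair, e; tauto).
  destruct (proj1 (h x)) as [e1|e1], (proj1 (h y)) as [e2|e2]; auto; subst.
  - destruct (proj2 (h y')); auto.
  - destruct (proj2 (h x')); auto.
Qed.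
Lemma pr_inj x y x' y' : pr x y = pr x' y' -> x = x' /\ y = y'.
Proof.
  intros e; apply upair_inj in e as [[e1 e2]|[e1 e2]]; apply upair_inj in e1; apply upair_inj in e2;
    intuition (subst; auto).
Qed.
Lemma pr_iff x y x' y' : pr x y = pr x' y' <-> x = x' /\ y = y'.
Proof. split; [apply pr_inj|intros [-> ->]; auto]. Qed.
End Ops.
Arguments emp {M}.

Ltac dfn_base := first [simple apply TDef_upair | simple apply TDef_un | simple apply TDef_pow].
Ltac dfn_hook ::= first [dfn_base |
  lazymatch goal with |- TDef (fun v => sing _) => unfold sing | |- TDef (fun v => cup _ _) => unfold cup
  | |- TDef (fun v => succ _) => unfold succ | |- TDef (fun v => pr _ _) => unfold pr end].

Section Ops2.
Context {M : zermelo}.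
Implicit Types x y z a b p f : M.

Definition prod a b : M := sep (pow (pow (cup a b))) (fun p => exists x y, x ∈ a /\ y ∈ b /\ p = pr x y).
Lemma in_prod a b p : p ∈ prod a b <-> exists x y, x ∈ a /\ y ∈ b /\ p = pr x y.
Proof.
  unfold prod; rewrite in_sep by dfn. split; [tauto|]. intros H; split; auto.
  destruct H as (x & y & hx & hy & ->). rewrite in_pow; intros z hz; rewrite in_pow; intros w hw.
  unfold pr in hz; rewrite in_upair in hz; rewrite in_cup.
  destruct hz as [-> | ->]; rewrite in_upair in hw; destruct hw as [-> | ->]; auto.
Qed.
Lemma pr_prod a b x y : pr x y ∈ prod a b <-> x ∈ a /\ y ∈ b.
Proof.
  rewrite in_prod; split; [|intros [? ?]; eauto 6]. intros (x' & y' & h & h' & e); apply pr_inj in e as [-> ->]; auto.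
Qed.
Lemma TDef_prod (s t : (nat -> M) -> M) : TDef s -> TDef t -> TDef (fun v => prod (s v) (t v)).
Proof. intros; unfold prod; dfn. Qed.

Lemma pr_field x y f : pr x y ∈ f -> x ∈ un (un f) /\ y ∈ un (un f).
Proof.
  intros H; split; apply in_un; exists (upair x y); rewrite in_upair, in_un; (split; [|auto]);
    exists (pr x y); unfold pr; rewrite in_upair; auto.
Qed.
Definition dom f : M := sep (un (un f)) (fun x => exists y, pr x y ∈ f).
Definition ran f : M := sep (un (un f)) (fun y => exists x, pr x y ∈ f).
Lemma in_dom f x : x ∈ dom f <-> exists y, pr x y ∈ f.
Proof. unfold dom; rewrite in_sep by dfn. split; [tauto|]. intros [y H]; split; eauto. apply (pr_field H). Qed.
Lemma in_ran f y : y ∈ ran f <-> exists x, pr x y ∈ f.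
Proof. unfold ran; rewrite in_sep by dfn. split; [tauto|]. intros [x H]; split; eauto. apply (pr_field H). Qed.
(** Taking a union makes application a total definable term; at a point with exactly one value it
    returns that value. *)
Definition ap f x : M := un (sep (un (un f)) (fun y => pr x y ∈ f)).
Lemma ap_eq f x y : pr x y ∈ f -> (forall y', pr x y' ∈ f -> y' = y) -> ap f x = y.
Proof.
  intros H u. unfold ap. replace (sep _ _) with (sing y).
  - apply mem_ext; intros z; rewrite in_un; split; [intros (w & h & h'); apply in_sing in h; subst; auto|].
    intros h; exists y; rewrite in_sing; auto.
  - apply mem_ext; intros z; rewrite in_sing, in_sep by dfn. split.
    + intros ->; split; auto. apply (pr_field H).
    + intros [_ h]; auto.
Qed.
Lemma TDef_dom (s : (nat -> M) -> M) : TDef s -> TDef (fun v => dom (s v)).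
Proof. intros; unfold dom; dfn. Qed.
Lemma TDef_ran (s : (nat -> M) -> M) : TDef s -> TDef (fun v => ran (s v)).
Proof. intros; unfold ran; dfn. Qed.
Lemma TDef_ap (s t : (nat -> M) -> M) : TDef s -> TDef t -> TDef (fun v => ap (s v) (t v)).
Proof. intros; unfold ap; dfn. Qed.

Definition lam a b (F : M -> M) : M := sep (prod a b) (fun p => exists x, p = pr x (F x)).
Lemma pr_lam a b F x y : D1T F -> pr x y ∈ lam a b F <-> x ∈ a /\ y ∈ b /\ y = F x.
Proof.
  intros H; unfold lam. rewrite in_sep, pr_prod by dfn. split.
  - intros [[h h'] (x' & e)]; apply pr_inj in e as [-> ->]; auto.
  - intros (h & h' & ->); eauto.
Qed.
Lemma ap_lam a b F x : D1T F -> x ∈ a -> F x ∈ b -> ap (lam a b F) x = F x.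
Proof.
  intros H h h'; apply ap_eq; [apply pr_lam; auto|]. intros y; rewrite pr_lam by auto; tauto.
Qed.

Fixpoint fset (l : list M) : M := match l with nil => emp | cons x l => cup (sing x) (fset l) end.
Lemma in_fset l z : z ∈ fset l <-> In z l.
Proof.
  induction l as [|x l IH]; simpl; [|rewrite in_cup, in_sing, IH; intuition].
  split; [apply in_emp|tauto].
Qed.
(* Finiteness seen from outside; it agrees with the internal notion because
   the model is well-founded. *)
Definition fin a := exists l, forall z, z ∈ a <-> In z l.
Lemma fin_sub a b : a ⊆ b -> fin b -> fin a.
Proof.
  intros H [l Hl].
  exists (filter (fun z => if excluded_middle_informative (z ∈ a) then true else false) l).
  intros z; rewrite filter_In. destruct (excluded_middle_informative (z ∈ a)).
  split; auto. split; auto. apply Hl; auto. split; [tauto|]. intros [_ h]; discriminate.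
Qed.
Lemma fin_fset l : fin (fset l).
Proof. exists l; apply in_fset. Qed.
Lemma fin_cup a b : fin a -> fin b -> fin (cup a b).
Proof. intros [l Hl] [m Hm]; exists (l ++ m); intros z; rewrite in_cup, Hl, Hm, in_app_iff; tauto. Qed.
Lemma fin_eq a : fin a -> exists l, a = fset l /\ NoDup l.
Proof.
  intros [l Hl]. exists (nodup (fun x y => excluded_middle_informative (x = y)) l). split; [|apply NoDup_nodup].
  apply mem_ext; intros z; rewrite in_fset, nodup_In; auto.
Qed.

Definition ind j := emp ∈ j /\ forall x, x ∈ j -> succ x ∈ j.
Lemma is_upair_iff p x y : is_upair mem p x y <-> p = upair x y.
Proof.
  unfold is_upair, same. split.
  - intros H; apply mem_ext; intros z; rewrite H, in_upair.
    split; (intros [h|h]; [left|right]); subst; try tauto; apply mem_ext; auto.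
  - intros -> z; rewrite in_upair. split; (intros [h|h]; [left|right]); subst; try tauto; apply mem_ext; auto.
Qed.
Lemma same_iff x y : same mem x y <-> x = y.
Proof. split; [apply mem_ext|intros -> ; unfold same; tauto]. Qed.
Lemma is_empty_iff x : is_empty mem x <-> x = emp.
Proof.
  split; [|intros ->; exact in_emp]. intros H; apply mem_ext; intros z; split; intros h; [destruct (H _ h)|destruct (in_emp h)].
Qed.
Lemma is_succ_iff s x : is_succ mem s x <-> s = succ x.
Proof.
  split.
  - intros H; apply mem_ext; intros z; rewrite in_succ, (H z), same_iff; tauto.
  - intros -> z; rewrite in_succ, same_iff; tauto.
Qed.
Lemma is_inductive_iff i : is_inductive mem i <-> ind i.
Proof.
  unfold is_inductive, ind. split; intros [H1 H2]; split.
  - destruct H1 as (e & h & h'); apply is_empty_iff in h; subst; auto.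
  - intros x hx; destruct (H2 x hx) as (s & h & h'); apply is_succ_iff in h; subst; auto.
  - exists emp; rewrite is_empty_iff; auto.
  - intros x hx; exists (succ x); rewrite is_succ_iff; auto.
Qed.
Definition om : M := sep (the ind) (fun x => forall j, ind j -> x ∈ j).
Fixpoint nm (n : nat) : M := match n with O => emp | S n => succ (nm n) end.
Lemma om_ind j : ind j -> om ⊆ j.
Proof. intros H x hx; unfold om in hx; rewrite in_sep in hx by (unfold ind; dfn). apply hx, H. Qed.
Lemma ind_om : ind om.
Proof.
  assert (H : ind (the ind)).
  { apply theP. destruct (z_inf M) as [i Hi]; exists i; apply is_inductive_iff, Hi. }
  assert (D : D1 (fun x : M => forall j, ind j -> x ∈ j)) by (unfold ind; dfn).
  split; [|intros x]; unfold om; rewrite ?in_sep by auto.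
  - split; [apply H|]. intros j hj; apply hj.
  - intros [h h']; split; [apply H, h|]. intros j hj; apply hj, h', hj.
Qed.
(** The numbers of the model are standard because membership is well-founded. An element of [om]
    that is neither empty nor a successor of an element of [om] could be removed and an inductive
    set would remain; the induction hypothesis then applies to the predecessor. *)
Lemma in_om x : x ∈ om <-> exists n, x = nm n.
Proof.
  split.
  - revert x; refine (mem_ind _). intros x IH hx.
    assert (H : ~ ind (sep om (fun y => y <> x))).
    { intros H; apply om_ind in H; specialize (H x hx). rewrite in_sep in H by dfn. tauto. }
    destruct (classic (x = emp)) as [->|ne]; [exists 0; auto|].
    assert (H' : exists y, y ∈ om /\ succ y = x).
    { apply NNPP; intros N; apply H. split; [|intros y]; rewrite !in_sep by dfn.
      - split; [apply ind_om|auto].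
      - intros [h h']; split; [apply ind_om, h|]. intros e; apply N; eauto. }
    destruct H' as (y & hy & e). destruct (IH y) as [n e']; auto. subst x; rewrite in_succ; auto.
    exists (S n); simpl; congruence.
  - intros [n ->]; induction n; simpl; apply ind_om; auto.
Qed.
Lemma nm_om n : nm n ∈ om.
Proof. apply in_om; eauto. Qed.
Lemma in_nm x n : x ∈ nm n <-> exists m, m < n /\ x = nm m.
Proof.
  induction n; simpl.
  - split; [intros h; destruct (in_emp h)|intros (m & h & _); lia].
  - rewrite in_succ, IHn. split.
    + intros [(m & h & ->)| ->]; [exists m|exists n]; auto.
    + intros (m & h & ->). destruct (Nat.eq_dec m n) as [->|]; auto. left; exists m; split; auto; lia.
Qed.
Lemma nm_lt m n : m < n -> nm m ∈ nm n.
Proof. intros; apply in_nm; eauto. Qed.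
Lemma nm_inj m n : nm m = nm n -> m = n.
Proof.
  intros e; destruct (Nat.lt_total m n) as [h|[h|h]]; auto; apply nm_lt in h; rewrite e in h; destruct (mem_irr h).
Qed.
Lemma nm_mem m n : nm m ∈ nm n <-> m < n.
Proof. split; [|apply nm_lt]. rewrite in_nm; intros (k & h & e); apply nm_inj in e; subst; auto. Qed.
Lemma om_trans x y : x ∈ y -> y ∈ om -> x ∈ om.
Proof. intros h h'; apply in_om in h' as [n ->]; apply in_nm in h as (m & _ & ->); apply nm_om. Qed.
Lemma fin_nm n : fin (nm n).
Proof.
  exists (map nm (seq 0 n)). intros z; rewrite in_nm, in_map_iff. split; intros (m & h & h').
  subst; exists m; rewrite in_seq; split; auto; lia. exists m; rewrite in_seq in h'; split; auto; lia.
Qed.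
End Ops2.
Arguments om {M}.

Ltac dfn_base2 := first [dfn_base | simple apply TDef_prod | simple apply TDef_dom | simple apply TDef_ran | simple apply TDef_ap |
  lazymatch goal with |- TDef (fun v => sing _) => unfold sing | |- TDef (fun v => cup _ _) => unfold cup
  | |- TDef (fun v => succ _) => unfold succ | |- TDef (fun v => pr _ _) => unfold pr
  | |- TDef (fun v => lam _ _ _) => unfold lam end].
Ltac dfn_hook ::= dfn_base2.

(** * Recursion, arithmetic and ordinals *)

Section Rec.
Context {M : zermelo} (H : M -> M) (DH : D1T H).
Implicit Types x y z a b c d p f g h A B : M.

Definition rst f a : M := sep f (fun p => exists c d, c ∈ a /\ p = pr c d).
Lemma pr_rst f a x y : pr x y ∈ rst f a <-> pr x y ∈ f /\ x ∈ a.
Proof.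
  unfold rst; rewrite in_sep by dfn. split; intros [h h']; split; eauto.
  destruct h' as (c & d & hc & e); apply pr_inj in e as [-> _]; auto.
Qed.
Lemma TDef_rst (s t : (nat -> M) -> M) : TDef s -> TDef t -> TDef (fun v => rst (s v) (t v)).
Proof. intros; unfold rst; dfn. Qed.

(** Attempts may be partial: a value of h at a only requires values on the elements of a. Uniqueness
    of values holds outright, whereas totality rests on the hypothesis [RB] that the graph of [Rel]
    over any set is a set. *)
Definition att h := forall a b, pr a b ∈ h ->
  (forall c, c ∈ a -> exists d, pr c d ∈ h) /\ b = H (rst h a).
Definition Rel x y := exists h, att h /\ pr x y ∈ h.
Definition graph_on x g := forall p, p ∈ g <-> exists a b, a ∈ x /\ Rel a b /\ p = pr a b.
Lemma Def_Rel : D2 Rel.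
Proof. unfold Rel, att, rst; dfn. Qed.
Lemma Rel_fun x y y' : Rel x y -> Rel x y' -> y = y'.
Proof.
  revert x y y'; refine (mem_ind _). intros x IH y y' (h & ah & hp) (h' & ah' & hp').
  destruct (ah _ _ hp) as [t ->], (ah' _ _ hp') as [t' ->]. f_equal.
  unfold rst; apply mem_ext; intros p; rewrite !in_sep by dfn.
  split; intros (hq & c & d & hc & ->); split; eauto.
  - destruct (t' _ hc) as [d' hd]. replace d with d'; auto. apply (IH c hc); [exists h'|exists h]; auto.
  - destruct (t _ hc) as [d' hd]. replace d with d'; auto. apply (IH c hc); [exists h|exists h']; auto.
Qed.
Lemma Rel_unfold x y : Rel x y ->
  (forall c, c ∈ x -> exists d, Rel c d) /\ forall g, graph_on x g -> y = H g.
Proof.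
  intros (h & ah & hp). destruct (ah _ _ hp) as [t ->]. split.
  - intros c hc; destruct (t c hc) as [d hd]; exists d, h; auto.
  - intros g Hg; f_equal. apply mem_ext; intros p; rewrite (Hg p). unfold rst; rewrite in_sep by dfn.
    split.
    + intros (hq & c & d & hc & ->); exists c, d; repeat split; auto. exists h; auto.
    + intros (a & b & ha & hr & ->). destruct (t a ha) as [d hd].
      assert (b = d) by (eapply Rel_fun; eauto; exists h; auto). subst; split; eauto.
Qed.

Variable RB : forall A, exists g, graph_on A g.
(** If x has no value yet, the graph of [Rel] over a transitive set around x does not involve x as
    an argument, so adding the one pair for x gives an attempt again. *)
Lemma Rel_fold x g : (forall c, c ∈ x -> exists d, Rel c d) -> graph_on x g ->
  (exists A, is_transitive mem A /\ x ∈ A) -> Rel x (H g).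
Proof.
  intros ex Hg (A & tA & xA). destruct (RB A) as [k Hk].
  assert (in_k : forall a b, a ∈ A -> Rel a b -> pr a b ∈ k) by (intros; apply Hk; eauto 6).
  assert (rk : forall a b, pr a b ∈ k -> a ∈ A /\ Rel a b).
  { intros a b hp; apply Hk in hp as (a' & b' & h1 & h2 & e); apply pr_inj in e as [-> ->]; auto. }
  destruct (classic (exists y, Rel x y)) as [[y hy]|no].
  { destruct (Rel_unfold hy) as [_ u]. rewrite <- (u g); auto. }
  assert (nx : forall d, pr x d ∉ k) by (intros d hd; apply rk in hd as [_ hd]; eauto).
  exists (cup k (sing (pr x (H g)))). split; [|rewrite in_cup, in_sing; auto].
  assert (gr : forall a, a ∈ A -> x ∉ a -> forall r, graph_on a r ->
    rst (cup k (sing (pr x (H g)))) a = r).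
  { intros a aA xa r hr; apply mem_ext; intros p; rewrite (hr p).
    unfold rst; rewrite in_sep, in_cup, in_sing by dfn. split.
    - intros ([hq|hq] & c & d & hc & ->).
      + apply rk in hq as [_ hq]; eauto 6.
      + apply pr_inj in hq as [-> _]; tauto.
    - intros (c & d & hc & hd & ->). split; eauto. left; apply in_k; auto. apply (tA a aA c hc). }
  intros a b hp. rewrite in_cup, in_sing, pr_iff in hp. destruct hp as [hp|[-> ->]].
  - apply rk in hp as [aA hr]. destruct (Rel_unfold hr) as [t u]. split.
    + intros c hc; destruct (t c hc) as [d hd]; exists d; rewrite in_cup; left; apply in_k; auto.
      apply (tA a aA c hc).
    + destruct (RB a) as [r Hr]. rewrite (gr a aA) with (r := r); auto.
  - split.
    + intros c hc; destruct (ex c hc) as [d hd]; exists d; rewrite in_cup; left; apply in_k; auto.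
      apply (tA x xA c hc).
    + rewrite (gr x xA) with (r := g); auto.
Qed.
Lemma Rel_total A x : is_transitive mem A -> x ∈ A -> exists y, Rel x y.
Proof.
  intros tA; revert x; refine (mem_ind _). intros x IH xA.
  destruct (RB x) as [g Hg]. exists (H g). apply Rel_fold; eauto.
  intros c hc; apply IH; auto. apply (tA x xA c hc).
Qed.
End Rec.

Ltac dfn_base3 := first [dfn_base2 | simple apply TDef_rst].
Ltac dfn_hook ::= dfn_base3.

Section Rec2.
Context {M : zermelo}.
Implicit Types x y z a b c d p f g h A B : M.

Definition funcs f A B := f ⊆ prod A B /\ forall x, x ∈ A -> ap f x ∈ B /\ forall y, pr x y ∈ f <-> y = ap f x.

(** A set B containing all values turns the graph into a subset of a product, so separation alone
    supplies [RB]. *)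
Lemma rec_bounded (H : M -> M) A B : D1T H -> is_transitive mem A -> (forall g, H g ∈ B) ->
  exists f, funcs f A B /\ forall x, x ∈ A -> ap f x = H (rst f x).
Proof.
  intros DH tA HB.
  assert (RelB : forall x y, Rel H x y -> y ∈ B).
  { intros x y (h & ah & hp). destruct (ah _ _ hp) as [_ ->]; auto. }
  assert (DR := Def_Rel DH).
  assert (RB : forall C, exists g, graph_on H C g).
  { intros C. exists (sep (prod C B) (fun p => exists a b, Rel H a b /\ p = pr a b)).
    intros p; rewrite in_sep, in_prod by dfn. split.
    - intros ((a & b & ha & hb & ->) & (a' & b' & hr & e)). apply pr_inj in e as [-> ->]. eauto 6.
    - intros (a & b & ha & hr & ->). split; eauto 8. }
  destruct (RB A) as [f Hf].
  assert (pf : forall x y, pr x y ∈ f <-> x ∈ A /\ Rel H x y).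
  { intros x y; rewrite (Hf (pr x y)); split.
    - intros (a & b & h & h' & e); apply pr_inj in e as [-> ->]; auto.
    - intros [h h']; eauto 6. }
  assert (apf : forall x y, x ∈ A -> Rel H x y -> ap f x = y).
  { intros x y hx hr; apply ap_eq; [apply pf; auto|]. intros y' h; apply pf in h as [_ h].
    eapply Rel_fun; eauto. }
  exists f; split; [split|].
  - intros p hp; apply Hf in hp as (a & b & h & h' & ->). apply pr_prod; eauto.
  - intros x hx; destruct (Rel_total RB tA hx) as [y hy]. rewrite (apf x y); auto. split; eauto.
    intros y'; rewrite pf. split; [intros [_ h]; eapply Rel_fun; eauto|intros ->; auto].
  - intros x hx; destruct (Rel_total RB tA hx) as [y hy]. rewrite (apf x y); auto.
    destruct (Rel_unfold hy) as [_ u]. apply u. intros p; unfold rst; rewrite in_sep by dfn. split.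
    + intros (h & c & d & hc & ->). apply pf in h as [_ h]; eauto 6.
    + intros (a & b & ha & hr & ->). split; eauto. apply pf; split; auto. apply (tA x hx a ha).
Qed.

Lemma trans_om : is_transitive mem (@om M).
Proof. intros y hy x hx; eapply om_trans; eauto. Qed.

(* The approximations to an iteration are finite sets of pairs each of which is
   the initial one or comes from another one. *)
Definition iter_att (z0 : M) (s : M -> M -> M) h := forall q, q ∈ h ->
  q = pr emp z0 \/ exists n z, pr n z ∈ h /\ q = pr (succ n) (s n z).
Lemma iter_att_unique z0 s h (u : nat -> M) : u 0 = z0 -> (forall n, u (S n) = s (nm n) (u n)) ->
  iter_att z0 s h -> forall n z, pr (nm n) z ∈ h -> z = u n.
Proof.
  intros u0 uS ah; induction n; intros z hz; destruct (ah _ hz) as [e|(m & w & hm & e)]; apply pr_inj in e as [e1 e2].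
  - congruence.
  - exfalso; apply (@in_emp M m). simpl in e1; rewrite e1; apply in_succ; auto.
  - exfalso; apply (@in_emp M (nm n)). rewrite <- e1; apply in_succ; auto.
  - assert (m = nm n).
    { assert (hm' : m ∈ om). { eapply om_trans. 2: apply (nm_om (S n)). rewrite e1; apply in_succ; auto. }
      apply in_om in hm' as [k ->]. apply (nm_inj (m := S n) (n := S k)) in e1.
      f_equal; lia. }
    subst. rewrite uS. f_equal. auto.
Qed.
Lemma iter_att_ex z0 s (u : nat -> M) : u 0 = z0 -> (forall n, u (S n) = s (nm n) (u n)) ->
  forall n, exists h, iter_att z0 s h /\ pr (nm n) (u n) ∈ h.
Proof.
  intros u0 uS n. exists (fset (map (fun i => pr (nm i) (u i)) (seq 0 (S n)))). split.
  - intros q hq. rewrite in_fset, in_map_iff in hq. destruct hq as (i & <- & hi). destruct i as [|i].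
    left; simpl; congruence. right; exists (nm i), (u i). split; [|rewrite uS; auto].
    rewrite in_fset, in_map_iff; exists i; split; auto. apply in_seq; apply in_seq in hi; lia.
  - rewrite in_fset, in_map_iff; exists n; split; auto. apply in_seq; lia.
Qed.
Lemma om_rec (z0 : M) (s : M -> M -> M) B : D2T s -> z0 ∈ B -> (forall n z, z ∈ B -> s n z ∈ B) ->
  exists f, funcs f om B /\ ap f (nm 0) = z0 /\ forall n, ap f (nm (S n)) = s (nm n) (ap f (nm n)).
Proof.
  intros Ds h0 hs.
  pose (u := fix u n := match n with O => z0 | S n => s (nm n) (u n) end).
  assert (uB : forall n, u n ∈ B) by (induction n; simpl; auto).
  pose (f := sep (prod om B) (fun p => exists h, iter_att z0 s h /\ p ∈ h)).
  assert (pf : forall n z, pr (nm n) z ∈ f <-> z = u n).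
  { intros n z; unfold f; rewrite in_sep, pr_prod by (unfold iter_att; dfn). split.
    - intros (_ & h & ah & hp). exact (iter_att_unique (u := u) eq_refl (fun _ => eq_refl) ah hp).
    - intros ->; split; [split; auto using nm_om|]. apply iter_att_ex; auto. }
  assert (af : forall n, ap f (nm n) = u n).
  { intros n; apply ap_eq; intros; apply pf; auto. }
  exists f; split; [split|split].
  - intros p hp; unfold f in hp; rewrite in_sep in hp by (unfold iter_att; dfn). tauto.
  - intros x hx; apply in_om in hx as [n ->]. rewrite af; split; [auto|intros y; apply pf].
  - apply af.
  - intros n; rewrite !af; auto.
Qed.
Lemma arith_rec (b : M -> M) (s : M -> M -> M) (bf : nat -> nat) (sf : nat -> nat -> nat) :
  D1T b -> D2T s -> (forall m, b (nm m) = nm (bf m)) -> (forall m k, s (nm m) (nm k) = nm (sf m k)) ->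
  exists F : M, forall m n, ap F (pr (nm m) (nm n)) = nm (nat_rect (fun _ => nat) (bf m) (fun _ k => sf m k) n).
Proof.
  intros Db Ds hb hs.
  exists (sep (prod (prod om om) om) (fun p => exists m n z, p = pr (pr m n) z /\
    exists h, iter_att (b m) (fun _ z => s m z) h /\ pr n z ∈ h)).
  intros m n. set (u := fun n => @nm M (nat_rect (fun _ => nat) (bf m) (fun _ k => sf m k) n)).
  assert (u0 : u 0 = b (nm m)) by (unfold u; simpl; rewrite hb; auto).
  assert (uS : forall n, u (S n) = s (nm m) (u n)) by (intros; unfold u; simpl; rewrite hs; auto).
  apply ap_eq; [|intros y'].
  - rewrite in_sep, !pr_prod by (unfold iter_att; dfn). split; [unfold u; auto using nm_om|].
    exists (nm m), (nm n), (u n); split; auto. apply iter_att_ex; auto.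
  - rewrite in_sep, !pr_prod by (unfold iter_att; dfn). intros [_ (m' & n' & z' & e & h & ah & hp)].
    apply pr_inj in e as [e ->]; apply pr_inj in e as [<- <-].
    exact (iter_att_unique (u := u) u0 uS ah hp).
Qed.
Definition Plus : M := the (fun F => forall m n, ap F (pr (nm m) (nm n)) = nm (m + n)).
Definition Times : M := the (fun F => forall m n, ap F (pr (nm m) (nm n)) = nm (m * n)).
Lemma ap_Plus m n : ap Plus (pr (nm m) (nm n)) = nm (m + n).
Proof.
  revert m n. refine (theP (fun F => forall m n, ap F (pr (nm m) (nm n)) = nm (m + n)) _).
  destruct (arith_rec (b := fun x => x) (s := fun _ z => succ z) (bf := fun m => m) (sf := fun _ k => S k)) as [F HF].
  dfn. dfn. auto. auto. exists F; intros m n; rewrite HF; f_equal. induction n; simpl; lia.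
Qed.
Lemma ap_Times m n : ap Times (pr (nm m) (nm n)) = nm (m * n).
Proof.
  revert m n. refine (theP (fun F => forall m n, ap F (pr (nm m) (nm n)) = nm (m * n)) _).
  destruct (arith_rec (b := fun x => emp) (s := fun m z => ap Plus (pr m z)) (bf := fun m => 0) (sf := fun m k => m + k)) as [F HF].
  dfn. dfn. auto. intros; apply ap_Plus. exists F; intros m n; rewrite HF; f_equal. induction n; simpl; lia.
Qed.
(** The value lies between the squares of m + n and m + n + 1, which gives injectivity. It is also
    at least m, and this later moves the bits of a row beyond a given finite condition. *)
Definition cpair (m n : nat) := (m + n) * (m + n) + m.
Lemma cpair_inj m n m' n' : cpair m n = cpair m' n' -> m = m' /\ n = n'.
Proof. unfold cpair; intros h. assert (m + n = m' + n') by nia. nia. Qed.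
Definition code (x y : M) : M :=
  ap Plus (pr (ap Times (pr (ap Plus (pr x y)) (ap Plus (pr x y)))) x).
Lemma code_nm m n : code (nm m) (nm n) = nm (cpair m n).
Proof. unfold code; rewrite !ap_Plus, ap_Times, ap_Plus; auto. Qed.
Lemma code_om x y : x ∈ om -> y ∈ om -> code x y ∈ om.
Proof. intros h h'; apply in_om in h as [m ->], h' as [n ->]. rewrite code_nm; apply nm_om. Qed.
Lemma code_inj x y x' y' : x ∈ om -> y ∈ om -> x' ∈ om -> y' ∈ om -> code x y = code x' y' -> x = x' /\ y = y'.
Proof.
  intros h1 h2 h3 h4. apply in_om in h1 as [m ->], h2 as [n ->], h3 as [m' ->], h4 as [n' ->].
  rewrite !code_nm. intros e; apply nm_inj, cpair_inj in e as [-> ->]; auto.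
Qed.
Lemma TDef_code (s t : (nat -> M) -> M) : TDef s -> TDef t -> TDef (fun v => code (s v) (t v)).
Proof. intros; unfold code; dfn. Qed.

Notation ord := (is_ordinal mem).
Lemma ord_elem a b : ord a -> b ∈ a -> ord b.
Proof. intros [t t'] h; split; auto. intros c hc; apply t'. apply (t b h c hc). Qed.
Lemma ord_trans a b c : ord c -> a ∈ b -> b ∈ c -> a ∈ c.
Proof. intros [t _] h h'; exact (t b h' a h). Qed.
Lemma ord_trich a b : ord a -> ord b -> a ∈ b \/ a = b \/ b ∈ a.
Proof.
  revert a b; refine (mem_ind _); intros a IHa; refine (mem_ind _); intros b IHb oa ob.
  destruct (classic (a ⊆ b)) as [hab|hab].
  - destruct (classic (b ⊆ a)) as [hba|hba]; [right; left; apply sub_antisym; auto|].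
    apply not_all_ex_not in hba as [c hc]. apply imply_to_and in hc as [hc hn].
    destruct (IHb c hc oa (ord_elem ob hc)) as [h|[h|h]]; [left|subst; auto|tauto].
    eapply ord_trans; eauto.
  - apply not_all_ex_not in hab as [c hc]. apply imply_to_and in hc as [hc hn].
    destruct (IHa c hc b (ord_elem oa hc) ob) as [h|[h|h]]; [tauto|subst; auto|].
    right; right; eapply ord_trans; eauto.
Qed.
Lemma ord_om : ord (@om M).
Proof.
  split; [exact trans_om|]. intros y hy; apply in_om in hy as [n ->].
  intros x hx z hz. apply in_nm in hx as (m & hm & ->). apply in_nm in hz as (k & hk & ->).
  apply nm_lt; lia.
Qed.
End Rec2.
Arguments Plus {M}. Arguments Times {M}.
Notation ord := (is_ordinal mem).
Ltac dfn_base4 := first [dfn_base3 | simple apply TDef_code].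
Ltac dfn_hook ::= dfn_base4.
#[export] Hint Unfold is_ordinal is_transitive ind iter_att : dfn.

(** * Finite and countable sets *)
#[export] Hint Unfold same is_empty is_upair is_pair is_prod is_power is_succ is_inductive is_omega app app2
  is_fun is_injective injects equinumerous finite countable : dfn.

Section Link.
Context {M : zermelo}.
Implicit Types x y z w u a b c d p f g h A B : M.

Lemma is_pair_iff p x y : is_pair mem p x y <-> p = pr x y.
Proof.
  unfold is_pair, pr. split.
  - intros (a & b & h1 & h2 & h3). rewrite is_upair_iff in h1, h2, h3; subst; auto.
  - intros ->; exists (upair x x), (upair x y); rewrite !is_upair_iff; auto.
Qed.
Lemma app_iff f x y : app mem f x y <-> pr x y ∈ f.
Proof.
  unfold app. split; [intros (p & h & h'); apply is_pair_iff in h; subst; auto|].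
  intros h; exists (pr x y); rewrite is_pair_iff; auto.
Qed.
Lemma app2_iff f x y z : app2 mem f x y z <-> pr (pr x y) z ∈ f.
Proof.
  unfold app2. split; [intros (p & h & h'); apply is_pair_iff in h; apply app_iff in h'; subst; auto|].
  intros h; exists (pr x y); rewrite is_pair_iff, app_iff; auto.
Qed.
Lemma is_omega_iff w : is_omega mem w <-> w = om.
Proof.
  unfold is_omega; rewrite is_inductive_iff. split.
  - intros [h h']; apply sub_antisym; [apply h', is_inductive_iff, ind_om|apply om_ind, h].
  - intros ->; split; [apply ind_om|]. intros i hi; apply om_ind, is_inductive_iff, hi.
Qed.
Lemma is_prod_iff c a b : is_prod mem c a b <-> c = prod a b.
Proof.
  split; [intros h; apply mem_ext; intros p; rewrite (h p)|intros -> p];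
    rewrite in_prod; split; intros (x & y & hx & hy & e); exists x, y; rewrite ?is_pair_iff in *; auto.
Qed.
Lemma is_power_iff c a : is_power mem c a <-> c = pow a.
Proof.
  split; [intros h; apply mem_ext; intros p; rewrite (h p)|intros -> p]; rewrite in_pow; tauto.
Qed.
Lemma is_fun_iff f a b : is_fun mem f a b <-> funcs f a b.
Proof.
  split.
  - intros [h1 h2]. split.
    + intros p hp. destruct (h1 p hp) as (x & y & hx & hy & e). apply is_pair_iff in e; subst. apply pr_prod; auto.
    + intros x hx. destruct (h2 x hx) as (y & hy & u). apply app_iff in hy.
      assert (e : ap f x = y). { apply ap_eq; auto. intros y' h; apply app_iff, u, same_iff in h; auto. }
      rewrite e; split.
      * destruct (h1 _ hy) as (x' & y' & _ & h & e'). apply is_pair_iff, pr_inj in e' as [_ <-]; auto.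
      * intros y'; split; [|intros ->; auto]. intros h; apply app_iff, u, same_iff in h; auto.
  - intros [h1 h2]. split.
    + intros p hp; apply h1, in_prod in hp as (x & y & hx & hy & ->). exists x, y; rewrite is_pair_iff; auto.
    + intros x hx; destruct (h2 x hx) as [h u]. exists (ap f x). rewrite app_iff, u. split; auto.
      intros y' h'; apply app_iff, u in h'; apply same_iff; auto.
Qed.
Lemma funcs_lam a b (F : M -> M) : D1T F -> (forall x, x ∈ a -> F x ∈ b) -> funcs (lam a b F) a b.
Proof.
  intros D h. split.
  - intros p hp; unfold lam in hp; rewrite in_sep in hp by dfn; tauto.
  - intros x hx; rewrite ap_lam; auto. split; auto. intros y; rewrite pr_lam by auto.
    split; [tauto|intros ->; auto].
Qed.
Lemma funcs_pr f a b x y : funcs f a b -> pr x y ∈ f <-> x ∈ a /\ y = ap f x.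
Proof.
  intros [h1 h2]; split; [|intros [h ->]; apply h2; auto].
  intros h. assert (hx := h1 _ h). apply pr_prod in hx as [hx _]. split; auto; apply h2; auto.
Qed.
Lemma funcs_ap f a b x : funcs f a b -> x ∈ a -> ap f x ∈ b.
Proof. intros [_ h] hx; apply h; auto. Qed.
Lemma funcs_ext f g a b : funcs f a b -> funcs g a b -> (forall x, x ∈ a -> ap f x = ap g x) -> f = g.
Proof.
  intros hf hg H; apply mem_ext; intros p; split; intros hp.
  - assert (hp' := hp). apply (proj1 hf), in_prod in hp' as (x & y & hx & hy & ->).
    rewrite (funcs_pr _ _ hf) in hp; rewrite (funcs_pr _ _ hg), <- H; tauto.
  - assert (hp' := hp). apply (proj1 hg), in_prod in hp' as (x & y & hx & hy & ->).
    rewrite (funcs_pr _ _ hg) in hp; rewrite (funcs_pr _ _ hf), H; tauto.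
Qed.

Definition inj a b := exists f, (forall x, x ∈ a -> ap f x ∈ b) /\
  forall x x', x ∈ a -> x' ∈ a -> ap f x = ap f x' -> x = x'.
Lemma injects_iff a b : injects mem a b <-> inj a b.
Proof.
  split.
  - intros (f & hf & hi). apply is_fun_iff in hf. exists f; split; [intros; eapply funcs_ap; eauto|].
    intros x x' hx hx' e. apply same_iff, (hi x x' (ap f x)); apply app_iff, (funcs_pr _ _ hf); auto.
  - intros (f & h1 & h2). exists (lam a b (ap f)). assert (D : D1T (ap f)) by dfn. split.
    + apply is_fun_iff, funcs_lam; auto.
    + intros x x' y h h'. apply app_iff, pr_lam in h as (hx & _ & ->); auto.
      apply app_iff, pr_lam in h' as (hx' & _ & e); auto. apply same_iff; auto.
Qed.

Lemma equin_list a k : equinumerous mem a (nm k) -> exists l, length l = k /\ forall z, z ∈ a <-> In z l.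
Proof.
  intros (f & hf & hi & hs). apply is_fun_iff in hf.
  exists (map (fun i => the (fun x => x ∈ a /\ pr x (nm i) ∈ f)) (seq 0 k)).
  split; [rewrite length_map, length_seq; auto|].
  assert (P : forall i, i < k -> let x := the (fun x => x ∈ a /\ pr x (nm i) ∈ f) in x ∈ a /\ pr x (nm i) ∈ f).
  { intros i hi'. apply (theP (fun x => x ∈ a /\ pr x (nm i) ∈ f)).
    destruct (hs (nm i)) as (x & hx & h); [apply nm_lt; auto|]. exists x; rewrite <- app_iff; auto. }
  intros z; rewrite in_map_iff; split.
  - intros hz. assert (h := funcs_ap hf hz). apply in_nm in h as (i & hi' & e).
    exists i; rewrite in_seq; split; [|lia]. destruct (P i hi') as [h1 h2].
    apply same_iff, (hi _ _ (nm i)); apply app_iff; auto. apply (funcs_pr _ _ hf); auto.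
  - intros (i & <- & h). apply in_seq in h. apply P; lia.
Qed.
Lemma finite_iff a : finite mem a <-> fin a.
Proof.
  split.
  - intros (w & n & hw & hn & h). apply is_omega_iff in hw; subst w.
    apply in_om in hn as [k ->]. destruct (equin_list h) as (l & _ & H); exists l; auto.
  - intros h; apply fin_eq in h as (l & -> & nd).
    exists om, (nm (length l)). rewrite is_omega_iff; split; auto. split; [apply nm_om|].
    pose (f := fset (map (fun i => pr (nth i l emp) (nm i)) (seq 0 (length l)))).
    assert (pf : forall x y, pr x y ∈ f <-> exists i, i < length l /\ x = nth i l emp /\ y = nm i).
    { intros x y; unfold f; rewrite in_fset, in_map_iff; split.
      - intros (i & e & h); apply pr_inj in e as [<- <-]; apply in_seq in h; exists i; repeat split; lia.
      - intros (i & h & -> & ->); exists i; rewrite in_seq; split; auto; lia. }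
    exists f; split; [split|split].
    + intros p hp; unfold f in hp; rewrite in_fset, in_map_iff in hp. destruct hp as (i & <- & h).
      apply in_seq in h. exists (nth i l emp), (nm i). rewrite in_fset, is_pair_iff; repeat split; auto.
      apply nth_In; lia. apply nm_lt; lia.
    + intros x hx; apply in_fset in hx. apply (In_nth _ _ emp) in hx as (i & h & <-).
      exists (nm i); split; [apply app_iff, pf; eauto|].
      intros y' h'; apply app_iff, pf in h' as (j & hj & e & ->). apply same_iff; f_equal.
      apply (proj1 (NoDup_nth l emp) nd); auto.
    + intros x x' y h h'. apply app_iff, pf in h as (i & _ & -> & ->), h' as (j & _ & -> & e).
      apply nm_inj in e; subst; apply same_iff; auto.
    + intros y hy; apply in_nm in hy as (i & hi & ->). exists (nth i l emp).
      rewrite in_fset, app_iff, pf; split; eauto. apply nth_In; auto.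
Qed.

(** The enumeration must hit every element of a but may take other values, so subsets inherit it;
    the index is an external number, in accordance with [in_om]. *)
Definition enum a := exists f, forall z, z ∈ a -> exists n, ap f (nm n) = z.
Lemma enum_rel A B (R : M -> M -> Prop) : D2 R -> enum A -> (forall z, z ∈ B -> exists a, a ∈ A /\ R a z) ->
  (forall a z z', z ∈ B -> z' ∈ B -> R a z -> R a z' -> z = z') -> enum B.
Proof.
  intros D (f & hf) hs hu.
  exists (sep (prod om B) (fun p => exists n z, p = pr n z /\ R (ap f n) z)).
  intros z hz. destruct (hs z hz) as (a & ha & hr). destruct (hf a ha) as [n e]. exists n; subst a.
  apply ap_eq; [|intros y']; rewrite in_sep, pr_prod by dfn.
  - split; eauto using nm_om.
  - intros [[_ hy] (n' & z' & e & hr')]; apply pr_inj in e as [<- <-]. eauto.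
Qed.
Lemma enum_img A B (F : M -> M) : D1T F -> enum A -> (forall z, z ∈ B -> exists a, a ∈ A /\ z = F a) -> enum B.
Proof.
  intros D h H. apply enum_rel with (A := A) (R := fun a z => z = F a); auto. dfn. intros; congruence.
Qed.
Lemma enum_sub a b : a ⊆ b -> enum b -> enum a.
Proof. intros h [f hf]; exists f; auto. Qed.
Lemma enum_om : enum om.
Proof.
  exists (lam om om (fun x => x)). intros z hz; apply in_om in hz as [n ->]. exists n.
  apply (ap_lam (F := fun x => x)); auto using nm_om. dfn.
Qed.
Lemma enum_prod a b : enum a -> enum b -> enum (prod a b).
Proof.
  intros [f hf] [g hg].
  apply enum_rel with (A := om) (R := fun k z => exists m n, m ∈ om /\ n ∈ om /\ k = code m n /\ z = pr (ap f m) (ap g n)).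
  - dfn.
  - apply enum_om.
  - intros z hz; apply in_prod in hz as (x & y & hx & hy & ->).
    destruct (hf x hx) as [m <-], (hg y hy) as [n <-]. exists (code (nm m) (nm n)).
    split; [apply code_om; apply nm_om|]. exists (nm m), (nm n); auto using nm_om.
  - intros k z z' _ _ (m & n & h1 & h2 & -> & ->) (m' & n' & h1' & h2' & e & ->).
    apply code_inj in e as [-> ->]; auto.
Qed.
Lemma fin_seq_graph (v : nat -> M) k : exists f, (forall i, i < k -> ap f (nm i) = v i) /\
  forall z, z ∈ f -> exists i, i < k /\ z = pr (nm i) (v i).
Proof.
  exists (fset (map (fun i => pr (nm i) (v i)) (seq 0 k))). split.
  - intros i hi. apply ap_eq; [|intros y]; rewrite in_fset, in_map_iff.
    + exists i; rewrite in_seq; split; auto; lia.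
    + intros (n & e & _); apply pr_inj in e as [e <-]; apply nm_inj in e; subst; auto.
  - intros z hz; apply in_fset, in_map_iff in hz as (i & <- & hi). apply in_seq in hi. exists i; split; auto; lia.
Qed.
Lemma fin_seq (v : nat -> M) k : exists f, forall i, i < k -> ap f (nm i) = v i.
Proof. destruct (fin_seq_graph v k) as (f & h & _); eauto. Qed.
Lemma enum_fin a : fin a -> enum a.
Proof.
  intros [l Hl]. destruct (fin_seq (fun i => nth i l emp) (length l)) as [f hf]. exists f.
  intros z hz; apply Hl, (In_nth _ _ emp) in hz as (i & h & <-). eauto.
Qed.
Lemma countable_iff a : countable mem a <-> enum a.
Proof.
  split.
  - intros (w & hw & h). apply is_omega_iff in hw; subst w. apply injects_iff in h as (f & h1 & h2).
    apply enum_rel with (A := om) (R := fun n x => ap f x = n); [dfn|apply enum_om|eauto|].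
    intros; subst; auto.
  - intros [g hg]. exists om; rewrite is_omega_iff, injects_iff; split; auto.
    (* Injectivity comes from sending each x to its least index. *)
    pose (f := sep (prod a om) (fun p => exists x n, p = pr x n /\ ap g n = x /\ forall m, m ∈ n -> ap g m <> x)).
    assert (pf : forall x n, pr x n ∈ f <-> x ∈ a /\ n ∈ om /\ ap g n = x /\ forall m, m ∈ n -> ap g m <> x).
    { intros x n; unfold f; rewrite in_sep, pr_prod by dfn. split.
      - intros [h (x' & n' & e & h')]; apply pr_inj in e as [<- <-]; tauto.
      - intros (h1 & h2 & h3); split; eauto. }
    assert (P : forall x, x ∈ a -> pr x (ap f x) ∈ f).
    { intros x hx. destruct (@mem_min M (fun n => n ∈ om /\ ap g n = x)) as (n & [h1 h2] & h3).
      destruct (hg x hx) as [n e]; exists (nm n); auto using nm_om.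
      assert (hn : pr x n ∈ f).
      { apply pf; repeat split; auto. intros m hm e; apply (h3 m hm); split; auto. eapply om_trans; eauto. }
      rewrite (@ap_eq _ f x n); auto. intros n' hn'; apply pf in hn' as (_ & h1' & h2' & h3').
      destruct (ord_trich (ord_elem ord_om h1) (ord_elem ord_om h1')) as [h|[h|h]]; auto.
      destruct (h3' n h h2). destruct (h3 n' h); auto. }
    exists f; split. intros x hx; apply P, pf in hx; tauto.
    intros x x' hx hx' e. apply P, pf in hx as (_ & _ & <- & _), hx' as (_ & _ & <- & _). congruence.
Qed.

Lemma fin_pow_aux (l : list M) : exists m : list M, forall b, b ⊆ fset l -> In b m.
Proof.
  induction l as [|x l [m Hm]].
  - exists (emp :: nil). intros b hb; left. apply sub_antisym; [intros z hz; destruct (in_emp hz)|exact hb].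
  - exists (m ++ map (fun c => cup (sing x) c) m). intros b hb; rewrite in_app_iff, in_map_iff.
    assert (h : In (sep b (fun z => z <> x)) m).
    { apply Hm; intros z; rewrite in_sep by dfn. intros [hz ne]; apply hb in hz; simpl in hz.
      rewrite in_cup, in_sing in hz; tauto. }
    destruct (classic (x ∈ b)) as [hx|hx]; [right; eexists; split; [|exact h]|left].
    + apply mem_ext; intros z; rewrite in_cup, in_sing, in_sep by dfn.
      destruct (classic (z = x)); [subst|]; tauto.
    + replace b with (sep b (fun z => z <> x)); auto. apply mem_ext; intros z; rewrite in_sep by dfn.
      split; [tauto|]. intros hz; split; auto. intros ->; auto.
Qed.
Lemma fin_pow a : fin a -> fin (pow a).
Proof.
  intros h; apply fin_eq in h as (l & -> & _). destruct (fin_pow_aux l) as [m Hm].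
  apply fin_sub with (fset m); [|apply fin_fset]. intros b hb; apply in_fset, Hm, in_pow, hb.
Qed.

Definition Fins a : M := sep (pow a) (finite mem).
Lemma in_Fins a x : x ∈ Fins a <-> x ⊆ a /\ fin x.
Proof. unfold Fins; rewrite in_sep, in_pow, finite_iff by dfn; tauto. Qed.
Lemma TDef_Fins (s : (nat -> M) -> M) : TDef s -> TDef (fun v => Fins (s v)).
Proof. intros; unfold Fins; dfn. Qed.

(* [wo w u]: w relates the elements of u injectively to ordinals. *)
Definition wo w u := (forall x, x ∈ u -> exists a, ord a /\ pr x a ∈ w) /\
  (forall x a, pr x a ∈ w -> ord a) /\ forall x y a, pr x a ∈ w -> pr y a ∈ w -> x = y.
Definition first w S x := x ∈ S /\ exists a, pr x a ∈ w /\ forall y b, y ∈ S -> pr y b ∈ w -> a = b \/ a ∈ b.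
(** The first elements form a singleton, and its union is its only element; thus choice becomes a
    definable term with parameter w. *)
Definition pick w S : M := un (sep S (first w S)).
Lemma pick_in w u S : wo w u -> S ⊆ u -> (exists x, x ∈ S) -> pick w S ∈ S.
Proof.
  intros (h1 & h2 & h3) hS [x0 hx0].
  destruct (@mem_min M (fun a => exists x, x ∈ S /\ pr x a ∈ w)) as (a & (x & hx & ha) & hmin).
  { destruct (h1 x0) as (a & _ & ha); eauto. }
  assert (hf : first w S x).
  { split; auto; exists a; split; auto. intros y b hy hb.
    destruct (ord_trich (h2 _ _ ha) (h2 _ _ hb)) as [h|[h|h]]; auto. destruct (hmin b h); eauto. }
  assert (e : sep S (first w S) = sing x).
  { apply mem_ext; intros y; rewrite in_sep, in_sing by (unfold first; dfn). split; [|intros ->; auto].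
    intros [hy (_ & b & hb & hy2)]. destruct hf as (_ & a' & ha' & hx2).
    destruct (hy2 x a' hx ha') as [e|e], (hx2 y b hy hb) as [e'|e']; subst; eauto;
      exfalso; first [eapply mem_irr; eassumption | eapply mem_asym; eassumption]. }
  unfold pick; rewrite e. replace (un (sing x)) with x; auto.
  apply mem_ext; intros z; rewrite in_un. split; [exists x; rewrite in_sing; auto|].
  intros (y & hy & hz); apply in_sing in hy; subst; auto.
Qed.
Lemma TDef_pick (s t : (nat -> M) -> M) : TDef s -> TDef t -> TDef (fun v => pick (s v) (t v)).
Proof. intros; unfold pick, first; dfn. Qed.
End Link.
Ltac dfn_base5 := first [dfn_base4 | simple apply TDef_Fins | simple apply TDef_pick].
Ltac dfn_hook ::= dfn_base5.

(** * Choice functions, countable unions and injections of ordinals *)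

Section Choice.
Context {M : zermelo}.
Implicit Types x y z w u a b c d p f g h A B : M.
Hypothesis WO : forall u : M, exists w, wo w u.

Lemma choice_fun A B (R : M -> M -> Prop) : D2 R -> (forall x, x ∈ A -> exists y, y ∈ B /\ R x y) ->
  exists f, funcs f A B /\ forall x, x ∈ A -> R x (ap f x).
Proof.
  intros D h. destruct (WO B) as [w hw].
  assert (P : forall x, x ∈ A -> pick w (sep B (R x)) ∈ B /\ R x (pick w (sep B (R x)))).
  { intros x hx. assert (D' : D1 (R x)) by dfn.
    assert (i : pick w (sep B (R x)) ∈ sep B (R x)).
    { apply pick_in with B; auto. intros y hy; rewrite in_sep in hy by auto; tauto.
      destruct (h x hx) as (y & hy); exists y; rewrite in_sep by auto; auto. }
    rewrite in_sep in i by auto; auto. }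
  assert (D' : D1T (fun x => pick w (sep B (R x)))) by dfn.
  exists (lam A B (fun x => pick w (sep B (R x)))). split.
  - apply funcs_lam; auto. intros x hx; apply P, hx.
  - intros x hx; rewrite ap_lam; auto; apply P, hx.
Qed.
Lemma enum_union I U (R : M -> M -> Prop) : D2 R -> enum I ->
  (forall i, i ∈ I -> enum (sep U (R i))) -> (forall z, z ∈ U -> exists i, i ∈ I /\ R i z) -> enum U.
Proof.
  intros D eI eF cov.
  destruct (@choice_fun I (pow (prod om U)) (fun i f => forall z, z ∈ U -> R i z -> exists n, n ∈ om /\ ap f n = z)) as (e & _ & he).
  - dfn.
  - intros i hi. destruct (eF i hi) as [f hf]. assert (Di : D1 (R i)) by dfn.
    exists (sep (prod om U) (fun p => exists n, p = pr n (ap f n))). split.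
    + rewrite in_pow; intros p hp; rewrite in_sep in hp by dfn; tauto.
    + intros z hz hr; destruct (hf z) as [n hn]; [apply in_sep; auto|]. exists (nm n); split; [apply nm_om|].
      apply ap_eq; [|intros y]; rewrite in_sep, pr_prod by dfn.
      * split; [auto using nm_om|exists (nm n); congruence].
      * intros [_ [n' e']]; apply pr_inj in e' as [<- ->]; auto.
  - apply enum_rel with (A := prod I om) (R := fun q z => exists i n, q = pr i n /\ z = ap (ap e i) n).
    + dfn.
    + apply enum_prod; auto using enum_om.
    + intros z hz; destruct (cov z hz) as (i & hi & hr). destruct (he i hi z hz hr) as (n & hn & e1).
      exists (pr i n); rewrite pr_prod; split; eauto.
    + intros q z z' _ _ (i & n & -> & ->) (i' & n' & e' & ->). apply pr_inj in e' as [-> ->]; auto.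
Qed.
(** A finite subset lies among the elements listed before some stage n, and these have only finitely
    many subsets. *)
Lemma enum_Fins a : enum a -> enum (Fins a).
Proof.
  intros [f hf].
  pose (W n := sep a (fun z => exists i, i ∈ n /\ ap f i = z)).
  assert (inW : forall n z, z ∈ W n <-> z ∈ a /\ exists i, i ∈ n /\ ap f i = z)
    by (intros; unfold W; rewrite in_sep by dfn; tauto).
  apply enum_union with (I := om) (R := fun n s => s ⊆ W n).
  - unfold W; dfn.
  - apply enum_om.
  - intros n hn. apply in_om in hn as [k ->]. apply enum_sub with (pow (W (nm k))).
    + intros s; rewrite in_sep, in_pow by (unfold W; dfn). tauto.
    + apply enum_fin, fin_pow. exists (filter (fun z => if excluded_middle_informative (z ∈ W (nm k)) then true else false)
        (map (fun i => ap f (nm i)) (seq 0 k))).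
      intros z; rewrite filter_In. destruct (excluded_middle_informative (z ∈ W (nm k))) as [h|h].
      * split; auto. intros _; split; auto. apply inW in h as (_ & i & hi & <-).
        apply in_nm in hi as (m & hm & ->). apply in_map_iff; exists m; rewrite in_seq; split; auto; lia.
      * split; [tauto|]. intros [_ h']; discriminate.
  - intros s hs. apply in_Fins in hs as [h1 h2]. apply fin_eq in h2 as (l & -> & _).
    assert (H : exists k, forall z, In z l -> exists i, i < k /\ ap f (nm i) = z).
    { assert (H : forall z, In z l -> exists n, ap f (nm n) = z) by (intros z hz; apply hf, h1, in_fset, hz).
      clear h1; induction l as [|x l IH]; [exists 0; intros z []|].
      destruct IH as [k Hk]; [intros z hz; apply H; right; exact hz|]. destruct (H x) as [n Hn]; [left; auto|].
      exists (S (n + k)). intros z [<-|hz]; [exists n; split; auto; lia|].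
      destruct (Hk z hz) as (i & hi & e); exists i; split; auto; lia. }
    destruct H as [k Hk]. exists (nm k); split; [apply nm_om|]. intros z hz.
    apply inW; split; [apply h1, hz|]. apply in_fset in hz. destruct (Hk z hz) as (i & hi & e).
    exists (nm i); split; auto using nm_lt.
Qed.

(** Recursion along o picks an element of u outside the earlier values. The earlier values are
    enumerated by an element of o, hence are countable and never exhaust u. *)
Lemma uncountable_inj u o : ~ enum u -> ord o -> (forall a, a ∈ o -> enum a) -> inj o u.
Proof.
  intros nu oo he. destruct (WO u) as [w hw].
  assert (hx : exists x0, x0 ∈ u).
  { apply NNPP; intros N; apply nu, enum_fin. exists nil; intros z; split; [intros hz; apply N; eauto|intros []]. }
  destruct hx as [x0 hx0].
  (* The default x0 keeps H total on approximations whose range already includes u. *)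
  pose (H g := pick w (sep u (fun x => (x ∉ ran g) \/ (x = x0 /\ u ⊆ ran g)))).
  assert (DH : D1T H) by (unfold H; dfn).
  assert (HP : forall g, H g ∈ u /\ (H g ∉ ran g \/ u ⊆ ran g)).
  { intros g. assert (D : D1 (fun x => (x ∉ ran g) \/ (x = x0 /\ u ⊆ ran g))) by dfn.
    assert (i : H g ∈ sep u (fun x => (x ∉ ran g) \/ (x = x0 /\ u ⊆ ran g))).
    { apply pick_in with u; auto. intros y hy; rewrite in_sep in hy by auto; tauto.
      destruct (classic (u ⊆ ran g)) as [h|h]; [exists x0; rewrite in_sep by auto; auto|].
      apply not_all_ex_not in h as [x h]; apply imply_to_and in h. exists x; rewrite in_sep by auto; tauto. }
    rewrite in_sep in i by auto. tauto. }
  destruct (rec_bounded DH (proj1 oo) (fun g => proj1 (HP g))) as (f & hf & hr).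
  assert (neq : forall a b, b ∈ o -> a ∈ b -> ap f a <> ap f b).
  { intros a b hb ha. assert (hao : a ∈ o) by (eapply ord_trans; eauto).
    destruct (HP (rst f b)) as [_ [h|h]]; [rewrite <- hr in h by auto|].
    - intros e; apply h. rewrite <- e. apply in_ran; exists a. apply pr_rst; split; auto.
      apply (funcs_pr _ _ hf); auto.
    - exfalso; apply nu. apply enum_img with (A := b) (F := ap f); [dfn|auto|].
      intros z hz; apply h, in_ran in hz as [c hc]. apply pr_rst in hc as [hc hcb].
      apply (funcs_pr _ _ hf) in hc as [_ ->]. eauto. }
  exists f; split; [intros; eapply funcs_ap; eauto|].
  intros a b ha hb e. destruct (ord_trich (ord_elem oo ha) (ord_elem oo hb)) as [h|[h|h]]; auto.
  - destruct (neq a b hb h e).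
  - destruct (neq b a ha h); auto.
Qed.
End Choice.

(** * Well-orderings and cardinals *)

Definition replacement (M : zermelo) := forall R : M -> M -> Prop, D2 R -> forall a : M,
  (forall x, x ∈ a -> exists y, R x y /\ forall y', R x y' -> y' = y) ->
  exists b, forall y, y ∈ b <-> exists x, x ∈ a /\ R x y.
Definition set_choice (M : zermelo) := forall a : M,
  (forall x, x ∈ a -> exists z, z ∈ x) ->
  (forall x y z, x ∈ a -> y ∈ a -> z ∈ x -> z ∈ y -> x = y) ->
  exists c, forall x, x ∈ a -> exists z, z ∈ x /\ z ∈ c /\ forall z', z' ∈ x -> z' ∈ c -> z' = z.

Section ZFC.
Context {M : zermelo}.
Hypothesis RP : replacement M.
Implicit Types x y z w u a b c d p f g h A B : M.

Definition img (F : M -> M) a : M := the (fun b => forall y, y ∈ b <-> exists x, x ∈ a /\ y = F x).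
Lemma in_img F a y : D1T F -> y ∈ img F a <-> exists x, x ∈ a /\ y = F x.
Proof.
  intros D; revert y. apply (theP (fun b => forall y, y ∈ b <-> exists x, x ∈ a /\ y = F x)).
  apply (RP (R := fun x y => y = F x)). dfn. intros; exists (F x); auto.
Qed.

(** Replacement wants a functional assignment, so each element z of x is sent to the least
    transitive set around it rather than to an arbitrary one. *)
Lemma trans_ex x : exists A, is_transitive mem A /\ x ∈ A.
Proof.
  revert x; refine (mem_ind _); intros x IH.
  pose (R z A := is_transitive mem A /\ z ∈ A /\ forall B, is_transitive mem B -> z ∈ B -> A ⊆ B).
  destruct (RP (R := R)) with (a := x) as [b Hb].
  - unfold R; dfn.
  - intros z hz; destruct (IH z hz) as (B & tB & zB).
    assert (D : D1 (fun w : M => forall B', is_transitive mem B' -> z ∈ B' -> w ∈ B')) by dfn.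
    exists (sep B (fun w => forall B', is_transitive mem B' -> z ∈ B' -> w ∈ B')). split; [split; [|split]|].
    + intros y hy w hw. rewrite in_sep in hy |- * by auto. split.
      apply (tB y); tauto. intros B' tB' zB'; apply (tB' y); auto; apply hy; auto.
    + rewrite in_sep by auto; auto.
    + intros B' tB' zB' w hw; rewrite in_sep in hw by auto; apply hw; auto.
    + intros A (tA & zA & mA). apply sub_antisym.
      * intros w hw; rewrite in_sep by auto; split; [apply mA; auto|intros; eapply mA; eauto].
      * intros w hw; rewrite in_sep in hw by auto; apply hw; auto.
  - exists (cup (un b) (sing x)). split; [|rewrite in_cup, in_sing; auto].
    intros y hy w hw. rewrite in_cup, in_un in hy |- *; left. destruct hy as [(A & hA & hy)|hy].
    + assert (hA' := hA). apply Hb in hA' as (z & _ & tA & _). exists A; split; auto. apply (tA y hy w hw).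
    + apply in_sing in hy; subst y. destruct (IH w hw) as (B & tB & wB).
      destruct (Hb (sep B (fun v => forall B', is_transitive mem B' -> w ∈ B' -> v ∈ B'))) as [_ h].
      assert (D : D1 (fun v : M => forall B', is_transitive mem B' -> w ∈ B' -> v ∈ B')) by dfn.
      eexists; split; [apply h; exists w; split; auto|rewrite in_sep by auto; auto].
      split; [|split].
      * intros y hy v hv. rewrite in_sep in hy |- * by auto. split.
        apply (tB y); tauto. intros B' tB' zB'; apply (tB' y); auto; apply hy; auto.
      * rewrite in_sep by auto; auto.
      * intros B' tB' zB' v hv; rewrite in_sep in hv by auto; apply hv; auto.
Qed.

Lemma rec_total (H : M -> M) : D1T H ->
  exists F, D1T F /\ forall x, F x = H (img (fun c => pr c (F c)) x).
Proof.
  intros DH. assert (DR := Def_Rel DH).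
  assert (RB : forall A, exists g, graph_on H A g).
  { intros A. destruct (RP (R := fun a p => exists b, Rel H a b /\ p = pr a b)) with (a := sep A (fun a => exists b, Rel H a b)) as [g Hg].
    - dfn.
    - intros x hx; rewrite in_sep in hx by dfn. destruct hx as [_ [b hb]]. exists (pr x b); split; eauto.
      intros y' (b' & hb' & ->). f_equal; eapply Rel_fun; eauto.
    - exists g; intros p; rewrite (Hg p). split.
      + intros (a & ha & b & hb & ->). rewrite in_sep in ha by dfn. exists a, b; tauto.
      + intros (a & b & ha & hb & ->). exists a; rewrite in_sep by dfn; repeat split; eauto. }
  assert (T : forall x, exists y, Rel H x y).
  { intros x; destruct (trans_ex x) as (A & tA & xA). eapply Rel_total; eauto. }
  assert (P : forall x, Rel H x (the (Rel H x))) by (intros; apply theP; auto).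
  assert (D : D1T (fun x => the (Rel H x))).
  { apply TDef_the with (P := fun v y => Rel H (v 0) y). 2: dfn.
    intros v; destruct (T (v 0)) as [y hy]; exists y; split; auto. intros; eapply Rel_fun; eauto. }
  exists (fun x => the (Rel H x)); split; [exact D|]. intros x. destruct (Rel_unfold (P x)) as [_ u].
  apply u. intros p. rewrite in_img by dfn. split.
  - intros (c & hc & ->); exists c, (the (Rel H c)); auto.
  - intros (c & d & hc & hd & ->); exists c; split; auto. f_equal. eapply Rel_fun; eauto.
Qed.

Hypothesis AC : set_choice M.
Lemma choice_on u : exists c, forall s, s ⊆ u -> (exists x, x ∈ s) ->
  un (sep s (fun x => pr s x ∈ c)) ∈ s.
Proof.
  (* The sets s are made disjoint by passing to the products of {s} with s. *)
  destruct (AC (a := img (fun s => prod (sing s) s) (sep (pow u) (fun s => exists x, x ∈ s)))) as [c Hc].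
  - intros q hq; rewrite in_img in hq by dfn. destruct hq as (s & hs & ->).
    rewrite in_sep in hs by dfn. destruct hs as [_ [x hx]]. exists (pr s x); rewrite pr_prod, in_sing; auto.
  - intros q q' z hq hq' hz hz'. rewrite in_img in hq, hq' by dfn.
    destruct hq as (s & _ & ->), hq' as (s' & _ & ->).
    apply in_prod in hz as (x & y & hx & hy & ->). apply pr_prod in hz' as [hx' _].
    rewrite in_sing in hx, hx'. congruence.
  - exists c. intros s hs hx. destruct (Hc (prod (sing s) s)) as (z & hz & hzc & hu).
    { rewrite in_img by dfn. exists s; rewrite in_sep, in_pow by dfn; auto. }
    apply in_prod in hz as (s' & y & hs' & hy & ->). apply in_sing in hs'; subst s'.
    replace (un _) with y; auto.
    assert (e : sep s (fun x => pr s x ∈ c) = sing y).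
    { apply mem_ext; intros w; rewrite in_sep, in_sing by dfn. split; [|intros ->; auto].
      intros [h h']. assert (e : pr s w = pr s y) by (apply hu; auto; rewrite pr_prod, in_sing; auto).
      apply pr_inj in e; tauto. }
    rewrite e. apply mem_ext; intros w; rewrite in_un. split; [exists y; rewrite in_sing; auto|].
    intros (y' & hy' & hw); apply in_sing in hy'; subst; auto.
Qed.

(** F enumerates u along the ordinals by choosing from what the earlier values leave over; it must
    exhaust u at some ordinal t, and the least such t indexes u injectively. *)
Lemma well_order u : exists w, wo w u.
Proof.
  destruct (choice_on u) as [c Hc].
  pose (r g := sep u (fun x => x ∉ ran g)).
  assert (inr : forall g x, x ∈ r g <-> x ∈ u /\ x ∉ ran g) by (intros; unfold r; rewrite in_sep by dfn; tauto).
  destruct (@rec_total (fun g => un (sep (r g) (fun x => pr (r g) x ∈ c)))) as (F & DF & HF).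
  { unfold r; dfn. }
  pose (gr a := img (fun c => pr c (F c)) a).
  assert (ingr : forall a y, y ∈ ran (gr a) <-> exists b, b ∈ a /\ y = F b).
  { intros a y; rewrite in_ran; unfold gr. split.
    - intros (b & h). rewrite in_img in h by dfn. destruct h as (b' & hb & e). apply pr_inj in e as [-> ->]; eauto.
    - intros (b & h & ->). exists b. rewrite in_img by dfn; eauto. }
  pose (good a := exists x, x ∈ u /\ forall b, b ∈ a -> x <> F b).
  assert (Fg : forall a, good a -> F a ∈ u /\ forall b, b ∈ a -> F a <> F b).
  { intros a (x & hx & hn). assert (i : F a ∈ r (gr a)).
    { rewrite HF; apply Hc. intros y hy; apply inr in hy; tauto.
      exists x; apply inr; split; auto. intros h; apply ingr in h as (b & hb & e). apply (hn b hb e). }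
    apply inr in i as [h1 h2]; split; auto. intros b hb e; apply h2, ingr; eauto. }
  assert (ng : exists t, ord t /\ ~ good t).
  { apply NNPP; intros N. assert (G : forall a, ord a -> good a) by (intros a ha; apply NNPP; intros h; apply N; eauto).
    assert (inj : forall a b, ord a -> ord b -> F a = F b -> a = b).
    { intros a b ha hb e. destruct (ord_trich ha hb) as [h|[h|h]]; auto.
      destruct (proj2 (Fg b (G b hb)) a h); auto. destruct (proj2 (Fg a (G a ha)) b h); auto. }
    (* Otherwise F is injective on all ordinals, and replacement along its inverse would collect
       them into a set, which is then an ordinal belonging to itself. *)
    destruct (RP (R := fun x a => ord a /\ F a = x)) with (a := sep u (fun x => exists a, ord a /\ F a = x)) as [b Hb].
    - dfn.
    - intros x hx; rewrite in_sep in hx by dfn. destruct hx as [_ (a & ha & e)]. exists a; split; auto.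
      intros a' [ha' e']. apply inj; congruence.
    - assert (B : forall a, a ∈ b <-> ord a).
      { intros a; rewrite Hb. split; [intros (x & _ & h & _); auto|].
        intros ha; exists (F a); split; auto. rewrite in_sep by dfn. split; eauto. apply (Fg a (G a ha)). }
      apply (@mem_irr M b), B. split.
      + intros a ha x hx; apply B. apply B in ha; eapply ord_elem; eauto.
      + intros a ha; apply B in ha; exact (proj1 ha). }
  destruct (@mem_min M (fun t => ord t /\ ~ good t) ng) as (t & [ot nt] & mt).
  assert (G : forall a, a ∈ t -> good a).
  { intros a ha; apply NNPP; intros h; apply (mt a ha); split; auto. eapply ord_elem; eauto. }
  exists (sep (prod u t) (fun p => exists x a, p = pr x a /\ x = F a)).
  assert (P : forall x a, pr x a ∈ sep (prod u t) (fun p => exists x a, p = pr x a /\ x = F a) <-> x ∈ u /\ a ∈ t /\ x = F a).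
  { intros x a; rewrite in_sep, pr_prod by dfn. split.
    - intros [h (x' & a' & e & e')]; apply pr_inj in e as [<- <-]; tauto.
    - intros (h1 & h2 & h3); split; eauto. }
  split; [|split].
  - intros x hx. apply NNPP; intros N. apply nt. exists x; split; auto. intros b hb e.
    apply N; exists b; split; [eapply ord_elem; eauto|]. apply P; auto.
  - intros x a h; apply P in h as (_ & h & _). eapply ord_elem; eauto.
  - intros x y a h h'; apply P in h as (_ & _ & ->), h' as (_ & _ & ->); auto.
Qed.
End ZFC.

(** * The first two uncountable cardinals *)

Section Cardinals.
Context {M : zermelo}.
Hypothesis WO : forall u : M, exists w, wo w u.
Implicit Types x y z w u a b c d p f g h A B : M.

Lemma enum_iff_inj a : enum a <-> inj a om.
Proof.
  rewrite <- countable_iff, <- injects_iff. unfold countable. split.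
  - intros (w & hw & h); apply is_omega_iff in hw; subst; auto.
  - intros h; exists om; rewrite is_omega_iff; auto.
Qed.

Lemma enum_union_sets (I : M) (F : M -> M) U : D1T F -> enum I -> (forall i, i ∈ I -> enum (F i)) ->
  (forall z, z ∈ U -> exists i, i ∈ I /\ z ∈ F i) -> enum U.
Proof.
  intros D eI eF h. apply (enum_union WO) with (I := I) (R := fun i z => z ∈ F i); auto. dfn.
  intros i hi; apply enum_sub with (F i); auto. intros z; rewrite in_sep by dfn; tauto.
Qed.
Lemma enum_cup a b : enum a -> enum b -> enum (cup a b).
Proof.
  intros ea eb. apply enum_union_sets with (I := om)
    (F := fun n => sep (cup a b) (fun z => (n = emp /\ z ∈ a) \/ (n <> emp /\ z ∈ b))).
  - dfn.
  - apply enum_om.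
  - intros i _. destruct (classic (i = emp)) as [e|e]; [apply enum_sub with a; auto|apply enum_sub with b; auto];
      intros z; rewrite in_sep by dfn; intuition congruence.
  - intros z hz; assert (hz' := hz). apply in_cup in hz' as [hz'|hz']; [exists (nm 0)|exists (nm 1)];
      rewrite in_sep by dfn; (split; [apply nm_om|]); split; auto.
    right; split; auto. intros e; apply (nm_inj (m := 1) (n := 0)) in e; discriminate.
Qed.

Variable w1 : M.
Hypothesis N1 : is_next_cardinal mem om w1.
Lemma ord_w1 : ord w1. Proof. apply N1. Qed.
Lemma w1_unctbl : ~ enum w1.
Proof. rewrite enum_iff_inj, <- injects_iff. apply N1. Qed.
Lemma w1_ctbl a : a ∈ w1 -> enum a.
Proof. rewrite enum_iff_inj, <- injects_iff. apply N1. Qed.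
Lemma w1_intro a : a ⊆ w1 -> is_transitive mem a -> enum a -> a ∈ w1.
Proof.
  intros h t e. assert (oa : ord a).
  { split; auto. intros b hb; apply (proj2 ord_w1), h, hb. }
  destruct (ord_trich oa ord_w1) as [h'|[h'|h']]; auto.
  - subst; destruct (w1_unctbl e).
  - destruct (mem_irr (h _ h')).
Qed.
Lemma ord_in_w1 a : a ∈ w1 -> ord a.
Proof. apply ord_elem, ord_w1. Qed.
Lemma w1_sup c : c ⊆ w1 -> enum c -> un c ∈ w1.
Proof.
  intros h e. apply w1_intro.
  - intros x hx; apply in_un in hx as (y & hy & hx). apply (proj1 ord_w1 y (h y hy) x hx).
  - intros x hx z hz; apply in_un in hx as (y & hy & hx). apply in_un; exists y; split; auto.
    apply (proj1 (ord_in_w1 (h y hy)) x hx z hz).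
  - apply enum_union_sets with (I := c) (F := fun x => x); auto. dfn.
    intros i hi; apply w1_ctbl, h, hi. intros z hz; apply in_un in hz; auto.
Qed.
Lemma w1_succ a : a ∈ w1 -> succ a ∈ w1.
Proof.
  intros h. apply w1_intro.
  - intros x hx; apply in_succ in hx as [hx| ->]; auto. apply (proj1 ord_w1 a h x hx).
  - intros x hx z hz; apply in_succ; left. apply in_succ in hx as [hx| ->]; auto.
    apply (proj1 (ord_in_w1 h) x hx z hz).
  - apply enum_cup; [apply w1_ctbl; auto|apply enum_fin]. exists (a :: nil). intros z; rewrite in_sing; simpl. intuition congruence.
Qed.

(** The value of f at n is the ordinal sum d + n; no other ordinal arithmetic is used. *)
Definition adds d f := funcs f om w1 /\ ap f emp = d /\ forall n, n ∈ om -> ap f (succ n) = succ (ap f n).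
Lemma adds_ex d : d ∈ w1 -> exists f, adds d f.
Proof.
  intros h. destruct (om_rec (z0 := d) (s := fun _ z => succ z) (B := w1)) as (f & h1 & h2 & h3).
  dfn. auto. auto using w1_succ. exists f; split; [auto|split; auto].
  intros n hn; apply in_om in hn as [k ->]. apply h3.
Qed.
Lemma adds_unique d f f' : adds d f -> adds d f' -> f = f'.
Proof.
  intros (h1 & h2 & h3) (h1' & h2' & h3'). eapply funcs_ext; eauto. intros x hx; apply in_om in hx as [n ->].
  induction n; simpl; [congruence|]. rewrite h3, h3', IHn; auto using nm_om.
Qed.
Lemma adds_lt d f m n : adds d f -> m < n -> ap f (nm m) ∈ ap f (nm n).
Proof.
  intros (h1 & h2 & h3) h. induction h; simpl; rewrite h3 by apply nm_om; apply in_succ; auto.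
Qed.
Definition limit_above c a := a ∈ w1 /\ c ⊆ a /\ forall x, x ∈ a -> succ x ∈ a.
(** The union of the sums d + n over d in c is countable and closed under successors. *)
Lemma limit_above_ex c : c ⊆ w1 -> enum c -> exists a, limit_above c a.
Proof.
  intros h e. pose (R q y := exists d n, q = pr d n /\ d ∈ c /\ n ∈ om /\ exists f, adds d f /\ y ∈ ap f n).
  assert (DR : D2 R) by (unfold R, adds, funcs; dfn).
  pose (X := sep w1 (fun y => exists q, R q y)).
  assert (DX : D1 (fun y => exists q, R q y)) by dfn.
  assert (inX : forall y, y ∈ X <-> exists d n f, d ∈ c /\ adds d f /\ y ∈ ap f (nm n)).
  { intros y; unfold X; rewrite in_sep by auto; split.
    - intros (_ & q & d & n & -> & hd & hn & f & hf & hy). apply in_om in hn as [k ->]. eauto 6.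
    - intros (d & n & f & hd & hf & hy). split.
      + apply (proj1 ord_w1 (ap f (nm n))); auto. apply (funcs_ap (proj1 hf)), nm_om.
      + exists (pr d (nm n)), d, (nm n). eauto 7 using nm_om. }
  exists X. split; [|split].
  - apply w1_intro.
    + intros y hy; unfold X in hy; rewrite in_sep in hy by auto; tauto.
    + intros y hy z hz; apply inX in hy as (d & n & f & hd & hf & hy). apply inX; exists d, n, f.
      split; [auto|split; [exact hf|]]. apply (proj1 (ord_in_w1 (funcs_ap (proj1 hf) (nm_om n))) y hy z hz).
    + apply (enum_union WO) with (I := prod c om) (R := R); auto using enum_prod, enum_om.
      * intros q hq; apply in_prod in hq as (d & n & hd & hn & ->).
        destruct (adds_ex (h d hd)) as [f hf]. apply enum_sub with (ap f n); [|apply w1_ctbl, (funcs_ap (proj1 hf) hn)].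
        intros y; rewrite in_sep by dfn. intros (_ & d' & n' & e' & _ & _ & f' & hf' & hy).
        apply pr_inj in e' as [<- <-]. rewrite (adds_unique hf hf'); auto.
      * intros y hy; apply inX in hy as (d & n & f & hd & hf & hy). exists (pr d (nm n)); rewrite pr_prod.
        split; auto using nm_om. exists d, (nm n). eauto 7 using nm_om.
  - intros d hd; apply inX. destruct (adds_ex (h d hd)) as [f hf]. exists d, 1, f.
    split; [auto|split; [exact hf|]]. replace d with (ap f (nm 0)) at 1 by apply (proj1 (proj2 hf)). eapply adds_lt; eauto.
  - intros y hy; apply inX in hy as (d & n & f & hd & hf & hy). apply inX; exists d, (S n), f.
    split; [auto|split; [exact hf|]]. simpl. rewrite (proj2 (proj2 hf)) by apply nm_om.
    assert (o := ord_in_w1 (funcs_ap (proj1 hf) (nm_om n))).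
    assert (os : ord (succ y)).
    { apply ord_in_w1, w1_succ. apply (proj1 ord_w1 _ (funcs_ap (proj1 hf) (nm_om n)) y hy). }
    destruct (ord_trich os o) as [k|[k|k]]; apply in_succ; auto.
    exfalso; apply in_succ in k as [k|k]; [apply (mem_asym k hy)|subst; apply (mem_irr hy)].
Qed.

(** J(a, n) is F(a) + n, where F(a) is closed under successors and lies above all earlier values of
    F. Hence F(a) + n stays below F(b) for a below b, and the value determines both arguments. *)
Lemma w1_pairing : exists J, forall a n, a ∈ w1 -> n ∈ om -> ap J (pr a n) ∈ w1 /\
  forall a' n', a' ∈ w1 -> n' ∈ om -> ap J (pr a n) = ap J (pr a' n') -> a = a' /\ n = n'.
Proof.
  destruct (WO w1) as [w hw].
  assert (e0 : emp ∈ w1).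
  { apply w1_intro; try (intros x hx; destruct (in_emp hx)). apply enum_fin; exists nil; intros z; split; [apply in_emp|intros []]. }
  pose (H g := pick w (sep w1 (fun a => (limit_above (ran g) a) \/ (a = emp /\ forall b, ~ limit_above (ran g) b)))).
  assert (DL : forall g, D1 (fun a => (limit_above (ran g) a) \/ (a = emp /\ forall b, ~ limit_above (ran g) b)))
    by (intros; unfold limit_above; dfn).
  assert (DH : D1T H) by (unfold H, limit_above; dfn).
  assert (HP : forall g, H g ∈ w1 /\ ((exists b, limit_above (ran g) b) -> limit_above (ran g) (H g))).
  { intros g. assert (i : H g ∈ sep w1 (fun a => (limit_above (ran g) a) \/ (a = emp /\ forall b, ~ limit_above (ran g) b))).
    { apply pick_in with w1; auto. intros y hy; rewrite in_sep in hy by auto; tauto.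
      destruct (classic (exists b, limit_above (ran g) b)) as [[b hb]|no].
      - exists b; rewrite in_sep by auto; split; auto; apply hb.
      - exists emp; rewrite in_sep by auto; split; auto. right; split; auto. intros b hb; eauto. }
    rewrite in_sep in i by auto. split; [tauto|]. intros [b hb]. destruct i as [_ [h|[_ h]]]; auto. destruct (h b hb). }
  destruct (rec_bounded DH (proj1 ord_w1) (fun g => proj1 (HP g))) as (F & hF & hr).
  assert (L : forall a, a ∈ w1 -> limit_above (ran (rst F a)) (ap F a)).
  { intros a ha; rewrite (hr a ha). apply HP. apply limit_above_ex.
    - intros y hy; apply in_ran in hy as [x hx]. apply pr_rst in hx as [hx _].
      apply (funcs_pr _ _ hF) in hx as [hx ->]. apply (funcs_ap hF hx).
    - apply enum_img with (A := a) (F := ap F). dfn. apply w1_ctbl; auto.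
      intros y hy; apply in_ran in hy as [x hx]. apply pr_rst in hx as [hx hxa].
      apply (funcs_pr _ _ hF) in hx as [hx ->]. eauto. }
  assert (lt : forall a b f n, b ∈ w1 -> a ∈ b -> adds (ap F a) f -> ap f (nm n) ∈ ap F b).
  { intros a b f n hb ha (h1 & h2 & h3). destruct (L b hb) as (_ & l2 & l3). induction n; simpl.
    - rewrite h2. apply l2, in_ran. exists a. apply pr_rst; split; auto. apply (funcs_pr _ _ hF); split; auto.
      apply (proj1 ord_w1 b hb a ha).
    - rewrite h3 by apply nm_om; auto. }
  assert (le : forall a f n, adds (ap F a) f -> ap F a ⊆ ap f (nm n)).
  { intros a f n (h1 & h2 & h3). induction n; simpl; [rewrite h2; apply sub_refl|].
    rewrite h3 by apply nm_om. intros x hx; apply in_succ; left; auto. }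
  assert (DA : D2 adds) by (unfold adds, funcs; dfn).
  exists (sep (prod (prod w1 om) w1) (fun p => exists a n f, adds (ap F a) f /\ p = pr (pr a n) (ap f n))).
  set (J := sep _ _).
  assert (P : forall a n f, a ∈ w1 -> n ∈ om -> adds (ap F a) f -> ap J (pr a n) = ap f n).
  { intros a n f ha hn hf. apply ap_eq; unfold J; [|intros y]; rewrite in_sep, !pr_prod by dfn.
    - split; [split; auto; apply (funcs_ap (proj1 hf) hn)|eauto 6].
    - intros (_ & a' & n' & f' & hf' & e). apply pr_inj in e as [e ->]; apply pr_inj in e as [<- <-].
      rewrite (adds_unique hf hf'); auto. }
  intros a n ha hn. destruct (adds_ex (funcs_ap hF ha)) as [f hf]. rewrite (P a n f); auto.
  split; [apply (funcs_ap (proj1 hf) hn)|].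
  intros a' n' ha' hn'. destruct (adds_ex (funcs_ap hF ha')) as [f' hf']. rewrite (P a' n' f'); auto.
  apply in_om in hn as [k ->], hn' as [k' ->]. intros e.
  destruct (ord_trich (ord_in_w1 ha) (ord_in_w1 ha')) as [h|[h|h]].
  - assert (h1 := lt a a' f k ha' h hf). rewrite e in h1. apply (le a' f' k' hf') in h1. destruct (mem_irr h1).
  - subst a'. split; auto. rewrite (adds_unique hf' hf) in e.
    destruct (Nat.lt_total k k') as [h|[h|h]]; [|subst; auto|]; apply (adds_lt hf) in h; rewrite e in h; destruct (mem_irr h).
  - assert (h1 := lt a' a f' k' ha h hf'). rewrite <- e in h1. apply (le a f k hf) in h1. destruct (mem_irr h1).
Qed.

Variable w2 : M.
Hypothesis N2 : is_next_cardinal mem w1 w2.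
(** If the sets covered w2, each d would receive a stage a together with its number in an
    enumeration of the a-th set, and [w1_pairing] would inject w2 into w1. *)
Lemma w2_not_union S : (forall a, a ∈ w1 -> enum (ap S a)) ->
  exists d, d ∈ w2 /\ forall a, a ∈ w1 -> d ∉ ap S a.
Proof.
  intros hS. apply NNPP; intros N.
  assert (cov : forall d, d ∈ w2 -> exists a, a ∈ w1 /\ d ∈ ap S a).
  { intros d hd; apply NNPP; intros n; apply N; exists d; split; auto. intros a ha h; eauto. }
  destruct w1_pairing as [J HJ].
  destruct (@choice_fun _ WO w1 (pow (prod om w2)) (fun a f => forall z, z ∈ w2 -> z ∈ ap S a -> exists n, n ∈ om /\ ap f n = z)) as (e & _ & he).
  - dfn.
  - intros a ha; destruct (hS a ha) as [f hf].
    exists (sep (prod om w2) (fun p => exists n, p = pr n (ap f n))). split.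
    + rewrite in_pow; intros p hp; rewrite in_sep in hp by dfn; tauto.
    + intros z hz hz'. destruct (hf z hz') as [n hn]. exists (nm n); split; [apply nm_om|].
      apply ap_eq; [|intros y]; rewrite in_sep, pr_prod by dfn.
      * split; [auto using nm_om|exists (nm n); congruence].
      * intros [_ [n' e']]; apply pr_inj in e' as [<- ->]; auto.
  - destruct (@choice_fun _ WO w2 (prod w1 om) (fun d q => exists a n, q = pr a n /\ ap (ap e a) n = d)) as (h & hh & hR).
    + dfn.
    + intros d hd. destruct (cov d hd) as (a & ha & hda). destruct (he a ha d hd hda) as (n & hn & e').
      exists (pr a n); rewrite pr_prod; split; eauto.
    + apply (proj1 (proj2 N2)), injects_iff.
      exists (lam w2 w1 (fun d => ap J (ap h d))).
      assert (DJ : D1T (fun d => ap J (ap h d))) by dfn.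
      assert (Q : forall d, d ∈ w2 -> ap J (ap h d) ∈ w1).
      { intros d hd. assert (i := funcs_ap hh hd). apply in_prod in i as (a & n & ha & hn & ->). apply HJ; auto. }
      split; [intros d hd; rewrite ap_lam; auto|].
      intros d d' hd hd'. rewrite !ap_lam by auto.
      destruct (hR d hd) as (a & n & e1 & e2), (hR d' hd') as (a' & n' & e1' & e2').
      assert (i := funcs_ap hh hd). assert (i' := funcs_ap hh hd').
      rewrite e1 in *. rewrite e1' in *. apply pr_prod in i as [ha hn], i' as [ha' hn'].
      intros q; apply HJ in q as [-> ->]; auto. congruence.
Qed.
End Cardinals.

(** * Forcing *)

Section Forcing.
Context {M : zermelo} (Pos : M).
Implicit Types x y z w u a b c d p q r s t : M.

Definition nmr a q s := pr a q ∈ s /\ q ∈ Pos.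
(** One half of forced equality: below p and the condition attached to a, densely many conditions
    relate a to an entry of t. Larger sets are stronger conditions. *)
Definition step (Q : M -> M -> M -> Prop) p s t := forall a q, nmr a q s ->
  forall r, r ∈ Pos -> p ⊆ r -> q ⊆ r ->
  exists r', r' ∈ Pos /\ r ⊆ r' /\ exists b q', nmr b q' t /\ q' ⊆ r' /\ Q r' a b.
Definition bisim Z := forall p s t, pr p (pr s t) ∈ Z -> p ∈ Pos /\
  step (fun r a b => pr r (pr a b) ∈ Z) p s t /\ step (fun r b a => pr r (pr a b) ∈ Z) p t s.
(* Forcing of equality between names, as a greatest fixed point; by
   well-foundedness it is also the usual recursively defined relation. *)
Definition feq p s t := exists Z, bisim Z /\ pr p (pr s t) ∈ Z.
(** Asking for the witness only densely below p makes every formula that is forced densely below p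
    forced by p, as in [forces_dense], so that negation behaves classically. *)
Definition fmem p s t := forall q, q ∈ Pos -> p ⊆ q ->
  exists r, r ∈ Pos /\ q ⊆ r /\ exists b u, nmr b u t /\ u ⊆ r /\ feq r s b.
Fixpoint forces (v : nat -> M) p (f : formula) : Prop :=
  match f with
  | Mem i j => fmem p (v i) (v j)
  | Bot => False
  | Imp f g => forall q, q ∈ Pos -> p ⊆ q -> forces v q f -> forces v q g
  | All f => forall x, forces (scons x v) p f
  end.

Lemma Def_fmem (s t k : (nat -> M) -> M) : TDef s -> TDef t -> TDef k -> Def (fun v => fmem (s v) (t v) (k v)).
Proof. intros; unfold fmem, feq, bisim, step, nmr; dfn. Qed.
Lemma Def_forces f : forall (s : nat -> (nat -> M) -> M) (k : (nat -> M) -> M), (forall i, TDef (s i)) -> TDef k ->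
  Def (fun v => forces (fun i => s i v) (k v) f).
Proof.
  induction f as [i j| |f IHf g IHg|f IH]; intros s k hs hk; simpl.
  - apply Def_fmem; auto.
  - apply Def_const.
  - dfn.
    + apply (IHf (fun i v => s i (fun n => v (S n))) (fun v => v 0)); [|dfn].
      intros i; apply (TDef_shift S), hs.
    + apply (IHg (fun i v => s i (fun n => v (S n))) (fun v => v 0)); [|dfn].
      intros i; apply (TDef_shift S), hs.
  - refine (Def_all (fun v x => forces (scons x (fun i => s i v)) (k v) f) _).
    apply Def_iff with (fun v => forces (fun i => match i with O => v 0 | S i => s i (fun n => v (S n)) end)
      (k (fun n => v (S n))) f).
    + intros v. replace (scons _ _) with (fun i => match i with O => v 0 | S i => s i (fun n => v (S n)) end); [tauto|].
      extensionality i; destruct i; auto.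
    + apply (IH (fun i v => match i with O => v 0 | S i => s i (fun n => v (S n)) end) (fun v => k (fun n => v (S n)))).
      intros [|i]; [dfn|apply (TDef_shift S), hs]. dfn.
Qed.

Lemma feq_unfold p s t : feq p s t -> p ∈ Pos /\ step feq p s t /\ step (fun r b a => feq r a b) p t s.
Proof.
  intros (Z & bZ & h). destruct (bZ _ _ _ h) as (h1 & h2 & h3). split; [auto|split].
  - intros a q ha r hr pr_ qr. destruct (h2 a q ha r hr pr_ qr) as (r' & h4 & h5 & b & q' & h6 & h7 & h8).
    exists r'; repeat split; auto. exists b, q'; repeat split; auto; try apply h6. exists Z; auto.
  - intros a q ha r hr pr_ qr. destruct (h3 a q ha r hr pr_ qr) as (r' & h4 & h5 & b & q' & h6 & h7 & h8).
    exists r'; repeat split; auto. exists b, q'; repeat split; auto; try apply h6. exists Z; auto.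
Qed.

Hypothesis RP : replacement M.
Lemma name_trans A a q s : is_transitive mem A -> s ∈ A -> pr a q ∈ s -> a ∈ A.
Proof.
  intros tA hs h. apply (tA s hs) in h. assert (h' : upair a a ∈ A).
  { apply (tA _ h). unfold pr; rewrite in_upair; auto. }
  apply (tA _ h'), in_upair; auto.
Qed.
(** The coinductive definition needs a bisimulation that is a set. All subnames of s and t lie in
    one transitive set A, so [feq] restricted to A, with the new triple added, is such a set. *)
Lemma feq_fold p s t : p ∈ Pos -> step feq p s t -> step (fun r b a => feq r a b) p t s -> feq p s t.
Proof.
  intros hp h1 h2. destruct (trans_ex RP (pr s t)) as (A & tA & hA).
  assert (hA' : upair s t ∈ A) by (apply (tA _ hA); unfold pr; rewrite in_upair; auto).
  assert (sA : s ∈ A) by (apply (tA _ hA'), in_upair; auto).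
  assert (tA' : t ∈ A) by (apply (tA _ hA'), in_upair; auto).
  pose (ZA := sep (prod Pos (prod A A)) (fun z => exists r a b, z = pr r (pr a b) /\ feq r a b)).
  assert (DD : D1 (fun z => exists r a b, z = pr r (pr a b) /\ feq r a b))
    by (unfold feq, bisim, step, nmr; dfn).
  assert (inZ : forall r a b, a ∈ A -> b ∈ A -> feq r a b -> pr r (pr a b) ∈ cup ZA (sing (pr p (pr s t)))).
  { intros r a b ha hb h. rewrite in_cup; left. unfold ZA; rewrite in_sep, !pr_prod by auto.
    split; [|eauto 6]. split; auto. apply (feq_unfold h). }
  exists (cup ZA (sing (pr p (pr s t)))). split; [|rewrite in_cup, in_sing; auto].
  assert (key : forall r a b, a ∈ A -> b ∈ A -> step feq r a b -> step (fun r b a => feq r a b) r b a ->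
    step (fun r a b => pr r (pr a b) ∈ cup ZA (sing (pr p (pr s t)))) r a b /\
    step (fun r b a => pr r (pr a b) ∈ cup ZA (sing (pr p (pr s t)))) r b a).
  { intros r a b ha hb k1 k2. split.
    - intros c q hc r1 hr1 rr qr. destruct (k1 c q hc r1 hr1 rr qr) as (r' & k4 & k5 & d & q' & k6 & k7 & k8).
      exists r'; repeat split; auto. exists d, q'; split; [auto|split; [auto|]]. apply inZ; auto.
      apply (name_trans tA ha (proj1 hc)). apply (name_trans tA hb (proj1 k6)).
    - intros c q hc r1 hr1 rr qr. destruct (k2 c q hc r1 hr1 rr qr) as (r' & k4 & k5 & d & q' & k6 & k7 & k8).
      exists r'; repeat split; auto. exists d, q'; split; [auto|split; [auto|]]. apply inZ; auto.
      apply (name_trans tA ha (proj1 k6)). apply (name_trans tA hb (proj1 hc)). }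
  intros r a b h. rewrite in_cup, in_sing, !pr_iff in h. destruct h as [h|(-> & -> & ->)].
  - unfold ZA in h; rewrite in_sep, !pr_prod in h by auto. destruct h as ((hr & ha & hb) & r' & a' & b' & e & h).
    apply pr_inj in e as [<- e]; apply pr_inj in e as [<- <-].
    apply feq_unfold in h as (_ & k1 & k2). split; auto.
  - split; auto.
Qed.
Lemma feq_mono p q s t : feq p s t -> q ∈ Pos -> p ⊆ q -> feq q s t.
Proof.
  intros h hq pq. apply feq_unfold in h as (hp & h1 & h2). apply feq_fold; auto; intros a u ha r hr qr ur.
  - apply h1 with u; auto. eapply sub_trans; eauto.
  - apply h2 with u; auto. eapply sub_trans; eauto.
Qed.
Lemma fmem_mono p q s t : fmem p s t -> q ∈ Pos -> p ⊆ q -> fmem q s t.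
Proof. intros h hq pq r hr qr. apply h; auto. eapply sub_trans; eauto. Qed.
Lemma forces_mono f : forall v p q, forces v p f -> q ∈ Pos -> p ⊆ q -> forces v q f.
Proof.
  induction f as [i j| |f IHf g IHg|f IH]; intros v p q h hq pq; simpl in *; auto.
  - eapply fmem_mono; eauto.
  - intros r hr qr. apply h; auto. eapply sub_trans; eauto.
  - intros x; eapply IH; eauto.
Qed.
Lemma fmem_dense p s t : (forall q, q ∈ Pos -> p ⊆ q -> exists r, r ∈ Pos /\ q ⊆ r /\ fmem r s t) -> fmem p s t.
Proof.
  intros h q hq pq. destruct (h q hq pq) as (r & hr & qr & h'). destruct (h' r hr (@sub_refl _ r)) as (r' & h1 & h2 & h3).
  exists r'; repeat split; auto. eapply sub_trans; eauto.
Qed.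
Lemma forces_dense f : forall v p, p ∈ Pos ->
  (forall q, q ∈ Pos -> p ⊆ q -> exists r, r ∈ Pos /\ q ⊆ r /\ forces v r f) -> forces v p f.
Proof.
  induction f as [i j| |f IHf g IHg|f IH]; intros v p hp h; simpl in *.
  - apply fmem_dense; auto.
  - destruct (h p hp (@sub_refl _ p)) as (r & _ & _ & []).
  - intros q hq pq hf. apply IHg; auto. intros q' hq' qq'.
    destruct (h q' hq') as (r & hr & qr & h'); [eapply sub_trans; eauto|].
    exists r; repeat split; auto. apply h'; auto. apply sub_refl.
    eapply forces_mono; eauto. eapply sub_trans; eauto.
  - intros x; apply IH; auto. intros q hq pq. destruct (h q hq pq) as (r & hr & qr & h'). eauto.
Qed.

Lemma name_ind (P : M -> Prop) : (forall s, (forall a q, pr a q ∈ s -> P a) -> P s) -> forall s, P s.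
Proof.
  (* In a Kuratowski pair the subname a sits three membership steps below s. The induction accounts
     for one of them and the strengthened statement for the other two. *)
  intros H. assert (K : forall x, P x /\ (forall y, y ∈ x -> P y) /\ forall y z, y ∈ x -> z ∈ y -> P z).
  { refine (mem_ind _). intros x IH. split; [|split].
    - apply H. intros a q h. destruct (IH _ h) as (_ & _ & k). apply (k (upair a a) a); [unfold pr|]; rewrite in_upair; auto.
    - intros y hy; exact (proj1 (IH y hy)).
    - intros y z hy hz; exact (proj1 (proj2 (IH y hy)) z hz). }
  intros s; apply K.
Qed.

Variable G : M -> Prop.
Record generic := {
  G_pos : forall p, G p -> p ∈ Pos;
  G_emp : G emp;
  G_up : forall p q, G p -> q ∈ Pos -> q ⊆ p -> G q;
  G_dir : forall p q, G p -> G q -> exists r, G r /\ p ⊆ r /\ q ⊆ r;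
  G_dense : forall A, A ⊆ Pos -> (forall p, p ∈ Pos -> exists q, q ∈ A /\ p ⊆ q) -> exists p, G p /\ p ∈ A
}.
Hypothesis GG : generic.
Lemma gen (A : M -> Prop) : D1 A ->
  (exists p, G p /\ A p) \/ (exists p, G p /\ forall q, q ∈ Pos -> p ⊆ q -> ~ A q).
Proof.
  intros D.
  pose (B := sep Pos (fun q => A q \/ forall r, r ∈ Pos -> q ⊆ r -> ~ A r)).
  assert (inB : forall q, q ∈ B <-> q ∈ Pos /\ (A q \/ forall r, r ∈ Pos -> q ⊆ r -> ~ A r))
    by (intros; unfold B; rewrite in_sep by dfn; tauto).
  destruct (G_dense GG (A := B)) as (p & hp & h).
  - intros q hq; apply inB in hq; tauto.
  - intros p hp. destruct (classic (exists r, r ∈ Pos /\ p ⊆ r /\ A r)) as [(r & hr & h & h')|no].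
    + exists r; rewrite inB; auto.
    + exists p; rewrite inB; split; [split; auto; right|apply sub_refl]. intros r hr h h'; apply no; eauto.
  - apply inB in h as [_ [h|h]]; eauto.
Qed.
Lemma gen_below (A : M -> Prop) p : D1 A -> G p ->
  (forall q, q ∈ Pos -> p ⊆ q -> exists r, r ∈ Pos /\ q ⊆ r /\ A r) -> exists r, G r /\ A r.
Proof.
  intros D hp h. destruct (gen D) as [?|(p' & hp' & no)]; auto.
  destruct (G_dir GG hp hp') as (r & hr & h1 & h2).
  destruct (h r (G_pos GG hr) h1) as (r' & h3 & h4 & h5). apply (no r') in h5; [tauto|auto|eapply sub_trans; eauto].
Qed.

Variables (N : Type) (EN : N -> N -> Prop).
Hypothesis extN : forall i j : N, (forall k : N, EN k i <-> EN k j) -> i = j.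
Hypothesis wfN : well_founded EN.
Variable VAL : M -> N.
Hypothesis VAL_surj : forall i : N, exists t, i = VAL t.
Hypothesis VAL_mem : forall (i : N) t, EN i (VAL t) <-> exists s p, pr s p ∈ t /\ G p /\ i = VAL s.

Lemma feq_sound s : forall p t, G p -> feq p s t -> VAL s = VAL t.
Proof.
  revert s; refine (name_ind _); intros s IH p t hp h. apply feq_unfold in h as (_ & h1 & h2).
  apply extN; intros x; rewrite !VAL_mem; split.
  - intros (a & q & ha & hq & ->). destruct (G_dir GG hp hq) as (r & hr & pr_ & qr).
    destruct (gen_below (A := fun r => exists b q', nmr b q' t /\ q' ⊆ r /\ feq r a b) (p := r)) as (r' & hr' & b & q' & k1 & k2 & k3); auto.
    { unfold feq, bisim, step, nmr; dfn. }
    { intros r1 hr1 rr1. apply (h1 a q); auto. split; auto; apply (G_pos GG hq). eapply sub_trans; eauto. eapply sub_trans; eauto. }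
    exists b, q'; repeat split. apply k1. apply (G_up GG hr' (proj2 k1) k2). eapply IH; eauto.
  - intros (a & q & ha & hq & ->). destruct (G_dir GG hp hq) as (r & hr & pr_ & qr).
    destruct (gen_below (A := fun r => exists b q', nmr b q' s /\ q' ⊆ r /\ feq r b a) (p := r)) as (r' & hr' & b & q' & k1 & k2 & k3); auto.
    { unfold feq, bisim, step, nmr; dfn. }
    { intros r1 hr1 rr1. apply (h2 a q); auto. split; auto; apply (G_pos GG hq). eapply sub_trans; eauto. eapply sub_trans; eauto. }
    exists b, q'; repeat split. apply k1. apply (G_up GG hr' (proj2 k1) k2). symmetry; eapply IH; eauto. apply k1.
Qed.
Lemma feq_complete s : forall t, VAL s = VAL t -> exists p, G p /\ feq p s t.
Proof.
  revert s; refine (name_ind _); intros s IH t e.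
  (* W says that some entry of a active under p is never equated, by an extension of p, with an
     active entry of b0; W' is the same with the arguments of [feq] exchanged. Densely, either the
     names are forced equal or such a difference is witnessed, and a witness in G contradicts
     equality of the values. *)
  pose (W p a b0 := exists a' q, nmr a' q a /\ q ⊆ p /\ forall r b q', r ∈ Pos -> p ⊆ r -> nmr b q' b0 -> q' ⊆ r -> ~ feq r a' b).
  pose (W' p a b0 := exists a' q, nmr a' q a /\ q ⊆ p /\ forall r b q', r ∈ Pos -> p ⊆ r -> nmr b q' b0 -> q' ⊆ r -> ~ feq r b a').
  destruct (gen (A := fun p => feq p s t \/ W p s t \/ W' p t s)) as [(p & hp & [h|[h|h]])|(p & hp & no)].
  - unfold W, W', feq, bisim, step, nmr; dfn.
  - eauto.
  - destruct h as (a & q & ha & qp & h). exfalso.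
    assert (k : EN (VAL a) (VAL t)).
    { rewrite <- e; apply VAL_mem; exists a, q; repeat split; [apply ha|]. apply (G_up GG hp (proj2 ha) qp). }
    apply VAL_mem in k as (b & q' & hb & hq' & e'). destruct (IH a q (proj1 ha) b e') as (p' & hp' & hf).
    destruct (G_dir GG hp hp') as (r & hr & r1 & r2). destruct (G_dir GG hr hq') as (r' & hr' & r3 & r4).
    apply (h r' b q'); auto. apply (G_pos GG hr'). eapply sub_trans; eauto. split; auto; apply (G_pos GG hq').
    eapply feq_mono; eauto. apply (G_pos GG hr'). eapply sub_trans; eauto.
  - destruct h as (a & q & ha & qp & h). exfalso.
    assert (k : EN (VAL a) (VAL s)).
    { rewrite e; apply VAL_mem; exists a, q; repeat split; [apply ha|]. apply (G_up GG hp (proj2 ha) qp). }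
    apply VAL_mem in k as (b & q' & hb & hq' & e'). destruct (IH b q' hb a (eq_sym e')) as (p' & hp' & hf).
    destruct (G_dir GG hp hp') as (r & hr & r1 & r2). destruct (G_dir GG hr hq') as (r' & hr' & r3 & r4).
    apply (h r' b q'); auto. apply (G_pos GG hr'). eapply sub_trans; eauto. split; auto; apply (G_pos GG hq').
    eapply feq_mono; eauto. apply (G_pos GG hr'). eapply sub_trans; eauto.
  - exists p; split; auto. apply feq_fold; [apply (G_pos GG hp)| |].
    + intros a q ha r hr h1 h2. apply NNPP; intros n. apply (no r hr h1). right; left.
      exists a, q; repeat split; try apply ha; auto. intros r' b q' k1 k2 k3 k4 k5. apply n.
      exists r'; repeat split; auto. exists b, q'; auto.
    + intros a q ha r hr h1 h2. apply NNPP; intros n. apply (no r hr h1). right; right.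
      exists a, q; repeat split; try apply ha; auto. intros r' b q' k1 k2 k3 k4 k5. apply n.
      exists r'; repeat split; auto. exists b, q'; auto.
Qed.
Lemma fmem_truth s t : EN (VAL s) (VAL t) <-> exists p, G p /\ fmem p s t.
Proof.
  rewrite VAL_mem. split.
  - intros (b & u & hb & hu & e). apply feq_complete in e as (p & hp & h).
    destruct (G_dir GG hp hu) as (r & hr & r1 & r2). exists r; split; auto. intros q hq rq.
    exists q; split; [auto|split; [apply sub_refl|]]. exists b, u. split; [split; auto; apply (G_pos GG hu)|split].
    eapply sub_trans; eauto. eapply feq_mono; eauto. eapply sub_trans; eauto.
  - intros (p & hp & h). destruct (gen_below (A := fun r => exists b u, nmr b u t /\ u ⊆ r /\ feq r s b) (p := p)) as (r & hr & b & u & k1 & k2 & k3); auto.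
    { unfold feq, bisim, step, nmr; dfn. }
    exists b, u; repeat split; [apply k1|apply (G_up GG hr (proj2 k1) k2)|eapply feq_sound; eauto].
Qed.
(** The implication and the quantifier need a condition of G that decides the formula. [gen]
    provides it because forcing is definable in M, and surjectivity of [VAL] replaces elements of N
    by names. *)
Theorem truth f : forall v, sat EN (fun i => VAL (v i)) f <-> exists p, G p /\ forces v p f.
Proof.
  assert (DD : forall f v, D1 (fun p => forces v p f)).
  { intros g v. apply (Def_forces g (s := fun i _ => v i) (k := fun v => v 0)); intros; dfn. }
  induction f as [i j| |f IHf g IHg|f IH]; intros v; cbn [sat].
  - apply fmem_truth.
  - simpl; split; [tauto|]. intros (p & _ & []).
  - rewrite IHf, IHg. split.
    + intros H. destruct (gen (A := fun p => forces v p f /\ forall q, q ∈ Pos -> p ⊆ q -> ~ forces v q g)) as [(p & hp & h1 & h2)|(p & hp & h)].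
      * assert (Df := DD f v). assert (Dg := DD g v). unfold D1 in *.
        apply Def_and; auto. dfn.
      * exfalso. destruct H as (q & hq & h); eauto. destruct (G_dir GG hp hq) as (r & hr & r1 & r2).
        apply (h2 r (G_pos GG hr) r1). eapply forces_mono; eauto. apply (G_pos GG hr).
      * exists p; split; auto. intros q hq pq hf. apply forces_dense; auto. intros q' hq' qq'.
        apply NNPP; intros n. apply (h q' hq'). eapply sub_trans; eauto. split; [eapply forces_mono; eauto|].
        intros r hr q'r hg; apply n; eauto.
    + intros (p & hp & h) (q & hq & hf). destruct (G_dir GG hp hq) as (r & hr & r1 & r2).
      exists r; split; auto. apply h; auto. apply (G_pos GG hr). eapply forces_mono; eauto. apply (G_pos GG hr).
  - assert (E : forall x, (fun i => VAL (scons x v i)) = scons (VAL x) (fun i => VAL (v i))).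
    { intros x; extensionality i; destruct i; auto. }
    split.
    + intros H. destruct (gen (A := fun p => exists x, forall q, q ∈ Pos -> p ⊆ q -> ~ forces (scons x v) q f)) as [(p & hp & x & h)|(p & hp & h)].
      * refine (Def_ex _ _). dfn.
        apply Def_iff with (fun e => forces (fun i => match i with O => e 1 | S i => v i end) (e 0) f).
        intros e; replace (scons _ _) with (fun i => match i with O => e 1 | S i => v i end); [tauto|].
        extensionality i; destruct i; auto.
        apply (Def_forces f (s := fun i e => match i with O => e 1 | S i => v i end) (k := fun e => e 0)).
        intros [|i]; dfn. dfn.
      * exfalso. specialize (H (VAL x)). rewrite <- E in H. apply IH in H as (q & hq & hf).
        destruct (G_dir GG hp hq) as (r & hr & r1 & r2). apply (h r (G_pos GG hr) r1). eapply forces_mono; eauto. apply (G_pos GG hr).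
      * exists p; split; auto. intros x. apply forces_dense. apply (G_pos GG hp). intros q hq pq.
        apply NNPP; intros n. apply (h q hq pq). exists x. intros r hr qr hf; eauto.
    + intros (p & hp & h) x. destruct (VAL_surj x) as [t ->]. rewrite <- E. apply IH. exists p; split; auto.
Qed.

Lemma VAL_pair s t : exists p, forall z : N, EN z (VAL p) <-> z = VAL s \/ z = VAL t.
Proof.
  exists (upair (pr s emp) (pr t emp)). intros z; rewrite VAL_mem. split.
  - intros (a & q & h & _ & ->). apply in_upair in h as [h|h]; apply pr_inj in h as [-> _]; auto.
  - intros [->| ->]; [exists s, emp|exists t, emp]; rewrite in_upair; repeat split; auto; apply (G_emp GG).
Qed.
End Forcing.

(** * The generic extension *)

Section Extension.
Context {M : zermelo} (Pos : M) (RP : replacement M) (WO : forall u : M, exists w, wo w u).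
Implicit Types x y z w u a b c d p q r s t : M.
Variable G : M -> Prop.
Hypothesis GG : generic Pos G.
Variables (N : Type) (EN : N -> N -> Prop).
Hypothesis extN : forall i j : N, (forall k : N, EN k i <-> EN k j) -> i = j.
Hypothesis wfN : well_founded EN.
Variable VAL : M -> N.
Hypothesis VAL_surj : forall i : N, exists t, i = VAL t.
Hypothesis VAL_mem : forall (i : N) t, EN i (VAL t) <-> exists s p, pr s p ∈ t /\ G p /\ i = VAL s.

Lemma VAL_union t : exists u, forall i : N, EN i (VAL u) <-> exists k, EN k (VAL t) /\ EN i k.
Proof.
  assert (D : D1 (fun z => exists s p, z = pr s p /\ exists a q r, pr a q ∈ t /\ pr s r ∈ a /\ q ∈ Pos /\ r ∈ Pos /\ q ⊆ p /\ r ⊆ p)) by dfn.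
  pose (A := un (un t)).
  exists (sep (prod (un (un (un A))) Pos) (fun z => exists s p, z = pr s p /\ exists a q r, pr a q ∈ t /\ pr s r ∈ a /\ q ∈ Pos /\ r ∈ Pos /\ q ⊆ p /\ r ⊆ p)).
  intros i; rewrite VAL_mem; split.
  - intros (s & p & h & hp & ->). rewrite in_sep in h by auto. destruct h as (_ & s' & p' & e & a & q & r & h1 & h2 & h3 & h4 & h5 & h6).
    apply pr_inj in e as [<- <-]. exists (VAL a); rewrite !VAL_mem. split.
    + exists a, q; repeat split; auto. apply (G_up GG hp h3 h5).
    + exists s, r; repeat split; auto. apply (G_up GG hp h4 h6).
  - intros (k & hk & hi). apply VAL_mem in hk as (a & q & h1 & hq & ->). apply VAL_mem in hi as (s & r & h2 & hr & ->).
    destruct (G_dir GG hq hr) as (p & hp & qp & rp). exists s, p; repeat split; auto.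
    assert (hqp := G_pos GG hq). assert (hrp := G_pos GG hr).
    rewrite in_sep, pr_prod by auto. split; [split; [|apply (G_pos GG hp)]|exists s, p; split; auto; exists a, q, r; auto 7].
    apply pr_field in h1 as [h1 _]. apply pr_field in h2 as [h2 _]. unfold A.
    apply in_un in h2 as (y & h2 & h3). apply in_un in h2 as (y' & h2 & h4).
    apply in_un; exists y; split; auto. apply in_un; exists y'; split; auto. apply in_un; exists a; split; auto.
Qed.
Lemma VAL_sep (f : formula) (v : nat -> N) (i : N) :
  exists k : N, forall x : N, EN x k <-> EN x i /\ sat EN (scons x v) f.
Proof.
  destruct (VAL_surj i) as [t ->].
  assert (hv : exists s : nat -> M, forall n, v n = VAL (s n)).
  { exists (fun n => the (fun t => v n = VAL t)). intros n; apply (theP (fun t => v n = VAL t)), VAL_surj. }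
  destruct hv as [s hs].
  assert (D : D1 (fun z => exists a p, z = pr a p /\ exists q, pr a q ∈ t /\ q ∈ Pos /\ q ⊆ p /\ forces Pos (scons a s) p f)).
  { dfn. apply Def_iff with (fun e => forces Pos (fun n => match n with O => e 2 | S n => s n end) (e 1) f).
    - intros e; replace (scons (e 2) s) with (fun n => match n with O => e 2 | S n => s n end); [tauto|].
      extensionality n; destruct n; auto.
    - apply (Def_forces Pos f (s := fun n e => match n with O => e 2 | S n => s n end) (k := fun e => e 1)).
      intros [|n]; dfn. dfn. }
  assert (E : forall x, (fun n => VAL (scons x s n)) = scons (VAL x) v).
  { intros x; extensionality n; destruct n; simpl; auto. }
  exists (VAL (sep (prod (dom t) Pos) (fun z => exists a p, z = pr a p /\ exists q, pr a q ∈ t /\ q ∈ Pos /\ q ⊆ p /\ forces Pos (scons a s) p f))).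
  intros x; rewrite !VAL_mem. split.
  - intros (a & p & h & hp & ->). rewrite in_sep in h by auto. destruct h as (_ & a' & p' & e & q & h1 & h2 & h3 & h4).
    apply pr_inj in e as [<- <-]. split; [exists a, q; repeat split; auto; apply (G_up GG hp h2 h3)|].
    rewrite <- E. apply (truth RP GG extN VAL_surj VAL_mem). eauto.
  - intros [(a & q & ha & hq & ->) hf]. rewrite <- E in hf. apply (truth RP GG extN VAL_surj VAL_mem) in hf as (p & hp & hf).
    destruct (G_dir GG hp hq) as (r & hr & r1 & r2). exists a, r; repeat split; auto.
    assert (hrP := G_pos GG hr). assert (hqP := G_pos GG hq).
    rewrite in_sep, pr_prod, in_dom by auto. split; [split; eauto|]. exists a, r; split; auto. exists q; repeat split; auto.
    eapply forces_mono; eauto.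
Qed.
(** A subset of [VAL t] has a name built from entries of [dom t] and conditions: attach to a every
    condition forcing it to belong. These names form a set of M, and the weakest condition [emp]
    puts all of them into one name. *)
Lemma VAL_power (i : N) : exists P : N, forall k : N, (forall x : N, EN x k -> EN x i) -> EN k P.
Proof.
  destruct (VAL_surj i) as [t ->].
  exists (VAL (prod (pow (prod (dom t) Pos)) (sing emp))). intros k hk. destruct (VAL_surj k) as [s ->].
  assert (D : D1 (fun z => exists a p, z = pr a p /\ fmem Pos p a s)) by (unfold fmem, feq, bisim, step, nmr; dfn).
  apply VAL_mem. exists (sep (prod (dom t) Pos) (fun z => exists a p, z = pr a p /\ fmem Pos p a s)), emp.
  rewrite pr_prod, in_pow, in_sing. split; [split; auto|split; [apply (G_emp GG)|]].
  - intros z hz; rewrite in_sep in hz by auto; tauto.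
  - apply extN; intros x; split.
    + intros hx. assert (hx' := hk x hx). apply VAL_mem in hx' as (a & q & ha & hq & ->).
      apply (fmem_truth RP GG extN VAL_mem) in hx as (p & hp & h). apply VAL_mem. exists a, p; repeat split; auto.
      rewrite in_sep, pr_prod, in_dom by auto. split; eauto 6. split; eauto. apply (G_pos GG hp).
    + intros hx; apply VAL_mem in hx as (a & p & ha & hp & ->). rewrite in_sep in ha by auto.
      destruct ha as (_ & a' & p' & e & h). apply pr_inj in e as [<- <-]. apply (fmem_truth RP GG extN VAL_mem). eauto.
Qed.

Lemma check_ex : exists ck : M -> M, D1T ck /\ forall x z, z ∈ ck x <-> exists c, c ∈ x /\ z = pr (ck c) emp.
Proof.
  destruct (rec_total RP (H := fun g => prod (ran g) (sing emp))) as (ck & D & H). dfn.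
  exists ck; split; auto. intros x z. rewrite H, in_prod. split.
  - intros (s & e & hs & he & ->). apply in_sing in he; subst e. apply in_ran in hs as [c hc].
    rewrite in_img in hc by (auto; dfn). destruct hc as (c' & hc & e). apply pr_inj in e as [-> ->]. eauto.
  - intros (c & hc & ->). exists (ck c), emp. rewrite in_sing, in_ran; repeat split; auto. exists c.
    rewrite in_img by (auto; dfn). eauto.
Qed.
Definition ck : M -> M := epsilon (inhabits (fun x => x)) (fun ck => D1T ck /\ forall x z, z ∈ ck x <-> exists c, c ∈ x /\ z = pr (ck c) emp).
Lemma ckP : D1T ck /\ forall x z, z ∈ ck x <-> exists c, c ∈ x /\ z = pr (ck c) emp.
Proof. unfold ck; apply epsilon_spec, check_ex. Qed.
Definition jn x : N := VAL (ck x).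
Lemma jn_mem (i : N) x : EN i (jn x) <-> exists c, c ∈ x /\ i = jn c.
Proof.
  unfold jn; rewrite VAL_mem. split.
  - intros (s & p & h & _ & ->). apply ckP in h as (c & hc & e). apply pr_inj in e as [-> ->]; eauto.
  - intros (c & hc & ->). exists (ck c), emp. repeat split; [apply ckP; eauto|apply (G_emp GG)].
Qed.

Lemma VAL_inf : exists i, is_inductive EN i.
Proof.
  exists (jn om). split.
  - exists (jn emp); split.
    + intros z hz; apply jn_mem in hz as (c & hc & _). destruct (in_emp hc).
    + apply jn_mem; exists emp; split; auto. apply (nm_om 0).
  - intros x hx. apply jn_mem in hx as (c & hc & ->). exists (jn (succ c)); split.
    + intros z; rewrite !jn_mem. split.
      * intros (d & hd & ->). apply in_succ in hd as [hd| ->]; [left; eauto|right; unfold same; tauto].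
      * intros [(d & hd & ->)|h]; [exists d; rewrite in_succ; auto|]. exists c; rewrite in_succ; split; auto.
    + apply jn_mem; exists (succ c); split; auto. apply ind_om; auto.
Qed.
Definition zN : zermelo.
Proof.
  refine (@Build_zermelo N EN extN wfN _ _ VAL_power VAL_inf VAL_sep).
  - intros i k. destruct (VAL_surj i) as [s ->], (VAL_surj k) as [t ->].
    destruct (VAL_pair GG VAL_mem s t) as [p hp]; eauto.
  - intros i. destruct (VAL_surj i) as [s ->]. destruct (VAL_union s) as [u hu]. eauto.
Defined.

Definition upn s t : M := upair (pr s emp) (pr t emp).
Lemma VAL_upn s t : VAL (upn s t) = @upair zN (VAL s) (VAL t).
Proof.
  apply (@mem_ext zN). intros z; rewrite in_upair. unfold upn. etransitivity; [apply VAL_mem|]. split.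
  - intros (a & q & h & _ & ->). apply in_upair in h as [h|h]; apply pr_inj in h as [-> _]; auto.
  - intros [->| ->]; [exists s, emp|exists t, emp]; rewrite in_upair; repeat split; auto; apply (G_emp GG).
Qed.
Definition opn s t : M := upn (upn s s) (upn s t).
Lemma VAL_opn s t : VAL (opn s t) = @pr zN (VAL s) (VAL t).
Proof. unfold opn, pr; rewrite !VAL_upn; auto. Qed.

Definition jj (x : M) : zN := jn x.
Lemma jj_in (z : zN) x : z ∈ jj x <-> exists c, c ∈ x /\ z = jj c.
Proof. apply jn_mem. Qed.
Lemma jj_inj x y : jj x = jj y -> x = y.
Proof.
  revert x y; refine (mem_ind _); intros x IH y e. apply mem_ext; intros z; split; intros hz.
  - assert (h : jj z ∈ jj x) by (apply jj_in; eauto). rewrite e in h. apply jj_in in h as (c & hc & e').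
    rewrite (IH z hz c e'); auto.
  - assert (h : jj z ∈ jj y) by (apply jj_in; eauto). rewrite <- e in h. apply jj_in in h as (c & hc & e').
    rewrite <- (IH c hc z); auto.
Qed.
Lemma jj_mem x y : jj x ∈ jj y <-> x ∈ y.
Proof.
  rewrite jj_in; split; [|eauto]. intros (c & hc & e); apply jj_inj in e; subst; auto.
Qed.
Lemma jj_ord x : ord x -> ord (jj x).
Proof.
  intros [h1 h2]; split.
  - intros y hy z hz. apply jj_in in hy as (c & hc & ->). apply jj_in in hz as (d & hd & ->). apply jj_mem, (h1 c hc d hd).
  - intros y' hy' y hy z hz. apply jj_in in hy' as (b & hb & ->). apply jj_in in hy as (c & hc & ->).
    apply jj_in in hz as (d & hd & ->). apply jj_mem, (h2 b hb c hc d hd).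
Qed.

(** A well-ordering in M of the names in [dom t] is turned into a name by pairing each name with the
    canonical name of its ordinal. An element with several names gets several ordinals, which [wo]
    permits. *)
Lemma WO_N (u : zN) : exists w : zN, wo w u.
Proof.
  destruct (VAL_surj u) as [t e]. destruct (WO (dom t)) as [o (o1 & o2 & o3)].
  assert (DC := proj1 ckP).
  destruct (RP (R := fun z y => exists s a, z = pr s a /\ y = pr (opn s (ck a)) emp)) with (a := sep o (fun z => exists s a, z = pr s a)) as [w hw].
  - unfold opn, upn; dfn.
  - intros z hz; rewrite in_sep in hz by dfn. destruct hz as [_ (s & a & ->)].
    exists (pr (opn s (ck a)) emp); split; eauto. intros y (s' & a' & e' & ->). apply pr_inj in e' as [<- <-]; auto.
  - assert (P : forall x b : zN, pr x b ∈ (VAL w : zN) <-> exists s a, pr s a ∈ o /\ x = VAL s /\ b = jj a).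
    { intros x b. etransitivity; [apply VAL_mem|]. split.
      - intros (m & p & h & _ & e1). apply hw in h as (z & hz & s & a & -> & e2). apply pr_inj in e2 as [-> ->].
        rewrite in_sep in hz by dfn. rewrite VAL_opn in e1. apply (@pr_inj zN) in e1 as [-> ->]. exists s, a; tauto.
      - intros (s & a & h & -> & ->). exists (opn s (ck a)), emp. split; [|split; [apply (G_emp GG)|rewrite VAL_opn; reflexivity]].
        apply hw. exists (pr s a). rewrite in_sep by dfn. split; [split; eauto|exists s, a; auto]. }
    exists (VAL w). split; [|split].
    + intros x hx. rewrite e in hx. apply VAL_mem in hx as (s & p & hs & _ & ->).
      destruct (o1 s) as (a & ha & hsa). apply in_dom; eauto. exists (jj a); split; [apply jj_ord; auto|].
      apply P; eauto.
    + intros x b h; apply P in h as (s & a & h & _ & ->). apply jj_ord; eauto.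
    + intros x y b h h'. apply P in h as (s & a & h & -> & ->), h' as (s' & a' & h' & -> & e').
      apply jj_inj in e'; subst a'. rewrite (o3 s s' a); auto.
Qed.

(* [rep A a R]: R is a ground model name of the trace of A on the ground model
   set a, listing the conditions which force each membership. *)
Definition rep (A : zN) a R := R ⊆ prod a Pos /\
  (forall x p q, pr x p ∈ R -> q ∈ Pos -> p ⊆ q -> pr x q ∈ R) /\
  (forall x p, x ∈ a -> p ∈ Pos ->
     (forall q, q ∈ Pos -> p ⊆ q -> exists r, r ∈ Pos /\ q ⊆ r /\ pr x r ∈ R) -> pr x p ∈ R) /\
  forall x, x ∈ a -> (jj x ∈ A <-> exists p, G p /\ pr x p ∈ R).
Lemma rep_ex (A : zN) a : exists R, rep A a R.
Proof.
  destruct (VAL_surj A) as [t ->]. assert (DC := proj1 ckP).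
  assert (D : D1 (fun z => exists x p, z = pr x p /\ fmem Pos p (ck x) t)) by (unfold fmem, feq, bisim, step, nmr; dfn).
  exists (sep (prod a Pos) (fun z => exists x p, z = pr x p /\ fmem Pos p (ck x) t)).
  assert (P : forall x p, pr x p ∈ sep (prod a Pos) (fun z => exists x p, z = pr x p /\ fmem Pos p (ck x) t) <->
    x ∈ a /\ p ∈ Pos /\ fmem Pos p (ck x) t).
  { intros x p; rewrite in_sep, pr_prod by auto. split.
    - intros [h (x' & p' & e & h')]; apply pr_inj in e as [<- <-]; tauto.
    - intros (h1 & h2 & h3); eauto 6. }
  split; [|split; [|split]].
  - intros z hz; rewrite in_sep in hz by auto; tauto.
  - intros x p q h hq pq; apply P in h as (h1 & h2 & h3); apply P; repeat split; auto. eapply fmem_mono; eauto.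
  - intros x p hx hp h. apply P; repeat split; auto. apply fmem_dense. intros q hq pq.
    destruct (h q hq pq) as (r & hr & qr & h'). apply P in h' as (_ & _ & h'); eauto.
  - intros x hx. etransitivity; [apply (fmem_truth RP GG extN VAL_mem (ck x) t)|].
    split; intros (p & hp & h); exists p; split; auto; [apply P|apply P in h; tauto].
    repeat split; auto. apply (G_pos GG hp).
Qed.
Lemma filter_ex : exists g : zN, forall z : zN, z ∈ g <-> exists p, G p /\ z = jj p.
Proof.
  assert (DC := proj1 ckP).
  destruct (RP (R := fun p y => y = pr (ck p) p)) with (a := Pos) as [w hw].
  - dfn.
  - intros p hp; eauto.
  - exists (VAL w). intros z. etransitivity; [apply VAL_mem|]. split.
    + intros (s & p & h & hp & ->). apply hw in h as (p' & _ & e). apply pr_inj in e as [-> ->]. eauto.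
    + intros (p & hp & ->). exists (ck p), p. repeat split; auto. apply hw. exists p; split; auto. apply (G_pos GG hp).
Qed.
End Extension.

(** * Supports of Cohen names *)

Section Cohen.
Context {M : zermelo}.
Hypothesis WO : forall u : M, exists w, wo w u.
Implicit Types x y z w u a b c d f p q r s t S R A : M.
Variable w2 : M.

Definition cond p := fin p /\ p ⊆ prod (prod w2 om) (nm 2) /\
  forall x i k, pr x i ∈ p -> pr x k ∈ p -> i = k.
Definition Pos : M := sep (Fins (prod (prod w2 om) (nm 2)))
  (fun p => forall x i k, pr x i ∈ p -> pr x k ∈ p -> i = k).
Lemma in_Pos p : p ∈ Pos <-> cond p.
Proof. unfold Pos, cond; rewrite in_sep, in_Fins by dfn; tauto. Qed.
Lemma Pos_sub p q : p ∈ Pos -> q ⊆ p -> q ∈ Pos.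
Proof.
  rewrite !in_Pos; intros (h1 & h2 & h3) h. split; [eapply fin_sub; eauto|split; [eapply sub_trans; eauto|]]. eauto.
Qed.
Lemma Pos_cup p q : p ∈ Pos -> q ∈ Pos -> (forall x i k, pr x i ∈ p -> pr x k ∈ q -> i = k) -> cup p q ∈ Pos.
Proof.
  rewrite !in_Pos; intros (h1 & h2 & h3) (h1' & h2' & h3') h. split; [apply fin_cup; auto|split].
  - intros z hz; apply in_cup in hz as [hz|hz]; auto.
  - intros x i k; rewrite !in_cup. intros [a|a] [b|b]; eauto. symmetry; eauto.
Qed.
Lemma sub_cup_l a b : a ⊆ cup a b.
Proof. intros z hz; apply in_cup; auto. Qed.
Lemma sub_cup_r a b : b ⊆ cup a b.
Proof. intros z hz; apply in_cup; auto. Qed.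

Definition rs p S : M := sep p (fun z => exists d n i, d ∈ S /\ z = pr (pr d n) i).
Lemma pr_rs p S d n i : pr (pr d n) i ∈ rs p S <-> pr (pr d n) i ∈ p /\ d ∈ S.
Proof.
  unfold rs; rewrite in_sep by dfn; split.
  - intros (h & d' & n' & i' & h' & e). apply pr_inj in e as [e _]; apply pr_inj in e as [-> _]; auto.
  - intros [h h']; split; eauto 6.
Qed.
Lemma rs_sub p S : rs p S ⊆ p.
Proof. intros z; unfold rs; rewrite in_sep by dfn; tauto. Qed.
Lemma rs_mono p q S : p ⊆ q -> rs p S ⊆ rs q S.
Proof. intros h z; unfold rs; rewrite !in_sep by dfn. intros [h1 h2]; auto. Qed.
Definition FS S : M := sep Pos (fun p => p ⊆ prod (prod S om) (nm 2)).
Lemma in_FS S p : p ∈ FS S <-> p ∈ Pos /\ p ⊆ prod (prod S om) (nm 2).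
Proof. unfold FS; rewrite in_sep by dfn; tauto. Qed.
Lemma D1T_FS : D1T FS.
Proof. unfold FS; dfn. Qed.
Lemma Pos_el p z : p ∈ Pos -> z ∈ p -> exists d n i, z = pr (pr d n) i /\ d ∈ w2 /\ n ∈ om /\ i ∈ nm 2.
Proof.
  rewrite in_Pos; intros (_ & h & _) hz. apply h, in_prod in hz as (x & i & hx & hi & ->).
  apply in_prod in hx as (d & n & hd & hn & ->). eauto 8.
Qed.
Lemma FS_el S p d n i : p ∈ FS S -> pr (pr d n) i ∈ p -> d ∈ S.
Proof. rewrite in_FS; intros [_ h] hz. apply h in hz. rewrite !pr_prod in hz; tauto. Qed.
Lemma FS_intro S p : p ∈ Pos -> (forall d n i, pr (pr d n) i ∈ p -> d ∈ S) -> p ∈ FS S.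
Proof.
  intros hp h. apply in_FS; split; auto. intros z hz. destruct (Pos_el hp hz) as (d & n & i & -> & _ & hn & hi).
  rewrite !pr_prod; eauto.
Qed.
Lemma rs_FS p S : p ∈ Pos -> rs p S ∈ FS S.
Proof.
  intros hp; apply FS_intro; [eapply Pos_sub; eauto; apply rs_sub|]. intros d n i h; apply pr_rs in h; tauto.
Qed.
(** On coordinates outside S only p speaks, and on S everything p says is already in q. *)
Lemma amalg p q S : p ∈ Pos -> q ∈ FS S -> rs p S ⊆ q -> cup p q ∈ Pos.
Proof.
  intros hp hq h. assert (hq' := proj1 (proj1 (in_FS _ _) hq)). apply Pos_cup; auto. intros x i k h1 h2.
  destruct (Pos_el hp h1) as (d & n & i' & e & _). apply pr_inj in e as [-> <-].
  apply in_Pos in hq' as (_ & _ & f). apply (f (pr d n)); auto. apply h, pr_rs; split; auto. eapply FS_el; eauto.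
Qed.
Lemma enum_FS S : enum S -> enum (FS S).
Proof.
  intros e. apply enum_sub with (Fins (prod (prod S om) (nm 2))).
  - intros p hp; apply in_FS in hp as [h1 h2]. apply in_Fins; split; auto. apply in_Pos in h1; apply h1.
  - apply enum_Fins; auto. apply enum_prod; [apply enum_prod; auto using enum_om|apply enum_fin, fin_nm].
Qed.
Lemma fin_dom f : fin f -> fin (dom f).
Proof.
  intros [l Hl]. assert (D : fin (fset (map (fun z => the (fun x => exists y, z = pr x y)) l))) by apply fin_fset.
  eapply fin_sub; [|exact D]. intros x hx; apply in_dom in hx as [y h]. apply in_fset, in_map_iff.
  exists (pr x y). split; [|apply Hl; auto]. apply the_eq; [eauto|]. intros x' [y' e]; apply pr_inj in e as [-> _]; auto.
Qed.
Definition supp p : M := dom (dom p).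
Lemma in_supp p d : d ∈ supp p <-> exists n i, pr (pr d n) i ∈ p.
Proof.
  unfold supp; rewrite in_dom; split.
  - intros [n h]; apply in_dom in h as [i h]; eauto.
  - intros (n & i & h); exists n; apply in_dom; eauto.
Qed.
Lemma fin_incr a (u : nat -> M) : fin a -> (forall m n, m <= n -> u m ⊆ u n) ->
  (forall z, z ∈ a -> exists n, z ∈ u n) -> exists n, a ⊆ u n.
Proof.
  intros [l Hl] hm. assert (H : (forall z, In z l -> exists n, z ∈ u n) -> exists n, forall z, In z l -> z ∈ u n).
  { clear Hl a. induction l as [|x l IH]; intros h; [exists 0; intros z []|].
    destruct IH as [n Hn]; [intros z hz; apply h; right; auto|]. destruct (h x) as [m hx]; [left; auto|].
    exists (n + m). intros z [<-|hz]; [apply (hm m); auto; lia|apply (hm n); auto; lia]. }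
  intros h; destruct H as [n Hn]; [intros z hz; apply h, Hl; auto|]. exists n; intros z hz; apply Hn, Hl; auto.
Qed.

(* A countable set of coordinates closed under witnesses: this replaces the
   countable chain condition and nice names. *)
Lemma support (c : M) (DD : M -> M -> Prop) : enum c -> D2 DD ->
  exists S, S ⊆ w2 /\ enum S /\ forall x p, x ∈ c -> p ∈ FS S ->
    (exists q, q ∈ Pos /\ p ⊆ q /\ DD x q) -> exists q, q ∈ FS S /\ p ⊆ q /\ DD x q.
Proof.
  intros ec D. destruct (WO Pos) as [w hw].
  pose (C x p := sep Pos (fun q => p ⊆ q /\ DD x q)).
  assert (inC : forall x p q, q ∈ C x p <-> q ∈ Pos /\ p ⊆ q /\ DD x q) by (intros; unfold C; rewrite in_sep by dfn; tauto).
  pose (R z d := exists x p, z = pr x p /\ d ∈ supp (pick w (C x p))).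
  assert (DR : D2 R) by (unfold R, supp, C; dfn).
  (* One closure step: for every x in c and every condition p on Z, the coordinates of the chosen
     witness are added. *)
  pose (st Z := cup Z (sep w2 (fun d => exists z, z ∈ prod c (FS Z) /\ R z d))).
  assert (Dst : D1T st) by (unfold st, FS; dfn).
  destruct (om_rec (z0 := emp) (s := fun _ Z => st Z) (B := pow w2)) as (f & hf & f0 & fS).
  { dfn. }
  { apply in_pow; intros z hz; destruct (in_emp hz). }
  { intros _ Z hZ; apply in_pow; intros z hz. apply in_cup in hz as [hz|hz].
    - rewrite in_pow in hZ; auto. - rewrite in_sep in hz by (unfold FS; dfn); tauto. }
  assert (DS : D1 (fun d => exists n, n ∈ om /\ d ∈ ap f n)) by dfn.
  pose (S := sep w2 (fun d => exists n, n ∈ om /\ d ∈ ap f n)).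
  assert (fw : forall n, ap f (nm n) ⊆ w2) by (intros; apply in_pow, (funcs_ap hf), nm_om).
  assert (inS : forall d, d ∈ S <-> exists n, d ∈ ap f (nm n)).
  { intros d; unfold S; rewrite in_sep by auto; split.
    - intros (_ & n & hn & h); apply in_om in hn as [k ->]; eauto.
    - intros [n h]; split; [apply (fw n); auto|]. exists (nm n); auto using nm_om. }
  assert (mono : forall m n, m <= n -> ap f (nm m) ⊆ ap f (nm n)).
  { intros m n h; induction h; [apply sub_refl|]. rewrite fS. intros z hz; apply in_cup; auto. }
  assert (en : forall n, enum (ap f (nm n))).
  { induction n; [rewrite f0; apply enum_fin; exists nil; intros z; split; [apply in_emp|intros []]|].
    rewrite fS. apply enum_cup; auto. apply (enum_union WO) with (I := prod c (FS (ap f (nm n)))) (R := R); auto.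
    - apply enum_prod; auto. apply enum_FS; auto.
    - intros z hz. apply in_prod in hz as (x & p & hx & hp & ->).
      destruct (classic (exists q, q ∈ C x p)) as [ne|ne].
      + apply enum_sub with (supp (pick w (C x p))).
        * intros d hd; rewrite in_sep in hd by dfn. destruct hd as (_ & x' & p' & e & h). apply pr_inj in e as [<- <-]; auto.
        * assert (h : pick w (C x p) ∈ C x p) by (apply pick_in with Pos; auto; intros q hq; apply inC in hq; tauto).
          apply enum_fin; unfold supp; do 2 apply fin_dom. apply inC in h as [h _]; apply in_Pos in h; apply h.
      + apply enum_fin; exists nil; intros d; split; [|intros []]. intros hd; rewrite in_sep in hd by dfn.
        destruct hd as (_ & x' & p' & e & h). apply pr_inj in e as [<- <-].
        exfalso. apply in_supp in h as (n' & i & h). unfold pick in h. apply in_un in h as (q & hq & _).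
        apply ne; exists q. rewrite in_sep in hq by (unfold first; dfn); tauto.
    - intros d hd; rewrite in_sep in hd by (unfold FS; dfn). apply hd. }
  exists S. split; [|split].
  - intros d hd; apply inS in hd as [n h]; apply (fw n); auto.
  - apply (enum_union WO) with (I := om) (R := fun n d => d ∈ ap f n); auto using enum_om. dfn.
    + intros n hn; apply in_om in hn as [k ->]. apply enum_sub with (ap f (nm k)); auto. intros d; rewrite in_sep by dfn; tauto.
    + intros d hd; apply inS in hd as [n h]; eauto using nm_om.
  - intros x p hx hp (q0 & h1 & h2 & h3).
    (* A condition is finite, so its coordinates are all present at some stage n, and those of its
       witness at the next one. *)
    destruct (@fin_incr (supp p) (fun n => ap f (nm n))) as [n hn]; auto.
    { unfold supp; do 2 apply fin_dom. apply in_FS in hp as [hp _]; apply in_Pos in hp; apply hp. }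
    { intros d hd; apply in_supp in hd as (m & i & h). apply inS. eapply FS_el; eauto. }
    assert (h : pick w (C x p) ∈ C x p).
    { apply pick_in with Pos; auto; [intros q hq; apply inC in hq; tauto|exists q0; apply inC; auto]. }
    exists (pick w (C x p)). assert (h' := h). apply inC in h' as (k1 & k2 & k3). split; [|auto].
    apply FS_intro; auto. intros d m i hd. apply inS. exists (Datatypes.S n). rewrite fS. apply in_cup; right.
    rewrite in_sep by (unfold FS; dfn). split.
    + destruct (Pos_el k1 hd) as (d' & m' & i' & e & hd' & _). apply pr_inj in e as [e _]; apply pr_inj in e as [-> _]; auto.
    + exists (pr x p). split; [apply pr_prod; split; auto|exists x, p; split; auto; apply in_supp; eauto].
      apply FS_intro; [apply in_FS in hp; tauto|]. intros d' m' i' h'. apply hn, in_supp; eauto.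
Qed.

Variable G : M -> Prop.
Hypothesis GG : generic Pos G.
Variable N : zermelo.
Variable j : M -> N.
Hypothesis j_in : forall (z : N) x, z ∈ j x <-> exists c, c ∈ x /\ z = j c.
(** The part of being a representation that concerns M alone: R is closed under extensions and
    contains what it contains densely. The link with an element of N is added in [is_rep]. *)
Definition nrep a R := R ⊆ prod a Pos /\
  (forall x p q, pr x p ∈ R -> q ∈ Pos -> p ⊆ q -> pr x q ∈ R) /\
  (forall x p, x ∈ a -> p ∈ Pos ->
     (forall q, q ∈ Pos -> p ⊆ q -> exists r, r ∈ Pos /\ q ⊆ r /\ pr x r ∈ R) -> pr x p ∈ R).
Definition is_rep (A : N) a R := nrep a R /\ forall x, x ∈ a -> (j x ∈ A <-> exists p, G p /\ pr x p ∈ R).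
Hypothesis reps : forall (A : N) a, exists R, is_rep A a R.

Definition neg R x p := forall q, q ∈ Pos -> p ⊆ q -> pr x q ∉ R.
Definition dec R x p := pr x p ∈ R \/ neg R x p.
Lemma neg_truth (A : N) a R x : is_rep A a R -> x ∈ a -> j x ∉ A <-> exists p, G p /\ neg R x p.
Proof.
  intros [(r1 & r2 & r3) r4] hx. rewrite r4 by auto. split.
  - intros n. destruct (gen GG (A := fun p => pr x p ∈ R)) as [(p & h & h')|?]; auto. dfn. destruct n; eauto.
  - intros (p & hp & h) (q & hq & h'). destruct (G_dir GG hp hq) as (r & hr & pr_ & qr).
    apply (h r (G_pos GG hr) pr_). apply r2 with q; auto. apply (G_pos GG hr).
Qed.
Lemma dec_dense R x p : p ∈ Pos -> exists q, q ∈ Pos /\ p ⊆ q /\ dec R x q.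
Proof.
  intros hp. destruct (classic (exists q, q ∈ Pos /\ p ⊆ q /\ pr x q ∈ R)) as [(q & h1 & h2 & h3)|no].
  - exists q; repeat split; auto. left; auto.
  - exists p; repeat split; auto using sub_refl. right. intros q hq h h'; eauto.
Qed.
Lemma neg_mono R x p q : neg R x p -> p ⊆ q -> neg R x q.
Proof. intros h pq r hr qr. apply h; auto. eapply sub_trans; eauto. Qed.
Lemma dec_mono a R x p q : nrep a R -> dec R x p -> q ∈ Pos -> p ⊆ q -> dec R x q.
Proof.
  intros (_ & r2 & _) [h|h] hq pq; [left; eapply r2; eauto|right; eapply neg_mono; eauto].
Qed.
Definition supports S a R := forall x p, x ∈ a -> p ∈ FS S -> exists q, q ∈ FS S /\ p ⊆ q /\ dec R x q.
(** If the restriction of p failed to force x, some extension q of it would force the negation. A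
    condition t on S extending the restriction of q and deciding x is compatible with both p and q,
    and either decision is contradictory. *)
Lemma supports_restrict S a a' R x p : nrep a' R -> x ∈ a' -> supports S a R -> x ∈ a -> pr x p ∈ R -> pr x (rs p S) ∈ R.
Proof.
  intros nR hx' hS hx h. assert (hp : p ∈ Pos). { apply (proj1 nR) in h. apply pr_prod in h; tauto. }
  assert (hpS := rs_FS S hp).
  apply (proj2 (proj2 nR)); auto. { apply in_FS in hpS; tauto. }
  intros q hq pq. apply NNPP; intros no.
  assert (nq : neg R x q). { intros r hr qr h'; apply no; eauto. }
  destruct (hS x (rs q S) hx (rs_FS S hq)) as (t & ht & qt & d).
  assert (c1 := amalg hq ht qt). assert (c2 : cup p t ∈ Pos).
  { apply (amalg (S := S)); auto. eapply sub_trans; [|exact qt].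
    intros z hz. destruct (Pos_el (proj1 (proj1 (in_FS _ _) hpS)) hz) as (d' & n & i & -> & _).
    apply pr_rs. split; [apply pq; auto|apply pr_rs in hz; tauto]. }
  destruct d as [d|d].
  - apply (nq _ c1 (@sub_cup_l _ _)). apply (proj1 (proj2 nR)) with t; auto. apply sub_cup_r.
  - apply (d _ c2 (@sub_cup_r _ _)). apply (proj1 (proj2 nR)) with p; auto. apply sub_cup_l.
Qed.
(** An extension q of the restriction forcing x could itself be restricted to S by
    [supports_restrict], and would then be compatible with p. *)
Lemma neg_restrict S a a' R x p : nrep a' R -> x ∈ a' -> supports S a R -> x ∈ a -> p ∈ Pos -> neg R x p -> neg R x (rs p S).
Proof.
  intros nR hx' hS hx hp h q hq pq hR.
  assert (hR' := supports_restrict nR hx' hS hx hR).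
  assert (c : cup p (rs q S) ∈ Pos).
  { apply (amalg (S := S)); auto using rs_FS. intros z hz. destruct (Pos_el hp (rs_sub hz)) as (d & n & i & -> & _).
    apply pr_rs. split; [apply pq; auto|apply pr_rs in hz; tauto]. }
  apply (h _ c (@sub_cup_l _ _)). apply (proj1 (proj2 nR)) with (rs q S); auto. apply sub_cup_r.
Qed.
Lemma supports_ex a R : enum a -> exists S, S ⊆ w2 /\ enum S /\ supports S a R.
Proof.
  intros e. destruct (@support a (fun x q => dec R x q)) as (S & h1 & h2 & h3); auto.
  { unfold dec, neg; dfn. }
  exists S; repeat split; auto. intros x p hx hp. apply h3; auto. apply dec_dense. apply in_FS in hp; tauto.
Qed.
Lemma supports_mono S S' a a' R : nrep a' R -> S ⊆ S' -> supports S a R -> supports S' a R.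
Proof.
  intros nR h hS x p hx hp. assert (hpP := proj1 (proj1 (in_FS _ _) hp)).
  destruct (hS x (rs p S) hx (rs_FS S hpP)) as (q & hq & pq & d).
  assert (c := amalg hpP hq pq). exists (cup p q). split; [|split; [apply sub_cup_l|]].
  - apply FS_intro; auto. intros d' n i hz; apply in_cup in hz as [hz|hz]; [eapply FS_el; eauto|].
    apply h; eapply FS_el; eauto.
  - eapply dec_mono; eauto. apply sub_cup_r.
Qed.

Variable w1 : M.
Hypothesis N1 : is_next_cardinal mem om w1.
(** This is the preservation of the first uncountable cardinal. Each value of the partial function
    is forced by a condition on a countable support S that is compatible with p0, and together with
    p0 such a condition forces at most one value for x. So only countably many values occur. *)
Lemma w1_bounded (A : N) c : enum c ->
  (forall x b b', x ∈ c -> b ∈ w1 -> b' ∈ w1 -> j (pr x b) ∈ A -> j (pr x b') ∈ A -> b = b') ->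
  exists b, b ∈ w1 /\ forall x b', x ∈ c -> b' ∈ w1 -> j (pr x b') ∈ A -> b' ∈ b.
Proof.
  intros ec fA. destruct (reps A (prod c w1)) as [R hR]. assert (hR' := hR). destruct hR' as [nR tR].
  (* Functionality holds in N, so a condition p0 of G has no extension forcing two values at one
     place. *)
  destruct (gen GG (A := fun t => exists x b b', x ∈ c /\ b ∈ w1 /\ b' ∈ w1 /\ b <> b' /\ pr (pr x b) t ∈ R /\ pr (pr x b') t ∈ R))
    as [(t & ht & x & b & b' & hx & hb & hb' & ne & h1 & h2)|(p0 & hp0 & no)].
  { dfn. }
  { exfalso; apply ne. apply fA with x; auto; apply tR; rewrite ?pr_prod; eauto. }
  destruct (@support c (fun x q => exists b, b ∈ w1 /\ pr (pr x b) q ∈ R)) as (S & _ & eS & hS); auto.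
  { dfn. }
  assert (uniq : forall x b b' t, x ∈ c -> b ∈ w1 -> b' ∈ w1 -> t ∈ Pos -> p0 ⊆ t -> pr (pr x b) t ∈ R -> pr (pr x b') t ∈ R -> b = b').
  { intros x b b' t hx hb hb' ht h h1 h2. apply NNPP; intros ne. apply (no t ht h). exists x, b, b'; auto 7. }
  pose (W := sep w1 (fun b => exists z, z ∈ prod c (FS S) /\ exists x q, z = pr x q /\ cup q p0 ∈ Pos /\ pr (pr x b) q ∈ R)).
  assert (DW : D1 (fun b => exists z, z ∈ prod c (FS S) /\ exists x q, z = pr x q /\ cup q p0 ∈ Pos /\ pr (pr x b) q ∈ R)) by dfn.
  assert (eW : enum W).
  { apply enum_rel with (A := prod c (FS S)) (R := fun z b => exists x q, x ∈ c /\ z = pr x q /\ cup q p0 ∈ Pos /\ pr (pr x b) q ∈ R).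
    - dfn.
    - apply enum_prod; auto. apply enum_FS; auto.
    - intros b hb; unfold W in hb; rewrite in_sep in hb by auto. destruct hb as (hb & z & hz & x & q & -> & h1 & h2).
      exists (pr x q); split; auto. apply pr_prod in hz as [hx _]. eauto 6.
    - intros z b b' hb hb' (x & q & hx & -> & h1 & h2) (x' & q' & hx' & e & h1' & h2').
      apply pr_inj in e as [<- <-]. unfold W in hb, hb'; rewrite in_sep in hb, hb' by auto.
      apply uniq with x (cup q p0); try tauto; [apply sub_cup_r| |]; apply (proj1 (proj2 nR)) with q; auto; apply sub_cup_l. }
  assert (Ww : W ⊆ w1) by (intros b hb; unfold W in hb; rewrite in_sep in hb by auto; tauto).
  assert (sw := w1_sup WO N1 Ww eW). exists (succ (un W)). split; [apply (w1_succ WO N1); auto|].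
  intros x b hx hb hA. apply tR in hA as (p & hp & h); [|apply pr_prod; auto].
  destruct (G_dir GG hp hp0) as (p' & hp' & k1 & k2). assert (hP := G_pos GG hp').
  assert (h' : pr (pr x b) p' ∈ R) by (apply (proj1 (proj2 nR)) with p; auto).
  destruct (hS x (rs p' S) hx (rs_FS S hP)) as (q & hq & pq & b' & hb' & hR').
  { exists p'; split; [auto|split; [apply rs_sub|eauto]]. }
  assert (cc := amalg hP hq pq).
  assert (e : b = b').
  { apply uniq with x (cup p' q); auto. eapply sub_trans; [exact k2|apply sub_cup_l].
    apply (proj1 (proj2 nR)) with p'; auto; apply sub_cup_l. apply (proj1 (proj2 nR)) with q; auto; apply sub_cup_r. }
  subst b'. assert (bW : b ∈ W).
  { unfold W; rewrite in_sep by auto. split; auto. exists (pr x q). rewrite pr_prod. split; auto. exists x, q. repeat split; auto.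
    apply Pos_sub with (cup p' q); auto. intros z hz; apply in_cup. apply in_cup in hz as [hz|hz]; auto. }
  apply in_succ. destruct (ord_trich (ord_in_w1 N1 hb) (ord_in_w1 N1 sw)) as [k|[k|k]]; auto.
  exfalso. apply (@mem_irr M (un W)). apply in_un; eauto.
Qed.
End Cohen.

(** * A Cohen real defeating uncountably many points *)

Section Core.
Context {M : zermelo}.
Hypothesis WO : forall u : M, exists w, wo w u.
Implicit Types x y z w u a b c d f p q r s t S R : M.
Variables w1 w2 : M.
Hypothesis N1 : is_next_cardinal mem om w1.
Hypothesis N2 : is_next_cardinal mem w1 w2.
Notation Pos := (Pos w2).
Notation FS := (FS w2).
Variable G : M -> Prop.
Hypothesis GG : generic Pos G.
Variable N : zermelo.
Variable j : M -> N.
Hypothesis j_in : forall (z : N) x, z ∈ j x <-> exists c, c ∈ x /\ z = j c.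
Hypothesis j_inj : forall x y, j x = j y -> x = y.
Hypothesis reps : forall (A : N) a, exists R, is_rep w2 G j A a R.
Variable Gam : N.
Hypothesis Gam_in : forall z : N, z ∈ Gam <-> exists p, G p /\ z = j p.

Lemma j_mem x y : j x ∈ j y <-> x ∈ y.
Proof. rewrite j_in; split; [|eauto]. intros (c & hc & e); apply j_inj in e; subst; auto. Qed.
Lemma j_upair x y : j (upair x y) = upair (j x) (j y).
Proof.
  apply mem_ext; intros z; rewrite j_in, in_upair. split.
  - intros (c & hc & ->). apply in_upair in hc as [->| ->]; auto.
  - intros [->| ->]; [exists x|exists y]; rewrite in_upair; auto.
Qed.
Lemma j_pr x y : j (pr x y) = pr (j x) (j y).
Proof. unfold pr; rewrite !j_upair; auto. Qed.

Lemma G_all (X : Type) (L : list X) (P : X -> M -> Prop) :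
  (forall v : X, In v L -> exists p, G p /\ forall q, q ∈ Pos -> p ⊆ q -> P v q) -> exists s, G s /\ forall v : X, In v L -> P v s.
Proof.
  intros h. assert (H : exists s, G s /\ forall v : X, In v L -> forall q, q ∈ Pos -> s ⊆ q -> P v q).
  { induction L as [|x L IH]; [exists emp; split; [apply (G_emp GG)|intros x []]|].
    destruct IH as (s & hs & H); [intros y hy; apply h; right; auto|]. destruct (h x) as (p & hp & H'); [left; auto|].
    destruct (G_dir GG hs hp) as (r & hr & sr & pr_). exists r; split; auto. intros y [<-|hy] q hq rq.
    apply H'; auto; eapply sub_trans; eauto. apply H; auto; eapply sub_trans; eauto. }
  destruct H as (s & hs & H); exists s; split; auto. intros x hx; apply H; auto. apply (G_pos GG hs). apply sub_refl.
Qed.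

(* [first_bit d q n i m]: the condition q decides that m is the first position
   of a 1 in the row (n, i) of the Cohen real d. *)
Definition first_bit d q n i m := pr (pr d (code n (code i m))) (nm 1) ∈ q /\
  forall m', m' ∈ m -> pr (pr d (code n (code i m'))) emp ∈ q.
(** At some n beyond n0, q decides that the sets selected by row n are pairwise disjoint and that
    the point with index a lies in the chosen one. RI codes the choice: i is the first index it
    accepts, with K as default when all smaller indices are refuted. *)
Definition bad d RA RK RD RI q a n0 := exists n K m, n ∈ om /\ K ∈ om /\ n0 ⊆ n /\ pr (pr n K) q ∈ RK /\
  (forall i, i ∈ succ K -> ap m i ∈ om /\ first_bit d q n i (ap m i)) /\
  (forall i i', i ∈ succ K -> i' ∈ succ K -> i <> i' -> pr (pr (ap m i) (ap m i')) q ∈ RD) /\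
  exists i, i ∈ succ K /\ (pr (pr n i) q ∈ RI \/ i = K) /\ (forall i', i' ∈ i -> neg w2 RI (pr n i') q) /\
    pr (pr a (ap m i)) q ∈ RA.

Variables RA RK RD : M.
Hypothesis nRA : nrep w2 (prod w1 om) RA.
Hypothesis nRK : nrep w2 (prod om om) RK.
Hypothesis nRD : nrep w2 (prod om om) RD.
Definition holds R x := exists p, G p /\ pr x p ∈ R.
Hypothesis totK : forall n, exists K, holds RK (pr (nm n) (nm K)).
Hypothesis separated : forall K (al : nat -> M), (forall i, i <= K -> al i ∈ w1) ->
  (forall i i', i <= K -> i' <= K -> al i = al i' -> i = i') ->
  exists m : nat -> nat, (forall i, i <= K -> holds RA (pr (al i) (nm (m i)))) /\
    forall i i', i <= K -> i' <= K -> i <> i' -> holds RD (pr (nm (m i)) (nm (m i'))).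

Definition base S a := supports w2 S (prod (sing a) om) RA /\ supports w2 S (prod om om) RK /\ supports w2 S (prod om om) RD.
Lemma base_ex a : exists S, S ⊆ w2 /\ enum S /\ base S a.
Proof.
  assert (e2 : enum (prod (@om M) om)) by (apply enum_prod; apply enum_om).
  destruct (@supports_ex _ WO w2 (prod (sing a) om) RA) as (S1 & h1 & e1 & s1).
  { apply enum_prod; [|apply enum_om]. apply enum_fin; exists (a :: nil); intros z; rewrite in_sing; simpl; intuition congruence. }
  destruct (@supports_ex _ WO w2 (prod om om) RK) as (S2 & h2 & e2' & s2); auto.
  destruct (@supports_ex _ WO w2 (prod om om) RD) as (S3 & h3 & e3 & s3); auto.
  exists (cup S1 (cup S2 S3)). split; [|split; [|split; [|split]]].
  - intros z hz; rewrite !in_cup in hz; destruct hz as [hz|[hz|hz]]; auto.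
  - repeat apply enum_cup; auto.
  - eapply supports_mono; [exact nRA| |exact s1]. apply sub_cup_l.
  - eapply supports_mono; [exact nRK| |exact s2]. intros z hz; rewrite !in_cup; auto.
  - eapply supports_mono; [exact nRD| |exact s3]. intros z hz; rewrite !in_cup; auto.
Qed.
Lemma bad_mono d RI q q' a n0 : nrep w2 (prod om om) RI -> bad d RA RK RD RI q a n0 -> q' ∈ Pos -> q ⊆ q' -> bad d RA RK RD RI q' a n0.
Proof.
  intros nRI (n & K & m & hn & hK & h1 & h2 & h3 & h4 & i & hi & h5 & h6 & h7) hq qq.
  exists n, K, m. split; [auto|split; [auto|split; [auto|split; [|split; [|split]]]]].
  - apply (proj1 (proj2 nRK)) with q; auto.
  - intros k hk; destruct (h3 k hk) as (g1 & g2 & g3). split; [auto|split; auto].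
  - intros; apply (proj1 (proj2 nRD)) with q; auto.
  - exists i; split; [auto|split; [|split]].
    + destruct h5 as [h5|h5]; [left; apply (proj1 (proj2 nRI)) with q; auto|auto].
    + intros; eapply neg_mono; eauto.
    + apply (proj1 (proj2 nRA)) with q; auto.
Qed.
(** Every clause of [bad] is either about bits of the real d or a decision about RA, RK, RD or RI,
    and the last four are supported by S and C. *)
Lemma bad_restrict d RI q a n0 S C : a ∈ w1 -> q ∈ Pos -> nrep w2 (prod om om) RI -> base S a -> supports w2 C (prod om om) RI ->
  bad d RA RK RD RI q a n0 -> bad d RA RK RD RI (rs q (cup S (cup C (sing d)))) a n0.
Proof.
  intros ha hq nRI (b1 & b2 & b3) sC (n & K & m & hn & hK & h1 & h2 & h3 & h4 & i & hi & h5 & h6 & h7).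
  set (T := cup S (cup C (sing d))).
  assert (ST : S ⊆ T) by (intros z hz; unfold T; rewrite !in_cup; auto).
  assert (CT : C ⊆ T) by (intros z hz; unfold T; rewrite !in_cup; auto).
  assert (dT : d ∈ T) by (unfold T; rewrite !in_cup, in_sing; auto).
  assert (iK : forall i, i ∈ succ K -> i ∈ om).
  { intros k hk. eapply om_trans; [exact hk|]. apply ind_om; auto. }
  exists n, K, m. split; [auto|split; [auto|split; [auto|split; [|split; [|split]]]]].
  - eapply supports_restrict; [exact nRK| |eapply supports_mono; [exact nRK|exact ST|exact b2]| |exact h2]; apply pr_prod; auto.
  - intros k hk; destruct (h3 k hk) as (g1 & g2 & g3). split; [auto|split].
    + apply pr_rs; auto. + intros; apply pr_rs; auto.
  - intros k k' hk hk' ne. eapply supports_restrict; [exact nRD| |eapply supports_mono; [exact nRD|exact ST|exact b3]| |auto];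
      apply pr_prod; split; apply h3; auto.
  - exists i; split; [auto|split; [|split]].
    + destruct h5 as [h5|h5]; [left|auto].
      eapply supports_restrict; [exact nRI| |eapply supports_mono; [exact nRI|exact CT|exact sC]| |exact h5]; apply pr_prod; auto.
    + intros k hk. assert (hk' : pr n k ∈ prod om om) by (apply pr_prod; split; auto; eapply om_trans; eauto).
      eapply neg_restrict; [exact nRI| |eapply supports_mono; [exact nRI|exact CT|exact sC]| | |]; auto.
    + eapply supports_restrict; [exact nRA| |eapply supports_mono; [exact nRA|exact ST|exact b1]| |exact h7]; apply pr_prod.
      split; auto; apply h3; auto. rewrite in_sing; split; auto; apply h3; auto.
Qed.

(** Each point has a countable support, chosen in M, and [w2_not_union] leaves a coordinate outside
    all of them. *)
Lemma free_coordinate : exists d Sf, d ∈ w2 /\ forall a, a ∈ w1 -> d ∉ ap Sf a /\ enum (ap Sf a) /\ base (ap Sf a) a.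
Proof.
  destruct (@choice_fun _ WO w1 (pow w2) (fun a S => countable mem S /\ base S a)) as (f & hf & hR).
  - unfold base, supports, dec, neg. assert (D : D1T FS) by apply D1T_FS. dfn.
  - intros a ha; destruct (base_ex a) as (S & h1 & h2 & h3). exists S; rewrite in_pow, countable_iff; auto.
  - destruct (w2_not_union WO N1 N2 (S := f)) as (d & hd & h).
    + intros a ha; apply countable_iff, hR; auto.
    + exists d, f; split; auto. intros a ha; split; [auto|split; [apply countable_iff|]; apply hR; auto].
Qed.

Lemma unbounded_list (Z : M -> Prop) : (forall b, b ∈ w1 -> exists a, a ∈ w1 /\ Z a /\ a ∉ b) ->
  forall k, exists al : nat -> M, (forall i, i <= k -> al i ∈ w1 /\ Z (al i)) /\
    forall i i', i <= k -> i' <= k -> al i = al i' -> i = i'.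
Proof.
  intros ub. assert (bd : forall l : list M, (forall a, In a l -> a ∈ w1) -> exists b, b ∈ w1 /\ forall a, In a l -> a ∈ b).
  { intros l hl. exists (succ (un (fset l))).
    assert (h : un (fset l) ∈ w1).
    { apply (w1_sup WO N1); [intros z hz; apply hl, in_fset, hz|apply enum_fin, fin_fset]. }
    split; [apply (w1_succ WO N1); auto|]. intros a ha. apply in_succ.
    destruct (ord_trich (ord_in_w1 N1 (hl a ha)) (ord_in_w1 N1 h)) as [k|[k|k]]; auto.
    exfalso; apply (@mem_irr M (un (fset l))), in_un. exists a; rewrite in_fset; auto. }
  induction k as [|k (al & h1 & h2)].
  - destruct (ub emp) as (a & ha & hz & _).
    { destruct (bd nil) as (b & hb & _); [intros a []|]. apply (w1_intro N1).
      intros z hz; destruct (in_emp hz). intros z hz; destruct (in_emp hz). apply enum_fin; exists nil; intros z; split; [apply in_emp|intros []]. }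
    exists (fun _ => a); split; auto. intros i i' h h' _; lia.
  - destruct (bd (map al (seq 0 (S k)))) as (b & hb & hl).
    { intros a ha; apply in_map_iff in ha as (i & <- & hi). apply in_seq in hi. apply h1; lia. }
    destruct (ub b hb) as (a & ha & hz & nab).
    assert (ne : forall i, i <= k -> a <> al i).
    { intros i hi ->. apply nab, hl, in_map_iff. exists i; rewrite in_seq; split; auto; lia. }
    exists (fun i => if Nat.eq_dec i (S k) then a else al i). split.
    + intros i hi. destruct (Nat.eq_dec i (S k)); auto. apply h1; lia.
    + intros i i' hi hi'. destruct (Nat.eq_dec i (S k)) as [q1|q1], (Nat.eq_dec i' (S k)) as [q2|q2]; intros e; try lia.
      * destruct (ne i'); auto; lia.
      * destruct (ne i); auto; lia.
      * apply h2; auto; lia.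
Qed.

Theorem core : exists d, d ∈ w2 /\ forall RI, nrep w2 (prod om om) RI ->
  exists a, a ∈ w1 /\ forall n0, n0 ∈ om -> exists q, G q /\ bad d RA RK RD RI q a n0.
Proof.
  destruct free_coordinate as (d & Sf & hd & hSf). exists d; split; auto. intros RI nRI.
  apply NNPP; intros N0.
  destruct (@supports_ex _ WO w2 (prod om om) RI) as (C & hC & eC & sC); [apply enum_prod; apply enum_om|].
  set (C' := cup C (sing d)).
  assert (eC' : enum C').
  { apply enum_cup; auto. apply enum_fin; exists (d :: nil); intros z; rewrite in_sing; simpl; intuition congruence. }
  pose (nobad p a n0 := forall q, q ∈ Pos -> p ⊆ q -> ~ bad d RA RK RD RI q a n0).
  assert (Dbad : forall a n, D1 (fun q => bad d RA RK RD RI q a n)) by (intros; unfold bad, first_bit, neg; dfn).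
  assert (nob : forall a, a ∈ w1 -> exists n0 p, n0 ∈ om /\ G p /\ nobad p a n0).
  { intros a ha. apply NNPP; intros no. apply N0. exists a; split; auto. intros n0 hn0.
    destruct (gen GG (Dbad a n0)) as [?|(p & hp & h)]; auto. exfalso; apply no; exists n0, p; auto. }
  (* A bad extension of the restricted condition would remain bad after being restricted to the same
     coordinates, and could then be amalgamated with p. *)
  assert (nobT : forall p a n0, p ∈ Pos -> a ∈ w1 -> nobad p a n0 -> nobad (rs p (cup (ap Sf a) C')) a n0).
  { intros p a n0 hp ha h q hq pq hb. destruct (hSf a ha) as (_ & _ & hbase).
    assert (hb' := bad_restrict ha hq nRI hbase sC hb). fold C' in hb'. set (T := cup (ap Sf a) C') in *.
    assert (cc : cup p (rs q T) ∈ Pos).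
    { apply (amalg (S := T)); auto using rs_FS. intros z hz. destruct (Pos_el hp (rs_sub hz)) as (d' & n & i & -> & _).
      apply pr_rs. split; [apply pq; auto|apply pr_rs in hz; tauto]. }
    apply (h _ cc (@sub_cup_l _ _ _)). eapply bad_mono; eauto. apply sub_cup_r. }
  pose (c := prod om (FS C')).
  assert (ec : enum c) by (apply enum_prod; [apply enum_om|apply enum_FS; auto]).
  (* The fibre over (n, r) collects the points that are never bad beyond n by order of a condition
     in G with trace r on the countable set C'. There are countably many pairs (n, r). *)
  pose (Z x a := exists n r p, x = pr n r /\ G p /\ rs p C' = r /\ nobad p a n).
  assert (cov : forall a, a ∈ w1 -> exists x, x ∈ c /\ Z x a).
  { intros a ha; destruct (nob a ha) as (n0 & p & hn & hp & h). exists (pr n0 (rs p C')). split.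
    - apply pr_prod; split; auto. apply rs_FS, (G_pos GG hp).
    - exists n0, (rs p C'), p; auto. }
  (* Some fiber is unbounded in w1, since the least bounds form a map from c to w1. *)
  assert (ub : exists x, x ∈ c /\ forall b, b ∈ w1 -> exists a, a ∈ w1 /\ Z x a /\ a ∉ b).
  { apply NNPP; intros no.
    assert (bdd : forall x, x ∈ c -> exists b, b ∈ w1 /\ forall a, a ∈ w1 -> Z x a -> a ∈ b).
    { intros x hx; apply NNPP; intros no'. apply no; exists x; split; auto. intros b hb.
      apply NNPP; intros no2. apply no'; exists b; split; auto. intros a ha hz; apply NNPP; intros na; apply no2; eauto. }
    (* Z refers to G and need not be a set of M. W lists in M the conditions that witness it, and
       [ZN] evaluates W in N through [Gam], so that least bounds become a function of N. *)
    pose (W := sep (prod (prod c w1) Pos) (fun y => exists n r a p, y = pr (pr (pr n r) a) p /\ rs p C' = r /\ nobad p a n)).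
    assert (DW : D1 (fun y => exists n r a p, y = pr (pr (pr n r) a) p /\ rs p C' = r /\ nobad p a n))
      by (unfold nobad, bad, first_bit, neg, rs; dfn).
    assert (hZ : forall x a, x ∈ c -> a ∈ w1 -> Z x a <-> exists p, G p /\ pr (pr x a) p ∈ W).
    { intros x a hx ha; unfold W; split.
      - intros (n & r & p & -> & hp & e & h). exists p; split; auto. rewrite in_sep, !pr_prod by auto.
        split; [split; [split; auto|apply (G_pos GG hp)]|]. exists n, r, a, p; auto.
      - intros (p & hp & h). rewrite in_sep in h by auto. destruct h as (_ & n & r & a' & p' & e & h1 & h2).
        apply pr_inj in e as [e <-]; apply pr_inj in e as [-> <-]. exists n, r, p; auto. }
    pose (ZN := sep (j (prod c w1)) (fun y : N => exists p : N, p ∈ Gam /\ pr y p ∈ j W)).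
    assert (hZN : forall x a, x ∈ c -> a ∈ w1 -> pr (j x) (j a) ∈ ZN <-> Z x a).
    { intros x a hx ha. unfold ZN. rewrite in_sep by dfn. rewrite <- j_pr, j_mem, pr_prod, hZ by auto. split.
      - intros [_ (p & hp & h)]. apply Gam_in in hp as (p' & hp & ->). rewrite <- j_pr, j_mem in h; eauto.
      - intros (p & hp & h). split; auto. exists (j p). rewrite <- j_pr, j_mem, Gam_in; eauto. }
    pose (bound (x b : N) := forall a : N, a ∈ j w1 -> pr x a ∈ ZN -> a ∈ b).
    assert (hb : forall x b, x ∈ c -> b ∈ w1 -> bound (j x) (j b) <-> forall a, a ∈ w1 -> Z x a -> a ∈ b).
    { intros x b hx hb; split.
      - intros h a ha hz. apply j_mem, h; [apply j_mem; auto|apply hZN; auto].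
      - intros h a' ha hz. apply j_in in ha as (a & ha & ->). apply j_mem, h; auto. apply hZN; auto. }
    pose (A := sep (j (prod c w1)) (fun y : N => exists x b : N, y = pr x b /\ bound x b /\ forall b' : N, b' ∈ b -> ~ bound x b')).
    assert (DA : D1 (fun y : N => exists x b : N, y = pr x b /\ bound x b /\ forall b' : N, b' ∈ b -> ~ bound x b'))
      by (unfold bound; dfn).
    assert (hA : forall x b, x ∈ c -> b ∈ w1 -> j (pr x b) ∈ A <-> bound (j x) (j b) /\ forall b', b' ∈ b -> ~ bound (j x) (j b')).
    { intros x b hx hb'. unfold A; rewrite in_sep, j_mem, pr_prod, j_pr by auto. split.
      - intros [_ (x' & b' & e & h1 & h2)]. apply pr_inj in e as [<- <-]. split; auto. intros b2 h; apply h2, j_mem; auto.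
      - intros [h1 h2]. split; auto. exists (j x), (j b); split; [auto|split; [auto|]].
        intros b2 h. apply j_in in h as (b3 & h & ->); auto. }
    destruct (w1_bounded WO GG reps N1 (A := A) ec) as (b & hbw & hall).
    { intros x b b' hx hbw hbw' h h'. apply hA in h as [h1 h2], h' as [h1' h2']; auto.
      destruct (ord_trich (ord_in_w1 N1 hbw) (ord_in_w1 N1 hbw')) as [k|[k|k]]; auto.
      destruct (h2' b k h1). destruct (h2 b' k h1'). }
    destruct (cov b hbw) as (x & hx & hz). destruct (bdd x hx) as (b0 & hb0 & hb0').
    destruct (@mem_min M (fun b => b ∈ w1 /\ bound (j x) (j b))) as (b1 & [hb1 k1] & k2).
    { exists b0; split; auto. apply hb; auto. }
    assert (h1 : b1 ∈ b).
    { apply (hall x); auto. apply hA; auto. split; auto. intros b' hb' hbo; apply (k2 b' hb'); split; auto.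
      apply (proj1 (ord_w1 N1) b1 hb1 b' hb'). }
    rewrite hb in k1 by auto. apply (mem_asym h1). apply k1; auto. }
  destruct ub as (x & hx & ub). assert (hx' := hx). apply in_prod in hx' as (n0 & r & hn0 & hr & ->).
  apply in_om in hn0 as [k0 ->].
  assert (bnd : exists B, forall (t : nat) (i : M), pr (pr d (nm t)) i ∈ r -> t < B).
  { assert (fr : fin r) by (apply in_FS in hr as [hr _]; apply in_Pos in hr; apply hr).
    destruct fr as [l Hl]. assert (H : exists B, forall (t : nat) (i : M), In (pr (pr d (nm t)) i) l -> t < B).
    { clear. induction l as [|z l [B IH]]; [exists 0; intros t i []|].
      destruct (classic (exists (t : nat) (i : M), z = pr (pr d (nm t)) i)) as [(t & i & e)|no].
      - exists (S (t + B)). intros t' i' [h|h]; [|apply IH in h; lia]. subst z.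
        apply pr_inj in h as [h _]; apply pr_inj in h as [_ h]; apply nm_inj in h; lia.
      - exists B; intros t i [h|h]; [destruct no; eauto|eauto]. }
    destruct H as [B H]; exists B; intros t i h; apply (H t i), Hl, h. }
  (* This n is at least k0, and every position coded from n is at least B, so r contains no bit of
     row n of the real d. *)
  destruct bnd as [B hB]. set (n := k0 + B).
  destruct (totK n) as [K hK].
  destruct (unbounded_list ub K) as (al & hal & dis).
  destruct (@separated K al) as (m & mA & mD); auto. { intros; apply hal; auto. }
  set (L := flat_map (fun i => map (fun i' => (i, i')) (seq 0 (S K))) (seq 0 (S K))).
  assert (inL : forall i i', In (i, i') L <-> i <= K /\ i' <= K).
  { intros i i'; unfold L; rewrite in_flat_map. split.
    - intros (y & hy & h). apply in_map_iff in h as (y' & e & h). injection e as <- <-. rewrite in_seq in *; lia.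
    - intros [h h']. exists i; rewrite in_seq; split; [lia|]. apply in_map_iff; exists i'; rewrite in_seq; split; auto; lia. }
  (* A single condition of G carries all decisions about the finitely many points and extends a
     prohibiting condition for each of them. *)
  destruct (@G_all (nat * nat) L (fun ii s => let (i, i') := ii in
      pr (pr (nm n) (nm K)) s ∈ RK /\ pr (pr (al i) (nm (m i))) s ∈ RA /\
      (i <> i' -> pr (pr (nm (m i)) (nm (m i'))) s ∈ RD) /\
      exists p, p ⊆ s /\ p ∈ Pos /\ rs p C' = r /\ nobad p (al i) (nm k0))) as (s & hs & hL).
  { intros [i i'] hii. apply inL in hii as [hi hi']. destruct hK as (q1 & g1 & h1). destruct (mA i hi) as (q2 & g2 & h2).
    destruct (hal i hi) as (_ & n' & r' & q3 & e & g3 & h3 & h4). apply pr_inj in e as [<- <-].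
    assert (H : exists q4, G q4 /\ (i <> i' -> pr (pr (nm (m i)) (nm (m i'))) q4 ∈ RD)).
    { destruct (Nat.eq_dec i i') as [e|e]; [exists q1; split; auto; tauto|]. destruct (mD i i' hi hi' e) as (q4 & ? & ?); eauto. }
    destruct H as (q4 & g4 & h5). destruct (G_dir GG g1 g2) as (q5 & g5 & k1 & k2). destruct (G_dir GG g3 g4) as (q6 & g6 & k3 & k4).
    destruct (G_dir GG g5 g6) as (q7 & g7 & k5 & k6). exists q7; split; auto. intros q hq k7.
    assert (up : forall a R y p, nrep w2 a R -> pr y p ∈ R -> p ⊆ q -> pr y q ∈ R).
    { intros a R y p nR h k; apply (proj1 (proj2 nR)) with p; auto. }
    split; [|split; [|split]].
    - apply (up _ _ _ _ nRK h1). repeat (eapply sub_trans; [eassumption|]); apply sub_refl.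
    - apply (up _ _ _ _ nRA h2). repeat (eapply sub_trans; [eassumption|]); apply sub_refl.
    - intros ne; apply (up _ _ _ _ nRD (h5 ne)). repeat (eapply sub_trans; [eassumption|]); apply sub_refl.
    - exists q3; split; [|split; [apply (G_pos GG g3)|auto]]. repeat (eapply sub_trans; [eassumption|]); apply sub_refl. }
  set (SS := un (fset (map (fun i => ap Sf (al i)) (seq 0 (S K))))).
  assert (inSS : forall i, i <= K -> ap Sf (al i) ⊆ SS).
  { intros i hi z hz; unfold SS; apply in_un. exists (ap Sf (al i)); split; auto.
    apply in_fset, in_map_iff. exists i; rewrite in_seq; split; auto; lia. }
  assert (dSS : d ∉ SS).
  { intros h; apply in_un in h as (y & hy & h). apply in_fset, in_map_iff in hy as (i & <- & hi). apply in_seq in hi.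
    apply (hSf (al i)) in h; auto. apply hal; lia. }
  assert (sP := G_pos GG hs).
  assert (rsub : r ⊆ s).
  { destruct (hL (0, 0)) as (_ & _ & _ & p & h1 & _ & <- & _). apply inL; lia. eapply sub_trans; [apply rs_sub|auto]. }
  (* Of s only the part on the supports of the points is kept, together with r. Since d is outside
     SS, the real d is then free apart from the finitely many bits in r. *)
  set (t0 := cup (rs s SS) r).
  assert (t0P : t0 ∈ Pos).
  { apply Pos_sub with s; auto. intros z hz; apply in_cup in hz as [hz|hz]; auto. apply (rs_sub hz). }
  (* The bits to be written: zeros and then a one, so that row (n, i) selects exactly the set m i
     around the i-th point. *)
  pose (bit (z : M) := exists i m', i <= K /\ m' <= m i /\
    z = pr (pr d (code (nm n) (code (nm i) (nm m')))) (nm (if Nat.eq_dec m' (m i) then 1 else 0))).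
  assert (nbit : exists nb, forall z, z ∈ nb <-> bit z).
  { exists (fset (flat_map (fun i => map (fun m' => pr (pr d (code (nm n) (code (nm i) (nm m'))))
       (nm (if Nat.eq_dec m' (m i) then 1 else 0))) (seq 0 (S (m i)))) (seq 0 (S K)))).
    intros z; rewrite in_fset, in_flat_map. split.
    - intros (i & hi & h). apply in_map_iff in h as (m' & <- & h). rewrite in_seq in *. exists i, m'; repeat split; lia.
    - intros (i & m' & hi & hm & ->). exists i; rewrite in_seq; split; [lia|]. apply in_map_iff. exists m'; rewrite in_seq; split; auto; lia. }
  destruct nbit as [nb hnb].
  assert (cn : forall i m', code (nm n) (code (nm i) (nm m')) = nm (cpair n (cpair i m'))) by (intros; rewrite !code_nm; auto).
  assert (nbP : nb ∈ Pos).
  { apply in_Pos; split; [|split].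
    - eapply fin_sub; [|apply fin_fset with (l := flat_map (fun i => map (fun m' => pr (pr d (code (nm n) (code (nm i) (nm m'))))
       (nm (if Nat.eq_dec m' (m i) then 1 else 0))) (seq 0 (S (m i)))) (seq 0 (S K)))].
      intros z hz; apply hnb in hz as (i & m' & hi & hm & ->). apply in_fset, in_flat_map. exists i; rewrite in_seq; split; [lia|].
      apply in_map_iff. exists m'; rewrite in_seq; split; auto; lia.
    - intros z hz; apply hnb in hz as (i & m' & hi & hm & ->). rewrite cn, !pr_prod. repeat split; auto using nm_om.
      destruct (Nat.eq_dec m' (m i)); apply nm_lt; lia.
    - intros y i i' h h'. apply hnb in h as (a & b & h1 & h2 & e), h' as (a' & b' & h1' & h2' & e').
      apply pr_inj in e as [-> ->], e' as [e ->]. apply pr_inj in e as [_ e]. rewrite !cn in e.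
      apply nm_inj, cpair_inj in e as [_ e]; apply cpair_inj in e as [-> ->]; auto. }
  set (t1 := cup t0 nb).
  assert (t1P : t1 ∈ Pos).
  { apply Pos_cup; auto. intros y i i' h h'. apply hnb in h' as (a & b & h1 & h2 & e). apply pr_inj in e as [-> _].
    exfalso. apply in_cup in h as [h|h]; [apply pr_rs in h; tauto|]. rewrite cn in h. apply hB in h. unfold n, cpair in h. nia. }
  assert (s1 : rs s SS ⊆ t1) by (intros z hz; unfold t1, t0; rewrite !in_cup; auto).
  (* The choice may depend on the new bits, so it is decided only after they are written. Whichever
     index it takes, a point has already been placed in that set. *)
  assert (t2 : forall k, k <= K -> exists t, t ∈ Pos /\ t1 ⊆ t /\ forall i, i <= k -> dec w2 RI (pr (nm n) (nm i)) t).
  { induction k as [|k IH]; intros hk.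
    - destruct (dec_dense RI (pr (nm n) (nm 0)) t1P) as (t & h1 & h2 & h3). exists t; repeat split; auto.
      intros i hi; replace i with 0 by lia; auto.
    - destruct IH as (t & h1 & h2 & h3); [lia|]. destruct (dec_dense RI (pr (nm n) (nm (S k))) h1) as (t' & h4 & h5 & h6).
      exists t'; split; [auto|split; [eapply sub_trans; eauto|]]. intros i hi.
      destruct (Nat.eq_dec i (S k)) as [->|]; auto. eapply dec_mono; eauto. apply h3; lia. }
  destruct (t2 K (Nat.le_refl K)) as (t & tP & t1t & hdec).
  assert (least : exists i, i <= K /\ (pr (pr (nm n) (nm i)) t ∈ RI \/ i = K) /\ forall i', i' < i -> neg w2 RI (pr (nm n) (nm i')) t).
  { assert (H : forall k, k <= K -> (exists i, i < k /\ pr (pr (nm n) (nm i)) t ∈ RI /\ forall i', i' < i -> neg w2 RI (pr (nm n) (nm i')) t)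
        \/ forall i', i' < k -> neg w2 RI (pr (nm n) (nm i')) t).
    { induction k as [|k IH]; intros hk; [right; intros; lia|]. destruct IH as [(i & h1 & h2)|h]; [lia|left; exists i; split; auto; lia|].
      destruct (hdec k) as [g|g]; [lia|left; exists k; auto|right]. intros i' hi. destruct (Nat.eq_dec i' k) as [->|]; auto. apply h; lia. }
    destruct (H K (Nat.le_refl K)) as [(i & h1 & h2 & h3)|h]; [exists i; split; [lia|auto]|exists K; auto]. }
  destruct least as (i0 & hi0 & hI & hneg).
  destruct (hL (i0, 0)) as (_ & _ & _ & p & ps & pP & er & nb0); [apply inL; lia|].
  destruct (hal i0 hi0) as [hai _].
  (* The trace of p on C' is r, and its part on the support of the chosen point lies in s; hence t
     extends the restricted p. It remains to see that t is bad for this point, against the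
     prohibition. *)
  apply (nobT p (al i0) (nm k0) pP hai nb0 t tP).
  { eapply sub_trans; [|exact t1t]. intros z hz. destruct (Pos_el pP (rs_sub hz)) as (d' & n' & i & -> & _).
    apply pr_rs in hz as [hz hd']. unfold t1, t0. rewrite !in_cup. left. apply in_cup in hd' as [hd'|hd'].
    - left; apply pr_rs; split; [apply ps; auto|]. apply (inSS i0 hi0); auto.
    - right; rewrite <- er; apply pr_rs; auto. }
  destruct (@fin_seq M (fun i => nm (m i)) (S K)) as [mm hmm].
  assert (restr : forall a' a R y, nrep w2 a' R -> y ∈ a' -> y ∈ a -> (exists i, i <= K /\ supports w2 (ap Sf (al i)) a R) ->
    pr y s ∈ R -> pr y t ∈ R).
  { intros a' a R y nR hy' hy (i & hi & hsup) h. apply (proj1 (proj2 nR)) with (rs s SS); auto; [|eapply sub_trans; eauto].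
    eapply supports_restrict; [exact nR|exact hy'|eapply supports_mono; [exact nR|apply (inSS i hi)|exact hsup]|exact hy|exact h]. }
  assert (hb0 : forall i, i <= K -> base (ap Sf (al i)) (al i)) by (intros i hi; apply hSf, hal; auto).
  exists (nm n), (nm K), mm. split; [apply nm_om|split; [apply nm_om|split; [|split; [|split; [|split]]]]].
  - intros z hz. apply in_nm in hz as (k & hk & ->). apply nm_lt. unfold n; lia.
  - apply (restr (prod om om) (prod om om)); rewrite ?pr_prod; auto using nm_om.
    + exists 0; split; [lia|]. apply (hb0 0); lia.
    + apply (hL (0, 0)). apply inL; lia.
  - intros i hi. apply (in_nm i (S K)) in hi as (k & hk & ->). rewrite hmm by auto. split; [apply nm_om|].
    split.
    + apply t1t. unfold t1. apply in_cup; right. apply hnb. exists k, (m k). destruct (Nat.eq_dec (m k) (m k)); [|lia].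
      repeat split; auto; lia.
    + intros m' hm'. apply in_nm in hm' as (e & he & ->). apply t1t. unfold t1. apply in_cup; right. apply hnb. exists k, e.
      destruct (Nat.eq_dec e (m k)); [lia|]. repeat split; auto; lia.
  - intros i i' hi hi' ne. apply (in_nm i (S K)) in hi as (k & hk & ->). apply (in_nm i' (S K)) in hi' as (k' & hk' & ->).
    rewrite !hmm by auto. apply (restr (prod om om) (prod om om)); rewrite ?pr_prod; auto using nm_om.
    + exists 0; split; [lia|]. apply (hb0 0); lia.
    + apply (hL (k, k')). apply inL; lia. congruence.
  - exists (nm i0). split; [apply (nm_lt (n := S K)); lia|split; [|split]].
    + destruct hI as [hI| ->]; auto.
    + intros i hi. apply in_nm in hi as (k & hk & ->). auto.
    + rewrite hmm by lia. apply (restr (prod w1 om) (prod (sing (al i0)) om)); rewrite ?pr_prod, ?in_sing; auto using nm_om.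
      * exists i0; split; auto. apply (hb0 i0 hi0).
      * apply (hL (i0, 0)). apply inL; lia.
Qed.
End Core.

(** * Closed sets separating points *)

Section OrderedField.
Variables (T : Type) (O I : T) (pl mu : T -> T -> T) (ng : T -> T) (le : T -> T -> Prop).
Hypothesis rt : ring_theory O I pl mu (fun x y => pl x (ng y)) ng eq.
Add Ring Tring : rt.
Notation "x + y" := (pl x y). Notation "x * y" := (mu x y). Notation "- x" := (ng x).
Notation "x <= y" := (le x y).
Hypothesis le_anti : forall x y, x <= y -> y <= x -> x = y.
Hypothesis le_tr : forall x y z, x <= y -> y <= z -> x <= z.
Hypothesis le_tot : forall x y, x <= y \/ y <= x.
Hypothesis le_pl : forall x y z, x <= y -> x + z <= y + z.
Hypothesis le_mu : forall x y, O <= x -> O <= y -> O <= x * y.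
Hypothesis inv_ex : forall x, x <> O -> exists y, x * y = I.
Hypothesis IO : I <> O.
Notation "x < y" := (~ y <= x).

Lemma le_sub x y : x <= y <-> O <= y + - x.
Proof.
  split; intros h.
  - apply (@le_pl _ _ (- x)) in h. replace (x + - x) with O in h by ring. auto.
  - apply (@le_pl _ _ x) in h. replace (O + x) with x in h by ring. replace (y + - x + x) with y in h by ring. auto.
Qed.
Lemma le_sub1 x y : x <= y -> O <= y + - x. Proof. apply le_sub. Qed.
Lemma le_sub2 x y : O <= y + - x -> x <= y. Proof. apply le_sub. Qed.
Lemma le_refl' x : x <= x. Proof. destruct (le_tot x x); auto. Qed.
Lemma lt_le x y : x < y -> x <= y. Proof. destruct (le_tot x y); tauto. Qed.
Lemma lt_le_tr x y z : x < y -> y <= z -> x < z.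
Proof. intros h h' n. apply h. eapply le_tr; eauto. Qed.
Lemma le_lt_tr x y z : x <= y -> y < z -> x < z.
Proof. intros h h' n. apply h'. eapply le_tr; eauto. Qed.
Lemma le_add2 x y z t : x <= y -> z <= t -> x + z <= y + t.
Proof.
  intros h h'. apply le_tr with (y + z); auto. replace (y + z) with (z + y) by ring. replace (y + t) with (t + y) by ring. auto.
Qed.
Lemma O_le_I : O <= I.
Proof.
  destruct (le_tot O I) as [h|h]; auto. apply (@le_pl _ _ (- I)) in h.
  replace (I + - I) with O in h by ring. replace (O + - I) with (- I) in h by ring.
  replace I with (- I * - I) by ring. auto.
Qed.
Lemma O_lt_I : O < I.
Proof. intros h; apply IO, le_anti; auto using O_le_I. Qed.
Lemma lt_succ x : x < x + I.
Proof.
  intros h. apply O_lt_I. apply (@le_pl _ _ (- x)) in h.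
  replace (x + I + - x) with I in h by ring. replace (x + - x) with O in h by ring. auto.
Qed.
Lemma pred_lt x : x + - I < x.
Proof. intros h. apply (@lt_succ (x + - I)). replace (x + - I + I) with x by ring. auto. Qed.
Lemma mu_pos_cancel n x : O < n -> O < n * x -> O < x.
Proof.
  intros h h' k. apply h'. apply le_sub2. replace (O + - (n * x)) with (n * (O + - x)) by ring.
  apply le_mu; [apply lt_le; auto|apply le_sub1 in k; auto].
Qed.

Fixpoint nT (n : nat) : T := match n with 0 => O | S n => nT n + I end.
Hypothesis arch : forall x, exists n, x <= nT n.
(** The element r is the fraction (a - b) / (c + 1), stated by an equation without division so that
    it can be copied inside the model. *)
Lemma dense x y : x < y -> exists a b c r, r * (nT c + I) + nT b = nT a /\ x < r /\ r < y.
Proof.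
  intros xy. set (e := y + - x).
  assert (e0 : O <= e) by (apply le_sub1, lt_le; auto).
  assert (ne : e <> O). { intros h; apply xy. replace y with (e + x) by (unfold e; ring). rewrite h. replace (O + x) with x by ring. apply le_refl'. }
  destruct (inv_ex ne) as [i hi].
  assert (hi0 : O <= i).
  { destruct (le_tot O i) as [h|h]; auto. apply le_sub1 in h. exfalso. apply O_lt_I. apply le_sub2.
    replace (O + - I) with (e * (O + - i)) by (rewrite <- hi; ring). auto. }
  (* Since c is at least the inverse of e, the multiple n e with n = c + 1 exceeds one, and the
     interval from n x to n y contains an integer in its interior. *)
  destruct (arch i) as [c hc]. set (n := nT c + I).
  assert (h1 : I <= nT c * e).
  { apply le_sub2. replace (nT c * e + - I) with ((nT c + - i) * e) by (rewrite <- hi; ring).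
    apply le_mu; auto. apply le_sub1; auto. }
  assert (n1 : I <= n).
  { unfold n. apply le_tr with (O + I); [replace (O + I) with I by ring; apply le_refl'|]. apply le_pl. eapply le_tr; eauto. }
  assert (n0 : O < n) by (eapply lt_le_tr; [apply O_lt_I|auto]).
  assert (nn : n <> O) by (intros h; apply n0; rewrite h; apply le_refl').
  assert (h2 : I < n * e).
  { intros h. apply ne. apply le_anti; auto. apply le_sub2.
    assert (k : O <= I + - (n * e)) by (apply le_sub1; auto).
    assert (k' : O <= nT c * e + - I) by (apply le_sub1; auto).
    assert (k2 := le_add2 k k'). replace (O + O) with O in k2 by ring.
    replace (O + - e) with (I + - (n * e) + (nT c * e + - I)) by (unfold n; ring). auto. }
  destruct (inv_ex nn) as [ni hni].
  (* The natural number b shifts n x to a nonnegative z, so that the next integer can be found by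
     counting up from zero. *)
  destruct (arch (- (n * x))) as [b hb]. set (z := n * x + nT b).
  assert (z0 : O <= z). { apply le_sub1 in hb. replace z with (nT b + - - (n * x)) by (unfold z; ring). auto. }
  assert (ha : exists a, z < nT (S a) /\ nT a <= z).
  { destruct (arch z) as [a0 h0]. assert (h : z < nT (S a0)) by (simpl; eapply le_lt_tr; [eauto|apply lt_succ]).
    clear h0. induction a0 as [|a0 IH]; [exists 0; split; auto|].
    destruct (classic (z < nT (S a0))) as [k|k]; [auto|exists (S a0); split; auto]. apply NNPP; auto. }
  destruct ha as (a & ha1 & ha2). exists (S a), b, c, ((nT (S a) + - nT b) * ni).
  assert (er : (nT (S a) + - nT b) * ni * n + nT b = nT (S a)).
  { replace ((nT (S a) + - nT b) * ni * n) with ((nT (S a) + - nT b) * (n * ni)) by ring. rewrite hni; ring. }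
  split; [exact er|]. set (r := (nT (S a) + - nT b) * ni) in *.
  assert (pos : forall u, O < u + - x -> x < u).
  { intros u h h'. apply h. apply (@le_pl _ _ (- x)) in h'. replace (x + - x) with O in h' by ring; auto. }
  assert (pos' : forall u, O < y + - u -> u < y).
  { intros u h h'. apply h. apply (@le_pl _ _ (- u)) in h'. replace (u + - u) with O in h' by ring; auto. }
  split.
  - apply pos. apply (@mu_pos_cancel n); auto. intros h. apply ha1. apply le_sub2.
    apply le_sub1 in h. replace (z + - nT (S a)) with (O + - (n * (r + - x))) by (unfold z; rewrite <- er; ring). auto.
  - apply pos'. apply (@mu_pos_cancel n); auto. intros h. apply h2.
    apply le_sub1 in h. apply le_sub1 in ha2. apply le_sub2.
    assert (k := le_add2 h ha2). replace (O + O) with O in k by ring.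
    replace (I + - (n * e)) with (O + - (n * (y + - r)) + (z + - nT a)); auto.
    unfold z, e. replace (n * (y + - r)) with (n * y + - (r * n + nT b) + nT b) by ring. rewrite er. simpl. ring.
Qed.

Lemma nT_succ_neq c : nT c + I <> O.
Proof.
  assert (h : O <= nT c).
  { induction c; simpl; [apply le_refl'|]. eapply le_tr; [exact IHc|apply lt_le, lt_succ]. }
  intros e. apply (@lt_succ (nT c)). rewrite e; auto.
Qed.
Lemma quot_unique r r' a b c : r * (nT c + I) + nT b = a -> r' * (nT c + I) + nT b = a -> r = r'.
Proof.
  intros h h'. destruct (inv_ex (nT_succ_neq (c := c))) as [i hi].
  replace r with ((r * (nT c + I) + nT b + - nT b) * i).
  - rewrite h, <- h'. replace ((r' * (nT c + I) + nT b + - nT b) * i) with (r' * ((nT c + I) * i)) by ring. rewrite hi; ring.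
  - replace ((r * (nT c + I) + nT b + - nT b) * i) with (r * ((nT c + I) * i)) by ring. rewrite hi; ring.
Qed.

Variable D : nat -> T.
Hypothesis dense_D : forall x y, x < y -> exists n, x < D n /\ D n < y.
Lemma D_below (l : list T) x : (forall y, In y l -> y < x) -> exists p, D p < x /\ forall y, In y l -> y < D p.
Proof.
  induction l as [|z l IH]; intros h.
  - destruct (dense_D (pred_lt (x := x))) as (n & _ & hn). exists n; split; auto.
  - destruct IH as (p & hp & hl); [intros; apply h; right; auto|].
    assert (hz : z < x) by (apply h; left; auto).
    destruct (le_tot z (D p)) as [k|k].
    + destruct (dense_D hp) as (n & h1 & h2). exists n; split; auto. intros y [<-|hy]; [eapply le_lt_tr; eauto|].
      eapply lt_le_tr; [apply hl; auto|apply lt_le; auto].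
    + destruct (dense_D hz) as (n & h1 & h2). exists n; split; auto. intros y [<-|hy]; auto.
      eapply lt_le_tr; [apply hl; auto|]. apply lt_le. eapply le_lt_tr; eauto.
Qed.
Lemma D_above (l : list T) x : (forall y, In y l -> x < y) -> exists p, x < D p /\ forall y, In y l -> D p < y.
Proof.
  induction l as [|z l IH]; intros h.
  - destruct (dense_D (lt_succ (x := x))) as (n & hn & _). exists n; split; auto.
  - destruct IH as (p & hp & hl); [intros; apply h; right; auto|].
    assert (hz : x < z) by (apply h; left; auto).
    destruct (le_tot (D p) z) as [k|k].
    + destruct (dense_D hp) as (n & h1 & h2). exists n; split; auto. intros y [<-|hy]; [eapply lt_le_tr; eauto|].
      eapply lt_le_tr; [apply h2|apply lt_le; auto].
    + destruct (dense_D hz) as (n & h1 & h2). exists n; split; auto. intros y [<-|hy]; auto.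
      eapply lt_le_tr; [apply h2|]. eapply le_tr; [exact k|apply lt_le; auto].
Qed.
(** A separator from D is fixed between any two of the points, and the endpoints for a point are
    then chosen closer to it than all its separators. *)
Lemma separating_intervals K (al : nat -> T) :
  (forall i i', (i <= K)%nat -> (i' <= K)%nat -> al i = al i' -> i = i') ->
  exists p q : nat -> nat, (forall i, (i <= K)%nat -> D (p i) <= al i /\ al i <= D (q i)) /\
    forall i i' x, (i <= K)%nat -> (i' <= K)%nat -> i <> i' ->
      D (p i) <= x -> x <= D (q i) -> D (p i') <= x -> x <= D (q i') -> False.
Proof.
  intros inj.
  assert (sx : forall i i', exists n, al i < al i' -> al i < D n /\ D n < al i').
  { intros i i'; destruct (classic (al i < al i')) as [h|h]; [|exists 0; tauto].
    destruct (dense_D h) as [n hn]; eauto. }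
  pose (s i i' := epsilon (inhabits 0) (fun n => al i < al i' -> al i < D n /\ D n < al i')).
  assert (hs : forall i i', al i < al i' -> al i < D (s i i') /\ D (s i i') < al i').
  { intros i i'; exact (epsilon_spec (inhabits 0) (fun n => al i < al i' -> al i < D n /\ D n < al i') (sx i i')). }
  assert (H : forall i, exists pq : nat * nat, (D (fst pq) < al i /\ al i < D (snd pq)) /\
    (forall i', (i' <= K)%nat -> al i' < al i -> D (s i' i) < D (fst pq)) /\
    (forall i', (i' <= K)%nat -> al i < al i' -> D (snd pq) < D (s i i'))).
  { intros i.
    pose (f (b : Prop) := if excluded_middle_informative b then true else false).
    assert (fP : forall b, f b = true <-> b) by (intros b; unfold f; destruct (excluded_middle_informative b); split; auto; discriminate).
    destruct (@D_below (map (fun i' => D (s i' i)) (filter (fun i' => f (al i' < al i)) (seq 0 (S K)))) (al i)) as (p & hp & hl).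
    { intros y hy; apply in_map_iff in hy as (i' & <- & hi). apply filter_In in hi as [_ hi]. apply (proj1 (fP _)) in hi. exact (proj2 (hs _ _ hi)). }
    destruct (@D_above (map (fun i' => D (s i i')) (filter (fun i' => f (al i < al i')) (seq 0 (S K)))) (al i)) as (q & hq & hl').
    { intros y hy; apply in_map_iff in hy as (i' & <- & hi). apply filter_In in hi as [_ hi]. apply (proj1 (fP _)) in hi. exact (proj1 (hs _ _ hi)). }
    exists (p, q); simpl. split; [auto|split].
    - intros i' hi hlt. apply hl, in_map_iff. exists i'; split; auto. apply filter_In; rewrite fP, in_seq; split; auto; lia.
    - intros i' hi hlt. apply hl', in_map_iff. exists i'; split; auto. apply filter_In; rewrite fP, in_seq; split; auto; lia. }
  destruct (fchoice _ H) as [pq hpq].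
  exists (fun i => fst (pq i)), (fun i => snd (pq i)). split.
  - intros i _; destruct (hpq i) as [[h1 h2] _]; split; apply lt_le; auto.
  - assert (W : forall i i' x, (i <= K)%nat -> (i' <= K)%nat -> al i < al i' -> x <= D (snd (pq i)) -> D (fst (pq i')) <= x -> False).
    { intros i i' x hi hi' h h1 h2. destruct (hpq i) as (_ & _ & k1), (hpq i') as (_ & k2 & _).
      apply (k1 i' hi' h). eapply le_tr; [|exact h1]. eapply le_tr; [|exact h2]. apply lt_le; auto. }
    intros i i' x hi hi' ne h1 h2 h3 h4.
    destruct (classic (al i <= al i')) as [h|h]; [|exact (W i' i x hi' hi h h4 h1)].
    apply (W i i' x hi hi'); auto.
Qed.
End OrderedField.

(** * Countably many closed intervals in a complete ordered field of the model *)

Section AbstractReals.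
Context {M : zermelo}.
Implicit Types x y z w u a b c d p f g h A B : M.
Variables R add mul le : M.
Hypothesis RR : is_reals mem R add mul le.
Let T := {x : M | x ∈ R}.
Let mkT (z : M) (h : z ∈ R) : T := exist (fun z => z ∈ R) z h.
Lemma T_eq (x y : T) : proj1_sig x = proj1_sig y -> x = y.
Proof. destruct x as [x hx], y as [y hy]; simpl; intros ->; f_equal; apply proof_irrelevance. Qed.
Lemma binop_funcs f : is_binop mem f R -> funcs f (prod R R) R.
Proof. intros (c & h1 & h2); apply is_prod_iff in h1; apply is_fun_iff in h2; subst; auto. Qed.
Lemma app2_binop f x y z : funcs f (prod R R) R -> app2 mem f x y z <-> x ∈ R /\ y ∈ R /\ z = ap f (pr x y).
Proof. intros h; rewrite app2_iff, (funcs_pr _ _ h), pr_prod; tauto. Qed.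
Let hadd := binop_funcs (add_binop RR).
Let hmul := binop_funcs (mul_binop RR).
Lemma op_in f x y : funcs f (prod R R) R -> x ∈ R -> y ∈ R -> ap f (pr x y) ∈ R.
Proof. intros h hx hy; apply (funcs_ap h), pr_prod; auto. Qed.
Let opT f (h : funcs f (prod R R) R) (x y : T) : T := mkT (op_in h (proj2_sig x) (proj2_sig y)).
Let pl := opT hadd.
Let mu := opT hmul.
Let leT (x y : T) := app mem le (proj1_sig x) (proj1_sig y).

Lemma pl_app (x y z : T) : app2 mem add (proj1_sig x) (proj1_sig y) (proj1_sig z) <-> z = pl x y.
Proof.
  rewrite (app2_binop _ _ _ hadd). split; [intros (_ & _ & e); apply T_eq; auto|intros ->]. repeat split; auto using proj2_sig. exact (proj2_sig x). exact (proj2_sig y).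
Qed.
Lemma mu_app (x y z : T) : app2 mem mul (proj1_sig x) (proj1_sig y) (proj1_sig z) <-> z = mu x y.
Proof.
  rewrite (app2_binop _ _ _ hmul). split; [intros (_ & _ & e); apply T_eq; auto|intros ->]. repeat split; auto. exact (proj2_sig x). exact (proj2_sig y).
Qed.
Lemma zero_T : exists o : T, is_zero mem R add (proj1_sig o).
Proof. destruct (zero_ex RR) as [o ho]. exists (mkT (proj1 ho)); auto. Qed.
Lemma reals_field : exists (O I : T) (ng : T -> T), is_zero mem R add (proj1_sig O) /\
  ring_theory O I pl mu (fun x y : T => pl x (ng y)) ng eq /\ I <> O /\ (forall x : T, x <> O -> exists y : T, mu x y = I).
Proof.
  destruct zero_T as [O hO]. destruct (one_ex RR) as (i & hi & ni & m1 & minv).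
  pose (I := mkT hi).
  assert (neg : forall x : T, exists y : T, pl x y = O).
  { intros x. destruct (add_inverse RR _ hO (proj2_sig x)) as (y & hy & h).
    exists (mkT hy). symmetry; apply pl_app; auto. }
  destruct (fchoice _ neg) as [ng hng]. exists O, I, ng.
  assert (pc : forall x y : T, pl x y = pl y x).
  { intros x y; apply pl_app, (add_comm RR), pl_app; auto. }
  assert (mc : forall x y : T, mu x y = mu y x).
  { intros x y; apply mu_app, (mul_comm RR), mu_app; auto. }
  assert (zr : forall x : T, pl x O = x).
  { intros x; symmetry; apply pl_app. apply hO. exact (proj2_sig x). }
  assert (uz : forall o : T, is_zero mem R add (proj1_sig o) -> o = O).
  { intros o ho. transitivity (pl O o); [rewrite pc; symmetry; apply zr|]. symmetry; apply pl_app. apply ho. exact (proj2_sig O). }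
  split; [auto|split; [|split]].
  - constructor; auto.
    + intros x; rewrite pc; auto.
    + intros x y z. symmetry; apply pl_app.
      apply (add_assoc RR) with (y := proj1_sig y) (z := proj1_sig z) (u := proj1_sig (pl x y)); apply pl_app; auto.
    + intros x. rewrite mc. symmetry; apply mu_app. apply m1. exact (proj2_sig x).
    + intros x y z. symmetry; apply mu_app.
      apply (mul_assoc RR) with (y := proj1_sig y) (z := proj1_sig z) (u := proj1_sig (mu x y)); apply mu_app; auto.
    + intros x y z. rewrite (mc (pl x y)), (mc x), (mc y). apply pl_app.
      apply (mul_add RR) with (x := proj1_sig z) (y := proj1_sig x) (z := proj1_sig y) (s := proj1_sig (pl x y)); try apply pl_app; try apply mu_app; auto.
  - intros e; apply ni. change i with (proj1_sig I). rewrite e; auto.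
  - intros x nx. destruct (minv (proj1_sig x) (proj2_sig x)) as (y & hy & h).
    { intros hz; apply nx, uz, hz. }
    exists (mkT hy). symmetry; apply mu_app; auto.
Qed.

Lemma leT_anti (x y : T) : leT x y -> leT y x -> x = y.
Proof. intros h h'; apply T_eq, same_iff. apply (le_antisym RR); auto; apply proj2_sig. Qed.
Lemma leT_tr (x y z : T) : leT x y -> leT y z -> leT x z.
Proof. apply (le_trans RR); apply proj2_sig. Qed.
Lemma leT_tot (x y : T) : leT x y \/ leT y x.
Proof. apply (le_total RR); apply proj2_sig. Qed.
Lemma leT_pl (x y z : T) : leT x y -> leT (pl x z) (pl y z).
Proof.
  intros h. refine (le_add RR (proj2_sig x) (proj2_sig y) (proj2_sig z) h _ _); apply pl_app; auto.
Qed.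
Lemma leT_mu (o x y : T) : is_zero mem R add (proj1_sig o) -> leT o x -> leT o y -> leT o (mu x y).
Proof.
  intros ho h h'. refine (le_mul RR ho (proj2_sig x) (proj2_sig y) h h' _); apply mu_app; auto.
Qed.

(** The row m of Kc is the closed interval whose endpoints in a countable dense set D have the
    indices coded by m. The field is an arbitrary one satisfying the axioms, so density comes from
    the supremum axiom by way of the Archimedean property. *)
Theorem closed_family : exists Kc : M,
  (forall X, X ⊆ R -> line_open mem R le X X) /\
  (forall X m, X ⊆ R -> line_open mem R le X (sep X (fun x => pr x m ∉ Kc))) /\
  forall K (al : nat -> M), (forall i, i <= K -> al i ∈ R) ->
    (forall i i', i <= K -> i' <= K -> al i = al i' -> i = i') ->
    exists m : nat -> nat, (forall i, i <= K -> pr (al i) (nm (m i)) ∈ Kc) /\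
      forall i i' x, i <= K -> i' <= K -> i <> i' -> pr x (nm (m i)) ∈ Kc -> pr x (nm (m i')) ∈ Kc -> False.
Proof.
  destruct reals_field as (O & I & ng & hO & rt & IO & inv).
  assert (lmu := fun x y : T => leT_mu (x := x) (y := y) hO).
  destruct (om_rec (z0 := proj1_sig O) (s := fun _ z => ap add (pr z (proj1_sig I))) (B := R)) as (io & hio & io0 & ioS).
  { dfn. } { apply proj2_sig. } { intros _ z hz; apply op_in; auto. apply proj2_sig. }
  pose (n := nT O I pl).
  assert (hn : forall k, ap io (nm k) = proj1_sig (n k)).
  { induction k; [exact io0|]. rewrite ioS, IHk. reflexivity. }
  (* If x bounded all the integers, their supremum s would satisfy s <= s - 1. *)
  assert (arch : forall x : T, exists k, leT x (n k)).
  { intros x; apply NNPP; intros no.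
    destruct (sup_ex RR (S := ran io)) as (s & hs & ub & lub).
    - intros y hy; apply in_ran in hy as [k hk]. apply (funcs_pr _ _ hio) in hk as [hk ->]. apply (funcs_ap hio hk).
    - exists (proj1_sig O). apply in_ran; exists (nm 0). apply (funcs_pr _ _ hio); auto using nm_om.
    - exists (proj1_sig x); split; [apply proj2_sig|]. intros y hy. apply in_ran in hy as [k hk].
      apply (funcs_pr _ _ hio) in hk as [hk ->]. apply in_om in hk as [k' ->]. rewrite hn.
      destruct (leT_tot (n k') x) as [h|h]; auto. destruct no; eauto.
    - set (sT := mkT hs : T). assert (ubn : forall k, leT (n k) sT).
      { intros k. apply ub, in_ran. exists (nm k). apply (funcs_pr _ _ hio). rewrite hn; auto using nm_om. }
      assert (h : leT sT (pl sT (ng I))).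
      { apply (lub (proj1_sig (pl sT (ng I)))); [apply proj2_sig|]. intros y hy. apply in_ran in hy as [k hk].
        apply (funcs_pr _ _ hio) in hk as [hk ->]. apply in_om in hk as [k' ->]. rewrite hn.
        assert (h := leT_pl (ng I) (ubn (S k'))). replace (n k') with (pl (n (S k')) (ng I)); auto.
        unfold n; simpl. rewrite <- (Radd_assoc rt), (Ropp_def rt), (Radd_comm rt). apply (Radd_0_l rt). }
      apply (pred_lt rt leT_anti leT_tot leT_pl lmu IO h). }
  (* Here t codes (a, b, c) and r is the fraction (a - b) / (c + 1). *)
  pose (P t r := exists a b c, a ∈ om /\ b ∈ om /\ c ∈ om /\ t = code a (code b c) /\ r ∈ R /\
    ap add (pr (ap mul (pr r (ap add (pr (ap io c) (proj1_sig I))))) (ap io b)) = ap io a).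
  assert (PT : forall t r, P t r <-> exists (a b c : nat) (q : T), t = nm (cpair a (cpair b c)) /\ r = proj1_sig q /\
    pl (mu q (pl (n c) I)) (n b) = n a).
  { intros t r; split.
    - intros (a & b & c & ha & hb & hc & -> & hr & e). apply in_om in ha as [a' ->], hb as [b' ->], hc as [c' ->].
      exists a', b', c', (mkT hr). rewrite !code_nm. repeat split; auto. apply T_eq. rewrite !hn in e. exact e.
    - intros (a & b & c & q & -> & -> & e). exists (nm a), (nm b), (nm c). rewrite !code_nm, !hn. repeat split; auto using nm_om.
      apply proj2_sig. rewrite <- e. reflexivity. }
  assert (Pu : forall t r r', P t r -> P t r' -> r = r').
  { intros t r r' h h'. apply PT in h as (a & b & c & q & -> & -> & e), h' as (a' & b' & c' & q' & e1 & -> & e').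
    apply nm_inj, cpair_inj in e1 as [<- e1]; apply cpair_inj in e1 as [<- <-]. f_equal.
    exact (quot_unique rt leT_anti leT_tr leT_tot leT_pl lmu inv IO e e'). }
  assert (DP : D2 P) by (unfold P; dfn).
  (* Indices that code no triple receive the value zero, which makes D total on [om]. *)
  pose (dr t r := P t r \/ (r = proj1_sig O /\ forall r', ~ P t r')).
  pose (D := sep (prod om R) (fun z => exists t r, z = pr t r /\ dr t r)).
  assert (Ddr : D1 (fun z => exists t r, z = pr t r /\ dr t r)) by (unfold dr; dfn).
  assert (hD : forall t r, t ∈ om -> r ∈ R -> dr t r -> ap D t = r).
  { intros t r ht hr h. apply ap_eq; unfold D; [|intros r']; rewrite in_sep, pr_prod by auto.
    - split; eauto.
    - intros (_ & t' & r2 & e & h'). apply pr_inj in e as [<- <-]. destruct h as [h|[-> h]], h' as [h'|[-> h']]; auto.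
      eapply Pu; eauto. destruct (h' _ h). destruct (h _ h'). }
  assert (Dtot : forall k, exists q : T, dr (nm k) (proj1_sig q)).
  { intros k. destruct (classic (exists r, P (nm k) r)) as [[r h]|no].
    - assert (hr : r ∈ R) by (apply PT in h as (? & ? & ? & q & _ & -> & _); apply proj2_sig).
      exists (mkT hr); left; auto.
    - exists O; right; split; auto. intros r h; eauto. }
  destruct (fchoice _ Dtot) as [DT hDT].
  assert (aD : forall k, ap D (nm k) = proj1_sig (DT k)) by (intros; apply hD; auto using nm_om; apply proj2_sig).
  assert (den : forall x y : T, ~ leT y x -> exists k, ~ leT (DT k) x /\ ~ leT y (DT k)).
  { intros x y h. destruct (dense rt leT_anti leT_tr leT_tot leT_pl lmu inv IO arch h) as (a & b & c & r & e & h1 & h2).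
    exists (cpair a (cpair b c)). replace (DT (cpair a (cpair b c))) with r; auto. apply T_eq. rewrite <- aD. symmetry.
    apply hD; [apply nm_om|apply proj2_sig|]. left. apply PT. exists a, b, c, r; auto. }
  pose (Kc := sep (prod R om) (fun z => exists x m p q, z = pr x m /\ p ∈ om /\ q ∈ om /\ m = code p q /\
    app mem le (ap D p) x /\ app mem le x (ap D q))).
  assert (DK : D1 (fun z => exists x m p q, z = pr x m /\ p ∈ om /\ q ∈ om /\ m = code p q /\
    app mem le (ap D p) x /\ app mem le x (ap D q))) by dfn.
  assert (inK : forall (x : T) (p q : nat), pr (proj1_sig x) (nm (cpair p q)) ∈ Kc <-> leT (DT p) x /\ leT x (DT q)).
  { intros x p q; unfold Kc; rewrite in_sep, pr_prod by auto. split.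
    - intros (_ & x' & m & p' & q' & e & hp & hq & -> & h1 & h2). apply in_om in hp as [p'' ->], hq as [q'' ->].
      apply pr_inj in e as [<- e]. rewrite code_nm in e. apply nm_inj, cpair_inj in e as [<- <-]. rewrite !aD in *. split; auto.
    - intros [h1 h2]. split; [split; [apply proj2_sig|apply nm_om]|]. exists (proj1_sig x), (nm (cpair p q)), (nm p), (nm q).
      rewrite code_nm, !aD. repeat split; auto using nm_om. }
  assert (lt_iff : forall x y : T, lt mem le (proj1_sig x) (proj1_sig y) <-> ~ leT y x).
  { intros x y; unfold lt. rewrite same_iff. split.
    - intros [h ne] h'. apply ne. f_equal. apply leT_anti; auto.
    - intros h; split; [destruct (leT_tot x y); tauto|]. intros e; apply h. apply T_eq in e; subst. destruct (leT_tot y y); auto. }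
  assert (below : forall x : T, ~ leT x (pl x (ng I))) by (intros; apply (pred_lt rt leT_anti leT_tot leT_pl lmu IO)).
  assert (above : forall x : T, ~ leT (pl x I) x) by (intros; apply (lt_succ rt leT_anti leT_tot leT_pl lmu IO)).
  exists Kc. split; [|split].
  - intros X hX; split; [apply sub_refl|]. intros x hx. set (xT := mkT (hX x hx) : T).
    exists (proj1_sig (pl xT (ng I))), (proj1_sig (pl xT I)). split; [apply proj2_sig|split; [apply proj2_sig|]].
    change x with (proj1_sig xT). rewrite !lt_iff; auto.
  - intros X m hX. assert (DX : D1 (fun x => pr x m ∉ Kc)) by dfn. split; [intros x hx; rewrite in_sep in hx by auto; tauto|].
    intros x hx; rewrite in_sep in hx by auto. destruct hx as [hx nk]. set (xT := mkT (hX x hx) : T).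
    assert (H : exists a b : T, ~ leT xT a /\ ~ leT b xT /\ forall y : T, ~ leT y a -> ~ leT b y -> pr (proj1_sig y) m ∉ Kc).
    { destruct (classic (exists p q : nat, m = nm (cpair p q))) as [(p & q & ->)|no].
      - assert (h : ~ leT (DT p) xT \/ ~ leT xT (DT q)).
        { apply NNPP; intros h. apply nk. apply (inK xT). split; apply NNPP; tauto. }
        destruct h as [h|h].
        + exists (pl xT (ng I)), (DT p). split; [auto|split; [auto|]]. intros y _ h2 hk. apply inK in hk; tauto.
        + exists (DT q), (pl xT I). split; [auto|split; [auto|]]. intros y h2 _ hk. apply inK in hk; tauto.
      (* A number coding no pair of endpoints names the empty set, so any neighbourhood will do. *)
      - exists (pl xT (ng I)), (pl xT I). split; [auto|split; [auto|]]. intros y _ _ hk. apply no.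
        unfold Kc in hk; rewrite in_sep in hk by auto. destruct hk as (_ & x' & m' & p & q & e & hp & hq & -> & _).
        apply pr_inj in e as [_ ->]. apply in_om in hp as [p' ->], hq as [q' ->]. exists p', q'. apply code_nm. }
    destruct H as (a & b & h1 & h2 & h3). exists (proj1_sig a), (proj1_sig b).
    split; [apply proj2_sig|split; [apply proj2_sig|]]. change x with (proj1_sig xT). rewrite !lt_iff. split; [auto|split; [auto|]].
    intros y hy ha hb. rewrite in_sep by auto. split; auto. exact (h3 (mkT (hX y hy)) (proj1 (lt_iff a (mkT (hX y hy))) ha) (proj1 (lt_iff (mkT (hX y hy)) b) hb)).
  - intros K al hal inj.
    assert (ext : exists aT : nat -> T, forall i, i <= K -> proj1_sig (aT i) = al i).
    { assert (h : forall i, exists t : T, i <= K -> proj1_sig t = al i).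
      { intros i. destruct (classic (i <= K)) as [h|h]; [exists (mkT (hal i h)); auto|exists O; tauto]. }
      destruct (fchoice _ h) as [aT h']; eauto. }
    destruct ext as [aT haT].
    destruct (separating_intervals rt leT_anti leT_tr leT_tot leT_pl lmu IO den (K := K) (al := aT)) as (p & q & h1 & h2).
    { intros i i' hi hi' e. apply inj; auto. rewrite <- !haT, e; auto. }
    exists (fun i => cpair (p i) (q i)). split.
    + intros i hi. rewrite <- haT by auto. apply inK; auto.
    + intros i i' x hi hi' ne k k'.
      assert (hx : x ∈ R) by (unfold Kc in k; rewrite in_sep, pr_prod in k by auto; tauto).
      change x with (proj1_sig (mkT hx : T)) in k, k'. apply inK in k, k'.
      apply (h2 i i' (mkT hx) hi hi' ne); tauto.
Qed.
End AbstractReals.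

(** * Strong gamma-sets *)

Section StrongGamma.
Context {M : zermelo}.
Hypothesis WO : forall u : M, exists w, wo w u.
Variables w1 w2 : M.
Hypothesis N1 : is_next_cardinal mem om w1.
Hypothesis N2 : is_next_cardinal mem w1 w2.
Notation Pos := (Pos w2).
Variable G : M -> Prop.
Hypothesis GG : generic Pos G.
Variable N : zermelo.
Hypothesis WON : forall u : N, exists w, wo w u.
Variable j : M -> N.
Hypothesis j_in : forall (z : N) x, z ∈ j x <-> exists c, c ∈ x /\ z = j c.
Hypothesis j_inj : forall x y, j x = j y -> x = y.
Hypothesis reps : forall (A : N) a, exists R, is_rep w2 G j A a R.
Variable Gam : N.
Hypothesis Gam_in : forall z : N, z ∈ Gam <-> exists p, G p /\ z = j p.
Lemma jm x y : j x ∈ j y <-> x ∈ y.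
Proof. apply j_mem; auto. Qed.
Lemma jp x y : j (pr x y) = pr (j x) (j y).
Proof. apply j_pr; auto. Qed.

Lemma j_emp : j emp = emp.
Proof. apply mem_ext; intros z; rewrite j_in; split; [intros (c & h & _); destruct (in_emp h)|intros h; destruct (in_emp h)]. Qed.
Lemma j_nm n : j (nm n) = nm n.
Proof.
  induction n; simpl; [apply j_emp|]. apply mem_ext; intros z; rewrite j_in, in_succ, <- IHn, j_in. split.
  - intros (c & h & ->). apply in_succ in h as [h| ->]; eauto.
  - intros [(c & h & ->)| ->]; [exists c|exists (nm n)]; rewrite in_succ; auto.
Qed.
Lemma j_om : j om = om.
Proof.
  apply mem_ext; intros z; rewrite j_in, in_om. split.
  - intros (c & h & ->). apply in_om in h as [n ->]. exists n; apply j_nm.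
  - intros [n ->]; exists (nm n); rewrite j_nm; auto using nm_om.
Qed.
Lemma j_prod a b : j (prod a b) = prod (j a) (j b).
Proof.
  apply mem_ext; intros z; rewrite j_in, in_prod. split.
  - intros (c & h & ->). apply in_prod in h as (x & y & hx & hy & ->). exists (j x), (j y). rewrite jp, !jm; auto.
  - intros (x & y & hx & hy & ->). apply j_in in hx as (x' & hx & ->), hy as (y' & hy & ->).
    exists (pr x' y'). rewrite jp, pr_prod; auto.
Qed.
Lemma j_ord a : ord a -> ord (j a).
Proof.
  intros [h1 h2]; split.
  - intros y hy z hz. apply j_in in hy as (c & hc & ->). apply j_in in hz as (d & hd & ->). apply jm, (h1 c hc d hd).
  - intros y' hy' y hy z hz. apply j_in in hy' as (b & hb & ->). apply j_in in hy as (c & hc & ->).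
    apply j_in in hz as (d & hd & ->). apply jm, (h2 b hb c hc d hd).
Qed.
Lemma j_enum a : enum a -> enum (j a).
Proof.
  intros [f hf]. pose (g := sep (prod om a) (fun z => exists n, z = pr n (ap f n))).
  assert (hg : forall n x, pr (nm n) x ∈ g <-> x ∈ a /\ x = ap f (nm n)).
  { intros n x; unfold g; rewrite in_sep, pr_prod by dfn. split.
    - intros [[_ h] (n' & e)]. apply pr_inj in e as [<- ->]; auto.
    - intros [h ->]; eauto using nm_om. }
  apply enum_rel with (A := om) (R := fun n z => n ∈ om /\ pr n z ∈ j g).
  - dfn.
  - apply enum_om.
  - intros z hz. apply j_in in hz as (x & hx & ->). destruct (hf x hx) as [n <-]. exists (nm n).
    split; [apply nm_om|split; [apply nm_om|]]. rewrite <- j_nm, <- jp, jm. apply hg; auto.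
  - intros n z z' hz hz' [hn h] [_ h']. apply in_om in hn as [k ->]. apply j_in in hz as (x & hx & ->), hz' as (x' & hx' & ->).
    rewrite <- j_nm, <- jp, jm in h, h'. apply hg in h as [_ ->], h' as [_ ->]; auto.
Qed.
Lemma holds_iff (A : N) a R x : is_rep w2 G j A a R -> x ∈ a -> holds G R x <-> j x ∈ A.
Proof. intros [_ h] hx. symmetry; apply h; auto. Qed.
Lemma first_bit_j d q n i m : first_bit d q (nm n) (nm i) (nm m) <-> first_bit (j d) (j q) (nm n) (nm i) (nm m).
Proof.
  unfold first_bit. rewrite !code_nm.
  assert (E : forall a b : nat, pr (pr (j d) (nm a)) (nm b) ∈ j q <-> pr (pr d (nm a)) (nm b) ∈ q).
  { intros a b. rewrite <- !(j_nm a), <- !(j_nm b), <- !jp, jm; tauto. }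
  rewrite E. split; intros [h1 h2]; (split; [auto|]); intros m' hm'; apply in_nm in hm' as (k & hk & ->);
    specialize (h2 (nm k) (nm_lt hk)); rewrite !code_nm in *; apply (E _ 0); auto.
Qed.

Variables (X R add mul le k : N).
Hypothesis RR : is_reals mem R add mul le.
Hypothesis XR : X ⊆ R.
Hypothesis hk : funcs k om om.
Hypothesis SG : forall Us, is_seq mem om Us ->
  (forall n kn U, app mem k n kn -> app mem Us n U -> is_k_cover mem (line_open mem R le X) kn X U) ->
  exists c, is_gamma_seq mem (line_open mem R le X) om X c /\ forall n u U, app mem c n u -> app mem Us n U -> u ∈ U.

Theorem strong_gamma_enum : enum X.
Proof.
  apply NNPP; intros nX.
  (* The points are indexed by the first uncountable cardinal of M. Its elements are countable in N,
     so it injects into every uncountable set of N. *)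
  destruct (uncountable_inj WON nX (o := j w1)) as (y & hy & yinj).
  { apply j_ord, (ord_w1 N1). }
  { intros a ha; apply j_in in ha as (b & hb & ->). apply j_enum, (w1_ctbl N1 hb). }
  destruct (closed_family RR) as (Kc & open_X & open_K & sep_K).
  set (disj := fun m m' : N => forall x, x ∈ R -> pr x m ∈ Kc -> pr x m' ∈ Kc -> False).
  assert (Ddisj : D2 disj) by (unfold disj; dfn).
  set (A := sep (j (prod w1 om)) (fun z => exists a m, z = pr a m /\ pr (ap y a) m ∈ Kc)).
  (* The last index is k_n + 1, which makes k_n + 2 sets. Then the complements also cover single
     points when k_n is zero. *)
  set (Kk := sep (j (prod om om)) (fun z => exists n m, z = pr n m /\ m = succ (ap k n))).
  set (Dd := sep (j (prod om om)) (fun z => exists m m', z = pr m m' /\ disj m m')).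
  assert (inA : forall a n, a ∈ w1 -> j (pr a (nm n)) ∈ A <-> pr (ap y (j a)) (nm n) ∈ Kc).
  { intros a n ha; unfold A; rewrite in_sep, jm, pr_prod, jp, j_nm by dfn. split.
    - intros [_ (a' & m & e & h)]; apply pr_inj in e as [<- <-]; auto.
    - intros h; split; eauto using nm_om. }
  assert (inKk : forall n m, j (pr (nm n) (nm m)) ∈ Kk <-> nm m = succ (ap k (nm n))).
  { intros n m; unfold Kk; rewrite in_sep, jm, pr_prod, jp, !j_nm by dfn. split.
    - intros [_ (a & b & e & h)]; apply pr_inj in e as [<- <-]; auto.
    - intros h; split; eauto using nm_om. }
  assert (inDd : forall n m, j (pr (nm n) (nm m)) ∈ Dd <-> disj (nm n) (nm m)).
  { intros n m; unfold Dd; rewrite in_sep, jm, pr_prod, jp, !j_nm by dfn. split.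
    - intros [_ (a & b & e & h)]; apply pr_inj in e as [<- <-]; auto.
    - intros h; split; [auto using nm_om|exists (nm n), (nm m); auto]. }
  destruct (reps A (prod w1 om)) as [RA hRA]. destruct (reps Kk (prod om om)) as [RK hRK].
  destruct (reps Dd (prod om om)) as [RD hRD].
  assert (hA : forall a n, a ∈ w1 -> holds G RA (pr a (nm n)) <-> pr (ap y (j a)) (nm n) ∈ Kc).
  { intros a n ha; rewrite (holds_iff hRA), inA by (rewrite ?pr_prod; auto using nm_om). tauto. }
  assert (hK : forall n m, holds G RK (pr (nm n) (nm m)) <-> nm m = succ (ap k (nm n))).
  { intros n m; rewrite (holds_iff hRK), inKk by (rewrite ?pr_prod; auto using nm_om). tauto. }
  assert (hD : forall n m, holds G RD (pr (nm n) (nm m)) <-> disj (nm n) (nm m)).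
  { intros n m; rewrite (holds_iff hRD), inDd by (rewrite ?pr_prod; auto using nm_om). tauto. }
  destruct (core WO N1 N2 GG j_in j_inj reps Gam_in (proj1 hRA) (proj1 hRK) (proj1 hRD)) as (d & hd & hcore).
  { intros n. assert (h := funcs_ap hk (nm_om n)). apply in_om in h as [m e]. exists (S m). apply hK. rewrite e; auto. }
  { intros K al hal inj. destruct (sep_K K (fun i => ap y (j (al i)))) as (m & h1 & h2).
    - intros i hi. apply XR, hy, jm; auto.
    - intros i i' hi hi' e. apply inj; auto. apply j_inj, yinj; auto; apply jm; auto.
    - exists m; split; [intros i hi; apply hA; auto|]. intros i i' hi hi' ne. apply hD. intros x hx h h'. eapply h2; eauto. }
  (* The selection made by the actual Cohen real, read off in N from the generic filter. *)
  pose (EN n i m := exists p, p ∈ Gam /\ first_bit (j d) p n i m).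
  assert (EN_G : forall n i m, EN (nm n) (nm i) (nm m) <-> exists q, G q /\ first_bit d q (nm n) (nm i) (nm m)).
  { intros n i m; split.
    - intros (p & hp & h). apply Gam_in in hp as (q & hq & ->). apply first_bit_j in h. eauto.
    - intros (q & hq & h). exists (j q). rewrite Gam_in, <- first_bit_j; eauto. }
  assert (ENu : forall n i m m', EN (nm n) (nm i) (nm m) -> EN (nm n) (nm i) (nm m') -> m = m').
  { assert (H : forall n i m m', EN (nm n) (nm i) (nm m) -> EN (nm n) (nm i) (nm m') -> m < m' -> False).
    { intros n i m m' h h' lt. apply EN_G in h as (q & hq & h & _), h' as (q' & hq' & _ & h').
      specialize (h' (nm m) (nm_lt lt)). destruct (G_dir GG hq hq') as (r & hr & k1 & k2).
      apply k1 in h. apply k2 in h'. apply (G_pos GG), in_Pos in hr as (_ & _ & f). specialize (f _ _ _ h h').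
      apply (nm_inj (m := 1) (n := 0)) in f; discriminate. }
    intros n i m m' h h'. destruct (Nat.lt_total m m') as [l|[l|l]]; auto; exfalso; eauto. }
  assert (DEN : forall s t u : (nat -> N) -> N, TDef s -> TDef t -> TDef u -> Def (fun v => EN (s v) (t v) (u v)))
    by (intros; unfold EN, first_bit; dfn).
  pose (U n i := sep X (fun x => forall m, m ∈ om -> EN n i m -> pr x m ∉ Kc)).
  assert (inU : forall n i x, x ∈ U n i <-> x ∈ X /\ forall m, m ∈ om -> EN n i m -> pr x m ∉ Kc)
    by (intros; unfold U; rewrite in_sep by (dfn; apply DEN; dfn); tauto).
  assert (DU : D2T U) by (unfold U; dfn; apply DEN; dfn).
  (* Row n is good when all its rows of bits contain a one and the sets they select are pairwise
     disjoint. *)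
  pose (good n := exists mm, forall i, i ∈ succ (succ (ap k n)) -> ap mm i ∈ om /\ EN n i (ap mm i) /\
    forall i', i' ∈ succ (succ (ap k n)) -> i <> i' -> disj (ap mm i) (ap mm i')).
  assert (Dgood : D1 good) by (unfold good; dfn; apply DEN; dfn).
  (* At a row that is not good the family is {X}, so that every term of the sequence is a cover of
     the required kind. *)
  pose (Fam n := sep (pow X) (fun u => (good n /\ exists i, i ∈ succ (succ (ap k n)) /\ u = U n i) \/ (~ good n /\ u = X))).
  assert (inFam : forall n u, u ∈ Fam n <-> (good n /\ exists i, i ∈ succ (succ (ap k n)) /\ u = U n i) \/ (~ good n /\ u = X)).
  { intros n u; unfold Fam; rewrite in_sep, in_pow by dfn. split; [tauto|]. intros h; split; auto.
    destruct h as [(_ & i & _ & ->)|[_ ->]]; [|apply sub_refl]. intros x hx; apply inU in hx; tauto. }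
  assert (DFam : D1T Fam) by (unfold Fam; dfn).
  assert (fUs : funcs (lam om (pow (pow X)) Fam) om (pow (pow X))).
  { apply funcs_lam; auto. intros n _. apply in_pow. intros u hu; unfold Fam in hu; rewrite in_sep in hu by dfn; tauto. }
  assert (apUs : forall n U, app mem (lam om (pow (pow X)) Fam) n U <-> n ∈ om /\ U = Fam n).
  { intros n V0; rewrite app_iff, (funcs_pr _ _ fUs). split; intros [h ->]; split; auto; [|symmetry]; apply ap_lam; auto;
    apply in_pow; intros u hu; unfold Fam in hu; rewrite in_sep in hu by dfn; tauto. }
  destruct (SG (Us := lam om (pow (pow X)) Fam)) as (c & (cseq & copen & cgam) & csel).
  { exists (pow (pow X)). apply is_fun_iff; auto. }
  { intros n kn V0 hkn hV. apply apUs in hV as [hn ->]. apply app_iff, (funcs_pr _ _ hk) in hkn as [_ ->].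
    assert (h := funcs_ap hk hn). apply in_om in h as [kk ekk]. apply in_om in hn as [n' ->].
    assert (cover : forall l, length l <= S kk -> (forall z, In z l -> z ∈ X) -> exists u, u ∈ Fam (nm n') /\ forall z, In z l -> z ∈ u).
    { intros l hl lX. destruct (classic (good (nm n'))) as [hg|ng].
      2: { exists X; split; auto. apply inFam; auto. }
      assert (hg' := hg). destruct hg' as [mm hmm]. rewrite ekk in hmm.
      apply NNPP; intros no.
      (* If no member included l, each of the k_n + 2 disjoint sets would contain a point of l, and
         these points would be distinct. *)
      assert (bad : forall i, exists z, i <= S kk -> In z l /\ pr z (ap mm (nm i)) ∈ Kc).
      { intros i. destruct (classic (i <= S kk)) as [hi|hi]; [|exists X; tauto].
        apply NNPP; intros no'. apply no. exists (U (nm n') (nm i)).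
        assert (hi' : @nm N i ∈ succ (succ (nm kk))) by (apply (nm_lt (m := i) (n := S (S kk))); lia).
        split; [apply inFam; left; split; [auto|rewrite ekk; eauto]|].
        intros z hz. apply inU; split; auto. intros m hm hE hz'. apply no'. exists z; intros _; split; auto.
        destruct (hmm (nm i) hi') as (h1 & h2 & _). apply in_om in h1 as [a ea], hm as [b ->]. rewrite ea in *.
        rewrite (ENu _ _ _ _ h2 hE); auto. }
      destruct (fchoice _ bad) as [zz hzz].
      assert (nd : NoDup (map zz (seq 0 (S (S kk))))).
      { apply NoDup_map_inv' || idtac. apply NoDup_nth with (d := X). rewrite length_map, length_seq. intros i i' hi hi' e.
        rewrite !(nth_indep _ X (zz 0)) in e by (rewrite length_map, length_seq; auto).
        rewrite !map_nth, !seq_nth in e by auto. simpl in e.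
        destruct (hzz i) as [h1 h2]; [lia|]. destruct (hzz i') as [h1' h2']; [lia|].
        apply NNPP; intros ne. destruct (hmm (nm i)) as (_ & _ & h); [apply (nm_lt (m := i) (n := S (S kk))); lia|].
        apply (h (nm i')) with (x := zz i); [apply (nm_lt (m := i') (n := S (S kk))); lia| |auto|auto|congruence].
        intros e'; apply nm_inj in e'; auto. }
      apply (NoDup_incl_length (l' := l)) in nd; [rewrite length_map, length_seq in nd; lia|].
      intros z hz; apply in_map_iff in hz as (i & <- & hi). apply in_seq in hi. apply hzz; lia. }
    split; [split|].
    - intros u hu; apply inFam in hu as [(hg & i & hi & ->)|[_ ->]]; [|apply open_X; auto].
      destruct hg as [mm hmm]. destruct (hmm i hi) as (h1 & h2 & _).
      assert (i ∈ om). { rewrite ekk in hi. eapply om_trans; [exact hi|apply (nm_om (S (S kk)))]. }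
      apply in_om in h1 as [a ea], H as [i' ->]. rewrite ea in h2.
      replace (U (nm n') (nm i')) with (sep X (fun x => pr x (nm a) ∉ Kc)); [apply open_K; auto|].
      apply mem_ext; intros x; rewrite inU, in_sep by dfn. split; intros [hx h]; (split; [auto|]).
      + intros m hm hE. apply in_om in hm as [b ->]. rewrite (ENu _ _ _ _ hE h2); auto.
      + apply h; auto using nm_om.
    - intros x hx. destruct (cover (x :: nil)) as (u & hu & h); [simpl; lia|intros z [<-|[]]; auto|].
      exists u; split; auto. apply h; left; auto.
    - intros F hF hq. rewrite ekk in hq. destruct (equin_list hq) as (l & hl & hl').
      destruct (cover l) as (u & hu & h); [lia|intros z hz; apply hF, hl', hz|].
      exists u; split; auto. intros z hz; apply h, hl', hz. }
  destruct cseq as [Z hc]. apply is_fun_iff in hc.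
  assert (cF : forall n, n ∈ om -> ap c n ∈ Fam n).
  { intros n hn. apply (csel n (ap c n) (Fam n)); [apply app_iff, (funcs_pr _ _ hc); auto|apply apUs; auto]. }
  (* RI records which complement the sequence c took. This is where the choice acquires a
     representation in M and [core] applies. *)
  destruct (reps (sep (j (prod om om)) (fun z => exists n i, z = pr n i /\ ap c n = U n i)) (prod om om)) as [RI hRI].
  assert (hI : forall n i, j (pr (nm n) (nm i)) ∈ sep (j (prod om om)) (fun z => exists n i, z = pr n i /\ ap c n = U n i)
    <-> ap c (nm n) = U (nm n) (nm i)).
  { intros n i; rewrite in_sep, jm, pr_prod, jp, !j_nm by dfn. split.
    - intros [_ (a & b & e & h)]; apply pr_inj in e as [<- <-]; auto.
    - intros h; split; eauto using nm_om. }
  destruct (hcore RI (proj1 hRI)) as (a & ha & hbad).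
  set (x := ap y (j a)). assert (hx : x ∈ X) by (apply hy, jm; auto).
  destruct (cgam x hx) as (F & fF & hF). apply finite_iff in fF.
  assert (bnd : exists B, forall t, @nm N t ∈ F -> t < B).
  { destruct fF as [l Hl]. assert (H : exists B, forall t, In (@nm N t) l -> t < B).
    { clear. induction l as [|z l [B IH]]; [exists 0; intros t []|].
      destruct (classic (exists t, z = @nm N t)) as [(t & e)|no].
      - exists (S (t + B)). intros t' [h|h]; [|apply IH in h; lia]. subst z. apply nm_inj in h; lia.
      - exists B; intros t [h|h]; [destruct no; eauto|eauto]. }
    destruct H as [B H]; exists B; intros t h; apply (H t), Hl, h. }
  destruct bnd as [B hB].
  destruct (hbad (nm B) (nm_om B)) as (q & hq & n & K & m & hn & hKo & n0n & hKq & hbits & hdis & i & hi & hch & hneg & hAq).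
  apply in_om in hn as [n' ->], hKo as [K' ->].
  assert (eK : nm K' = succ (ap k (nm n'))) by (apply hK; exists q; auto).
  assert (hg : forall i, i <= K' -> exists mi, ap m (nm i) = nm mi /\ first_bit d q (nm n') (nm i) (nm mi)).
  { intros i' hi'. destruct (hbits (nm i')) as [h1 h2]; [apply (nm_lt (m := i') (n := S K')); lia|].
    apply in_om in h1 as [mi e]. rewrite e in h2; eauto. }
  assert (hg' : exists mf : nat -> nat, forall i, i <= K' -> ap m (nm i) = nm (mf i) /\ first_bit d q (nm n') (nm i) (nm (mf i))).
  { assert (h : forall i, exists mi, i <= K' -> ap m (nm i) = nm mi /\ first_bit d q (nm n') (nm i) (nm mi)).
    { intros i'. destruct (classic (i' <= K')) as [h|h]; [destruct (hg i' h) as [mi ?]; eauto|exists 0; tauto]. }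
    destruct (fchoice _ h) as [mf ?]; eauto. }
  destruct hg' as [mf hmf].
  assert (hE : forall i, i <= K' -> EN (nm n') (nm i) (nm (mf i))).
  { intros i' hi'; apply EN_G; exists q; split; auto. apply hmf; auto. }
  assert (gd : good (nm n')).
  { destruct (@fin_seq N (fun i => nm (mf i)) (S K')) as [mm hmm]. exists mm. rewrite <- eK. intros i1 hi1.
    apply (in_nm i1 (S K')) in hi1 as (a1 & ha1 & ->). rewrite hmm by auto. split; [apply nm_om|split; [apply hE; lia|]].
    intros i2 hi2 ne. apply (in_nm i2 (S K')) in hi2 as (a2 & ha2 & ->). rewrite hmm by auto.
    apply hD. exists q; split; auto. assert (ne' : a1 <> a2) by congruence.
    rewrite <- (proj1 (hmf a1 ltac:(lia))), <- (proj1 (hmf a2 ltac:(lia))).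
    apply hdis; [apply (nm_lt (m := a1) (n := S K')); auto|apply (nm_lt (m := a2) (n := S K')); auto|]. intros e; apply nm_inj in e; auto. }
  apply (in_nm i (S K')) in hi as (i0 & hi0 & ->).
  (* In the default case i0 = K all smaller indices are refuted, so the index taken by c is K as
     well. *)
  assert (ce : ap c (nm n') = U (nm n') (nm i0)).
  { assert (h := cF (nm n') (nm_om n')). apply inFam in h as [(_ & i1 & hi1 & e)|[h _]]; [|tauto].
    rewrite <- eK in hi1. apply (in_nm i1 (S K')) in hi1 as (a1 & ha1 & ->).
    destruct hch as [hch|hch].
    - apply hI. apply hRI; [apply pr_prod; auto using nm_om|]. exists q; auto.
    - apply nm_inj in hch; subst i0. destruct (Nat.eq_dec a1 K') as [->|ne]; [exact e|]. exfalso.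
      assert (h : @nm M a1 ∈ nm K') by (apply nm_lt; lia). specialize (hneg _ h).
      apply hI in e. revert e. apply (neg_truth GG hRI); [apply pr_prod; auto using nm_om|]. exists q; auto. }
  assert (xn : x ∉ ap c (nm n')).
  { rewrite ce, inU. intros [_ h]. apply (h (nm (mf i0)) (nm_om _)); [apply hE; lia|].
    apply hA; auto. exists q; split; auto. rewrite <- (proj1 (hmf i0 ltac:(lia))). exact hAq. }
  assert (nF : nm n' ∈ F).
  { apply (hF (nm n') (ap c (nm n'))); auto. apply app_iff, (funcs_pr _ _ hc); auto using nm_om. }
  apply hB in nF. assert (h : @nm M n' ∈ nm B) by (apply nm_lt; auto). apply n0n in h. destruct (mem_irr h).
Qed.
End StrongGamma.

(** * The tower *)

Section Tower.
Context {M : zermelo}.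
Implicit Types x y z w u a b c d f g n m k p s t U V W X Y A F : M.

Definition Fin0 : M := Fins om.
Definition Bas : M := Fins (prod Fin0 om).
Definition cap a b := sep a (fun i => i ∈ b).
Lemma in_cap a b i : i ∈ cap a b <-> i ∈ a /\ i ∈ b.
Proof. unfold cap; rewrite in_sep by dfn; tauto. Qed.
(* The clopen subset of the Cantor space coded by b. *)
Definition Op b z := exists t m, m ∈ om /\ pr t m ∈ b /\ cap z m = t.
Definition infinite x := forall n, n ∈ om -> exists i, i ∈ x /\ n ⊆ i.
Definition almost x y := exists m, m ∈ om /\ forall i, i ∈ x -> m ⊆ i -> i ∈ y.
Definition wcover V X := forall p F, p ∈ om -> F ⊆ X -> finite mem F -> exists b, b ∈ Bas /\ pr p b ∈ V /\ forall z, z ∈ F -> Op b z.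
Definition selects V A U := A ⊆ om /\ infinite A /\ forall n p, n ∈ A -> p ∈ n -> pr p (ap U (pr n p)) ∈ V.
Definition covered A U z := exists n0, n0 ∈ om /\ forall n p, n ∈ A -> n0 ⊆ n -> p ∈ n -> Op (ap U (pr n p)) z.
Definition Cov V x Y := exists A U, selects V A U /\ forall z, z ⊆ om -> z ∈ Y \/ almost z x -> covered A U z.

Lemma nm_sub (i k : nat) : @nm M i ⊆ nm k <-> i <= k.
Proof.
  split.
  - intros h. destruct (Nat.le_gt_cases i k) as [l|l]; auto. apply nm_lt, h in l. destruct (mem_irr l).
  - intros h z hz; apply in_nm in hz as (e & he & ->). apply nm_lt; lia.
Qed.
Lemma Bas_all : forall b, b ∈ Bas -> fin b /\ forall z, z ∈ b -> exists t m, z = pr t m /\ m ∈ om.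
Proof.
  intros b hb; apply in_Fins in hb as [h1 h2]; split; auto. intros z hz.
  apply h1, in_prod in hz as (t & m & _ & hm & ->); eauto.
Qed.

Section Step.
Variables (V Y f : M).
Hypothesis Yom : forall y, y ∈ Y -> y ⊆ om.
Hypothesis enY : forall y, y ∈ Y -> exists i, ap f (nm i) = y.
Hypothesis meetY : forall F, F ⊆ Y -> fin F -> forall e : nat, exists i, e <= i /\ forall y, y ∈ F -> nm i ∈ y.
Hypothesis VB : V ⊆ prod om Bas.
Hypothesis cV : wcover V (cup Fin0 Y).
Definition Wk k := sep Y (fun y => exists i, i ∈ k /\ ap f i = y).
Lemma in_Wk k y : y ∈ Wk k <-> y ∈ Y /\ exists i, i ∈ k /\ ap f i = y.
Proof. unfold Wk; rewrite in_sep by dfn; tauto. Qed.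
Lemma fin_Wk (k : nat) : fin (Wk (nm k)).
Proof.
  apply fin_sub with (fset (map (fun i => ap f (nm i)) (seq 0 k))); [|apply fin_fset].
  intros y hy; apply in_Wk in hy as (_ & i & hi & <-). apply in_nm in hi as (n & hn & ->).
  apply in_fset, in_map_iff; exists n; rewrite in_seq; split; auto; lia.
Qed.
(** One interval [k, k') of the construction. The point a is meant for x, while a' stays outside x
    and prevents almost containment of the members of Y in x. The sets U p contain the first members
    of Y and every z without points in [k, k'). *)
Definition block k k' U a a' := k ∈ k' /\ k ⊆ a /\ a ∈ a' /\ a' ∈ k' /\ (forall y, y ∈ Wk k -> a ∈ y /\ a' ∈ y) /\
  forall p, p ∈ k -> pr p (ap U p) ∈ V /\ (forall z, z ∈ Wk k -> Op (ap U p) z) /\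
    forall z, z ⊆ om -> cap z k' ⊆ k -> Op (ap U p) z.
Lemma Bas_bound b : b ∈ Bas -> exists B, forall t m, pr t m ∈ b -> exists i, m = nm i /\ i <= B.
Proof.
  intros hb; apply Bas_all in hb as [[l Hl] h].
  assert (H : forall l' : list M, (forall z, In z l' -> exists t m, z = pr t m /\ m ∈ om) ->
    exists B, forall t m, In (pr t m) l' -> exists i, m = nm i /\ i <= B).
  { clear. induction l' as [|z l' IH]; intros h; [exists 0; intros t m []|].
    destruct IH as [B IH]; [intros z' hz'; apply h; right; auto|]. destruct (h z) as (t & m & -> & hm); [left; auto|].
    apply in_om in hm as [i ->]. exists (B + i). intros t' m' [e|e].
    - apply pr_inj in e as [_ <-]. exists i; split; auto; lia.
    - destruct (IH _ _ e) as (i' & e' & hi). exists i'; split; auto; lia. }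
  destruct (H l) as [B HB]; [intros z hz; apply h, Hl, hz|]. exists B; intros t m htm; apply (HB t m), Hl, htm.
Qed.
Lemma block_ex (k : nat) : exists (k' : nat) U (a a' : nat), block (nm k) (nm k') U (nm a) (nm a') /\ U ⊆ prod om Bas.
Proof.
  assert (hb : forall p : nat, exists b (B : nat), p < k -> b ∈ Bas /\ pr (nm p) b ∈ V /\ (forall z, z ∈ cup (pow (nm k)) (Wk (nm k)) -> Op b z) /\
    forall t m, pr t m ∈ b -> exists i, m = nm i /\ i <= B).
  { intros p. destruct (classic (p < k)) as [hp|hp]; [|exists emp, 0; tauto].
    (* All subsets of k are covered along with the listed members of Y: a set without points in [k,
       k') agrees below k' with one of them. *)
    destruct (@cV (nm p) (cup (pow (nm k)) (Wk (nm k)))) as (b & h1 & h2 & h3).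
    - apply nm_om.
    - intros z hz; apply in_cup. apply in_cup in hz as [hz|hz]; [left|right; apply in_Wk in hz; tauto].
      apply in_pow in hz. apply in_Fins; split; [|eapply fin_sub; eauto using fin_nm].
      intros i hi; apply hz in hi. eapply om_trans; [exact hi|apply nm_om].
    - apply finite_iff, fin_cup; [apply fin_pow, fin_nm|apply fin_Wk].
    - destruct (Bas_bound h1) as [B hB]. exists b, B; auto. }
  destruct (fchoice _ hb) as [b hb']. destruct (fchoice _ hb') as [B hB]. clear hb hb'.
  destruct (@fin_seq_graph M b k) as (U & hU & hU').
  destruct (meetY (F := Wk (nm k))) with (e := k) as (a & ha & hay); [intros y hy; apply in_Wk in hy; tauto|apply fin_Wk|].
  destruct (meetY (F := Wk (nm k))) with (e := S a) as (a' & ha' & hay'); [intros y hy; apply in_Wk in hy; tauto|apply fin_Wk|].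
  assert (bd : exists BB, forall p : nat, p < k -> B p <= BB).
  { clear -B. induction k as [|k [BB IH]]; [exists 0; intros; lia|]. exists (BB + B k). intros p hp.
    destruct (Nat.eq_dec p k) as [->|]; [lia|]. assert (B p <= BB) by (apply IH; lia). lia. }
  (* The bound k' exceeds every place inspected by the chosen codes, so their clopen sets depend on
     z below k' only. *)
  destruct bd as [BB hBB]. exists (S (k + a' + BB)), U, a, a'. split.
  2: { intros z hz; apply hU' in hz as (i & hi & ->). apply pr_prod; split; [apply nm_om|]. apply (hB i hi). }
  split; [apply nm_lt; lia|split; [apply nm_sub; auto|split; [apply nm_lt; lia|split; [apply nm_lt; lia|split; [auto|]]]]].
  intros p hp. apply in_nm in hp as (i & hi & ->). rewrite (hU i) by auto. destruct (hB i hi) as (h1 & h2 & h3 & h4).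
  split; [auto|split; [intros z hz; apply h3, in_cup; auto|]]. intros z hz hk.
  destruct (h3 (cap z (nm (S (k + a' + BB))))) as (t & m & hm & htm & e); [apply in_cup; left; apply in_pow; auto|].
  exists t, m; repeat split; auto. rewrite <- e. apply mem_ext; intros y; rewrite !in_cap.
  destruct (h4 _ _ htm) as (i' & -> & hi'). split; [|tauto]. intros [g1 g2]; repeat split; auto.
  apply (nm_sub i' (S (k + a' + BB))); auto. assert (B i <= BB) by auto. lia.
Qed.

Hypothesis WO : forall u : M, exists w, wo w u.
(** Blocks alternate: one contributes a single point to x, the next is left empty, and the covering
    sets are those of the empty blocks. A set almost contained in x eventually has no point in an
    empty block. Each y in Y eventually contains the point put into x and also the point left out of
    that block. *)
Lemma step_lemma : exists x, x ⊆ om /\ infinite x /\ (forall y, y ∈ Y -> almost x y /\ ~ almost y x) /\ Cov V x Y.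
Proof.
  assert (bo : forall k, k ∈ om -> exists k' U a a', block k k' U a a' /\ U ∈ pow (prod om Bas) /\ k' ∈ om /\ a ∈ om /\ a' ∈ om).
  { intros k hk; apply in_om in hk as [i ->]. destruct (block_ex i) as (k' & U & a & a' & h & h').
    exists (nm k'), U, (nm a), (nm a'). rewrite in_pow; auto 6 using nm_om. }
  destruct (@choice_fun _ WO om om (fun k k' => exists U a a', block k k' U a a' /\ U ∈ pow (prod om Bas) /\ a ∈ om /\ a' ∈ om)) as (nx & hnx & r1).
  { unfold block, Op, cap, Wk; dfn. }
  { intros k hk; destruct (bo k hk) as (k' & U & a & a' & h & h1 & h2 & h3 & h4). eauto 9. }
  destruct (@choice_fun _ WO om (pow (prod om Bas)) (fun k U => exists a a', block k (ap nx k) U a a' /\ a ∈ om /\ a' ∈ om)) as (UU & hUU & r2).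
  { unfold block, Op, cap, Wk; dfn. }
  { intros k hk; destruct (r1 k hk) as (U & a & a' & h & h1 & h2 & h3). eauto 8. }
  destruct (@choice_fun _ WO om om (fun k a => exists a', block k (ap nx k) (ap UU k) a a')) as (aa & haa & r3).
  { unfold block, Op, cap, Wk; dfn. }
  { intros k hk; destruct (r2 k hk) as (a & a' & h & h1 & h2). eauto. }
  clear bo r1 r2.
  (* Two blocks per step: one to hold a point of x and one to stay empty. *)
  destruct (om_rec (z0 := emp) (s := fun _ k => ap nx (ap nx k)) (B := om)) as (L & hL & L0 & LS).
  { dfn. } { apply (nm_om 0). } { intros _ k hk. repeat apply (funcs_ap hnx); auto. }
  assert (ex : forall k : nat, exists e, ap nx (nm k) = nm e) by (intros; apply in_om, (funcs_ap hnx), nm_om).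
  destruct (fchoice _ ex) as [nX hX].
  pose (l := fix l (n : nat) : nat := match n with 0 => 0 | S n => nX (nX (l n)) end).
  assert (hl : forall n : nat, ap L (nm n) = nm (l n)).
  { induction n; [exact L0|]. rewrite LS, IHn, !hX. reflexivity. }
  assert (ea : forall k : nat, exists e, ap aa (nm k) = nm e) by (intros; apply in_om, (funcs_ap haa), nm_om).
  destruct (fchoice _ ea) as [A1 hA1].
  assert (B : forall k : nat, exists a' : nat, block (nm k) (nm (nX k)) (ap UU (nm k)) (nm (A1 k)) (nm a') /\ k <= A1 k /\ A1 k < a' /\ a' < nX k).
  { intros k. destruct (r3 (nm k) (nm_om k)) as (a' & h). rewrite hX, hA1 in h.
    assert (ha : a' ∈ om) by (eapply om_trans; [exact (proj1 (proj2 (proj2 (proj2 h))))|apply nm_om]). apply in_om in ha as [e ->]. exists e. split; auto.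
    destruct h as (_ & h1 & h2 & h3 & _). rewrite nm_sub in h1. rewrite nm_mem in h2, h3. auto. }
  assert (nXlt : forall k : nat, k < nX k) by (intros k; destruct (B k) as (a' & _ & h); lia).
  assert (lmono : forall i n : nat, i < n -> nX (nX (l i)) <= l n).
  { intros i n h; induction h; simpl; auto. assert (h1 := nXlt (l m)). assert (h2 := nXlt (nX (l m))). lia. }
  assert (lge : forall n : nat, n <= l n).
  { induction n; simpl; [lia|]. assert (h1 := nXlt (l n)). assert (h2 := nXlt (nX (l n))). lia. }
  pose (x := sep om (fun i => exists n, n ∈ om /\ i = ap aa (ap L n))).
  assert (inx : forall i : nat, nm i ∈ x <-> exists n : nat, i = A1 (l n)).
  { intros i; unfold x; rewrite in_sep by dfn. split.
    - intros (_ & n & hn & e). apply in_om in hn as [n' ->]. rewrite hl, hA1 in e. apply nm_inj in e; eauto.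
    - intros [n ->]; split; [apply nm_om|]. exists (nm n). rewrite hl, hA1; auto using nm_om. }
  assert (xom : x ⊆ om) by (intros i; unfold x; rewrite in_sep by dfn; tauto).
  assert (blockx : forall n i : nat, l n <= i -> i < l (S n) -> nm i ∈ x -> i = A1 (l n)).
  { intros n i h1 h2 h. apply inx in h as [n' ->]. destruct (B (l n')) as (a' & _ & g1 & g2 & g3).
    destruct (Nat.lt_total n n') as [h|[h|h]]; [|subst; auto|].
    - apply lmono in h. simpl in h2. lia.
    - apply lmono in h. assert (h3 := nXlt (nX (l n'))). lia. }
  assert (inY : forall y, y ∈ Y -> exists k0 : nat, forall k : nat, k0 < k -> y ∈ Wk (nm k)).
  { intros y hy; destruct (enY hy) as [i hi]. exists i. intros k hk. apply in_Wk; split; auto. exists (nm i); split; auto using nm_lt. }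
  exists x. split; [auto|split; [|split]].
  - intros n hn; apply in_om in hn as [e ->]. exists (nm (A1 (l e))). split; [apply inx; eauto|].
    apply nm_sub. destruct (B (l e)) as (a' & _ & h & _). assert (h' := lge e). lia.
  - intros y hy. destruct (inY y hy) as [k0 hk0]. split.
    + exists (nm (l (S k0))). split; [apply nm_om|]. intros i hi hm. assert (hio := xom i hi). apply in_om in hio as [e ->].
      apply inx in hi as [n ->]. apply nm_sub in hm. destruct (B (l n)) as (a' & (_ & _ & _ & _ & h & _) & g).
      apply h, hk0. destruct (Nat.le_gt_cases n k0) as [g'|g'].
      * assert (h1 : n < S k0) by lia. apply lmono in h1. assert (h3 := nXlt (nX (l n))). lia.
      * assert (h3 := lge n). lia.
    + intros (m & hm & h). apply in_om in hm as [m' ->]. set (n := S (k0 + m')).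
      assert (hn : k0 < n /\ m' < n) by (unfold n; lia). clearbody n.
      destruct (B (l n)) as (a' & (_ & _ & _ & _ & hW & _) & g1 & g2 & g3). assert (h3 := lge n).
      assert (hx : nm a' ∈ x). { apply h; [apply hW, hk0; lia|]. apply nm_sub. lia. }
      apply (blockx n) in hx; [lia|lia|]. simpl. assert (h4 := nXlt (nX (l n))). lia.
  (* A consists of the starting points of the empty blocks. *)
  - pose (A := sep om (fun k => exists n, n ∈ om /\ k = ap nx (ap L n))).
    assert (inA : forall k : nat, nm k ∈ A <-> exists n : nat, k = nX (l n)).
    { intros i; unfold A; rewrite in_sep by dfn. split.
      - intros (_ & n & hn & e). apply in_om in hn as [n' ->]. rewrite hl, hX in e. apply nm_inj in e; eauto.
      - intros [n ->]; split; [apply nm_om|]. exists (nm n). rewrite hl, hX; auto using nm_om. }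
    assert (Aom : A ⊆ om) by (intros i; unfold A; rewrite in_sep by dfn; tauto).
    pose (U := sep (prod (prod om om) Bas) (fun z => exists n p, z = pr (pr n p) (ap (ap UU n) p))).
    assert (UUB : forall n p, n ∈ om -> p ∈ n -> ap (ap UU n) p ∈ Bas -> ap U (pr n p) = ap (ap UU n) p).
    { intros n p hn hp hb. assert (p ∈ om) by (eapply om_trans; eauto). apply ap_eq; unfold U; [|intros y]; rewrite in_sep, !pr_prod by dfn.
      - split; eauto 6.
      - intros (_ & n' & p' & e). apply pr_inj in e as [e ->]. apply pr_inj in e as [<- <-]; auto. }
    assert (key : forall (k : nat) p, p ∈ nm k -> pr p (ap U (pr (nm k) p)) ∈ V /\
      (forall z, z ∈ Wk (nm k) -> Op (ap U (pr (nm k) p)) z) /\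
      forall z, z ⊆ om -> cap z (nm (nX k)) ⊆ nm k -> Op (ap U (pr (nm k) p)) z).
    { intros k p hp. destruct (B k) as (a' & (_ & _ & _ & _ & _ & h) & _). destruct (h p hp) as (h1 & h2 & h3).
      rewrite UUB; auto using nm_om. assert (hVB := VB h1). apply pr_prod in hVB; tauto. }
    exists A, U. split; [split; [auto|split]|].
    + intros n hn; apply in_om in hn as [e ->]. exists (nm (nX (l e))). split; [apply inA; eauto|].
      apply nm_sub. assert (h1 := lge e). assert (h2 := nXlt (l e)). lia.
    + intros n p hn hp. assert (hno := Aom n hn). apply in_om in hno as [k ->]. apply key; auto.
    + intros z hz [hzY|(m & hm & hzx)].
      * destruct (inY z hzY) as [k0 hk0]. exists (nm (S k0)). split; [apply nm_om|]. intros n p hn h0 hp.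
        assert (hno := Aom n hn). apply in_om in hno as [k ->]. apply nm_sub in h0. destruct (key k p hp) as (_ & g & _). apply g, hk0; lia.
      * exists m; split; auto. intros n p hn h0 hp. assert (hno := Aom n hn). apply in_om in hno as [k ->].
        destruct (key k p hp) as (_ & _ & g0). apply g0; auto. intros i hi. apply in_cap in hi as [hi hi']. assert (hio := hz i hi).
        apply in_om in hio as [i' ->]. apply in_om in hm as [m' ->]. apply nm_sub in h0. apply nm_mem in hi'. apply nm_mem.
        destruct (Nat.lt_ge_cases i' k) as [g|g]; auto. exfalso.
        assert (hx : nm i' ∈ x) by (apply hzx; auto; apply nm_sub; lia).
        apply inA in hn as [n' ->]. apply (blockx n') in hx; [|assert (h1 := nXlt (l n')); lia|exact hi'].
        destruct (B (l n')) as (a' & _ & g1 & g2 & g3). lia.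
Qed.
End Step.

Hypothesis WO : forall u : M, exists w, wo w u.
Lemma wcover_all X : wcover (prod om Bas) X.
Proof.
  (* The code {(0, 0)} imposes no restriction and denotes the whole space. *)
  intros p F hp _ _. exists (sing (pr emp emp)).
  assert (e0 : emp ∈ om) by apply (@nm_om M 0).
  assert (hb : sing (pr emp emp) ∈ Bas).
  { apply in_Fins; split.
    - intros z hz; apply in_sing in hz as ->. apply pr_prod; split; auto. apply in_Fins; split.
      intros z hz; destruct (in_emp hz). exists nil; intros z; split; [apply in_emp|intros []].
    - exists (pr emp emp :: nil); intros z; rewrite in_sing; simpl; intuition congruence. }
  split; [auto|split; [apply pr_prod; auto|]]. intros z _. exists emp, emp. rewrite in_sing; repeat split; auto.
  apply mem_ext; intros i; rewrite in_cap. split; [tauto|intros h; destruct (in_emp h)].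
Qed.
Lemma wcover_sub V X Y : Y ⊆ X -> wcover V X -> wcover V Y.
Proof. intros h hX p F hp hF; apply hX; auto. eapply sub_trans; eauto. Qed.

Definition next V Y x := x ⊆ om /\ infinite x /\ (forall y, y ∈ Y -> almost x y /\ ~ almost y x) /\
  (V ⊆ prod om Bas -> wcover V (cup Fin0 Y) -> Cov V x Y).
Lemma next_ex V Y : (forall y, y ∈ Y -> y ⊆ om) -> enum Y ->
  (forall F, F ⊆ Y -> fin F -> forall e : nat, exists i, e <= i /\ forall y, y ∈ F -> nm i ∈ y) ->
  exists x, next V Y x.
Proof.
  intros Yom [f hf] meet. destruct (classic (V ⊆ prod om Bas /\ wcover V (cup Fin0 Y))) as [[h1 h2]|h].
  - destruct (step_lemma hf meet h1 h2 WO) as (x & k1 & k2 & k3 & k4). exists x; repeat split; auto; apply k3; auto.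
  (* When V is no sequence of covers its clause is vacuous, and the step is carried out with all
     codes instead. *)
  - destruct (step_lemma (V := prod om Bas) hf meet) as (x & k1 & k2 & k3 & k4); auto.
    apply sub_refl. apply wcover_all. exists x; repeat split; auto; try apply k3; auto. intros; tauto.
Qed.

Variable w1 : M.
Hypothesis N1 : is_next_cardinal mem om w1.
Variable En : M.
Hypothesis hEn : forall V, V ⊆ prod om Bas -> exists a, a ∈ w1 /\ ap En a = V.
(** Stage a treats the a-th coded sequence. Its selection covers the earlier members outright and,
    through almost containment in F(a), also the finite sets, F(a) itself and all later members;
    thus one stage settles a sequence for good. *)
Theorem tower : exists X, Fin0 ⊆ X /\ X ⊆ pow om /\ ~ enum X /\ forall V, V ⊆ prod om Bas -> wcover V X ->
  exists A U, selects V A U /\ forall z, z ∈ X -> covered A U z.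
Proof.
  destruct (WO (pow om)) as [w hw].
  assert (Dnext : Def (fun v => next (v 0) (v 1) (v 2))) by (unfold next, Cov, covered, selects, wcover, infinite, almost, Op, cap; dfn).
  assert (Dn : forall V Y, D1 (next V Y)) by (intros; unfold next, Cov, covered, selects, wcover, infinite, almost, Op, cap; dfn).
  (* The domain of the approximation g is the current stage and its range is the set of earlier
     members. *)
  pose (H g := pick w (sep (pow om) (next (ap En (dom g)) (ran g)))).
  assert (DH : D1T H) by (unfold H, next, Cov, covered, selects, wcover, infinite, almost, Op, cap; dfn).
  assert (HP : forall g, H g ∈ pow om /\ ((exists x, next (ap En (dom g)) (ran g) x) -> next (ap En (dom g)) (ran g) (H g))).
  { intros g. destruct (classic (exists x, next (ap En (dom g)) (ran g) x)) as [[x hx]|no].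
    - assert (i : H g ∈ sep (pow om) (next (ap En (dom g)) (ran g))).
      { apply pick_in with (pow om); auto. intros y hy; rewrite in_sep in hy by auto; tauto.
        exists x; rewrite in_sep, in_pow by auto; split; auto; apply hx. }
      rewrite in_sep in i by auto. tauto.
    - split; [|tauto]. apply in_pow. intros i hi. exfalso. unfold H, pick in hi. apply in_un in hi as (x & hx & _).
      rewrite in_sep in hx by (unfold first; dfn). destruct hx as [hx _]. rewrite in_sep in hx by auto. apply no; exists x; tauto. }
  destruct (rec_bounded DH (proj1 (ord_w1 N1)) (fun g => proj1 (HP g))) as (F & hF & hr).
  assert (inR : forall a y, a ∈ w1 -> y ∈ ran (rst F a) <-> exists b, b ∈ a /\ y = ap F b).
  { intros a y ha; rewrite in_ran; split.
    - intros [b h]; apply pr_rst in h as [h hb]. apply (funcs_pr _ _ hF) in h as [_ ->]; eauto.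
    - intros (b & hb & ->); exists b; apply pr_rst; split; auto. apply (funcs_pr _ _ hF); split; auto.
      apply (proj1 (ord_w1 N1) a ha b hb). }
  assert (edom : forall a, a ∈ w1 -> dom (rst F a) = a).
  { intros a ha; apply mem_ext; intros b; rewrite in_dom; split.
    - intros [y h]; apply pr_rst in h; tauto.
    - intros hb; exists (ap F b); apply pr_rst; split; auto. apply (funcs_pr _ _ hF); split; auto.
      apply (proj1 (ord_w1 N1) a ha b hb). }
  assert (G : forall a, a ∈ w1 -> next (ap En a) (ran (rst F a)) (ap F a)).
  { refine (mem_ind _). intros a IH ha.
    assert (IH' : forall b, b ∈ a -> next (ap En b) (ran (rst F b)) (ap F b)).
    { intros b hb; apply IH; auto. apply (proj1 (ord_w1 N1) a ha b hb). }
    rewrite hr by auto. rewrite <- (edom a ha) at 1. apply HP. rewrite (edom a ha). apply next_ex.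
    - intros y hy; apply inR in hy as (b & hb & ->); auto. apply IH'; auto.
    - apply enum_img with (A := a) (F := ap F); [dfn|apply (w1_ctbl N1 ha)|]. intros y hy; apply inR in hy; auto.
    - intros S hS [l Hl] e.
      (* Among finitely many earlier members the latest is almost contained in the others; being
         infinite, it supplies arbitrarily large common elements. *)
      assert (K : forall l' : list M, (forall y, In y l' -> y ∈ ran (rst F a)) -> l' = nil \/
        exists b (m : nat), b ∈ a /\ forall y i, In y l' -> i ∈ ap F b -> nm m ⊆ i -> i ∈ y).
      { clear l Hl. induction l' as [|y l' IHl]; intros hl; [auto|right].
        destruct (proj1 (inR a y ha) (hl y (or_introl eq_refl))) as (c & hc & ->).
        destruct IHl as [->|(b & m & hb & hm)]; [intros z hz; apply hl; right; auto| |].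
        - exists c, 0. split; auto. intros y i [<-|[]] h _; auto.
        - assert (oa := ord_in_w1 N1 ha).
          destruct (ord_trich (ord_elem oa hb) (ord_elem oa hc)) as [h|[h|h]].
          + destruct (IH' c hc) as (_ & _ & hal & _). destruct (hal (ap F b)) as [(m' & hm' & h') _].
            { apply inR; eauto. apply (proj1 (ord_w1 N1) a ha c hc). }
            apply in_om in hm' as [m2 ->]. exists c, (m + m2). split; auto. intros y i [<-|hy] hi hmi; auto.
            apply hm; auto. apply h'; auto. eapply sub_trans; [|exact hmi]; apply nm_sub; lia.
            eapply sub_trans; [|exact hmi]; apply nm_sub; lia.
          + subst c. exists b, m; split; auto. intros y i [<-|hy] hi hmi; auto.
          + destruct (IH' b hb) as (_ & _ & hal & _). destruct (hal (ap F c)) as [(m' & hm' & h') _].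
            { apply inR; eauto. apply (proj1 (ord_w1 N1) a ha b hb). }
            apply in_om in hm' as [m2 ->]. exists b, (m + m2). split; auto. intros y i [<-|hy] hi hmi.
            apply h'; auto. eapply sub_trans; [|exact hmi]; apply nm_sub; lia.
            apply hm; auto. eapply sub_trans; [|exact hmi]; apply nm_sub; lia. }
      destruct (K l) as [->|(b & m & hb & hm)]; [intros y hy; apply hS, Hl, hy| |].
      + exists e; split; auto. intros y hy; apply Hl in hy as [].
      + destruct (IH' b hb) as (hom & hinf & _). destruct (hinf (nm (m + e)) (nm_om _)) as (i & hi & hmi).
        assert (hio := hom i hi). apply in_om in hio as [i' ->]. apply nm_sub in hmi. exists i'; split; [lia|].
        intros y hy. apply (hm y); [apply Hl, hy|auto|apply nm_sub; lia]. }
  assert (refl : forall x, almost x x) by (intros x; exists emp; split; [apply (@nm_om M 0)|auto]).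
  set (X := cup Fin0 (ran F)).
  assert (inX : forall z, z ∈ ran F <-> exists a, a ∈ w1 /\ z = ap F a).
  { intros z; rewrite in_ran; split; intros [a h]; [apply (funcs_pr _ _ hF) in h; eauto|exists a; apply (funcs_pr _ _ hF); auto]. }
  exists X. split; [apply sub_cup_l|split; [|split]].
  - intros z hz; apply in_pow. apply in_cup in hz as [hz|hz]; [apply in_Fins in hz; tauto|].
    apply inX in hz as (a & ha & ->). apply (G a ha).
  - intros eX. apply (w1_unctbl N1). apply enum_rel with (A := X) (R := fun x a => ap F a = x); auto.
    + dfn.
    + intros a ha; exists (ap F a); split; auto. apply in_cup; right; apply inX; eauto.
    + assert (ne : forall a b, b ∈ w1 -> a ∈ b -> ap F a <> ap F b).
      { intros a b hb ha e. destruct (G b hb) as (_ & _ & h & _). destruct (h (ap F a)) as [_ n]; [apply inR; eauto|].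
        apply n; rewrite e; auto. }
      intros x a b ha hb h1 h2. destruct (ord_trich (ord_in_w1 N1 ha) (ord_in_w1 N1 hb)) as [h|[h|h]]; auto.
      destruct (ne a b hb h); congruence. destruct (ne b a ha h); congruence.
  - intros V hV cV. destruct (hEn hV) as (a & ha & ea). destruct (G a ha) as (_ & _ & _ & h). rewrite ea in h.
    destruct h as (A & U & hs & hc); auto.
    { eapply wcover_sub; [|exact cV]. intros z hz; apply in_cup; apply in_cup in hz as [hz|hz]; auto.
      right. apply inR in hz as (b & hb & ->); auto. apply inX; exists b; split; auto. apply (proj1 (ord_w1 N1) a ha b hb). }
    exists A, U; split; auto. intros z hz. apply in_cup in hz as [hz|hz].
    + apply in_Fins in hz as [hzo hz]. apply hc; auto. right.
      destruct (fin_incr (a := z) (u := fun n : nat => nm n)) as [n hn]; auto.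
      { intros m n h; apply nm_sub; auto. }
      { intros i hi; apply hzo, in_om in hi as [i' ->]. exists (S i'); apply nm_lt; lia. }
      exists (nm n); split; [apply nm_om|]. intros i hi h. apply hn in hi. apply h in hi. destruct (mem_irr hi).
    + apply inX in hz as (b & hb & ->). apply hc; [apply (G b hb)|].
      destruct (ord_trich (ord_in_w1 N1 hb) (ord_in_w1 N1 ha)) as [h|[->|h]]; auto.
      * left; apply inR; eauto.
      * right. destruct (G b hb) as (_ & _ & h' & _). apply h', inR; eauto.
Qed.
End Tower.

(** * Enumeration of the coded sequences under CH *)

Section ContinuumHypothesis.
Context {M : zermelo}.
Implicit Types x y z w u a b f g V : M.
Hypothesis WO : forall u : M, exists w, wo w u.
Variable w1 : M.
Hypothesis N1 : is_next_cardinal mem om w1.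
Lemma cantor : ~ enum (pow (@om M)).
Proof.
  intros [f hf]. destruct (hf (sep om (fun i => i ∉ ap f i))) as [n hn].
  { apply in_pow; intros z; rewrite in_sep by dfn; tauto. }
  assert (h : nm n ∈ sep om (fun i => i ∉ ap f i) <-> nm n ∉ ap f (nm n)).
  { rewrite in_sep by dfn. split; [tauto|]. auto using nm_om. }
  rewrite hn in h. tauto.
Qed.
(** The first uncountable cardinal injects into the power set of [om] with uncountable image, so CH
    maps this image onto the whole power set. Subsets of the countable set of pairs in [prod om Bas]
    are coded by subsets of [om]. *)
Lemma CH_enumeration : CH (@mem M) -> exists En : M, forall V, V ⊆ prod om Bas -> exists a, a ∈ w1 /\ ap En a = V.
Proof.
  intros (w & P & hw & hP & hCH). apply is_omega_iff in hw; subst w. apply is_power_iff in hP; subst P.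
  destruct (uncountable_inj WO cantor (ord_w1 N1) (fun a h => w1_ctbl N1 h)) as (f & hf & fi).
  pose (S := sep (pow om) (fun x => exists a, a ∈ w1 /\ x = ap f a)).
  assert (inS : forall x, x ∈ S <-> exists a, a ∈ w1 /\ x = ap f a).
  { intros x; unfold S; rewrite in_sep by dfn. split; [tauto|]. intros (a & ha & ->); split; eauto. }
  destruct (hCH S) as [h|h].
  - intros x hx; unfold S in hx; rewrite in_sep in hx by dfn; tauto.
  - exfalso. apply countable_iff in h. apply (w1_unctbl N1). apply enum_rel with (A := S) (R := fun x a => a ∈ w1 /\ ap f a = x); auto.
    + dfn.
    + intros a ha; exists (ap f a); split; auto. apply inS; eauto.
    + intros x a b ha hb [_ <-] [_ e]; auto.
  - destruct h as (g & hg & _ & hsur). apply is_fun_iff in hg.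
    assert (eB : enum (prod om (@Bas M))).
    { apply enum_prod; [apply enum_om|]. apply enum_Fins; auto. apply enum_prod; [|apply enum_om]. apply enum_Fins; auto. apply enum_om. }
    apply enum_iff_inj in eB as (e & he & ei).
    pose (Q a := sep (prod om Bas) (fun z => ap e z ∈ ap g (ap f a))).
    assert (DQ : D1T Q) by (unfold Q; dfn).
    exists (lam w1 (pow (prod om Bas)) Q). intros V hV.
    pose (s := sep om (fun i => exists z, z ∈ V /\ i = ap e z)).
    assert (hs : s ∈ pow om) by (apply in_pow; intros i; unfold s; rewrite in_sep by dfn; tauto).
    destruct (hsur s hs) as (x & hx & hxs). apply app_iff, (funcs_pr _ _ hg) in hxs as [_ es].
    apply inS in hx as (a & ha & ->). exists a; split; auto. rewrite ap_lam; auto.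
    + apply mem_ext; intros z; unfold Q; rewrite in_sep, <- es by dfn. unfold s; rewrite in_sep by dfn. split.
      * intros (hz & _ & z' & hz' & ez). apply ei in ez; subst; auto.
      * intros hz; split; auto. split; eauto.
    + apply in_pow; intros z; unfold Q; rewrite in_sep by dfn; tauto.
Qed.
End ContinuumHypothesis.

(** * Preservation of the selection principle *)

Section Preservation.
Context {M : zermelo}.
Hypothesis WO : forall u : M, exists w, wo w u.
Variable w2 : M.
Notation Pos := (Pos w2).
Notation FS := (FS w2).
Variable G : M -> Prop.
Hypothesis GG : generic Pos G.
Variable N : zermelo.
Variable j : M -> N.
Hypothesis j_in : forall (z : N) x, z ∈ j x <-> exists c, c ∈ x /\ z = j c.
Hypothesis j_inj : forall x y, j x = j y -> x = y.
Hypothesis reps : forall (A : N) a, exists R, is_rep w2 G j A a R.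

Lemma jm' x y : j x ∈ j y <-> x ∈ y. Proof. apply j_mem; auto. Qed.
Lemma jp' x y : j (pr x y) = pr (j x) (j y). Proof. apply j_pr; auto. Qed.
Lemma j_un a : j (un a) = un (j a).
Proof.
  apply mem_ext; intros z; rewrite j_in, in_un. split.
  - intros (c & h & ->). apply in_un in h as (y & h1 & h2). exists (j y); rewrite !jm'; auto.
  - intros (y & hy & hz). apply j_in in hy as (y' & hy & ->). apply j_in in hz as (c & hc & ->). exists c; split; auto. apply in_un; eauto.
Qed.
Lemma j_ap f x : j (ap f x) = ap (j f) (j x).
Proof.
  unfold ap. rewrite j_un. f_equal. apply mem_ext; intros z; rewrite j_in, in_sep by dfn. rewrite <- !j_un. split.
  - intros (c & h & ->). rewrite in_sep in h by dfn. rewrite <- jp', !jm'; auto.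
  - intros [h1 h2]. apply j_in in h1 as (c & hc & ->). rewrite <- jp', jm' in h2. exists c; split; auto. rewrite in_sep by dfn; auto.
Qed.
Lemma j_cap a b : j (cap a b) = cap (j a) (j b).
Proof.
  apply mem_ext; intros z; rewrite j_in, in_cap. split.
  - intros (c & h & ->). apply in_cap in h. rewrite !jm'; auto.
  - intros [h1 h2]. apply j_in in h1 as (c & hc & ->). rewrite jm' in h2. exists c; split; auto. apply in_cap; auto.
Qed.
Lemma j_Op b z : b ∈ Bas -> Op b z <-> Op (j b) (j z).
Proof.
  intros hb. split.
  - intros (t & m & hm & h & e). exists (j t), (j m). rewrite <- (j_om j_in j_inj), !jm', <- jp', jm', <- j_cap, e; auto.
  - intros (t & m & hm & h & e). apply j_in in h as (c & hc & e'). destruct (proj2 (Bas_all hb) c hc) as (t' & m' & -> & hm').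
    rewrite jp' in e'. apply pr_inj in e' as [-> ->]. rewrite <- j_cap in e. apply j_inj in e. exists t', m'; auto.
Qed.
Lemma j_fin a : fin a -> fin (j a).
Proof.
  intros [l Hl]; exists (map j l). intros z; rewrite j_in, in_map_iff. split; intros (c & h & h'); exists c;
    [rewrite <- Hl; auto|rewrite Hl; auto].
Qed.
Lemma fin_j (F : N) x : fin F -> F ⊆ j x -> exists F', F = j F' /\ fin F' /\ F' ⊆ x.
Proof.
  intros hF h. apply fin_eq in hF as (l & -> & _).
  assert (H : exists l', forall z, In z l <-> exists c, In c l' /\ z = j c).
  { assert (h' : forall z, In z l -> exists c, z = j c) by (intros z hz; apply in_fset, h, j_in in hz as (c & _ & e); eauto).
    clear h. induction l as [|z l IH]; [exists nil; intros z; split; [intros []|intros (c & [] & _)]|].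
    destruct IH as [l' H]; [intros; apply h'; right; auto|]. destruct (h' z) as [c ->]; [left; auto|].
    exists (c :: l'). intros z; simpl. rewrite H. split.
    - intros [<-|(c' & h1 & h2)]; [exists c; auto|exists c'; auto].
    - intros (c' & [<-|h1] & ->); eauto. }
  destruct H as [l' H]. assert (e : fset l = j (fset l')).
  { apply mem_ext; intros z; rewrite in_fset, H, j_in. split; intros (c & h1 & h2); exists c; rewrite in_fset in *; auto. }
  exists (fset l'). split; [auto|split; [apply fin_fset|]]. intros z hz. apply jm', h. rewrite e; apply jm'; auto.
Qed.

Variable X : M.
Hypothesis sel : forall V, V ⊆ prod om Bas -> wcover V X -> exists A U, selects V A U /\ forall z, z ∈ X -> covered A U z.
Lemma preserved (DD : N) : DD ⊆ j Bas ->
  (forall F, F ⊆ j X -> fin F -> exists b, b ∈ DD /\ forall z, z ∈ F -> Op b z) ->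
  exists A U : N, (forall e : nat, exists n p, e <= n /\ nm n ∈ A /\ p ∈ nm n /\ ap U (pr (nm n) p) ∈ DD) /\
    forall z, z ∈ j X -> covered A U z.
Proof.
  intros hDB hD. destruct (reps DD Bas) as [R hR]. assert (hR' := hR). destruct hR' as [nR tR].
  assert (eB : enum (@Bas M)).
  { apply enum_Fins; auto. apply enum_prod; [|apply enum_om]. apply enum_Fins; auto. apply enum_om. }
  destruct (@support _ WO w2 Bas (fun b q => pr b q ∈ R)) as (C & hC & eC & sC); auto. { dfn. }
  (* A bad q has a finite F covered by no code that an extension of q puts into DD. The covering
     property of DD keeps bad conditions out of G, so some p0 in G has no bad extension. *)
  pose (Bad q := exists F, F ⊆ X /\ finite mem F /\ forall b r, b ∈ Bas -> r ∈ Pos -> q ⊆ r -> pr b r ∈ R -> ~ forall z, z ∈ F -> Op b z).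
  destruct (gen GG (A := Bad)) as [(q & hq & F & hF & fF & hb)|(p0 & hp0 & no)].
  { unfold Bad, Op, cap; dfn. }
  { exfalso. apply finite_iff in fF. destruct (hD (j F)) as (b & hbD & hcov); [|apply j_fin; auto|].
    { intros z hz; apply j_in in hz as (c & hc & ->). apply jm'; auto. }
    assert (hbB := hDB b hbD). apply j_in in hbB as (b' & hb' & ->). apply tR in hbD as (p & hp & h); auto.
    destruct (G_dir GG hp hq) as (r & hr & k1 & k2). apply (hb b' r hb' (G_pos GG hr) k2).
    - apply (proj1 (proj2 nR)) with p; auto. apply (G_pos GG hr).
    - intros z hz; apply j_Op; auto. apply hcov, jm'; auto. }
  assert (p0P := G_pos GG hp0).
  destruct (enum_FS WO w2 eC) as [f hf].
  pose (V := sep (prod om Bas) (fun z => exists n b, z = pr n b /\ ((rs p0 C ⊆ ap f n /\ ap f n ∈ FS C) -> exists q, q ∈ FS C /\ ap f n ⊆ q /\ pr b q ∈ R))).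
  assert (hV : forall n b, pr n b ∈ V <-> n ∈ om /\ b ∈ Bas /\ ((rs p0 C ⊆ ap f n /\ ap f n ∈ FS C) -> exists q, q ∈ FS C /\ ap f n ⊆ q /\ pr b q ∈ R)).
  { intros n b; unfold V; rewrite in_sep, pr_prod by dfn. split.
    - intros [h (n' & b' & e & h')]; apply pr_inj in e as [<- <-]; tauto.
    - intros (h1 & h2 & h3); split; eauto. }
  destruct (sel (V := V)) as (A & U & (sA & sinf & sV) & cov).
  { intros z hz; unfold V in hz; rewrite in_sep in hz by dfn; tauto. }
  { intros p F hp hF fF. destruct (classic (rs p0 C ⊆ ap f p /\ ap f p ∈ FS C)) as [[h1 h2]|h].
    - assert (c := amalg p0P h2 h1).
      destruct (classic (Bad (cup p0 (ap f p)))) as [hbad|hbad]; [destruct (no _ c (@sub_cup_l _ _ _) hbad)|].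
      assert (k : exists b r, b ∈ Bas /\ r ∈ Pos /\ cup p0 (ap f p) ⊆ r /\ pr b r ∈ R /\ forall z, z ∈ F -> Op b z).
      { apply NNPP; intros n. apply hbad. exists F; split; [auto|split; [auto|]]. intros b r k1 k2 k3 k4 k5. apply n; exists b, r; auto. }
      destruct k as (b & r & k1 & k2 & k3 & k4 & k5). exists b; split; [auto|split; [|auto]]. apply hV; split; [auto|split; [auto|]].
      intros _. apply (sC b (ap f p)); auto. exists r; repeat split; auto. eapply sub_trans; [apply sub_cup_r|exact k3].
    - destruct (wcover_all hp hF fF) as (b & k1 & k2 & k3). exists b; split; [auto|split; [|auto]]. apply hV; tauto. }
  exists (j A), (j U). split.
  - intros e. destruct (gen GG (A := fun t => exists n p, n ∈ A /\ nm e ⊆ n /\ p ∈ n /\ pr (ap U (pr n p)) t ∈ R)) as [(t & ht & n & p & h1 & h2 & h3 & h4)|(p1 & hp1 & no1)].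
    { dfn. }
    + assert (hno := sA n h1). apply in_om in hno as [n' ->]. exists n', (j p). apply nm_sub in h2.
      assert (hb : ap U (pr (nm n') p) ∈ Bas) by (apply (proj1 nR), pr_prod in h4; tauto).
      rewrite <- !(j_nm j_in j_inj), <- jp', <- j_ap, !jm'. split; [auto|split; [auto|split; [auto|]]]. apply tR; eauto.
    + exfalso. destruct (G_dir GG hp0 hp1) as (p2 & hp2 & k1 & k2). assert (P2 := G_pos GG hp2).
      (* The trace of p2 on C has a number n1. A late n in A offers the code U(n, n1), which some
         extension of that trace on C puts into DD; amalgamated with p2 it contradicts the choice of
         p1. *)
      destruct (hf (rs p2 C) (rs_FS C P2)) as [n1 e1].
      destruct (sinf (nm (S (e + n1))) (nm_om _)) as (n & hn & hle). assert (hno := sA n hn). apply in_om in hno as [n' ->].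
      apply nm_sub in hle. assert (hlt : @nm M n1 ∈ nm n') by (apply nm_lt; lia).
      assert (h := sV _ _ hn hlt). apply hV in h as (_ & hB & h). rewrite e1 in h.
      destruct h as (q & hq & pq & hqR); [split; [apply rs_mono; auto|apply rs_FS; auto]|].
      assert (c := amalg P2 hq pq). apply (no1 _ c); [eapply sub_trans; [exact k2|apply sub_cup_l]|].
      exists (nm n'), (nm n1). split; [auto|split; [apply nm_sub; lia|split; [auto|]]].
      apply (proj1 (proj2 nR)) with q; auto. apply sub_cup_r.
  - intros z hz. apply j_in in hz as (x & hx & ->). destruct (cov x hx) as (n0 & hn0 & h). apply in_om in hn0 as [n0' ->].
    exists (j (nm n0')). rewrite (j_nm j_in j_inj). split; [apply nm_om|]. intros n p hn hle hp.
    apply j_in in hn as (n1 & hn & ->). apply j_in in hp as (p1 & hp & ->).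
    assert (hno := sA n1 hn). apply in_om in hno as [n' ->]. rewrite (j_nm j_in j_inj) in hle. apply nm_sub in hle.
    rewrite <- jp', <- j_ap. apply j_Op; [|apply h; auto; apply nm_sub; auto]. assert (h' := sV _ _ hn hp). apply hV in h'; tauto.
Qed.
End Preservation.

(** * The reals as cuts *)

Section Rationals.
Local Open Scope R_scope.
Definition qv (a b c : nat) : R := (INR a - INR b) / INR (S c).
Lemma INR_S_pos c : 0 < INR (S c). Proof. apply lt_0_INR; lia. Qed.
Lemma qv_dense x y : x < y -> exists a b c, x < qv a b c /\ qv a b c < y.
Proof.
  intros h. destruct (INR_unbounded (/ (y - x))) as [c hc].
  assert (hn := INR_S_pos c). set (n := INR (S c)) in *.
  assert (h1 : 1 < n * (y - x)).
  { assert (c1 : / (y - x) < n) by (unfold n; rewrite S_INR; lra).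
    apply Rmult_lt_compat_r with (r := y - x) in c1; [|lra]. rewrite Rinv_l in c1; lra. }
  destruct (archimed (n * x)) as [u1 u2]. set (k := up (n * x)) in *.
  exists (Z.to_nat k), (Z.to_nat (- k)), c.
  assert (e : INR (Z.to_nat k) - INR (Z.to_nat (- k)) = IZR k).
  { rewrite !INR_IZR_INZ, <- minus_IZR. f_equal. lia. }
  unfold qv; rewrite e. fold n. split.
  - apply Rmult_lt_reg_r with n; auto. unfold Rdiv; rewrite Rmult_assoc, Rinv_l; lra.
  - apply Rmult_lt_reg_r with n; auto. unfold Rdiv; rewrite Rmult_assoc, Rinv_l; [|lra]. lra.
Qed.
Lemma INR_lt_iff (m n : nat) : (m < n)%nat <-> INR m < INR n.
Proof. split; [apply lt_INR|apply INR_lt]. Qed.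
Lemma frac_lt (x y n : R) : 0 < n -> x / n < y <-> x < y * n.
Proof.
  intros h. split; intros k.
  - apply Rmult_lt_compat_r with (r := n) in k; auto. unfold Rdiv in k; rewrite Rmult_assoc, Rinv_l in k; lra.
  - apply Rmult_lt_reg_r with n; auto. unfold Rdiv; rewrite Rmult_assoc, Rinv_l; lra.
Qed.
(** A bilinear function on a box is minimal at a corner: one factor at a time is moved to an
    endpoint, according to the sign of the other. *)
Lemma corner_bound q x y l1 h1 l2 h2 : l1 <= x -> x <= h1 -> l2 <= y -> y <= h2 ->
  q < l1 * l2 -> q < l1 * h2 -> q < h1 * l2 -> q < h1 * h2 -> q < x * y.
Proof.
  intros. assert (A : q < l1 * y).
  { destruct (Rle_dec 0 l1); [assert (l1 * l2 <= l1 * y) by (apply Rmult_le_compat_l; auto)|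
      assert (l1 * h2 <= l1 * y) by (apply Rmult_le_compat_neg_l; lra)]; lra. }
  assert (B : q < h1 * y).
  { destruct (Rle_dec 0 h1); [assert (h1 * l2 <= h1 * y) by (apply Rmult_le_compat_l; auto)|
      assert (h1 * h2 <= h1 * y) by (apply Rmult_le_compat_neg_l; lra)]; lra. }
  destruct (Rle_dec 0 y); [assert (l1 * y <= x * y) by (apply Rmult_le_compat_r; auto)|]; [lra|].
  assert (h1 * y <= x * y); [|lra]. rewrite !(Rmult_comm _ y). apply Rmult_le_compat_neg_l; lra.
Qed.
(** With K = |x| + |y| + 1, moving both factors by less than e <= 1 changes the product by at most e
    K; the choice of e makes this at most half of the gap between q and x y. *)
Lemma corner_ex q x y : q < x * y -> exists e, 0 < e /\ forall l1 h1 l2 h2,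
  x - e < l1 -> l1 <= x -> x <= h1 -> h1 < x + e -> y - e < l2 -> l2 <= y -> y <= h2 -> h2 < y + e ->
  q < l1 * l2 /\ q < l1 * h2 /\ q < h1 * l2 /\ q < h1 * h2.
Proof.
  intros h. set (K := Rabs x + Rabs y + 1). assert (hx := Rabs_pos x). assert (hy := Rabs_pos y).
  assert (hK : 1 <= K) by (unfold K; lra).
  set (e := Rmin 1 ((x * y - q) / (2 * K))). exists e.
  assert (he : 0 < e). { unfold e; apply Rmin_glb_lt; [lra|]. apply Rdiv_lt_0_compat; lra. }
  assert (e1 : e <= 1) by apply Rmin_l.
  assert (e2 : e * (2 * K) <= x * y - q).
  { assert (c : e <= (x * y - q) / (2 * K)) by apply Rmin_r. apply Rmult_le_compat_r with (r := 2 * K) in c; [|lra].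
    unfold Rdiv in c; rewrite Rmult_assoc, Rinv_l in c; lra. }
  assert (key : forall u v, Rabs (u - x) < e -> Rabs (v - y) < e -> q < u * v).
  { intros u v hu hv. replace (u * v) with (x * y + ((u - x) * v + x * (v - y))) by ring.
    assert (b1 : Rabs ((u - x) * v + x * (v - y)) <= e * (Rabs y + 1) + Rabs x * e).
    { eapply Rle_trans; [apply Rabs_triang|]. rewrite !Rabs_mult. apply Rplus_le_compat.
      - apply Rmult_le_compat; try apply Rabs_pos; [lra|]. replace v with (y + (v - y)) by ring.
        eapply Rle_trans; [apply Rabs_triang|lra].
      - apply Rmult_le_compat_l; [apply Rabs_pos|lra]. }
    assert (b2 : e * (Rabs y + 1) + Rabs x * e = e * K) by (unfold K; ring).
    assert (b3 : 0 < e * K) by (apply Rmult_lt_0_compat; lra).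
    assert (b4 := Rle_abs (- ((u - x) * v + x * (v - y)))). rewrite Rabs_Ropp in b4. lra. }
  split; auto. intros l1 h1 l2 h2 k1 k2 k3 k4 k5 k6 k7 k8.
  assert (Rabs (l1 - x) < e) by (apply Rabs_def1; lra). assert (Rabs (h1 - x) < e) by (apply Rabs_def1; lra).
  assert (Rabs (l2 - y) < e) by (apply Rabs_def1; lra). assert (Rabs (h2 - y) < e) by (apply Rabs_def1; lra).
  repeat split; apply key; auto.
Qed.
End Rationals.

Section Cuts.
Context {N : zermelo}.
Implicit Types x y z u v w f S : N.
Definition tri (a b c : nat) : N := pr (nm a) (pr (nm b) (nm c)).
Definition QQ : N := prod om (prod om om).
Lemma in_QQ z : z ∈ QQ <-> exists a b c, z = tri a b c.
Proof.
  unfold QQ, tri; rewrite in_prod; split.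
  - intros (x & y & hx & hy & ->). apply in_prod in hy as (y1 & y2 & h1 & h2 & ->).
    apply in_om in hx as [a ->], h1 as [b ->], h2 as [c ->]. eauto.
  - intros (a & b & c & ->). exists (nm a), (pr (nm b) (nm c)). rewrite pr_prod; auto using nm_om.
Qed.
Definition pa x y : N := ap Plus (pr x y).
Definition ta x y : N := ap Times (pr x y).
(** Denominators are cleared and subtractions moved across, so that only sums and products of
    naturals occur. [ltadd] and [ltmul] express u < v + w and u < v w in the same manner. *)
Definition ltq u v := exists a b c a' b' c', u = pr a (pr b c) /\ v = pr a' (pr b' c') /\
  pa (ta a (succ c')) (ta b' (succ c)) ∈ pa (ta a' (succ c)) (ta b (succ c')).
Definition ltadd u v w := exists a b c a1 b1 c1 a2 b2 c2, u = pr a (pr b c) /\ v = pr a1 (pr b1 c1) /\ w = pr a2 (pr b2 c2) /\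
  pa (pa (ta a (ta (succ c1) (succ c2))) (ta b1 (ta (succ c) (succ c2)))) (ta b2 (ta (succ c) (succ c1))) ∈
  pa (pa (ta a1 (ta (succ c) (succ c2))) (ta a2 (ta (succ c) (succ c1)))) (ta b (ta (succ c1) (succ c2))).
Definition ltmul u v w := exists a b c a1 b1 c1 a2 b2 c2, u = pr a (pr b c) /\ v = pr a1 (pr b1 c1) /\ w = pr a2 (pr b2 c2) /\
  pa (ta a (ta (succ c1) (succ c2))) (ta (pa (ta a1 b2) (ta b1 a2)) (succ c)) ∈
  pa (ta (pa (ta a1 a2) (ta b1 b2)) (succ c)) (ta b (ta (succ c1) (succ c2))).
Lemma nm_S n : succ (nm n) = @nm N (S n). Proof. reflexivity. Qed.
Lemma tri_inj a b c x y z : tri a b c = pr x (pr y z) -> x = nm a /\ y = nm b /\ z = nm c.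
Proof. intros e; apply pr_inj in e as [<- e]; apply pr_inj in e as [<- <-]; auto. Qed.
Lemma ltq_iff a b c a' b' c' : ltq (tri a b c) (tri a' b' c') <-> (qv a b c < qv a' b' c')%R.
Proof.
  assert (H : (a * S c' + b' * S c < a' * S c + b * S c')%nat <-> (qv a b c < qv a' b' c')%R).
  { unfold qv. rewrite INR_lt_iff, !plus_INR, !mult_INR. assert (h := INR_S_pos c). assert (h' := INR_S_pos c').
    rewrite frac_lt by auto. replace ((INR a' - INR b') / INR (S c') * INR (S c))%R with (((INR a' - INR b') * INR (S c)) / INR (S c'))%R by (field; lra).
    split; intros k.
    - apply Rnot_ge_lt; intros g. apply Rge_le in g. apply Rmult_le_compat_r with (r := INR (S c')) in g; [|lra].
      unfold Rdiv in g; rewrite (Rmult_assoc _ (/ _)), Rinv_l in g by lra. lra.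
    - apply Rmult_lt_compat_r with (r := INR (S c')) in k; auto. unfold Rdiv in k; rewrite (Rmult_assoc _ (/ _)), Rinv_l in k by lra. lra. }
  rewrite <- H. unfold ltq, pa, ta; split.
  - intros (x & y & z & x' & y' & z' & e & e' & h). apply tri_inj in e as (-> & -> & ->), e' as (-> & -> & ->).
    rewrite !nm_S, !ap_Times, !ap_Plus, nm_mem in h. exact h.
  - intros h. exists (nm a), (nm b), (nm c), (nm a'), (nm b'), (nm c'). split; [auto|split; [auto|]].
    rewrite !nm_S, !ap_Times, !ap_Plus, nm_mem. exact h.
Qed.
Lemma ltadd_iff a b c a1 b1 c1 a2 b2 c2 :
  ltadd (tri a b c) (tri a1 b1 c1) (tri a2 b2 c2) <-> (qv a b c < qv a1 b1 c1 + qv a2 b2 c2)%R.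
Proof.
  assert (H : (a * (S c1 * S c2) + b1 * (S c * S c2) + b2 * (S c * S c1) < a1 * (S c * S c2) + a2 * (S c * S c1) + b * (S c1 * S c2))%nat
     <-> (qv a b c < qv a1 b1 c1 + qv a2 b2 c2)%R).
  { unfold qv. rewrite INR_lt_iff, !plus_INR, !mult_INR.
    assert (h := INR_S_pos c). assert (h1 := INR_S_pos c1). assert (h2 := INR_S_pos c2).
    set (n := INR (S c)) in *. set (n1 := INR (S c1)) in *. set (n2 := INR (S c2)) in *.
    assert (p : (0 < n * (n1 * n2))%R) by (repeat apply Rmult_lt_0_compat; auto).
    assert (E : forall X Y : R, (X < Y)%R <-> (X * (n * (n1 * n2)) < Y * (n * (n1 * n2)))%R).
    { intros X Y; split; intros k; [apply Rmult_lt_compat_r; auto|eapply Rmult_lt_reg_r; eauto]. }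
    rewrite (E ((INR a - INR b) / n)%R).
    replace ((INR a - INR b) / n * (n * (n1 * n2)))%R with ((INR a - INR b) * (n1 * n2))%R by (field; lra).
    replace (((INR a1 - INR b1) / n1 + (INR a2 - INR b2) / n2) * (n * (n1 * n2)))%R with
      ((INR a1 - INR b1) * (n * n2) + (INR a2 - INR b2) * (n * n1))%R by (field; lra).
    split; intros; lra. }
  rewrite <- H. unfold ltadd, pa, ta; split.
  - intros (x & y & z & x1 & y1 & z1 & x2 & y2 & z2 & e & e1 & e2 & h).
    apply tri_inj in e as (-> & -> & ->), e1 as (-> & -> & ->), e2 as (-> & -> & ->).
    rewrite !nm_S, !ap_Times, !ap_Plus, nm_mem in h. exact h.
  - intros h. exists (nm a), (nm b), (nm c), (nm a1), (nm b1), (nm c1), (nm a2), (nm b2), (nm c2).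
    split; [auto|split; [auto|split; [auto|]]]. rewrite !nm_S, !ap_Times, !ap_Plus, nm_mem. exact h.
Qed.
Lemma ltmul_iff a b c a1 b1 c1 a2 b2 c2 :
  ltmul (tri a b c) (tri a1 b1 c1) (tri a2 b2 c2) <-> (qv a b c < qv a1 b1 c1 * qv a2 b2 c2)%R.
Proof.
  assert (H : (a * (S c1 * S c2) + (a1 * b2 + b1 * a2) * S c < (a1 * a2 + b1 * b2) * S c + b * (S c1 * S c2))%nat
     <-> (qv a b c < qv a1 b1 c1 * qv a2 b2 c2)%R).
  { unfold qv. rewrite INR_lt_iff. rewrite !plus_INR, !mult_INR, !plus_INR, !mult_INR.
    assert (h := INR_S_pos c). assert (h1 := INR_S_pos c1). assert (h2 := INR_S_pos c2).
    set (n := INR (S c)) in *. set (n1 := INR (S c1)) in *. set (n2 := INR (S c2)) in *.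
    assert (p : (0 < n * (n1 * n2))%R) by (repeat apply Rmult_lt_0_compat; auto).
    assert (E : forall X Y : R, (X < Y)%R <-> (X * (n * (n1 * n2)) < Y * (n * (n1 * n2)))%R).
    { intros X Y; split; intros k; [apply Rmult_lt_compat_r; auto|eapply Rmult_lt_reg_r; eauto]. }
    rewrite (E ((INR a - INR b) / n)%R).
    replace ((INR a - INR b) / n * (n * (n1 * n2)))%R with ((INR a - INR b) * (n1 * n2))%R by (field; lra).
    replace (((INR a1 - INR b1) / n1 * ((INR a2 - INR b2) / n2)) * (n * (n1 * n2)))%R with
      ((INR a1 - INR b1) * (INR a2 - INR b2) * n)%R by (field; lra).
    split; intros; lra. }
  rewrite <- H. unfold ltmul, pa, ta; split.
  - intros (x & y & z & x1 & y1 & z1 & x2 & y2 & z2 & e & e1 & e2 & h).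
    apply tri_inj in e as (-> & -> & ->), e1 as (-> & -> & ->), e2 as (-> & -> & ->).
    rewrite !nm_S, !ap_Times, !ap_Plus, !ap_Times, !ap_Plus, nm_mem in h. exact h.
  - intros h. exists (nm a), (nm b), (nm c), (nm a1), (nm b1), (nm c1), (nm a2), (nm b2), (nm c2).
    split; [auto|split; [auto|split; [auto|]]]. rewrite !nm_S, !ap_Times, !ap_Plus, !ap_Times, !ap_Plus, nm_mem. exact h.
Qed.

(** Reals of the host logic serve as a calculus for the cuts of N. Every element of [Rs] represents
    a unique r, but the cut of a given r need not belong to N. *)
Definition isrep x (r : R) := x ⊆ QQ /\ forall a b c, tri a b c ∈ x <-> (qv a b c < r)%R.
Lemma isrep_inj x y r : isrep x r -> isrep y r -> x = y.
Proof.
  intros [h1 h2] [k1 k2]; apply sub_antisym; intros z hz.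
  - assert (h := h1 z hz). apply in_QQ in h as (a & b & c & ->). apply k2, h2, hz.
  - assert (h := k1 z hz). apply in_QQ in h as (a & b & c & ->). apply h2, k2, hz.
Qed.
Lemma isrep_le x y r s : isrep x r -> isrep y s -> x ⊆ y <-> (r <= s)%R.
Proof.
  intros [h1 h2] [k1 k2]; split.
  - intros h. apply Rnot_lt_le; intros l. destruct (qv_dense l) as (a & b & c & g1 & g2).
    apply h2, h, k2 in g2. lra.
  - intros h z hz. assert (hq := h1 z hz). apply in_QQ in hq as (a & b & c & ->). apply k2. apply h2 in hz. lra.
Qed.
Lemma isrep_eq x r s : isrep x r -> isrep x s -> r = s.
Proof. intros h k. apply Rle_antisym; eapply isrep_le; eauto using sub_refl. Qed.
Definition cut x := (exists z, z ∈ x) /\ (exists z, z ∈ QQ /\ z ∉ x) /\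
  (forall u v, u ∈ x -> v ∈ QQ -> ~ ltq u v -> v ∈ x) /\ (forall u, u ∈ x -> exists v, v ∈ x /\ ltq u v).
Definition Rs : N := sep (pow QQ) cut.
Lemma in_Rs x : x ∈ Rs <-> exists r, isrep x r.
Proof.
  unfold Rs; rewrite in_sep, in_pow by (unfold cut, ltq, pa, ta; dfn). split.
  - intros (hx & (z0 & hz0) & (z1 & hz1 & nz1) & hd & hu).
    destruct (completeness (fun r => exists a b c, tri a b c ∈ x /\ r = qv a b c)) as [r [ub lub]].
    + apply in_QQ in hz1 as (a1 & b1 & c1 & ->). exists (qv a1 b1 c1). intros r (a & b & c & h & ->).
      apply Rnot_lt_le; intros l. apply nz1. apply (hd (tri a b c)); auto. apply in_QQ; eauto. rewrite ltq_iff. lra.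
    + assert (h := hx z0 hz0). apply in_QQ in h as (a & b & c & ->). eauto 6.
    + exists r; split; auto. intros a b c; split.
      * intros h. destruct (hu _ h) as (v & hv & l). assert (hq := hx v hv). apply in_QQ in hq as (a' & b' & c' & ->).
        apply ltq_iff in l. assert (qv a' b' c' <= r)%R by (apply ub; eauto 6). lra.
      * intros h. apply NNPP; intros n. assert (r <= qv a b c)%R; [|lra]. apply lub. intros s (a' & b' & c' & h' & ->).
        apply Rnot_lt_le; intros l. apply n. apply (hd (tri a' b' c')); auto. apply in_QQ; eauto. rewrite ltq_iff; lra.
  - intros (r & hx & h). split; [auto|split; [|split; [|split]]].
    + destruct (@qv_dense (r - 1) r) as (a & b & c & _ & l); [lra|]. exists (tri a b c); apply h; auto.
    + destruct (@qv_dense r (r + 1)) as (a & b & c & l & _); [lra|]. exists (tri a b c). rewrite h, in_QQ. split; [eauto|lra].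
    + intros u v hu hv l. assert (hq := hx u hu). apply in_QQ in hq as (a & b & c & ->), hv as (a' & b' & c' & ->).
      rewrite ltq_iff in l. apply h. apply h in hu. lra.
    + intros u hu. assert (hq := hx u hu). apply in_QQ in hq as (a & b & c & ->). apply h in hu.
      destruct (qv_dense hu) as (a' & b' & c' & l1 & l2). exists (tri a' b' c'). rewrite h, ltq_iff; auto.
Qed.
Definition rv x : R := epsilon (inhabits 0%R) (isrep x).
Lemma rvP x : x ∈ Rs -> isrep x (rv x).
Proof. intros h; apply in_Rs in h. exact (epsilon_spec (inhabits 0%R) (isrep x) h). Qed.
Lemma rv_eq x r : isrep x r -> x ∈ Rs /\ rv x = r.
Proof. intros h; assert (x ∈ Rs) by (apply in_Rs; eauto). split; auto. eapply isrep_eq; eauto. apply rvP; auto. Qed.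
Lemma rv_inj x y : x ∈ Rs -> y ∈ Rs -> rv x = rv y -> x = y.
Proof. intros hx hy e. apply isrep_inj with (rv x); [apply rvP; auto|rewrite e; apply rvP; auto]. Qed.

Definition rc u : N := sep QQ (fun v => ltq v u).
Lemma D1T_rc : D1T rc. Proof. unfold rc, ltq, pa, ta; dfn. Qed.
Lemma isrep_rc a b c : isrep (rc (tri a b c)) (qv a b c).
Proof.
  assert (h : forall v, v ∈ rc (tri a b c) <-> v ∈ QQ /\ ltq v (tri a b c)) by (intros; unfold rc; rewrite in_sep by (unfold ltq, pa, ta; dfn); tauto).
  split; [intros v hv; apply h in hv; tauto|]. intros a' b' c'; rewrite h, ltq_iff, in_QQ. split; [tauto|eauto].
Qed.
Definition addf x y : N := sep QQ (fun u => exists v w, v ∈ x /\ w ∈ y /\ ltadd u v w).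
Lemma D2T_addf : D2T addf. Proof. unfold addf, ltadd, pa, ta; dfn. Qed.
Lemma isrep_add x y r s : isrep x r -> isrep y s -> isrep (addf x y) (r + s).
Proof.
  intros [h1 h2] [k1 k2].
  assert (H : forall u, u ∈ addf x y <-> u ∈ QQ /\ exists v w, v ∈ x /\ w ∈ y /\ ltadd u v w)
    by (intros; unfold addf; rewrite in_sep by (unfold ltadd, pa, ta; dfn); tauto).
  split; [intros u hu; apply H in hu; tauto|]. intros a b c; rewrite H, in_QQ; split.
  - intros [_ (v & w & hv & hw & l)]. assert (g1 := h1 v hv). assert (g2 := k1 w hw).
    apply in_QQ in g1 as (a1 & b1 & c1 & ->), g2 as (a2 & b2 & c2 & ->). apply ltadd_iff in l. apply h2 in hv. apply k2 in hw. lra.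
  - intros l. split; [eauto|]. set (d := ((r + s - qv a b c) / 2)%R).
    destruct (@qv_dense (r - d) r) as (a1 & b1 & c1 & l1 & l2); [unfold d; lra|].
    destruct (@qv_dense (s - d) s) as (a2 & b2 & c2 & l3 & l4); [unfold d; lra|].
    exists (tri a1 b1 c1), (tri a2 b2 c2). rewrite h2, k2, ltadd_iff. unfold d in *; repeat split; auto; lra.
Qed.
(** Interval arithmetic: u is below the product when it is below all four corner products of some
    rational box around (x, y). This treats all signs alike. *)
Definition mulf x y : N := sep QQ (fun u => exists l1 h1 l2 h2, l1 ∈ x /\ h1 ∈ QQ /\ h1 ∉ x /\ l2 ∈ y /\ h2 ∈ QQ /\ h2 ∉ y /\
  ltmul u l1 l2 /\ ltmul u l1 h2 /\ ltmul u h1 l2 /\ ltmul u h1 h2).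
Lemma D2T_mulf : D2T mulf. Proof. unfold mulf, ltmul, pa, ta; dfn. Qed.
Lemma isrep_mul x y r s : isrep x r -> isrep y s -> isrep (mulf x y) (r * s).
Proof.
  intros [h1 h2] [k1 k2].
  assert (H : forall u, u ∈ mulf x y <-> u ∈ QQ /\ exists l1 h1 l2 h2, l1 ∈ x /\ h1 ∈ QQ /\ h1 ∉ x /\ l2 ∈ y /\ h2 ∈ QQ /\ h2 ∉ y /\
    ltmul u l1 l2 /\ ltmul u l1 h2 /\ ltmul u h1 l2 /\ ltmul u h1 h2)
    by (intros; unfold mulf; rewrite in_sep by (unfold ltmul, pa, ta; dfn); tauto).
  split; [intros u hu; apply H in hu; tauto|]. intros a b c; rewrite H, in_QQ; split.
  - intros [_ (u1 & v1 & u2 & v2 & g1 & g2 & g3 & g4 & g5 & g6 & l)]. assert (e1 := h1 _ g1). assert (e2 := k1 _ g4).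
    apply in_QQ in e1 as (a1 & b1 & c1 & ->), e2 as (a2 & b2 & c2 & ->), g2 as (a3 & b3 & c3 & ->), g5 as (a4 & b4 & c4 & ->).
    rewrite !ltmul_iff in l. rewrite h2 in g1, g3. rewrite k2 in g4, g6.
    apply (@corner_bound _ r s (qv a1 b1 c1) (qv a3 b3 c3) (qv a2 b2 c2) (qv a4 b4 c4)); lra.
  - intros l. split; [eauto|]. destruct (corner_ex l) as (e & he & hc).
    destruct (@qv_dense (r - e) r) as (a1 & b1 & c1 & l1 & l2); [lra|].
    destruct (@qv_dense (s - e) s) as (a2 & b2 & c2 & l3 & l4); [lra|].
    destruct (@qv_dense r (r + e)) as (a3 & b3 & c3 & l5 & l6); [lra|].
    destruct (@qv_dense s (s + e)) as (a4 & b4 & c4 & l7 & l8); [lra|].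
    exists (tri a1 b1 c1), (tri a3 b3 c3), (tri a2 b2 c2), (tri a4 b4 c4).
    rewrite !h2, !k2, !ltmul_iff, !in_QQ.
    destruct (hc (qv a1 b1 c1) (qv a3 b3 c3) (qv a2 b2 c2) (qv a4 b4 c4)) as (m1 & m2 & m3 & m4); try lra.
    repeat split; eauto; lra.
Qed.

Definition addN : N := sep (prod (prod Rs Rs) Rs) (fun p => exists x y, p = pr (pr x y) (addf x y)).
Definition mulN : N := sep (prod (prod Rs Rs) Rs) (fun p => exists x y, p = pr (pr x y) (mulf x y)).
Definition leN : N := sep (prod Rs Rs) (fun p => exists x y, p = pr x y /\ x ⊆ y).
Lemma op_iff (f : N -> N -> N) (o : R -> R -> R) : D2T f -> (forall x y r s, isrep x r -> isrep y s -> isrep (f x y) (o r s)) ->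
  forall x y z, app2 mem (sep (prod (prod Rs Rs) Rs) (fun p => exists x y, p = pr (pr x y) (f x y))) x y z <->
    x ∈ Rs /\ y ∈ Rs /\ z ∈ Rs /\ rv z = o (rv x) (rv y).
Proof.
  intros D h x y z. rewrite app2_iff, in_sep, !pr_prod by dfn. split.
  - intros [((hx & hy) & hz) (x' & y' & e)]. apply pr_inj in e as [e ->]; apply pr_inj in e as [<- <-].
    repeat split; auto. apply rv_eq, h; apply rvP; auto.
  - intros (hx & hy & hz & e). split; auto. exists x, y. f_equal.
    assert (k := h x y _ _ (rvP hx) (rvP hy)). apply rv_eq in k as [k1 k2]. apply rv_inj; auto; congruence.
Qed.
Lemma add_iff x y z : app2 mem addN x y z <-> x ∈ Rs /\ y ∈ Rs /\ z ∈ Rs /\ rv z = (rv x + rv y)%R.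
Proof. apply (op_iff D2T_addf isrep_add). Qed.
Lemma mul_iff x y z : app2 mem mulN x y z <-> x ∈ Rs /\ y ∈ Rs /\ z ∈ Rs /\ rv z = (rv x * rv y)%R.
Proof. apply (op_iff D2T_mulf isrep_mul). Qed.
Lemma le_iff x y : app mem leN x y <-> x ∈ Rs /\ y ∈ Rs /\ (rv x <= rv y)%R.
Proof.
  unfold leN; rewrite app_iff, in_sep, pr_prod by dfn. split.
  - intros [[hx hy] (x' & y' & e & h)]. apply pr_inj in e as [<- <-]. repeat split; auto. eapply isrep_le; eauto; apply rvP; auto.
  - intros (hx & hy & h). split; auto. exists x, y; split; auto. eapply isrep_le; eauto; apply rvP; auto.
Qed.
Lemma rat_ex a b c : exists x, x ∈ Rs /\ rv x = qv a b c.
Proof. exists (rc (tri a b c)). apply rv_eq, isrep_rc. Qed.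
Lemma addf_in x y : x ∈ Rs -> y ∈ Rs -> exists z, z ∈ Rs /\ rv z = (rv x + rv y)%R.
Proof. intros hx hy; exists (addf x y). apply rv_eq, isrep_add; apply rvP; auto. Qed.
Lemma mulf_in x y : x ∈ Rs -> y ∈ Rs -> exists z, z ∈ Rs /\ rv z = (rv x * rv y)%R.
Proof. intros hx hy; exists (mulf x y). apply rv_eq, isrep_mul; apply rvP; auto. Qed.
Lemma zero_iff o : is_zero mem Rs addN o <-> o ∈ Rs /\ rv o = 0%R.
Proof.
  unfold is_zero; split; intros [h h']; split; auto.
  - assert (k := h' o h). apply add_iff in k as (_ & _ & _ & k). lra.
  - intros x hx. apply add_iff. repeat split; auto. rewrite h'; ring.
Qed.
Lemma lt_iff' x y : x ∈ Rs -> y ∈ Rs -> lt mem leN x y <-> (rv x < rv y)%R.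
Proof.
  intros hx hy; unfold lt; rewrite le_iff, same_iff. split.
  - intros [(_ & _ & h) ne]. destruct h; auto. destruct ne; apply rv_inj; auto.
  - intros h; split; [repeat split; auto; lra|]. intros ->; lra.
Qed.
Lemma sup_real S : S ⊆ Rs -> (exists x, x ∈ S) -> (exists B : R, forall x, x ∈ S -> (rv x <= B)%R) ->
  exists s, s ∈ Rs /\ (forall x, x ∈ S -> (rv x <= rv s)%R) /\ forall B : R, (forall x, x ∈ S -> (rv x <= B)%R) -> (rv s <= B)%R.
Proof.
  intros hS [x0 h0] [B hB]. destruct (completeness (fun r => exists x, x ∈ S /\ r = rv x)) as [r [ub lub]].
  { exists B; intros r (x & hx & ->); auto. } { eauto. }
  assert (k : isrep (un S) r).
  { split.
    - intros z hz; apply in_un in hz as (x & hx & hz). apply (proj1 (rvP (hS x hx))); auto.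
    - intros a b c; rewrite in_un; split.
      + intros (x & hx & h). apply (rvP (hS x hx)) in h. assert (rv x <= r)%R by (apply ub; eauto). lra.
      + intros h. apply NNPP; intros n. assert (r <= qv a b c)%R; [|lra]. apply lub. intros s (x & hx & ->).
        apply Rnot_lt_le; intros l. apply n. exists x; split; auto. apply (rvP (hS x hx)); auto. }
  apply rv_eq in k as [k1 k2]. exists (un S); split; [auto|rewrite k2; split].
  - intros x hx; apply ub; eauto.
  - intros C hC; apply lub; intros s (x & hx & ->); auto.
Qed.
(** The cut of r lies in N when some definable P singles out the elements of [Rs] up to r, since it
    is then the supremum of a set of N. Negatives and inverses are obtained in this way from
    addition and multiplication. *)
Lemma real_by_sup (P : N -> Prop) (r : R) : D1 P -> (forall x, x ∈ Rs -> P x <-> (rv x <= r)%R) -> exists s, s ∈ Rs /\ rv s = r.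
Proof.
  intros D h.
  assert (inS : forall x, x ∈ sep Rs P <-> x ∈ Rs /\ (rv x <= r)%R).
  { intros x; rewrite in_sep by auto. split; intros [h1 h2]; split; auto; apply h; auto. }
  destruct (@sup_real (sep Rs P)) as (s & hs & ub & lub).
  - intros x hx; apply inS in hx; tauto.
  - destruct (@qv_dense (r - 1) r) as (a & b & c & _ & l); [lra|]. destruct (rat_ex a b c) as (x & hx & e).
    exists x; apply inS; split; auto; lra.
  - exists r; intros x hx; apply inS in hx; tauto.
  - exists s; split; auto. apply Rle_antisym; [apply lub; intros x hx; apply inS in hx; tauto|].
    apply Rnot_lt_le; intros l. destruct (qv_dense l) as (a & b & c & l1 & l2). destruct (rat_ex a b c) as (x & hx & e).
    assert (rv x <= rv s)%R by (apply ub, inS; split; auto; lra). lra.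
Qed.

Theorem reals_ex : is_reals mem Rs addN mulN leN.
Proof.
  assert (bin : forall f : N, (f ⊆ prod (prod Rs Rs) Rs) -> (forall x y, x ∈ Rs -> y ∈ Rs -> exists z, app2 mem f x y z /\ forall z', app2 mem f x y z' -> z' = z) -> is_binop mem f Rs).
  { intros f hf h. exists (prod Rs Rs); split; [apply is_prod_iff; auto|]. split.
    - intros p hp; apply hf, in_prod in hp as (x & y & hx & hy & ->). exists x, y; rewrite is_pair_iff; auto.
    - intros p hp; apply in_prod in hp as (x & y & hx & hy & ->). destruct (h x y hx hy) as (z & hz & u).
      apply app2_iff in hz. exists z; rewrite app_iff; split; auto. intros z' hz'. apply same_iff, u, app2_iff, app_iff, hz'. }
  destruct (rat_ex 0 0 0) as (O & hO & eO). destruct (rat_ex 1 0 0) as (I & hI & eI).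
  assert (e0 : rv O = 0%R) by (rewrite eO; unfold qv; simpl; lra).
  assert (e1 : rv I = 1%R) by (rewrite eI; unfold qv; simpl; lra). clear eO eI.
  constructor.
  - apply bin; [intros p hp; unfold addN in hp; rewrite in_sep in hp by (assert (D := D2T_addf); dfn); tauto|].
    intros x y hx hy. destruct (addf_in hx hy) as (z & hz & e). exists z; rewrite add_iff. split; [auto|]. intros z' h; apply add_iff in h as (_ & _ & hz' & e').
    apply rv_inj; auto; congruence.
  - apply bin; [intros p hp; unfold mulN in hp; rewrite in_sep in hp by (assert (D := D2T_mulf); dfn); tauto|].
    intros x y hx hy. destruct (mulf_in hx hy) as (z & hz & e). exists z; rewrite mul_iff. split; [auto|]. intros z' h; apply mul_iff in h as (_ & _ & hz' & e').
    apply rv_inj; auto; congruence.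
  - intros x y z; rewrite !add_iff. intros (h1 & h2 & h3 & e); repeat split; auto; lra.
  - intros x y z; rewrite !mul_iff. intros (h1 & h2 & h3 & e); repeat split; auto; lra.
  - intros x y z u v s; rewrite !add_iff. intros (h1 & h2 & h3 & e) (_ & h5 & h6 & e') (_ & _ & h7 & e''); repeat split; auto; lra.
  - intros x y z u v s; rewrite !mul_iff. intros (h1 & h2 & h3 & e) (_ & h5 & h6 & e') (_ & _ & h7 & e''); repeat split; auto.
    rewrite e', e, e''; ring.
  - intros x y z s t u v; rewrite !add_iff, !mul_iff. intros (h1 & h2 & h3 & e) (h4 & _ & h6 & e') (_ & _ & h7 & e'') (_ & _ & h8 & e3).
    repeat split; auto. rewrite e', e, e'', e3; ring.
  - exists O; apply zero_iff; auto.
  - intros o x ho hx. apply zero_iff in ho as [ho eo].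
    destruct (@real_by_sup (fun z => app mem leN (addf x z) O) (- rv x)) as (y & hy & e).
    { assert (D := D2T_addf). dfn. }
    { intros z hz. rewrite le_iff. assert (k := isrep_add (rvP hx) (rvP hz)). apply rv_eq in k as [k1 k2]. rewrite k2, e0.
      split; [intros (_ & _ & h); lra|intros h; repeat split; auto; lra]. }
    exists y; split; auto. apply add_iff; repeat split; auto; lra.
  - exists I. split; [auto|split; [rewrite zero_iff; intros [_ h]; lra|split]].
    + intros x hx; apply mul_iff; repeat split; auto. rewrite e1; ring.
    + intros x hx nz. assert (nx : rv x <> 0%R) by (intros h; apply nz, zero_iff; auto).
      assert (H : exists y, y ∈ Rs /\ rv y = (/ rv x)%R).
      (* The inequality defining the inverse as an upper bound reverses with the sign of x. *)
      { destruct (Rtotal_order (rv x) 0) as [l|[l|l]]; [|tauto|].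
        - apply real_by_sup with (P := fun z => app mem leN I (mulf x z)).
          { assert (D := D2T_mulf). dfn. }
          intros z hz. rewrite le_iff. assert (k := isrep_mul (rvP hx) (rvP hz)). apply rv_eq in k as [k1 k2]. rewrite k2, e1.
          assert (E : (rv x * / rv x = 1)%R) by (apply Rinv_r; auto).
          split; [intros (_ & _ & h)|intros h; split; [auto|split; [auto|]]].
          + apply Rnot_lt_le; intros g. apply Rmult_lt_gt_compat_neg_l with (r := rv x) in g; lra.
          + rewrite <- E. apply Rmult_le_compat_neg_l; lra.
        - apply real_by_sup with (P := fun z => app mem leN (mulf x z) I).
          { assert (D := D2T_mulf). dfn. }
          intros z hz. rewrite le_iff. assert (k := isrep_mul (rvP hx) (rvP hz)). apply rv_eq in k as [k1 k2]. rewrite k2, e1.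
          assert (E : (rv x * / rv x = 1)%R) by (apply Rinv_r; auto).
          split; [intros (_ & _ & h)|intros h; split; [auto|split; [auto|]]].
          + apply Rmult_le_reg_l with (rv x); lra.
          + rewrite <- E. apply Rmult_le_compat_l; lra. }
      destruct H as (y & hy & e). exists y; split; auto. apply mul_iff; repeat split; auto. rewrite e, e1. symmetry; apply Rinv_r; auto.
  - intros x hx; apply le_iff; repeat split; auto; lra.
  - intros x y hx hy h h'; apply le_iff in h as (_ & _ & h), h' as (_ & _ & h'). apply same_iff, rv_inj; auto; lra.
  - intros x y z hx hy hz h h'; apply le_iff in h as (_ & _ & h), h' as (_ & _ & h'). apply le_iff; repeat split; auto; lra.
  - intros x y hx hy. rewrite !le_iff. destruct (Rle_dec (rv x) (rv y)); [left|right]; repeat split; auto; lra.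
  - intros x y z u v hx hy hz h h1 h2. apply le_iff in h as (_ & _ & h). apply add_iff in h1 as (_ & _ & k1 & k2), h2 as (_ & _ & k3 & k4).
    apply le_iff; repeat split; auto; lra.
  - intros o x y z ho hx hy h1 h2 h3. apply zero_iff in ho as [ho eo]. apply le_iff in h1 as (_ & _ & h1), h2 as (_ & _ & h2).
    apply mul_iff in h3 as (_ & _ & k1 & k2). apply le_iff; repeat split; auto. rewrite eo, k2. rewrite eo in *. apply Rmult_le_pos; auto.
  - intros S hS hne (b & hb & hB). destruct (@sup_real S) as (s & hs & ub & lub); auto.
    { exists (rv b); intros x hx. apply hB, le_iff in hx; tauto. }
    exists s; split; [auto|split].
    + intros x hx; apply le_iff; auto.
    + intros b' hb' hB'. apply le_iff; repeat split; auto. apply lub. intros x hx. apply hB', le_iff in hx; tauto.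
Qed.
End Cuts.

(** * The gamma-set *)

Section GammaSpace.
Context {N : zermelo}.
Implicit Types x y z u r s t o F A U : N.
Hypothesis WO : forall u : N, exists w, wo w u.
Variable X : N.
Hypothesis Xom : X ⊆ pow om.
Hypothesis Xfin : Fin0 ⊆ X.

Definition agree x y (n : nat) := cap x (nm n) = cap y (nm n).
Lemma agree_iff x y (n : nat) : x ⊆ om -> y ⊆ om -> agree x y n <-> forall i : nat, i < n -> (nm i ∈ x <-> nm i ∈ y).
Proof.
  intros hx hy; unfold agree; split.
  - intros e i hi. assert (h : nm i ∈ cap x (nm n) <-> nm i ∈ cap y (nm n)) by (rewrite e; tauto).
    rewrite !in_cap, !nm_mem in h. tauto.
  - intros h. apply mem_ext; intros z; rewrite !in_cap. split; intros [k1 k2]; split; auto;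
      apply in_nm in k2 as (i & hi & ->); apply (h i hi); auto.
Qed.
(** The usual metric of the Cantor space: [qv 1 0 n] is 1 / (n + 1), where n is the first place at
    which x and y differ. *)
Definition dist_val x y (v : R) := (x = y /\ v = 0%R) \/ exists n : nat, agree x y n /\ ~ agree x y (S n) /\ v = qv 1 0 n.
Lemma unit_lt (m n : nat) : (qv 1 0 m < qv 1 0 n)%R <-> n < m.
Proof.
  unfold qv. assert (h := INR_S_pos m). assert (h' := INR_S_pos n). simpl (INR 1); simpl (INR 0). rewrite Rminus_0_r. split.
  - intros l. apply Nat.succ_lt_mono, INR_lt. apply Rnot_le_lt; intros k.
    apply Rinv_le_contravar in k; auto. unfold Rdiv in l. lra.
  - intros l. unfold Rdiv. rewrite !Rmult_1_l. apply Rinv_lt_contravar; [apply Rmult_lt_0_compat; auto|]. apply lt_INR; lia.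
Qed.
Lemma unit_pos (n : nat) : (0 < qv 1 0 n)%R.
Proof. unfold qv. simpl (INR 1); simpl (INR 0). apply Rdiv_lt_0_compat; [lra|apply INR_S_pos]. Qed.
Lemma unit_small (e : R) : (0 < e)%R -> exists n, (qv 1 0 n < e)%R.
Proof.
  intros h. destruct (INR_unbounded (/ e)) as [n hn]. exists n. unfold qv. simpl (INR 1); simpl (INR 0).
  assert (hp := INR_S_pos n). rewrite frac_lt by auto. apply Rmult_lt_compat_l with (r := e) in hn; auto.
  rewrite Rinv_r in hn by lra. rewrite S_INR. lra.
Qed.
Lemma agree_le x y (m n : nat) : x ⊆ om -> y ⊆ om -> m <= n -> agree x y n -> agree x y m.
Proof. intros hx hy h; rewrite !agree_iff; auto. intros k i hi; apply k; lia. Qed.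
Lemma dist_lt x y (v : R) (n : nat) : x ⊆ om -> y ⊆ om -> dist_val x y v -> (v < qv 1 0 n)%R <-> agree x y (S n).
Proof.
  intros hx hy [[-> ->]|(k & h1 & h2 & ->)].
  - split; [reflexivity|intros _; apply unit_pos].
  - rewrite unit_lt. split; intros h; [apply (agree_le hx hy h h1)|].
    destruct (Nat.lt_ge_cases n k) as [|g]; auto. destruct h2. apply (@agree_le _ _ _ (S n)); auto; lia.
Qed.
Lemma dist_ex x y : x ⊆ om -> y ⊆ om -> exists v, dist_val x y v.
Proof.
  intros hx hy. destruct (classic (x = y)) as [e|ne]; [exists 0%R; left; auto|].
  destruct (classic (exists n, ~ agree x y n)) as [[n hn]|no].
  - assert (H : exists k, agree x y k /\ ~ agree x y (S k)).
    { clear ne. induction n; [destruct hn; apply agree_iff; auto; intros; lia|]. destruct (classic (agree x y n)); eauto. }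
    destruct H as (k & h1 & h2). exists (qv 1 0 k). right; eauto.
  - destruct ne. apply mem_ext; intros z. assert (h : forall n, agree x y n) by (intros n; apply NNPP; eauto).
    split; intros hz; [assert (hz' := hx z hz)|assert (hz' := hy z hz)]; apply in_om in hz' as [i ->];
      assert (k := h (S i)); rewrite agree_iff in k by auto; apply (k i); auto.
Qed.
Lemma dist_nonneg x y v : dist_val x y v -> (0 <= v)%R.
Proof. intros [[_ ->]|(k & _ & _ & ->)]; [lra|]. left; apply unit_pos. Qed.
Lemma dist_eq x y : dist_val x y 0 <-> x = y.
Proof.
  split; [|intros ->; left; auto]. intros [[h _]|(k & _ & _ & h)]; auto. assert (h' := unit_pos k). lra.
Qed.
Lemma dist_sym x y v : dist_val x y v -> dist_val y x v.
Proof. unfold dist_val, agree. intros [[-> ->]|(k & h1 & h2 & ->)]; [left|right; exists k]; auto. Qed.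
Lemma dist_unique x y v v' : x ⊆ om -> y ⊆ om -> dist_val x y v -> dist_val x y v' -> v = v'.
Proof.
  assert (H : forall v v' : R, x ⊆ om -> y ⊆ om -> dist_val x y v -> dist_val x y v' -> (v <= v')%R).
  { clear. intros v v' hx hy h h'. apply Rnot_lt_le; intros l. assert (n := dist_nonneg h').
    destruct h as [[-> ->]|(k & h1 & h2 & ->)]; [lra|]. apply (dist_lt k hx hy h') in l. auto. }
  intros; apply Rle_antisym; auto.
Qed.
(** The ultrametric reason: if both distances were below that of x and z, then x and z would agree
    with y, hence with each other, beyond their first difference. *)
Lemma dist_tri x y z a b c : x ⊆ om -> y ⊆ om -> z ⊆ om -> dist_val x y a -> dist_val y z b -> dist_val x z c -> (c <= a + b)%R.
Proof.
  intros hx hy hz h1 h2 h3. assert (n1 := dist_nonneg h1). assert (n2 := dist_nonneg h2).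
  destruct h3 as [[-> ->]|(k & _ & h & ->)]; [lra|]. apply Rnot_lt_le; intros l.
  apply h. transitivity (cap y (nm (S k))); [apply (dist_lt k hx hy h1)|apply (dist_lt k hy hz h2)]; lra.
Qed.

Definition dist : N := sep (prod (prod X X) Rs) (fun p => exists x y r, p = pr (pr x y) r /\
  ((x = y /\ r = rc (tri 0 0 0)) \/ exists n, n ∈ om /\ cap x n = cap y n /\ cap x (succ n) <> cap y (succ n) /\
    r = rc (pr (nm 1) (pr emp n)))).
Lemma dist_iff x y r : app2 mem dist x y r <-> x ∈ X /\ y ∈ X /\ r ∈ Rs /\ dist_val x y (rv r).
Proof.
  assert (D := @D1T_rc N). rewrite app2_iff. unfold dist. rewrite in_sep, !pr_prod by (unfold cap; dfn).
  assert (Hrc : forall a b c, r ∈ Rs -> (r = rc (tri a b c) <-> rv r = qv a b c)).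
  { intros a b c hr. assert (k := isrep_rc a b c (N := N)). apply rv_eq in k as [k1 k2]. split; [intros ->; auto|]. intros e; apply rv_inj; auto; congruence. }
  assert (q0 : qv 0 0 0 = 0%R) by (unfold qv; simpl; lra).
  split.
  - intros [[[hx hy] hr] (x' & y' & r' & e & h)]. apply pr_inj in e as [e <-]; apply pr_inj in e as [<- <-]. do 3 (split; [assumption|]).
    destruct h as [[-> h]|(n & hn & h1 & h2 & h3)].
    + left; split; auto. rewrite <- q0. apply Hrc; auto.
    + apply in_om in hn as [k ->]. right; exists k. split; [exact h1|split; [exact h2|]]. apply Hrc; auto.
  - intros (hx & hy & hr & h). split; [auto|]. exists x, y, r. split; auto. destruct h as [[-> h]|(k & h1 & h2 & h3)].
    + left; split; auto. apply Hrc; auto. congruence.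
    + right; exists (nm k). split; [apply nm_om|split; [exact h1|split; [exact h2|]]]. apply Hrc in h3; auto.
Qed.
Lemma X_om x : x ∈ X -> x ⊆ om.
Proof. intros h; apply in_pow; auto. Qed.
Lemma dist_real x y : x ∈ X -> y ∈ X -> exists r, app2 mem dist x y r.
Proof.
  intros hx hy. destruct (dist_ex (X_om hx) (X_om hy)) as [v hv].
  assert (H : exists r, r ∈ @Rs N /\ rv r = v).
  { destruct hv as [[_ ->]|(k & _ & _ & ->)]; [|apply rat_ex]. destruct (@rat_ex N 0 0 0) as (r & h1 & h2).
    exists r; split; auto. rewrite h2; unfold qv; simpl; lra. }
  destruct H as (r & hr & <-). exists r. apply dist_iff; auto.
Qed.
Lemma dist_metric : is_metric mem Rs addN leN X dist.
Proof.
  constructor.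
  - exists (prod X X); split; [apply is_prod_iff; auto|]. split.
    + intros p hp. unfold dist in hp. assert (D := @D1T_rc N). rewrite in_sep in hp by (unfold cap; dfn). destruct hp as [hp _].
      apply in_prod in hp as (q & r & hq & hr & ->). exists q, r. rewrite is_pair_iff; auto.
    + intros p hp. apply in_prod in hp as (x & y & hx & hy & ->). destruct (dist_real hx hy) as [r hr]. exists r.
      assert (E : forall r', app mem dist (pr x y) r' <-> app2 mem dist x y r') by (intros r'; rewrite app2_iff, app_iff; tauto).
      rewrite E. split; auto. intros r' hr'. rewrite E in hr'. apply dist_iff in hr as (_ & _ & h1 & h2), hr' as (_ & _ & h3 & h4).
      apply same_iff, rv_inj; auto. apply (dist_unique (X_om hx) (X_om hy) h4 h2).
  - intros o x y r ho h. apply zero_iff in ho as [ho eo]. apply dist_iff in h as (_ & _ & h1 & h2). apply le_iff. repeat split; auto.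
    rewrite eo; eapply dist_nonneg; eauto.
  - intros o x y ho hx hy. apply zero_iff in ho as [ho eo]. rewrite dist_iff, same_iff, eo, dist_eq. tauto.
  - intros x y r h. apply dist_iff in h as (h1 & h2 & h3 & h4). apply dist_iff; auto using dist_sym.
  - intros x y z r s t u h1 h2 h3 h4. apply dist_iff in h1 as (k1 & k2 & k3 & k4), h2 as (_ & k5 & k6 & k7), h3 as (_ & _ & k8 & k9).
    apply add_iff in h4 as (_ & _ & k10 & e). apply le_iff. repeat split; auto. rewrite e. eapply (@dist_tri x y z); eauto using X_om.
Qed.
Lemma positive_iff (e : N) : is_positive mem Rs addN leN e <-> e ∈ Rs /\ (0 < rv e)%R.
Proof.
  unfold is_positive; split.
  - intros [h h']. split; auto. destruct (@rat_ex N 0 0 0) as (o & h1 & h2). assert (e0 : rv o = 0%R) by (rewrite h2; unfold qv; simpl; lra).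
    rewrite <- e0. apply lt_iff'; auto. apply h', zero_iff; auto.
  - intros [h h']. split; auto. intros o ho. apply zero_iff in ho as [h1 h2]. apply lt_iff'; auto. rewrite h2; auto.
Qed.
Lemma ball_iff x y (e : N) : x ∈ X -> y ∈ X -> e ∈ Rs -> in_ball mem leN dist x e y <-> exists v, dist_val x y v /\ (v < rv e)%R.
Proof.
  intros hx hy he; unfold in_ball; split.
  - intros (r & h1 & h2). apply dist_iff in h1 as (_ & _ & h3 & h4). apply lt_iff' in h2; eauto.
  - intros (v & h1 & h2). destruct (dist_real hx hy) as [r hr]. exists r; split; auto. apply dist_iff in hr as (_ & _ & h3 & h4).
    apply lt_iff'; auto. rewrite (dist_unique (X_om hx) (X_om hy) h4 h1); auto.
Qed.
Lemma open_iff u : metric_open mem Rs addN leN X dist u <-> u ⊆ X /\ forall x, x ∈ u -> exists n, forall y, y ∈ X -> agree x y n -> y ∈ u.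
Proof.
  unfold metric_open; split; intros [hu h]; (split; [auto|]); intros x hx.
  - destruct (h x hx) as (e & he & h'). apply positive_iff in he as [he pe]. destruct (unit_small pe) as [n hn].
    exists (S n). intros y hy a. apply h'; auto. apply ball_iff; auto. destruct (dist_ex (X_om (hu x hx)) (X_om hy)) as [v hv].
    exists v; split; auto. apply (dist_lt n (X_om (hu x hx)) (X_om hy) hv) in a. lra.
  - destruct (h x hx) as [n h']. destruct (@rat_ex N 1 0 n) as (e & he & ee). exists e. split; [apply positive_iff; rewrite ee; auto using unit_pos|].
    intros y hy hb. apply ball_iff in hb as (v & h1 & h2); auto. rewrite ee in h2. apply (dist_lt n (X_om (hu x hx)) (X_om hy) h1) in h2.
    apply h'; auto. eapply agree_le; [| | |exact h2]; auto using X_om.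
Qed.
Lemma dist_separable : metric_separable mem Rs addN leN X dist.
Proof.
  exists Fin0. split; [auto|split; [apply countable_iff, enum_Fins; auto using enum_om|]].
  intros x e hx he. apply positive_iff in he as [he pe]. destruct (unit_small pe) as [n hn].
  assert (hc : cap x (nm (S n)) ∈ Fin0).
  { apply in_Fins; split; [intros z hz; apply in_cap in hz; apply (X_om hx); tauto|].
    apply fin_sub with (nm (S n)); [intros z hz; apply in_cap in hz; tauto|apply fin_nm]. }
  exists (cap x (nm (S n))); split; auto. apply ball_iff; auto.
  destruct (dist_ex (X_om hx) (X_om (Xfin hc))) as [v hv]. exists v; split; auto.
  assert (a : agree x (cap x (nm (S n))) (S n)) by (apply mem_ext; intros z; rewrite !in_cap; tauto).
  apply (dist_lt n (X_om hx) (X_om (Xfin hc)) hv) in a. lra.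
Qed.

Hypothesis sel : forall DD, DD ⊆ Bas ->
  (forall F, F ⊆ X -> fin F -> exists b, b ∈ DD /\ forall z, z ∈ F -> Op b z) ->
  exists A U : N, (forall e : nat, exists n p, e <= n /\ nm n ∈ A /\ p ∈ nm n /\ ap U (pr (nm n) p) ∈ DD) /\
    forall z, z ∈ X -> covered A U z.
Theorem gamma_space : is_gamma_set mem X dist.
Proof.
  exists Rs, addN, mulN, leN. split; [apply reals_ex|split; [apply dist_metric|split; [apply dist_separable|]]].
  intros U [[hop hcov] [hX hom]].
  assert (DOp : D2 (@Op N)) by (unfold Op, cap; dfn).
  (* The selection principle concerns clopen codes, so U is replaced by the codes whose sets lie in
     one of its members. *)
  pose (DD := sep Bas (fun b => exists u, u ∈ U /\ forall z, z ∈ X -> Op b z -> z ∈ u)).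
  assert (inDD : forall b, b ∈ DD <-> b ∈ Bas /\ exists u, u ∈ U /\ forall z, z ∈ X -> Op b z -> z ∈ u).
  { intros b; unfold DD; rewrite in_sep by dfn; tauto. }
  destruct (@sel DD) as (A & S & hA & hS).
  { intros b hb; apply inDD in hb; tauto. }
  { intros F hF fF. assert (fF' := fF). apply finite_iff in fF'. destruct (hom F hF fF') as (u & hu & hFu).
    assert (ou := hop u hu). apply open_iff in ou as [uX ou]. destruct fF as [l hl].
    assert (H : forall z, exists n : nat, z ∈ u -> forall y, y ∈ X -> agree z y n -> y ∈ u).
    { intros z; destruct (classic (z ∈ u)) as [h|h]; [destruct (ou z h) as [n hn]; exists n; auto|exists 0; tauto]. }
    (* A finite set F included in the open set u has a clopen neighbourhood inside u: the union of
       basic neighbourhoods of its points. *)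
    destruct (fchoice _ H) as [m hm]. set (b := fset (map (fun z => pr (cap z (nm (m z))) (nm (m z))) l)).
    assert (inb : forall y, y ∈ b <-> exists z, z ∈ F /\ y = pr (cap z (nm (m z))) (nm (m z))).
    { intros y; unfold b; rewrite in_fset, in_map_iff. split; intros (z & h1 & h2); exists z; [rewrite hl|rewrite hl in h1]; auto. }
    exists b. split; [apply inDD; split; [apply in_Fins; split|]|].
    - intros y hy; apply inb in hy as (z & hz & ->). apply pr_prod; split; [|apply nm_om]. apply in_Fins; split.
      + intros i hi; apply in_cap in hi as [hi _]. apply (X_om (hF z hz)); auto.
      + apply fin_sub with (nm (m z)); [|apply fin_nm]. intros i hi; apply in_cap in hi; tauto.
    - apply fin_fset.
    - exists u; split; auto. intros y hy (t & k & hk & h & e). apply inb in h as (z & hz & e'). apply pr_inj in e' as [-> ->].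
      apply (hm z); auto. symmetry; exact e.
    - intros z hz. exists (cap z (nm (m z))), (nm (m z)). split; [apply nm_om|split; auto]. apply inb; eauto. }
  (* The i-th member includes a selected clopen set whose first index is at least i, so every point
     lies in all late members. *)
  destruct (@choice_fun _ WO om U (fun i u => exists n p, n ∈ A /\ i ⊆ n /\ p ∈ n /\ forall z, z ∈ X -> Op (ap S (pr n p)) z -> z ∈ u)) as (f & hf & hr).
  { dfn. }
  { intros i hi; apply in_om in hi as [e ->]. destruct (hA e) as (n & p & h1 & h2 & h3 & h4). apply inDD in h4 as (h4 & u & hu & h5).
    exists u; split; auto. exists (nm n), p. rewrite nm_sub; auto. }
  assert (late : forall z, z ∈ X -> exists n0 : nat, forall i : nat, n0 <= i -> z ∈ ap f (nm i)).
  { intros z hz. destruct (hS z hz) as (n0 & hn0 & h). apply in_om in hn0 as [k ->]. exists k. intros i hi.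
    destruct (hr (nm i) (nm_om i)) as (n & p & h1 & h2 & h3 & h4). apply h4; auto. apply h; auto. apply (nm_sub (M := N)) in hi. eapply sub_trans; eauto. }
  pose (W := sep U (fun u => exists i, i ∈ om /\ u = ap f i)).
  assert (inW : forall u, u ∈ W <-> exists i : nat, u = ap f (nm i)).
  { intros u; unfold W; rewrite in_sep by dfn. split.
    - intros (_ & i & hi & ->). apply in_om in hi as [k ->]; eauto.
    - intros [i ->]. split; [apply (funcs_ap hf), nm_om|]. exists (nm i); auto using nm_om. }
  assert (WU : W ⊆ U) by (intros u hu; unfold W in hu; rewrite in_sep in hu by dfn; tauto).
  clearbody W. exists W. split; [auto|split; [auto|split]].
  - intros fW. apply finite_iff in fW as [l hl]. apply hX.
    (* If W were finite and each of its members missed a point, all these points would lie in a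
       common late member, which misses one of them. So some member is X, and an omega-cover
       excludes that. *)
    assert (H : exists u, u ∈ W /\ X ⊆ u).
    { apply NNPP; intros no.
      assert (H : exists n0 : nat, forall u, In u l -> exists x, x ∈ X /\ x ∉ u /\ forall i : nat, n0 <= i -> x ∈ ap f (nm i)).
      { assert (hl' : forall u, In u l -> u ∈ W) by (intros; apply hl; auto). clear hl. induction l as [|u l IH]; [exists 0; intros u []|].
        destruct IH as [n0 IH]; [intros; apply hl'; right; auto|].
        assert (k : exists x, x ∈ X /\ x ∉ u).
        { apply NNPP; intros n. apply no. exists u; split; [apply hl'; left; auto|]. intros x hx. apply NNPP; eauto. }
        destruct k as (x & hx & hxu). destruct (late x hx) as [n1 h1]. exists (n0 + n1). intros u' [<-|h].
        - exists x; repeat split; auto. intros; apply h1; lia.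
        - destruct (IH u' h) as (x' & k1 & k2 & k3). exists x'; repeat split; auto. intros; apply k3; lia. }
      destruct H as [n0 H]. destruct (H (ap f (nm n0))) as (x & h1 & h2 & h3); [apply hl, inW; eauto|]. apply h2, h3; auto. }
    destruct H as (u & hu & h). assert (ou := hop u (WU u hu)). destruct ou as [ou _]. rewrite (sub_antisym h ou). auto.
  - intros x hx. destruct (late x hx) as [n0 h]. exists (fset (map (fun i => ap f (nm i)) (seq 0 n0))). split; [apply finite_iff, fin_fset|].
    intros u hu hxu. apply inW in hu as [i ->]. apply in_fset, in_map_iff. exists i; split; auto. apply in_seq.
    destruct (Nat.lt_ge_cases i n0); [lia|]. destruct hxu; auto.
Qed.
End GammaSpace.

(** * The uncountable gamma-set in the extension *)

Section CohenGamma.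
Context {M : zermelo}.
Hypothesis WO : forall u : M, exists w, wo w u.
Variables w1 w2 : M.
Hypothesis N1 : is_next_cardinal mem om w1.
Variable G : M -> Prop.
Hypothesis GG : generic (Pos w2) G.
Variable N : zermelo.
Hypothesis WON : forall u : N, exists w, wo w u.
Variable j : M -> N.
Hypothesis j_in : forall (z : N) x, z ∈ j x <-> exists c, c ∈ x /\ z = j c.
Hypothesis j_inj : forall x y, j x = j y -> x = y.
Hypothesis reps : forall (A : N) a, exists R, is_rep w2 G j A a R.

(** X contains a copy of the first uncountable cardinal of M. An enumeration of [j X] in N would
    give a partial map from [om] onto that cardinal, against [w1_bounded]. *)
Lemma uncountable_preserved X : ~ enum X -> ~ enum (j X).
Proof.
  intros nX [e he].
  destruct (uncountable_inj WO nX (ord_w1 N1) (w1_ctbl N1)) as (f & hf & fi).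
  pose (A := sep (j (prod om w1)) (fun z => exists n a, z = pr n a /\ ap e n = ap (j f) a)).
  assert (inA : forall n b, n ∈ om -> b ∈ w1 -> (j (pr n b) ∈ A <-> ap e (j n) = j (ap f b))).
  { intros n b hn hb; unfold A; rewrite in_sep by dfn. rewrite (j_mem j_in j_inj), pr_prod, (j_pr j_in j_inj), (j_ap j_in j_inj). split.
    - intros [_ (n' & b' & h & h')]. apply pr_inj in h as [-> ->]; auto.
    - intros h; split; eauto. }
  destruct (w1_bounded WO GG reps N1 (A := A) (c := om)) as (b & hb & hB).
  - apply enum_om.
  - intros n b b' hn hb hb' h h'. apply inA in h, h'; auto. rewrite h in h'. apply j_inj in h'. apply fi; auto.
  - destruct (he (j (ap f b))) as [n hn]; [apply (j_mem j_in j_inj); auto|].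
    apply (@mem_irr M b), (hB (nm n)); auto using nm_om. apply inA; auto using nm_om. rewrite (j_nm j_in j_inj); auto.
Qed.
Lemma j_Fin0 : j Fin0 = Fin0.
Proof.
  apply mem_ext; intros z; rewrite j_in. split.
  - intros (c & hc & ->). apply in_Fins in hc as [h1 h2]. apply in_Fins; split; [|apply (j_fin j_in); auto].
    rewrite <- (j_om j_in j_inj). intros y hy. apply j_in in hy as (i & hi & ->). apply j_in; eauto.
  - intros hz. apply in_Fins in hz as [h1 h2]. rewrite <- (j_om j_in j_inj) in h1. destruct (fin_j j_in j_inj h2 h1) as (F & -> & h3 & h4).
    exists F; split; auto. apply in_Fins; auto.
Qed.
(** Codes of clopen sets are hereditarily finite, so the extension has no new ones. *)
Lemma Bas_j (b : N) : b ∈ Bas -> b ∈ j Bas.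
Proof.
  intros hb. apply in_Fins in hb as [h1 h2]. rewrite <- j_Fin0, <- (j_om j_in j_inj), <- (j_prod j_in j_inj) in h1.
  destruct (fin_j j_in j_inj h2 h1) as (F & -> & h3 & h4). apply (j_mem j_in j_inj). apply in_Fins; auto.
Qed.
Hypothesis ch : CH (@mem M).
Theorem uncountable_gamma_ex : exists X d : N, is_gamma_set mem X d /\ ~ enum X.
Proof.
  destruct (CH_enumeration WO N1 ch) as [En hEn].
  destruct (tower WO N1 hEn) as (X & X1 & X2 & X3 & sel).
  exists (j X), (dist (j X)). split; [|apply uncountable_preserved; auto].
  apply gamma_space; auto.
  - intros z hz. apply j_in in hz as (x & hx & ->). apply in_pow. rewrite <- (j_om j_in j_inj). intros i hi. apply j_in in hi as (c & hc & ->).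
    apply (j_mem j_in j_inj). assert (h := X2 x hx). apply in_pow in h. auto.
  - rewrite <- j_Fin0. intros z hz. apply j_in in hz as (x & hx & ->). apply (j_mem j_in j_inj); auto.
  - intros DD hD h. apply (preserved WO GG j_in j_inj reps sel); auto. intros b hb; apply Bas_j; auto.
Qed.
End CohenGamma.

(** * Transfer between structures *)

Section Transfer.
Variables (D D' : Type) (E : D -> D -> Prop) (E' : D' -> D' -> Prop) (h : D -> D').
Hypothesis hs : forall y, exists x, y = h x.
Hypothesis hE : forall x y, E x y <-> E' (h x) (h y).

Lemma tr_all (P : D -> Prop) (P' : D' -> Prop) : (forall x, P x <-> P' (h x)) -> (forall x, P x) <-> (forall y, P' y).
Proof. intros H; split; intros k x; [destruct (hs x) as [x' ->]|]; apply H, k. Qed.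
Lemma tr_ex (P : D -> Prop) (P' : D' -> Prop) : (forall x, P x <-> P' (h x)) -> (exists x, P x) <-> (exists y, P' y).
Proof.
  intros H; split; intros [x k]; [exists (h x); apply H, k|]. destruct (hs x) as [x' ->]; exists x'; apply H, k.
Qed.
Lemma tr_imp (A B A' B' : Prop) : (A <-> A') -> (B <-> B') -> (A -> B) <-> (A' -> B').
Proof. tauto. Qed.
Lemma tr_and (A B A' B' : Prop) : (A <-> A') -> (B <-> B') -> (A /\ B) <-> (A' /\ B').
Proof. tauto. Qed.
Lemma tr_or (A B A' B' : Prop) : (A <-> A') -> (B <-> B') -> (A \/ B) <-> (A' \/ B').
Proof. tauto. Qed.
Lemma tr_fwd (A A' : Prop) : (A <-> A') -> A -> A'. Proof. tauto. Qed.
Lemma tr_bwd (A A' : Prop) : (A <-> A') -> A' -> A. Proof. tauto. Qed.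
Lemma tr_sat p : forall v, sat E v p <-> sat E' (fun n => h (v n)) p.
Proof.
  induction p as [i j| |p IHp q IHq|p IHp]; intros v; simpl; try tauto.
  - apply hE.
  - rewrite IHp, IHq; tauto.
  - apply tr_all; intros x. rewrite IHp. replace (fun n => h (scons x v n)) with (scons (h x) (fun n => h (v n))); [tauto|].
    extensionality n; destruct n; auto.
Qed.
Lemma tr_sat1 p x v : sat E (scons x v) p <-> sat E' (scons (h x) (fun n => h (v n))) p.
Proof.
  rewrite tr_sat. replace (fun n => h (scons x v n)) with (scons (h x) (fun n => h (v n))); [tauto|].
  extensionality n; destruct n; auto.
Qed.
Lemma tr_sat2 p x y v : sat E (scons x (scons y v)) p <-> sat E' (scons (h x) (scons (h y) (fun n => h (v n)))) p.
Proof.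
  rewrite tr_sat1. replace (fun n => h (scons y v n)) with (scons (h y) (fun n => h (v n))); [tauto|].
  extensionality n; destruct n; auto.
Qed.
Ltac head t := lazymatch t with ?f _ => head f | _ => t end.
(** Formulas are compared connective by connective, unfolding definitions until membership is
    reached; surjectivity of h handles the quantifiers. *)
Ltac tr := repeat lazymatch goal with
  | |- E _ _ <-> E' _ _ => apply hE
  | |- (_ /\ _) <-> (_ /\ _) => apply tr_and
  | |- (_ \/ _) <-> (_ \/ _) => apply tr_or
  | |- (forall _ : D, _) <-> _ => refine (tr_all _); intro
  | |- (exists _, _) <-> _ => refine (tr_ex _); intro
  | |- (_ <-> _) <-> (_ <-> _) => apply tr_and
  | |- (_ -> _) <-> (_ -> _) => apply tr_imp
  | |- False <-> False => tauto
  | |- sat _ _ _ <-> _ => first [apply tr_sat2 | apply tr_sat1]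
  | |- ?A <-> _ => first [match goal with H : _ |- _ => apply H end | let a := head A in unfold a]
  end.

Lemma tr_is_pair x y z : is_pair E x y z <-> is_pair E' (h x) (h y) (h z).
Proof. tr. Qed.
Lemma tr_countable x : countable E x <-> countable E' (h x).
Proof. tr. Qed.
Lemma tr_CH : CH E <-> CH E'.
Proof. tr. Qed.
Lemma tr_cohen_condition p : cohen_condition E p <-> cohen_condition E' (h p).
Proof. tr. Qed.
Lemma tr_cohen_dense p : cohen_dense E p <-> cohen_dense E' (h p).
Proof. tr. Qed.
Lemma tr_zfc : zfc E -> zfc E'.
Proof.
  intros H; constructor.
  - refine (tr_fwd _ (zfc_extensionality H)); tr.
  - refine (tr_fwd _ (zfc_foundation H)); tr.
  - refine (tr_fwd _ (zfc_pairing H)); tr.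
  - refine (tr_fwd _ (zfc_union H)); tr.
  - refine (tr_fwd _ (zfc_power H)); tr.
  - refine (tr_fwd _ (zfc_infinity H)); tr.
  - intros p v a. destruct (fchoice _ (fun n => hs (v n))) as [w hw]. destruct (hs a) as [b ->].
    replace v with (fun n => h (w n)) by (extensionality n; auto).
    refine (tr_fwd _ (zfc_separation H p w b)); tr.
  - intros p v a. destruct (fchoice _ (fun n => hs (v n))) as [w hw]. destruct (hs a) as [b ->].
    replace v with (fun n => h (w n)) by (extensionality n; auto).
    refine (tr_fwd _ (@zfc_replacement _ _ H p w b)); tr.
  - refine (tr_fwd _ (@zfc_choice _ _ H)); tr.
Qed.
Ltac forward F := refine (tr_fwd _ F); tr.
Ltac backward F := refine (tr_bwd _ F); tr.
Ltac reals_fields t H := constructor;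
  [ t (@add_binop _ _ _ _ _ _ H) | t (@mul_binop _ _ _ _ _ _ H) | t (@add_comm _ _ _ _ _ _ H)
     | t (@mul_comm _ _ _ _ _ _ H) | t (@add_assoc _ _ _ _ _ _ H) | t (@mul_assoc _ _ _ _ _ _ H)
     | t (@mul_add _ _ _ _ _ _ H) | t (@zero_ex _ _ _ _ _ _ H) | t (@add_inverse _ _ _ _ _ _ H)
     | t (@one_ex _ _ _ _ _ _ H) | t (@le_refl _ _ _ _ _ _ H) | t (@le_antisym _ _ _ _ _ _ H)
     | t (@le_trans _ _ _ _ _ _ H) | t (@le_total _ _ _ _ _ _ H) | t (@le_add _ _ _ _ _ _ H)
     | t (@le_mul _ _ _ _ _ _ H) | t (@sup_ex _ _ _ _ _ _ H) ].
Ltac metric_fields t H := constructor;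
  [ t (@metric_fun _ _ _ _ _ _ _ H) | t (@metric_nonneg _ _ _ _ _ _ _ H) | t (@metric_zero _ _ _ _ _ _ _ H)
     | t (@metric_sym _ _ _ _ _ _ _ H) | t (@metric_triangle _ _ _ _ _ _ _ H) ].
Lemma tr_is_reals R add mul le : is_reals E R add mul le <-> is_reals E' (h R) (h add) (h mul) (h le).
Proof. split; intros H; [reals_fields forward H|reals_fields backward H]. Qed.
Lemma tr_is_metric R add le X d : is_metric E R add le X d <-> is_metric E' (h R) (h add) (h le) (h X) (h d).
Proof. split; intros H; [metric_fields forward H|metric_fields backward H]. Qed.
Lemma tr_is_gamma_set X d : is_gamma_set E X d <-> is_gamma_set E' (h X) (h d).
Proof. tr; first [apply tr_is_reals|apply tr_is_metric]. Qed.
Lemma tr_is_strong_gamma_set X : is_strong_gamma_set E X <-> is_strong_gamma_set E' (h X).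
Proof. tr; apply tr_is_reals. Qed.
Lemma tr_cohen_generic G : cohen_generic E G -> cohen_generic E' (fun y => exists p, G p /\ y = h p).
Proof.
  intros H; constructor.
  - intros y (p & hp & ->). apply tr_cohen_condition, (generic_condition H p hp).
  - destruct (generic_nonempty H) as [p hp]; eauto.
  - intros y z (p & hp & ->) hz hzy. destruct (hs z) as [q ->]. exists q; split; auto. apply (@generic_upward _ _ _ H p); auto.
    + apply tr_cohen_condition; auto.
    + refine (tr_bwd _ hzy); tr.
  - intros y z (p & hp & ->) (q & hq & ->). destruct (@generic_directed _ _ _ H p q hp hq) as (r & hr & k1 & k2).
    exists (h r). split; [eauto|]. split; [refine (tr_fwd _ k1)|refine (tr_fwd _ k2)]; tr.
  - intros A' hA. destruct (hs A') as [A ->]. destruct (@generic_dense _ _ _ H A) as (p & hp & hpA); [apply tr_cohen_dense; auto|].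
    exists (h p). split; [eauto|]. apply hE; auto.
Qed.
End Transfer.

(** * Evaluation and the extensional collapse *)

Lemma veq_refl x : veq x x.
Proof. induction x as [A f IH]; simpl; split; intros a; exists a; auto. Qed.
Lemma veq_sym x : forall y, veq x y -> veq y x.
Proof.
  induction x as [A f IH]; intros [B g] [h1 h2]; simpl; split; intros a; [destruct (h2 a) as [b h]|destruct (h1 a) as [b h]]; exists b; auto.
Qed.
Lemma veq_trans x : forall y z, veq x y -> veq y z -> veq x z.
Proof.
  induction x as [A f IH]; intros [B g] [C k] [h1 h2] [h3 h4]; simpl; split; intros a.
  - destruct (h1 a) as [b h], (h3 b) as [c h']. eauto.
  - destruct (h4 a) as [b h], (h2 b) as [c h']. eauto.
Qed.
Lemma vmem_l x x' y : veq x x' -> vmem x y -> vmem x' y.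
Proof. destruct y as [B g]; intros e [b h]. exists b. eapply veq_trans; [apply veq_sym; exact e|exact h]. Qed.
Lemma vmem_r x y y' : veq y y' -> vmem x y -> vmem x y'.
Proof. destruct y as [B g], y' as [B' g']; intros [e _] [b h]. destruct (e b) as [b' h']. exists b'. eapply veq_trans; eauto. Qed.
Lemma elt_mem x (i : idx x) : vmem (elt x i) x.
Proof. destruct x as [A f]; exists i; apply veq_refl. Qed.
Lemma veq_iff x y : veq x y <-> forall z, vmem z x <-> vmem z y.
Proof.
  split.
  - intros e z; split; apply vmem_r; auto using veq_sym.
  - destruct x as [A f], y as [B g]; intros H; split; intros a.
    + exact (proj1 (H (f a)) (@elt_mem (mkV f) a)).
    + destruct (proj2 (H (g a)) (@elt_mem (mkV g) a)) as [b h]. exists b; apply veq_sym, h.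
Qed.
Lemma vmem_wf : well_founded vmem.
Proof.
  assert (H : forall x y, veq y x -> Acc vmem y).
  { induction x as [A f IH]; intros y e; constructor; intros z hz. apply (vmem_r e) in hz as [a ha]. eapply IH; eauto. }
  intros x; apply (H x), veq_refl.
Qed.
Lemma in_vupair x y z : vmem z (vupair x y) <-> veq z x \/ veq z y.
Proof. split; [intros [[] h]; auto|intros [h|h]; [exists true|exists false]; auto]. Qed.
Lemma vupair_eq x x' y y' : veq x x' -> veq y y' -> veq (vupair x y) (vupair x' y').
Proof. intros h h'; split; intros []; [exists true|exists false|exists true|exists false]; auto. Qed.
Lemma vpair_eq x x' y y' : veq x x' -> veq y y' -> veq (vpair x y) (vpair x' y').
Proof. intros h h'; apply vupair_eq; apply vupair_eq; auto. Qed.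

Notation below := (clos_trans V vmem).
Lemma below_pair s p t : vmem (vpair s p) t -> below s t.
Proof.
  intros h. apply t_trans with (vpair s p); [|apply t_step, h].
  apply t_trans with (vupair s s); apply t_step, in_vupair; left; apply veq_refl.
Qed.

Section Evaluation.
Variable G : V -> Prop.
Lemma val_elim y t : vmem y (val G t) -> exists s p, vmem (vpair s p) t /\ G p /\ veq y (val G s).
Proof.
  destruct t as [A f]. intros [[[a [b c]] (p & hp & e)] h]. exists (elt (elt (f a) b) c), p.
  split; [exists a; exact (veq_sym e)|split; [exact hp|exact h]].
Qed.
(** [val] reaches s through its position inside the coded pair, which yields a set merely [veq] to
    s. Hence the invariance hypothesis, discharged by induction in [val_eq]. *)
Lemma val_intro s p t : vmem (vpair s p) t -> G p -> (forall s', veq s s' -> veq (val G s) (val G s')) -> vmem (val G s) (val G t).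
Proof.
  intros hm hp H. destruct t as [A f]. destruct hm as [a e].
  assert (h : exists b c, veq s (elt (elt (f a) b) c)).
  { assert (h : vmem (vupair s s) (f a)) by (apply (vmem_r e), in_vupair; left; apply veq_refl).
    destruct (f a) as [B g]. destruct h as [b hb]. exists b. cbn [elt].
    assert (h : vmem s (g b)) by (apply (vmem_r hb), in_vupair; left; apply veq_refl). destruct (g b) as [C k]. exact h. }
  destruct h as (b & c & hs).
  assert (k : exists p, G p /\ veq (f a) (vpair (elt (elt (f a) b) c) p)).
  { exists p; split; auto. exact (veq_trans (veq_sym e) (vpair_eq hs (veq_refl p))). }
  exists (exist _ (existT _ a (existT _ b c)) k). apply H, hs.
Qed.
Lemma val_eq t t' : veq t t' -> veq (val G t) (val G t').
Proof.
  revert t'. induction t as [t IH] using (well_founded_ind (wf_clos_trans _ _ vmem_wf)). intros t' e.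
  apply veq_iff. intros y; split; intros h; apply val_elim in h as (s & p & h1 & h2 & h3); apply (vmem_l (veq_sym h3)).
  - apply val_intro with p; auto. apply (vmem_r e h1). apply IH. eapply below_pair; eauto.
  - apply (vmem_r (veq_sym e)) in h1. apply val_intro with p; auto. apply IH. eapply below_pair; eauto.
Qed.
Lemma val_mem y t : vmem y (val G t) <-> exists s p, vmem (vpair s p) t /\ G p /\ veq y (val G s).
Proof.
  split; [apply val_elim|]. intros (s & p & h1 & h2 & h3). apply (vmem_l (veq_sym h3)). apply val_intro with p; auto. apply val_eq.
Qed.
End Evaluation.

Section Collapse.
Variable K : V -> Prop.
Hypothesis K_tr : transitive_class K.
Notation C := (carrier K).
Notation E := (@mem_in K).
(** Transitivity puts every member of x and y into K, so quantifying over K or over V makes no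
    difference. *)
Lemma carrier_same (x y : C) : same E x y <-> veq (proj1_sig x) (proj1_sig y).
Proof.
  rewrite veq_iff. unfold same, mem_in. split; intros H z; [|apply H].
  split; intros h; assert (k := h); [apply (K_tr (proj2_sig x)) in k|apply (K_tr (proj2_sig y)) in k]; apply (H (exist _ z k)), h.
Qed.
Lemma carrier_upair (p x y : C) : is_upair E p x y <-> veq (proj1_sig p) (vupair (proj1_sig x) (proj1_sig y)).
Proof.
  unfold is_upair. rewrite veq_iff. split; intros H z.
  - rewrite in_vupair. split.
    + intros h. assert (k := K_tr (proj2_sig p) h). rewrite <- !(fun x => carrier_same (exist _ z k) x). apply H, h.
    + intros [h|h]; apply (vmem_l (veq_sym h)), H; [left|right]; unfold same; tauto.
  - rewrite !carrier_same, <- in_vupair. apply H.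
Qed.
Lemma carrier_pair (p x y : C) : is_pair E p x y <-> veq (proj1_sig p) (vpair (proj1_sig x) (proj1_sig y)).
Proof.
  unfold is_pair; split.
  - intros (a & b & ha & hb & hp). rewrite carrier_upair in *. eapply veq_trans; [exact hp|]. apply vupair_eq; auto.
  - intros e. assert (k : forall z, vmem z (vpair (proj1_sig x) (proj1_sig y)) -> K z).
    { intros z hz. apply (K_tr (proj2_sig p)). apply (vmem_r (veq_sym e)), hz. }
    assert (k1 : K (vupair (proj1_sig x) (proj1_sig x))) by (apply k, in_vupair; left; apply veq_refl).
    assert (k2 : K (vupair (proj1_sig x) (proj1_sig y))) by (apply k, in_vupair; right; apply veq_refl).
    exists (exist _ _ k1), (exist _ _ k2). rewrite !carrier_upair. split; [apply veq_refl|split; [apply veq_refl|exact e]].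
Qed.

(* Elements are identified when they have the same members, so that equality
   becomes Leibniz equality. *)
Definition coll : Type := {P : C -> Prop | exists x, P = same E x}.
Definition cl (x : C) : coll := exist _ (same E x) (ex_intro _ x eq_refl).
Definition cmem (P Q : coll) : Prop := exists x y, P = cl x /\ Q = cl y /\ E x y.
Lemma cl_surj (P : coll) : exists x, P = cl x.
Proof. destruct P as [P [x e]]. subst P. exists x; reflexivity. Qed.
Lemma cl_eq (x y : C) : cl x = cl y <-> same E x y.
Proof.
  split.
  - intros e. assert (e' : same E x = same E y) by exact (f_equal (@proj1_sig _ _) e).
    rewrite e'. unfold same; tauto.
  - intros h. apply eq_sig_hprop; [intros; apply proof_irrelevance|]. simpl. extensionality z. apply propositional_extensionality.
    unfold same in *. split; intros k w; rewrite <- k; [symmetry|]; apply h.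
Qed.
Lemma cl_mem (x y : C) : E x y <-> cmem (cl x) (cl y).
Proof.
  split; [intros; exists x, y; auto|]. intros (x' & y' & e1 & e2 & h). apply cl_eq, carrier_same in e1. apply cl_eq in e2.
  apply e2. unfold mem_in in *. eapply vmem_l; [apply veq_sym|]; eauto.
Qed.
Lemma cmem_ext (P Q : coll) : (forall z, cmem z P <-> cmem z Q) -> P = Q.
Proof.
  destruct (cl_surj P) as [x ->], (cl_surj Q) as [y ->]. intros H. apply cl_eq. intros z. rewrite !cl_mem. apply H.
Qed.
Lemma cmem_wf : well_founded cmem.
Proof.
  assert (H : forall v (x : C), proj1_sig x = v -> Acc cmem (cl x)).
  { intros v; induction v as [v IH] using (well_founded_ind vmem_wf). intros x e. constructor. intros Q hQ.
    destruct (cl_surj Q) as [y ->]. apply cl_mem in hQ. apply (IH (proj1_sig y)); auto. subst v; exact hQ. }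
  intros P. destruct (cl_surj P) as [x ->]. eapply H; eauto.
Qed.
End Collapse.

(** * The Cohen poset *)

Section OfZFC.
Variables (D : Type) (E : D -> D -> Prop).
Hypothesis ext : forall x y, (forall z, E z x <-> E z y) -> x = y.
Hypothesis wf : well_founded E.
Hypothesis Z : zfc E.
Lemma same_eq x y : same E x y <-> x = y.
Proof. split; [apply ext|intros ->; unfold same; tauto]. Qed.
Definition of_zfc : zermelo.
Proof.
  refine (@Build_zermelo D E ext wf _ (zfc_union Z) _ (zfc_infinity Z) (zfc_separation Z)).
  - intros x y. destruct (zfc_pairing Z x y) as [p hp]. exists p. intros z. rewrite <- !same_eq. apply hp.
  - intros x. destruct (zfc_power Z x) as [P hP]. exists P. intros z hz. exact (proj2 (hP z) hz).
Defined.
Lemma of_zfc_replacement : replacement of_zfc.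
Proof.
  intros R (p & r & hR) a hf.
  (* In the replacement scheme x is variable 0, y is variable 1 and parameters start at 2; any other
     variable of the environment may be read as x. *)
  pose (f := fun i => match r i with inl 1 => 1 | inl _ => 0 | inr _ => S (S i) end).
  pose (v := fun i => match r i with inr c => c | _ => a end).
  assert (e : forall x y, R x y <-> sat E (scons x (scons y v)) (ren f p)).
  { intros x y. rewrite sat_ren. rewrite (hR (fun n => match n with 1 => y | _ => x end)).
    replace (look r _) with (fun i => scons x (scons y v) (f i)); [reflexivity|].
    extensionality i. unfold look, f, v. destruct (r i) as [[|[|k]]|c] eqn:h; simpl; rewrite ?h; auto. }
  destruct (@zfc_replacement _ _ Z (ren f p) v a) as [b hb].
  - intros x hx. destruct (hf x hx) as (y & hy & u). exists y. rewrite <- e. split; auto.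
    intros y'. rewrite <- e, same_eq. apply u.
  - exists b. intros y. rewrite (hb y). split; intros (x & hx & h); exists x; split; auto; apply e; auto.
Qed.
Lemma of_zfc_choice : set_choice of_zfc.
Proof.
  intros a h1 h2. destruct (@zfc_choice _ _ Z a h1) as [c hc].
  - intros x y z hx hy hzx hzy. apply same_eq. apply (h2 x y z); auto.
  - exists c. intros x hx. destruct (hc x hx) as (z & k1 & k2 & k3). exists z. split; [auto|split; auto].
    intros z' g1 g2. apply same_eq; auto.
Qed.
End OfZFC.

Section CohenPoset.
Context {M : zermelo}.
Lemma next_cardinal_unique (k l l' : M) : is_next_cardinal mem k l -> is_next_cardinal mem k l' -> l = l'.
Proof.
  intros (o & n & h) (o' & n' & h'). destruct (ord_trich o o') as [k1|[k1|k1]]; auto.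
  - destruct n; auto.
  - destruct n'; auto.
Qed.
Lemma is_two_iff (t : M) : is_two mem t <-> t = nm 2.
Proof.
  unfold is_two; split.
  - intros (z & o & h1 & h2 & h3). apply is_empty_iff in h1. apply is_succ_iff in h2, h3. subst; reflexivity.
  - intros ->. exists emp, (succ emp). rewrite is_empty_iff, !is_succ_iff; auto.
Qed.
Lemma cohen_condition_iff (w1 w2 : M) : is_next_cardinal mem om w1 -> is_next_cardinal mem w1 w2 ->
  forall p, cohen_condition mem p <-> p ∈ Pos w2.
Proof.
  intros N1 N2 p. rewrite in_Pos. unfold cohen_condition, cond. split.
  - intros (w & u & c & t & h1 & (w' & u1 & h2 & h3 & h4) & h5 & h6 & h7 & h8 & h9).
    apply is_omega_iff in h1, h2. apply is_prod_iff in h5. apply is_two_iff in h6. apply finite_iff in h7. subst.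
    rewrite (next_cardinal_unique h3 N1) in h4. rewrite (next_cardinal_unique h4 N2) in h8.
    split; [auto|split].
    + intros q hq. destruct (h8 q hq) as (x & i & hx & hi & e). apply is_pair_iff in e as ->. apply pr_prod; auto.
    + intros x i k hi hk. apply same_iff, (h9 x); apply app_iff; auto.
  - intros (h1 & h2 & h3). exists om, w2, (prod w2 om), (nm 2). rewrite is_omega_iff, is_prod_iff, is_two_iff, finite_iff.
    do 2 (split; [solve [auto | exists om, w1; rewrite is_omega_iff; auto]|]). do 3 (split; [auto|]). split.
    + intros q hq. apply h2, in_prod in hq as (x & i & hx & hi & ->). exists x, i. rewrite is_pair_iff; auto.
    + intros x i k hi hk. apply app_iff in hi, hk. apply same_iff. eauto.
Qed.
(** The two cardinals are read off from a condition in G, since [cohen_condition] already provides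
    them. *)
Lemma cohen_generic_Pos (G : M -> Prop) : cohen_generic mem G ->
  exists w1 w2 : M, is_next_cardinal mem om w1 /\ is_next_cardinal mem w1 w2 /\ generic (Pos w2) G.
Proof.
  intros H. destruct (generic_nonempty H) as [p0 hp0].
  assert (h := generic_condition H p0 hp0). destruct h as (_ & w2 & _ & _ & _ & (w & w1 & hw & N1 & N2) & _).
  apply is_omega_iff in hw as ->. exists w1, w2. split; [auto|split; [auto|]].
  assert (C := cohen_condition_iff N1 N2). constructor.
  - intros p hp. apply C, (generic_condition H p hp).
  - apply (@generic_upward _ _ _ H p0); auto.
    + apply C, (@Pos_sub M w2 p0). apply C, (generic_condition H p0 hp0). intros z hz; destruct (in_emp hz).
    + intros z hz; destruct (in_emp hz).
  - intros p q hp hq hqp. apply (@generic_upward _ _ _ H p); auto. apply C; auto.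
  - exact (@generic_directed _ _ _ H).
  - intros A hA hd. apply (generic_dense H). split; [intros p hp; apply C; auto|]. intros p hp. apply hd, C, hp.
Qed.
End CohenPoset.

(** * The Cohen extension of a transitive model *)

Section Assembly.
Variable M : V -> Prop.
Hypothesis M_tr : transitive_class M.
Hypothesis M_zfc : zfc (@mem_in M).
Hypothesis M_CH : CH (@mem_in M).
Variable G : carrier M -> Prop.
Hypothesis G_gen : cohen_generic (@mem_in M) G.
Notation GV := (fun p => exists q, G q /\ veq p (proj1_sig q)).
Notation N := (generic_extension G).

Lemma M_pair s p t : M t -> vmem (vpair s p) t -> M s /\ M p.
Proof.
  intros ht h. assert (h1 := M_tr ht h).
  assert (h2 : M (vupair s p)) by (apply (M_tr h1), in_vupair; right; apply veq_refl).
  split; apply (M_tr h2), in_vupair; [left|right]; apply veq_refl.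
Qed.
Lemma N_tr : transitive_class N.
Proof.
  intros x y (t & ht & e) h. apply (vmem_r e) in h. apply val_mem in h as (s & p & h1 & h2 & h3).
  exists s; split; auto. apply (M_pair ht h1).
Qed.
Notation surjM := (@cl_surj M).
Notation surjN := (@cl_surj N).
Notation memM := (cl_mem M_tr).
Notation memN := (cl_mem N_tr).
Definition zM : zermelo := of_zfc (cmem_ext M_tr) (cmem_wf M_tr) (tr_zfc surjM memM M_zfc).
Let RP : replacement zM := @of_zfc_replacement _ _ _ _ _.
Let WO : forall u : zM, exists w, wo w u := well_order RP (@of_zfc_choice _ _ _ _ _).
Definition rp (z : zM) : carrier M := proj1_sig (constructive_indefinite_description _ (surjM z)).
Lemma rpP (z : zM) : z = cl (rp z).
Proof. exact (proj2_sig (constructive_indefinite_description _ (surjM z))). Qed.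
Definition evl (t : carrier M) : carrier N := exist N (val GV (proj1_sig t)) (ex_intro _ _ (conj (proj2_sig t) (veq_refl _))).
Definition VAL (t : zM) : coll N := cl (evl (rp t)).
Lemma VAL_cl t : VAL (cl t) = cl (evl t).
Proof.
  apply cl_eq, (carrier_same N_tr), val_eq. apply (carrier_same M_tr), cl_eq. symmetry; apply rpP.
Qed.
Lemma VAL_surj (i : coll N) : exists t, i = VAL t.
Proof.
  destruct (surjN i) as [[y (t & ht & e)] ->]. exists (cl (exist M t ht)). rewrite VAL_cl.
  apply cl_eq, (carrier_same N_tr). exact e.
Qed.
Lemma pr_cl s p t : pr (cl s : zM) (cl p) ∈ (cl t : zM) <-> vmem (vpair (proj1_sig s) (proj1_sig p)) (proj1_sig t).
Proof.
  split.
  - intros h. destruct (surjM (pr (cl s : zM) (cl p))) as [y e]. rewrite e in h. apply memM in h.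
    assert (k : is_pair (@mem zM) (cl y) (cl s) (cl p)) by (apply is_pair_iff; auto).
    apply (tr_is_pair surjM memM), (carrier_pair M_tr) in k. exact (vmem_l k h).
  - intros h. assert (hy := M_tr (proj2_sig t) h). set (y := exist M _ hy).
    assert (k : is_pair (@mem zM) (cl y) (cl s) (cl p)) by (apply (tr_is_pair surjM memM), (carrier_pair M_tr), veq_refl).
    apply is_pair_iff in k. rewrite <- k. apply memM. exact h.
Qed.
Definition GM (z : zM) : Prop := exists p, G p /\ z = cl p.
Lemma VAL_mem (i : coll N) t : cmem i (VAL t) <-> exists s p, pr s p ∈ t /\ GM p /\ i = VAL s.
Proof.
  destruct (surjN i) as [y ->]. destruct (surjM t) as [t' ->]. rewrite VAL_cl, <- memN. unfold mem_in. simpl.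
  rewrite val_mem. split.
  - intros (s & p & h1 & (q & hq & e) & h2). destruct (M_pair (proj2_sig t') h1) as [hs hp].
    exists (cl (exist M s hs)), (cl (exist M p hp)). split; [apply pr_cl; exact h1|split].
    + exists q; split; auto. apply cl_eq, (carrier_same M_tr). exact e.
    + rewrite VAL_cl. apply cl_eq, (carrier_same N_tr). exact h2.
  - intros (s & p & h1 & (q & hq & ->) & h2). destruct (surjM s) as [s' ->]. apply pr_cl in h1.
    exists (proj1_sig s'), (proj1_sig q). split; [exact h1|split; [exists q; split; auto using veq_refl|]].
    rewrite VAL_cl in h2. apply cl_eq, (carrier_same N_tr) in h2. exact h2.
Qed.

Theorem cohen_extension : (forall X : carrier N, is_strong_gamma_set (@mem_in N) X -> countable (@mem_in N) X) /\
  (exists X d : carrier N, is_gamma_set (@mem_in N) X d /\ ~ countable (@mem_in N) X).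
Proof.
  assert (GG0 : cohen_generic (@mem zM) GM) by exact (tr_cohen_generic surjM memM G_gen).
  destruct (cohen_generic_Pos GG0) as (w1 & w2 & N1 & N2 & GG).
  assert (CHM : CH (@mem zM)) by exact (proj1 (tr_CH surjM memM) M_CH).
  set (zN' := zN RP GG (cmem_ext N_tr) (cmem_wf N_tr) VAL_surj VAL_mem).
  set (j := jj RP GG (cmem_ext N_tr) (cmem_wf N_tr) VAL_surj VAL_mem : zM -> zN').
  assert (j_in : forall (z : zN') x, z ∈ j x <-> exists c, c ∈ x /\ z = j c) by (intros; apply jj_in).
  assert (j_inj : forall x y, j x = j y -> x = y) by (intros x y; apply jj_inj).
  assert (reps : forall (A : zN') a, exists R, is_rep w2 GM j A a R).
  { intros A a. destruct (rep_ex A a) as (R & h1 & h2 & h3 & h4). exists R. split; [split; [exact h1|split; [exact h2|exact h3]]|exact h4]. }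
  assert (WON : forall u : zN', exists w, wo w u) by (intros u; apply (WO_N WO)).
  destruct (filter_ex RP GG (cmem_ext N_tr) (cmem_wf N_tr) VAL_surj VAL_mem) as [Gam hGam].
  split.
  - intros X hX. apply (tr_countable surjN memN). apply (@countable_iff zN').
    apply (tr_is_strong_gamma_set surjN memN) in hX.
    destruct hX as (R & add & mul & le & RR & XR & w & k & hw & hk & _ & SG).
    apply (@is_omega_iff zN') in hw as ->. apply (@is_fun_iff zN') in hk.
    exact (strong_gamma_enum WO N1 N2 GG WON j_in j_inj reps hGam RR XR hk SG).
  - destruct (uncountable_gamma_ex WO N1 GG WON j_in j_inj reps CHM) as (X' & d' & h1 & h2).
    destruct (surjN X') as [X ->], (surjN d') as [d ->]. exists X, d. split.
    + apply (tr_is_gamma_set surjN memN). exact h1.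
    + intros h. apply h2. apply (tr_countable surjN memN) in h. apply (@countable_iff zN'). exact h.
Qed.
End Assembly.

Unset Implicit Arguments.
Theorem theorem9 (M : V -> Prop)
    (M_transitive : transitive_class M)
    (M_zfc : zfc (@mem_in M))
    (M_CH : CH (@mem_in M))
    (G : carrier M -> Prop)
    (G_generic : cohen_generic (@mem_in M) G)
    (N : V -> Prop)
    (N_def : N = generic_extension G) :
  (forall X : carrier N,
     is_strong_gamma_set (@mem_in N) X -> countable (@mem_in N) X) /\
  (exists X d : carrier N,
     is_gamma_set (@mem_in N) X d /\ ~ countable (@mem_in N) X).
Proof.
  subst N. exact (cohen_extension M_transitive M_zfc M_CH G_generic).
Qed.
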